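(* Let $1<p<\infty$. If there is some zero of $\zeta(s)$ with real part $1/p$, then the sequences $(S_n)$ and $(V_n)$ diverge in $L_p(0,\infty)$. In particular, $(S_n)$ and $(V_n)$ diverge in $L_2(0,\infty)$.
   Context: $\zeta$ is the Riemann zeta function, $\mu$ the Möbius function, and $\rho(x):=x-[x]$ the fractional part of $x$. $g(x):=\sum_{k\le x}\mu(k)/k$. For $n\in\mathbb N$ and $x>0$, $$S_n(x):=\sum_{k=1}^{n}\mu(k)\,\rho\left(\frac{1}{kx}\right),\qquad V_n(x):=\sum_{k=1}^{n}\mu(k)\,\rho\left(\frac{1}{kx}\right)-g(n)\,\rho\left(\frac1x\right).$$ ''Diverges in $L_p$'' means that the sequence does not converge in the $L_p(0,\infty)$ norm as $n\to\infty$. *)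

(* Defs.v *)
From HB Require Import structures.
From mathcomp Require Import all_boot all_order all_algebra.
From mathcomp Require Import all_classical all_reals all_analysis.
From mathcomp Require Import complex.

Set Implicit Arguments.
Unset Strict Implicit.
Unset Printing Implicit Defensive.

Import Order.TTheory GRing.Theory Num.Theory.
Import numFieldNormedType.Exports.

Local Open Scope classical_set_scope.
Local Open Scope ring_scope.
Local Open Scope complex_scope.

(* The topology and norm of MathComp-Analysis live on the regular module
   (R[i])^o, which is convertible to R[i]. *)
Definition complex_series_sum (R : realType) (u : nat -> R[i]) (l : R[i]) : Prop :=
  series (u : nat -> (R[i])^o) @ \oo --> (l : (R[i])^o).

Definition complex_analytic_at (R : realType) (f : R[i] -> R[i]) (z : R[i]) : Prop :=
  exists a : nat -> R[i],
    \forall w \near (z : (R[i])^o),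
      complex_series_sum (fun n => a n * (w - z) ^+ n) (f w).

Definition complex_exp (R : realType) (z : R[i]) : R[i] :=
  (expR (complex.Re z))%:C * (cos (complex.Im z) +i* sin (complex.Im z)).

(* n ^ s = exp (s log n), meaningful for 0 < n *)
Definition nat_cpow (R : realType) (n : nat) (s : R[i]) : R[i] :=
  complex_exp (s * (ln (n%:R : R))%:C).

(* zeta is the analytic continuation to C \ {1} of the Dirichlet series
   1 + 2 ^ (- s) + 3 ^ (- s) + ..., Re s > 1.  This determines zeta everywhere
   except at the pole s = 1, where its value is left arbitrary. *)
Definition is_riemann_zeta (R : realType) (zeta : R[i] -> R[i]) : Prop :=
  (forall s, 1 < complex.Re s ->
     complex_series_sum (fun n => nat_cpow n.+1 (- s)) (zeta s)) /\
  (forall s, s != 1 -> complex_analytic_at zeta s).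

Definition moebius (n : nat) : int :=
  if (0 < n)%N && all (fun p => logn p n == 1%N) (primes n)
  then (-1) ^+ size (primes n) else 0.

Definition frac_part (R : realType) (x : R) : R := x - (Num.floor x)%:~R.

(* For x >= 0, Num.truncn x is the integer part of x. *)
Definition moebius_g (R : realType) (x : R) : R :=
  \sum_(1 <= k < (Num.truncn x).+1) (moebius k)%:~R / k%:R.

Definition S_seq (R : realType) (n : nat) (x : R) : R :=
  \sum_(1 <= k < n.+1) (moebius k)%:~R * frac_part (1 / (k%:R * x)).

Definition V_seq (R : realType) (n : nat) (x : R) : R :=
  \sum_(1 <= k < n.+1) (moebius k)%:~R * frac_part (1 / (k%:R * x))
  - moebius_g (n%:R : R) * frac_part (1 / x).

Lemma measurable_positive_reals (R : realType) :
  measurable (`]0, +oo[%classic : set (measurableTypeR R)).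
Proof. exact: measurable_itv. Qed.

(* Lebesgue measure on (0, +oo), as a measure on R that does not charge
   (-oo, 0]. *)
Definition lebesgue_positive (R : realType) :
    {measure set (measurableTypeR R) -> \bar R} :=
  mrestr (@lebesgue_measure R) (@measurable_positive_reals R).

Definition converges_in_Lp (R : realType) (p : R) (u : nat -> R -> R) : Prop :=
  exists2 f : measurableTypeR R -> R,
    f \in Lfun (lebesgue_positive R) p%:E &
    (fun n => 'N[lebesgue_positive R]_(p%:E)[EFin \o (u n \- f)%R])%E @ \oo --> 0%E.

Definition diverges_in_Lp (R : realType) (p : R) (u : nat -> R -> R) : Prop :=
  ~ converges_in_Lp p u.

(* Main.v *)
(** Let J(s) be the Mellin transform of rho(1/x), so that J(s) = - zeta(s) / s for 0 < Re s < 1.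

    Let U_n be S_n or V_n. By Moebius inversion U_n(x) = g(n) h(x) - 1_{x <= 1} for x > 1/n, where h is
    comparable to 1/x near 0. If U_n converges in L_p, then looking at (1/n, 2/n) shows that
    |g(n)| n^(1 - 1/p) tends to 0. The Mellin transform of U_n at s is J(s) times a partial sum of
    mu(k) / k^s (corrected by g(n) for V_n), and Abel summation bounds that sum by o(1) / (Re s - 1/p)
    as Re s decreases to 1/p, while the transform itself stays away from 0, since U_n tends to
    - 1_{x <= 1}. As J is Lipschitz, J(1/p + it) cannot vanish. A zero of zeta is a zero of J by the
    identity theorem, which settles the first part.

    For p = 2 a zero of J on Re s = 1/2 is needed, which is Hardy's theorem. If there were none, J times
    a Gamma factor, a real continuous function of t, would be of constant sign; it is the Fourier
    transform of a kernel K built from the theta series, and so is e^(t a) times it for the rotated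
    kernel u |-> K(u + ia), |a| < pi / 4. Positivity makes Re K(u + ia) maximal at u = 0. But by the
    theta identities near the point i the theta series is negligible there as a tends to pi / 4, and
    what remains, cos(a / 2) cosh(u / 2), is not maximal at u = 0. *)

From HB Require Import structures.
From mathcomp Require Import all_boot all_order all_algebra.
From mathcomp Require Import all_classical all_reals all_analysis.
From mathcomp Require Import measurable_realfun complex ring lra zify.
Require Import Defs.

Set Implicit Arguments.
Unset Strict Implicit.
Unset Printing Implicit Defensive.

Import Order.TTheory GRing.Theory Num.Theory.
Import numFieldNormedType.Exports.

Local Open Scope classical_set_scope.
Local Open Scope ring_scope.
Local Open Scope complex_scope.

(** The first part is a race of rates. At distance [eta] to the right of a zero, [|J| <= K eta], so
    a partial sum of size [O(1) / eta] is still compatible with the zero: boundedness of the norms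
    is not enough. Comparing [U_n] with [U_m] and letting [m] grow cancels the limit function and
    improves [O(1)] to [o(1)]. The region [x < 1 / n], where no formula is available, is absorbed by
    Young's inequality with a small weight. The second part balances orders too: at distance about
    [A] from [i], the gain of [cosh] over its value at 0 is of order [A^2], while theta is [O(A^3)],
    so a small [A] decides. The substitution [x = e^(- v)] makes Mellin transforms and
    multiplicative convolutions additive. Contour shifts are homotopies in a real parameter. One
    concentration argument ([peak_le]) serves for the uniqueness of Fourier series, the nonvanishing
    of the Gamma factor and the maximality at 0. The identity theorem is run along a segment. *)

(* Locked, so that [rewrite cabsM] does not see the product inside [complex_exp]. *)
Fact cexp_key : unit. Proof. exact: tt. Qed.
Definition cexp {R : realType} (z : R[i]) : R[i] := locked_with cexp_key (complex_exp z).
Lemma cexpE {R : realType} (z : R[i]) : cexp z = complex_exp z.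
Proof. by rewrite /cexp unlock. Qed.

(** * Complex-valued functions of a real variable *)

Section ComplexCalculus.
Context {R : realType}.
Local Notation C := R[i].
Implicit Types (x y : R) (z w : R[i]) (f g : R -> R[i]).

Lemma ReD z w : complex.Re (z + w) = complex.Re z + complex.Re w.
Proof. by case: z; case: w. Qed.
Lemma ImD z w : complex.Im (z + w) = complex.Im z + complex.Im w.
Proof. by case: z; case: w. Qed.
Lemma ReN z : complex.Re (- z) = - complex.Re z.
Proof. by case: z. Qed.
Lemma ImN z : complex.Im (- z) = - complex.Im z.
Proof. by case: z. Qed.
Lemma ReM z w : complex.Re (z * w) =
  complex.Re z * complex.Re w - complex.Im z * complex.Im w.
Proof. by case: z; case: w. Qed.
Lemma ImM z w : complex.Im (z * w) =
  complex.Re z * complex.Im w + complex.Im z * complex.Re w.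
Proof. by case: z; case: w. Qed.

Lemma complex_ext z w :
  complex.Re z = complex.Re w -> complex.Im z = complex.Im w -> z = w.
Proof. by case: z => a b; case: w => c d /= -> ->. Qed.

Definition ReImE := (ReD, ImD, ReN, ImN, ReM, ImM).

Lemma Re_sum (I : Type) (r : seq I) (P : pred I) (F : I -> C) :
  complex.Re (\sum_(i <- r | P i) F i) = \sum_(i <- r | P i) complex.Re (F i).
Proof. by apply: (big_morph _ ReD). Qed.
Lemma Im_sum (I : Type) (r : seq I) (P : pred I) (F : I -> C) :
  complex.Im (\sum_(i <- r | P i) F i) = \sum_(i <- r | P i) complex.Im (F i).
Proof. by apply: (big_morph _ ImD). Qed.

(** The modulus as an element of [R]; the norm of [R[i]] takes its values in [R[i]]. *)
Definition cabs z : R := Normc.normc z.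

Arguments cabs : simpl never.

Lemma cabsE z : cabs z = Num.sqrt (complex.Re z ^+ 2 + complex.Im z ^+ 2).
Proof. by case: z. Qed.
Lemma cabs_ge0 z : 0 <= cabs z.
Proof. by rewrite cabsE sqrtr_ge0. Qed.
Lemma cabs0 : cabs 0 = 0. Proof. exact: Normc.normc0. Qed.
Lemma cabs_eq0 z : cabs z = 0 -> z = 0. Proof. exact: Normc.eq0_normc. Qed.
Lemma cabsM z w : cabs (z * w) = cabs z * cabs w. Proof. exact: Normc.normcM. Qed.
Lemma cabsN z : cabs (- z) = cabs z. Proof. exact: normcN. Qed.
Lemma cabsD z w : cabs (z + w) <= cabs z + cabs w. Proof. exact: le_normcD. Qed.
Lemma cabsB z w : cabs (z - w) <= cabs z + cabs w.
Proof. by rewrite -(cabsN w) cabsD. Qed.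
Lemma cabs_real x : cabs x%:C = `|x|.
Proof. by rewrite cabsE /= expr0n addr0 sqrtr_sqr. Qed.
Lemma cabs1 : cabs 1 = 1. Proof. exact: Normc.normc1. Qed.
Lemma cabsV z : cabs z^-1 = (cabs z)^-1. Proof. exact: Normc.normcV. Qed.
Lemma cabsX z n : cabs (z ^+ n) = cabs z ^+ n.
Proof. by elim: n => [|n IH]; rewrite ?expr0 ?cabs1// !exprS cabsM IH. Qed.
Lemma cabs_gt0 z : z != 0 -> 0 < cabs z.
Proof.
move=> z0; rewrite lt_neqAle cabs_ge0 andbT eq_sym.
by apply: contra z0 => /eqP/cabs_eq0->.
Qed.
Lemma cabs_Re z : `|complex.Re z| <= cabs z.
Proof. by rewrite cabsE -sqrtr_sqr ler_sqrt ?addr_ge0 ?sqr_ge0// lerDl sqr_ge0. Qed.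
Lemma cabs_Im z : `|complex.Im z| <= cabs z.
Proof. by rewrite cabsE -sqrtr_sqr ler_sqrt ?addr_ge0 ?sqr_ge0// lerDr sqr_ge0. Qed.
Lemma cabs_le z : cabs z <= `|complex.Re z| + `|complex.Im z|.
Proof.
rewrite cabsE -(ger0_norm (addr_ge0 (normr_ge0 _) (normr_ge0 _))) -sqrtr_sqr.
rewrite ler_sqrt ?sqr_ge0// sqrrD !real_normK ?num_real//.
by rewrite lerD2r lerDl mulrn_wge0// mulr_ge0.
Qed.
Lemma cabs_sum (I : Type) (r : seq I) (P : pred I) (F : I -> C) :
  cabs (\sum_(i <- r | P i) F i) <= \sum_(i <- r | P i) cabs (F i).
Proof.
elim/big_rec2: _ => [|i y z _ h]; first by rewrite cabs0.
by apply: le_trans (cabsD _ _) _; rewrite lerD2l.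
Qed.

Lemma Re_cexp z : complex.Re (cexp z) = expR (complex.Re z) * cos (complex.Im z).
Proof. by rewrite cexpE /complex_exp ReM /= mul0r subr0. Qed.
Lemma Im_cexp z : complex.Im (cexp z) = expR (complex.Re z) * sin (complex.Im z).
Proof. by rewrite cexpE /complex_exp ImM /= mul0r addr0. Qed.
Lemma cexpD z w : cexp (z + w) = cexp z * cexp w.
Proof.
by apply: complex_ext; rewrite !(ReImE, Re_cexp, Im_cexp) expRD ?cosD ?sinD; ring.
Qed.
Lemma cexp0 : cexp (0 : C) = 1.
Proof.
by apply: complex_ext; rewrite ?Re_cexp ?Im_cexp /= expR0 ?cos0 ?sin0 ?mulr1 ?mulr0.
Qed.
Lemma cexp_real x : cexp x%:C = (expR x)%:C.
Proof.
by apply: complex_ext; rewrite ?Re_cexp ?Im_cexp /= ?cos0 ?sin0 ?mulr1 ?mulr0.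
Qed.
Lemma cabs_cexp z : cabs (cexp z) = expR (complex.Re z).
Proof.
rewrite cabsE Re_cexp Im_cexp !exprMn -mulrDr cos2Dsin2 mulr1 sqrtr_sqr.
by rewrite ger0_norm// expR_ge0.
Qed.
Lemma cexp_neq0 z : cexp z != 0.
Proof.
apply/eqP => /(congr1 cabs); rewrite cabs_cexp cabs0 => /eqP.
by rewrite gt_eqF// expR_gt0.
Qed.
Lemma cexpN z : cexp (- z) = (cexp z)^-1.
Proof.
by apply: (mulfI (cexp_neq0 z)); rewrite -cexpD subrr cexp0 mulfV// cexp_neq0.
Qed.
Lemma is_derive_val (h : R -> R) x (a b : R) : is_derive x 1 h a -> a = b -> is_derive x 1 h b.
Proof. by move=> dh <-. Qed.

Lemma is_derive_sub (h k : R -> R) x (a b : R) : is_derive x 1 h a -> is_derive x 1 k b ->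
  is_derive x 1 (fun y => h y - k y) (a - b).
Proof. by move=> dh dk; exact: is_deriveB. Qed.

Lemma is_derive_add (h k : R -> R) x (a b : R) : is_derive x 1 h a -> is_derive x 1 k b ->
  is_derive x 1 (fun y => h y + k y) (a + b).
Proof. by move=> dh dk; exact: is_deriveD. Qed.

Lemma is_derive_mul (h k : R -> R) x (a b : R) : is_derive x 1 h a -> is_derive x 1 k b ->
  is_derive x 1 (fun y => h y * k y) (a * k x + h x * b).
Proof.
move=> dh dk; apply: (is_derive_val (is_deriveM dh dk)).
by rewrite /GRing.scale /=; ring.
Qed.

Lemma is_derive_comp (h k : R -> R) x (a b : R) : is_derive (k x) 1 h a -> is_derive x 1 k b ->
  is_derive x 1 (fun y => h (k y)) (a * b).
Proof. exact: is_derive1_comp. Qed.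

(** Only derivatives along a real parameter occur. A complex variable enters as a path [W], and
    holomorphy shows in the derivative of [W] coming out as a factor. *)
Definition cderiv (f : R -> C) (x : R) (d : C) : Prop := is_derive x 1 (fun y => complex.Re (f y)) (complex.Re d) /\
  is_derive x 1 (fun y => complex.Im (f y)) (complex.Im d).

Lemma cderiv_eq f x d d' : cderiv f x d -> d = d' -> cderiv f x d'.
Proof. by move=> h <-. Qed.

Lemma cderiv_cst z x : cderiv (fun=> z) x 0.
Proof. by split; exact: is_derive_cst. Qed.

Lemma cderiv_id x : cderiv (fun y => y%:C) x 1.
Proof. by split => /=; [exact: is_derive_id|exact: is_derive_cst]. Qed.

Lemma cderivD f g x (a b : C) : cderiv f x a -> cderiv g x b ->
  cderiv (fun y => f y + g y) x (a + b).
Proof.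
move=> [fr fi] [gr gi]; split; rewrite ?ReD ?ImD.
  by under eq_fun do rewrite ReD; exact: is_deriveD.
by under eq_fun do rewrite ImD; exact: is_deriveD.
Qed.

Lemma cderivN f x (a : C) : cderiv f x a -> cderiv (fun y => - f y) x (- a).
Proof.
move=> [fr fi]; split; rewrite ?ReN ?ImN.
  by under eq_fun do rewrite ReN; exact: is_deriveN.
by under eq_fun do rewrite ImN; exact: is_deriveN.
Qed.

Lemma cderivM f g x (a b : C) : cderiv f x a -> cderiv g x b ->
  cderiv (fun y => f y * g y) x (a * g x + f x * b).
Proof.
move=> [fr fi] [gr gi]; split; rewrite !ReImE.
  under eq_fun do rewrite ReM.
  apply: (is_derive_val (is_derive_sub (is_derive_mul fr gr) (is_derive_mul fi gi))).
  by ring.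
under eq_fun do rewrite ImM.
apply: (is_derive_val (is_derive_add (is_derive_mul fr gi) (is_derive_mul fi gr))).
by ring.
Qed.

Lemma cderivZ c f x (a : C) : cderiv f x a -> cderiv (fun y => c * f y) x (c * a).
Proof. by move=> h; apply: cderiv_eq (cderivM (cderiv_cst c x) h) _; rewrite mul0r add0r. Qed.

Lemma cderiv_exp f x (a : C) : cderiv f x a ->
  cderiv (fun y => cexp (f y)) x (a * cexp (f x)).
Proof.
move=> [fr fi]; have de := is_derive_comp (is_derive_expR _) fr.
split; rewrite !(ReImE, Re_cexp, Im_cexp).
  under eq_fun do rewrite Re_cexp.
  apply: (is_derive_val (is_derive_mul de (is_derive_comp (is_derive_cos _) fi))).
  by ring.
under eq_fun do rewrite Im_cexp.
apply: (is_derive_val (is_derive_mul de (is_derive_comp (is_derive_sin _) fi))).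
by ring.
Qed.

Definition ccont f := continuous (fun x => complex.Re (f x)) /\
  continuous (fun x => complex.Im (f x)).

Lemma is_derive_continuous (h : R -> R) x d : is_derive x 1 h d -> {for x, continuous h}.
Proof. by move=> hd; apply/differentiable_continuous/derivable1_diffP; case: hd. Qed.

Lemma cderiv_ccont f (d : R -> C) : (forall x, cderiv f x (d x)) -> ccont f.
Proof. by move=> h; split => x; have [/is_derive_continuous ? /is_derive_continuous] := h x. Qed.

Lemma ccont_cst z : ccont (fun=> z).
Proof. by apply: cderiv_ccont => x; exact: cderiv_cst. Qed.
Lemma ccont_real (h : R -> R) : continuous h -> ccont (fun x => (h x)%:C).
Proof. by move=> ch; split => //= x; exact: cvg_cst. Qed.
Lemma ccontD f g : ccont f -> ccont g -> ccont (fun x => f x + g x).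
Proof.
move=> [fr fi] [gr gi]; split => x.
  under eq_fun do rewrite ReD; apply: cvgD; [exact: fr|exact: gr].
under eq_fun do rewrite ImD; apply: cvgD; [exact: fi|exact: gi].
Qed.
Lemma ccontM f g : ccont f -> ccont g -> ccont (fun x => f x * g x).
Proof.
move=> [fr fi] [gr gi]; split => x.
  under eq_fun do rewrite ReM; apply: cvgB; apply: cvgM; [exact: fr|exact: gr|exact: fi|exact: gi].
under eq_fun do rewrite ImM; apply: cvgD; apply: cvgM; [exact: fr|exact: gi|exact: fi|exact: gr].
Qed.

End ComplexCalculus.
Arguments cabs {R} z : simpl never.

(** * Integration over the line *)

Section RealIntegral.
Context {R : realType}.
Local Notation mu := (@lebesgue_measure R).
Implicit Types (h k g F : R -> R) (a : R).

Definition rint h : R := \int[mu]_x h x.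
Definition rintg h : Prop := mu.-integrable setT (fun x => (h x)%:E).
Definition rmeas h : Prop :=
  measurable_fun [set: measurableTypeR R] (h : measurableTypeR R -> measurableTypeR R).

Lemma rmeasP h : rmeas h <->
  measurable_fun [set: measurableTypeR R] (fun x : measurableTypeR R => (h x)%:E).
Proof. exact: iff_sym (measurable_EFinP _ h). Qed.

Lemma rmeas_cont h : continuous h -> rmeas h.
Proof. exact: continuous_measurable_fun. Qed.

Lemma rintg_meas h : rintg h -> rmeas h.
Proof. by move=> /integrableP[/rmeasP]. Qed.

Lemma rintg_dom h g : rmeas h -> rintg g -> (forall x, `|h x| <= g x) -> rintg h.
Proof.
move=> mh ig hg; apply: (le_integrable _ _ _ ig) => //.
  exact/rmeasP.
by move=> x _; rewrite lee_fin (le_trans (hg x))// ler_norm.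
Qed.

Lemma rintgD h k : rintg h -> rintg k -> rintg (fun x => h x + k x).
Proof. by move=> ih ik; apply: (integrableD _ ih ik). Qed.
Lemma rintgZ c h : rintg h -> rintg (fun x => c * h x).
Proof. by move=> ih; apply: (integrableZl _ c ih). Qed.
Lemma rintgN h : rintg h -> rintg (fun x => - h x).
Proof.
move=> ih; have := rintgZ (-1) ih; rewrite /rintg.
by under eq_fun do rewrite mulN1r.
Qed.
Lemma rintgB h k : rintg h -> rintg k -> rintg (fun x => h x - k x).
Proof. by move=> ih ik; apply: rintgD => //; exact: rintgN. Qed.
Lemma rintg_norm h : rintg h -> rintg (fun x => `|h x|).
Proof. exact: integrable_norm. Qed.

Lemma rintD h k : rintg h -> rintg k -> rint (fun x => h x + k x) = rint h + rint k.
Proof. by move=> ih ik; exact: RintegralD. Qed.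
Lemma rintB h k : rintg h -> rintg k -> rint (fun x => h x - k x) = rint h - rint k.
Proof. by move=> ih ik; exact: RintegralB. Qed.
Lemma rintZ c h : rintg h -> rint (fun x => c * h x) = c * rint h.
Proof. by move=> ih; exact: RintegralZl. Qed.
Lemma rint_cst0 : rint (fun=> 0) = 0.
Proof. by rewrite /rint /Rintegral integral0. Qed.
Lemma rint_le h k : rintg h -> rintg k -> (forall x, h x <= k x) -> rint h <= rint k.
Proof. by move=> ih ik hk; apply: le_Rintegral. Qed.
Lemma rint_ge0 h : (forall x, 0 <= h x) -> 0 <= rint h.
Proof. by move=> h0; exact: Rintegral_ge0. Qed.
Lemma rint_norm h : rintg h -> `|rint h| <= rint (fun x => `|h x|).
Proof. by move=> ih; exact: le_normr_Rintegral. Qed.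
Lemma rint_EFin h : rintg h -> (\int[mu]_x (h x)%:E)%E = (rint h)%:E.
Proof. by move=> ih; rewrite /rint /Rintegral fineK// integrable_fin_num. Qed.

Lemma rint_dct (f_ : nat -> R -> R) h g :
  (forall n, rmeas (f_ n)) -> (forall x, f_ ^~ x @ \oo --> h x) -> rintg g ->
  (forall n x, `|f_ n x| <= g x) ->
  rintg h /\ (fun n => rint (f_ n)) @ \oo --> rint h.
Proof.
move=> mf fh ig fg.
have mh : rmeas h.
  by apply: (measurable_fun_cvg (h := f_)) => // x _; exact: fh.
have H1 n : measurable_fun [set: measurableTypeR R] (fun x : measurableTypeR R => (f_ n x)%:E) by exact/rmeasP.
have H2 : measurable_fun [set: measurableTypeR R] (fun x : measurableTypeR R => (h x)%:E) by exact/rmeasP.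
have H3 : {ae mu, forall x : measurableTypeR R, setT x -> (fun n => (f_ n x)%:E) @ \oo --> (h x)%:E}.
  by apply: aeW => x _; apply: cvg_EFin; [exact: nearW|exact: fh].
have H4 : {ae mu, forall x : measurableTypeR R, forall n, setT x -> (`|(f_ n x)%:E| <= (g x)%:E)%E}.
  by apply: aeW => x n _; rewrite lee_fin.
have [ih _ cv] := dominated_convergence measurableT H1 H2 H3 ig H4.
split => //; apply: fine_cvg; rewrite fineK ?integrable_fin_num//.
Qed.

Lemma measurable_shiftR a : measurable_fun [set: measurableTypeR R]
  ((fun x => x + a) : measurableTypeR R -> measurableTypeR R).
Proof. by apply: rmeas_cont => x; apply: cvgD; [exact: cvg_id|exact: cvg_cst]. Qed.

(** The image measure takes the same values on half-open intervals, and these determine Lebesgue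
    measure. *)
Lemma lebesgue_shift a (A : set (measurableTypeR R)) : measurable A ->
  mu ((fun x => x + a) @^-1` A) = mu A.
Proof.
pose nu : {measure set (measurableTypeR R) -> \bar R} :=
  pushforward mu ((fun x => x + a) : measurableTypeR R -> measurableTypeR R).
move=> mA; symmetry; rewrite [LHS](lebesgue_measure_unique (mu := nu (measurable_shiftR a)))//.
move=> X [[b c] _ <-] /=; rewrite /nu /= /pushforward.
have -> : (fun x : R => x + a) @^-1` `]b, c] = `]b - a, c - a]%classic.
  by apply/seteqP; split => x /=; rewrite !in_itv /= ltrBlDr lerBrDr.
rewrite !lebesgue_measure_itv /= !lte_fin ltrD2r.
by case: ifP => // _; rewrite -!EFinD; congr EFin; ring.
Qed.

Lemma ge0_integral_shift (h : R -> R) a : rmeas h -> (forall x, 0 <= h x) ->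
  (\int[mu]_x (h (x + a))%:E = \int[mu]_x (h x)%:E)%E.
Proof.
move=> mh h0.
have mf := measurable_shiftR a.
have := @ge0_integral_pushforward _ _ _ _ R _ mf mu setT (fun x => (h x)%:E) measurableT.
rewrite preimage_setT => <-; last 2 first.
- exact/rmeasP.
- by move=> x _; rewrite lee_fin.
apply: eq_measure_integral => A mA _; exact: lebesgue_shift.
Qed.

Lemma rmeas_shift h a : rmeas h -> rmeas (fun x => h (x + a)).
Proof. by move=> mh; exact: (measurableT_comp mh (measurable_shiftR a)). Qed.

Lemma rintg_shift h a : rintg h -> rintg (fun x => h (x + a)).
Proof.
move=> ih; have mh := rintg_meas ih; apply/integrableP; split.
  by apply/rmeasP; exact: rmeas_shift.
under eq_integral do rewrite /=.
rewrite (@ge0_integral_shift (fun x => `|h x|))//.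
  by move/integrableP : ih => [].
exact: measurableT_comp.
Qed.

Lemma rint_shift h a : rintg h -> rint (fun x => h (x + a)) = rint h.
Proof.
move=> ih; have mh := rintg_meas ih.
have mf := measurable_shiftR a.
have := @integral_pushforward _ _ _ _ R _ mf mu setT (fun x => (h x)%:E).
rewrite preimage_setT /rint /Rintegral => <-; last 3 first.
- exact/rmeasP.
- exact: rintg_shift.
- exact: measurableT.
congr fine; apply: eq_measure_integral => A mA _; exact: lebesgue_shift.
Qed.

Lemma measurable_negR : measurable_fun [set: measurableTypeR R]
  (-%R : measurableTypeR R -> measurableTypeR R).
Proof. by apply: rmeas_cont => x; apply: cvgN; exact: cvg_id. Qed.

Lemma lebesgue_opp (A : set (measurableTypeR R)) : measurable A ->
  mu (-%R @^-1` A) = mu A.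
Proof.
pose nu : {measure set (measurableTypeR R) -> \bar R} :=
  pushforward mu (-%R : measurableTypeR R -> measurableTypeR R).
move=> mA; symmetry; rewrite [LHS](lebesgue_measure_unique (mu := nu measurable_negR))//.
move=> X [[b c] _ <-] /=; rewrite /nu /= /pushforward.
have -> : (-%R : R -> R) @^-1` `]b, c] = `[- c, - b[%classic.
  by apply/seteqP; split => x /=; rewrite !in_itv /= lerNl ltrNr andbC.
rewrite !lebesgue_measure_itv /= !lte_fin ltrN2.
by case: ifP => // _; rewrite -!EFinD opprK addrC.
Qed.

Lemma ge0_integral_opp (k : R -> R) : rmeas k -> (forall x, 0 <= k x) ->
  (\int[mu]_x (k (- x))%:E = \int[mu]_x (k x)%:E)%E.
Proof.
move=> mk k0.
have := @ge0_integral_pushforward _ _ _ _ R _ measurable_negR mu setT (fun x => (k x)%:E) measurableT.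
rewrite preimage_setT => <-; last 2 first.
- exact/rmeasP.
- by move=> x _; rewrite lee_fin.
apply: eq_measure_integral => A mA _; exact: lebesgue_opp.
Qed.

Lemma rintg_opp (h : R -> R) : rintg h -> rintg (fun x => h (- x)).
Proof.
move=> ih; have mh := rintg_meas ih; apply/integrableP; split.
  apply/rmeasP; apply: (measurableT_comp mh); exact: oppr_measurable.
have mn : rmeas (fun x => `|h x|) by exact: measurableT_comp.
have := ge0_integral_opp mn (fun x => normr_ge0 _).
by rewrite /= => ->; have /integrableP[_] := ih.
Qed.

Lemma rint_opp h : rintg h -> rint (fun x => h (- x)) = rint h.
Proof.
move=> ih; have mh := rintg_meas ih.
have := @integral_pushforward _ _ _ _ R _ measurable_negR mu setT (fun x => (h x)%:E).
rewrite preimage_setT /rint /Rintegral => <-; [|exact/rmeasP|exact: rintg_opp|exact: measurableT].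
by congr fine; apply: eq_measure_integral => A mA _; exact: lebesgue_opp.
Qed.

Definition rmeas2 (F : R -> R -> R) : Prop :=
  measurable_fun [set: measurableTypeR R * measurableTypeR R]
    (fun p : measurableTypeR R * measurableTypeR R => F p.1 p.2 : measurableTypeR R).

(** The majorant [c] of the partial L1 norms feeds Tonelli and yields integrability on the product.
    Integrability of every section, not just almost every one, lets [rint] replace the extended
    integral throughout. *)
Lemma rint_fubini (F : R -> R -> R) (c : R -> R) :
  rmeas2 F -> (forall x, rintg (F x)) ->
  (forall y, rintg (F ^~ y)) -> (forall y, rint (fun x => `|F x y|) <= c y) -> rintg c ->
  rintg (fun x => rint (F x)) /\
  rint (fun x => rint (F x)) = rint (fun y => rint (F ^~ y)).
Proof.
move=> mF iF1 iF Fc ic.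
pose f (p : measurableTypeR R * measurableTypeR R) : \bar R := (F p.1 p.2)%:E.
have mf : measurable_fun setT f by exact: (iffRL (measurable_EFinP _ _) mF).
have iP : (mu \x mu)%E.-integrable setT f.
  apply/integrable21ltyP => //.
  have e y : (\int[mu]_x `|f (x, y)| = (rint (fun x => `|F x y|))%:E)%E.
    by rewrite -(rint_EFin (rintg_norm (iF y))).
  have mG : measurable_fun [set: measurableTypeR R]
      (fun y : measurableTypeR R => (\int[mu]_x `|f (x, y)|)%E).
    apply: (@measurable_fun_fubini_tonelli_G _ _ _ _ R mu (fun p => `|f p|%E)) => //.
    exact: measurableT_comp.
  apply: (@le_lt_trans _ _ (\int[mu]_y (c y)%:E)%E); last first.
    by rewrite rint_EFin// ltry.
  apply: ge0_le_integral => //.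
  - by move=> y _; exact: integral_ge0.
  - by apply/rmeasP; exact: rintg_meas.
  - by move=> y _; rewrite e lee_fin.
have E1 x : fubini_F mu f x = (rint (F x))%:E by rewrite /fubini_F -(rint_EFin (iF1 x)).
have E2 y : (\int[mu]_x f (x, y))%E = (rint (F ^~ y))%:E.
  by rewrite -(rint_EFin (iF y)).
split.
  have := integrable_fubini_F iP; rewrite /rintg.
  by have -> : fubini_F mu f = (fun x => (rint (F x))%:E) by apply/funext => x; exact: E1.
rewrite {1 3}/rint /Rintegral; congr fine.
have -> : (\int[mu]_x (rint (F x))%:E = \int[mu]_x \int[mu]_y f (x, y))%E.
  by apply: eq_integral => x _; rewrite -E1.
by rewrite (Fubini iP); apply: eq_integral => y _; rewrite E2.
Qed.

Lemma rint_ftc_itv F h (a b : R) : a < b -> (forall x : R, is_derive x 1 F (h x)) ->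
  continuous h -> rint (fun x => \1_(`[a, b]%classic) x * h x) = F b - F a.
Proof.
move=> ab dF ch; have := @continuous_FTC2 R h F _ _ ab.
rewrite /rint /Rintegral => E.
have -> : (\int[mu]_x (\1_(`[a, b]%classic) x * h x)%:E = \int[mu]_(x in `[a, b]) (h x)%:E)%E.
  rewrite [RHS]integral_mkcond; apply: eq_integral => x _.
  by rewrite patchE indicE; case: (x \in _); rewrite ?mul1r ?mul0r.
rewrite E ?fineD//.
- exact: continuous_subspaceT.
- split => [x _||]; first by case: (dF x).
    by apply: cvg_at_right_filter; exact: (is_derive_continuous (dF _)).
  by apply: cvg_at_left_filter; exact: (is_derive_continuous (dF _)).
- by move=> x _; rewrite derive1E; case: (dF x).
Qed.

(** The fundamental theorem on [[- n, n]], passed to the limit by dominated convergence with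
    majorant [|h|]. *)
Lemma rint_ftc F h (l l' : R) : (forall x : R, is_derive x 1 F (h x)) -> continuous h -> rintg h ->
  F n%:R @[n --> \oo] --> l -> F (- n%:R) @[n --> \oo] --> l' ->
  rint h = l - l'.
Proof.
move=> dF ch ih Fl Fl'.
pose A n := `[- n%:R, n%:R : R]%classic.
pose f_ n x := h x * \1_(A n) x.
have mf n : rmeas (f_ n).
  apply: measurable_funM; first exact: rintg_meas.
  by apply: measurable_indic; exact: measurable_itv.
have fh x : f_ ^~ x @ \oo --> h x.
  apply: (@cvg_trans _ ((fun=> h x) @ \oo)); last exact: cvg_cst.
  apply: near_eq_cvg; near=> n.
  rewrite /f_ indicE mem_set ?mulr1// /A /= in_itv /=.
  have : `|x| <= n%:R by near: n; exact: nbhs_infty_ger.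
  by rewrite ler_norml.
have fg n x : `|f_ n x| <= `|h x|.
  by rewrite /f_ normrM ler_piMr// ger0_norm ?indicE//; case: (x \in A n).
have [_ cv] := rint_dct mf fh (rintg_norm ih) fg.
have {cv} : (fun n => rint (f_ n)) @ \oo --> rint h by [].
have E : \forall n \near \oo, rint (f_ n) = F n%:R - F (- n%:R).
  near=> n.
  have n0 : - n%:R < n%:R :> R by rewrite gtrN// ltr0n; near: n; exact: nbhs_infty_gt.
  have -> : f_ n = (fun x => \1_(A n) x * h x) by apply/funext => x; rewrite /f_ mulrC.
  exact: rint_ftc_itv n0 dF ch.
move=> cv; apply/esym; apply: (cvg_unique _ _ cv) => //.
apply: (@cvg_trans _ ((fun n => F n%:R - F (- n%:R)) @ \oo)); last exact: cvgB.
by apply: near_eq_cvg; apply: filterS E => n.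
Unshelve. all: by end_near.
Qed.

End RealIntegral.

(** * Invariance of a line integral under deformation *)

Section Homotopy.
Context {R : realType}.
Local Notation mu := (@lebesgue_measure R).

(* Stands in for Cauchy's theorem: [d/dt Phi = d/dx Psi] makes the integral of
   [Phi t] independent of [t]. *)
Lemma rint_homotopy (Phi Psi D : R -> R -> R) (lo hi : R) (g : R -> R) :
  (forall t x : R, lo < t < hi -> is_derive t 1 (Phi ^~ x) (D t x)) ->
  (forall t x : R, lo < t < hi -> is_derive x 1 (Psi t) (D t x)) ->
  (forall t : R, lo < t < hi -> continuous (D t)) ->
  (forall t : R, lo < t < hi -> rintg (Phi t)) ->
  (forall t x : R, lo < t < hi -> `|D t x| <= g x) -> rintg g ->
  (forall t : R, lo < t < hi -> Psi t n%:R @[n --> \oo] --> 0) ->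
  (forall t : R, lo < t < hi -> Psi t (- n%:R) @[n --> \oo] --> 0) ->
  forall s t, lo < s < hi -> lo < t < hi -> rint (Phi s) = rint (Phi t).
Proof.
move=> dPhi dPsi cD iPhi Dg ig Py PNy.
(* The [t]-derivative of the integral is the integral of [D t], an exact [x]-derivative whose
   primitive [Psi t] vanishes at both ends. *)
have D0 t : lo < t < hi -> rint (D t) = 0.
  move=> ht; have iD : rintg (D t).
    apply: rintg_dom ig _; first by apply: rmeas_cont; exact: cD.
    by move=> x; exact: Dg.
  rewrite (rint_ftc (fun x => dPsi t x ht) (cD t ht) iD (Py t ht) (PNy t ht)).
  by rewrite subrr.
have itvE t : (`]lo, hi[%classic t) = (lo < t < hi) by rewrite /= in_itv.
have g0 x : 0 <= `|g x| by [].
have dF t : lo < t < hi -> is_derive t 1 (fun u => rint (Phi u)) 0.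
  move=> ht; have It : `]lo, hi[%classic t by rewrite itvE.
  have H1 u : `]lo, hi[%classic u -> mu.-integrable setT (EFin \o Phi u).
    by rewrite itvE => hu; exact: iPhi.
  have H2 u x : `]lo, hi[%classic u -> setT x -> derivable (Phi ^~ x) u 1.
    by rewrite itvE => hu _; case: (dPhi u x hu).
  have H3 u x : `]lo, hi[%classic u -> setT x -> `|partial1of2 Phi u x| <= `|g x|.
    rewrite itvE => hu _; have [_ e] := dPhi u x hu.
    by rewrite /partial1of2 derive1E e (le_trans (Dg _ _ hu))// ler_norm.
  have ig' := integrable_norm ig.
  have dd := @derivable_under_integral R _ _ mu Phi setT measurableT t lo hi It H1 H2 _ g0 ig' H3.
  have de := @differentiation_under_integral R _ _ mu Phi setT measurableT t lo hi It H1 H2 _ g0 ig' H3.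
  apply: DeriveDef => //; rewrite -derive1E [LHS]de -[RHS](D0 t ht).
  by apply: eq_Rintegral => x _; have [_ <-] := dPhi t x ht; rewrite /partial1of2 derive1E.
have key s t : lo < s < hi -> lo < t < hi -> s < t -> rint (Phi s) = rint (Phi t).
  move=> /andP[s1 s2] /andP[t1 t2] st.
  have din x : x \in `]s, t[ -> is_derive x 1 (fun u => rint (Phi u)) ((fun=> 0) x).
    by rewrite in_itv /= => /andP[sx xt]; apply: dF; rewrite (lt_trans s1)//= (lt_trans xt).
  have cin : {within `[s, t], continuous (fun u => rint (Phi u))}.
    apply: derivable_within_continuous => x; rewrite in_itv /= => /andP[sx xt].
    by case: (dF x) => //; rewrite (lt_le_trans s1)//= (le_lt_trans xt).
  have [c _] := MVT st din cin.
  by rewrite mul0r => /eqP; rewrite subr_eq0 => /eqP.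
move=> s t hs ht; have [st|ts|-> //] := ltgtP s t; first exact: key.
by apply/esym; exact: key.
Qed.

End Homotopy.

(** * Integrals of complex-valued functions *)

Section ComplexIntegral.
Context {R : realType}.
Local Notation mu := (@lebesgue_measure R).
Local Notation C := R[i].
Implicit Types (f g : R -> R[i]) (h k : R -> R).

Definition cmeas f := rmeas (fun x => complex.Re (f x)) /\ rmeas (fun x => complex.Im (f x)).
Definition cintg f := rintg (fun x => complex.Re (f x)) /\ rintg (fun x => complex.Im (f x)).
Definition cint f : C :=
  rint (fun x => complex.Re (f x)) +i* rint (fun x => complex.Im (f x)).

Lemma cmeas_cont f : ccont f -> cmeas f.
Proof. by move=> [fr fi]; split; exact: rmeas_cont. Qed.
Lemma cintg_meas f : cintg f -> cmeas f.
Proof. by move=> [fr fi]; split; exact: rintg_meas. Qed.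

Lemma cintg_dom f k : cmeas f -> rintg k -> (forall x, cabs (f x) <= k x) -> cintg f.
Proof.
move=> [mr mi] ik fk; split; apply: (rintg_dom _ ik) => // x;
  apply: le_trans (fk x); [exact: cabs_Re|exact: cabs_Im].
Qed.

Lemma rmeas_cabs f : cmeas f -> rmeas (fun x => cabs (f x)).
Proof.
move=> [mr mi]; have -> : (fun x => cabs (f x)) = (fun y : R => Num.sqrt y) \o
    (fun x => complex.Re (f x) ^+ 2 + complex.Im (f x) ^+ 2).
  by apply/funext => x; rewrite /= cabsE.
apply: measurableT_comp; first by apply: rmeas_cont; exact: sqrt_continuous.
by apply: measurable_funD; apply: measurable_funX.
Qed.

Lemma rintg_cabs f : cintg f -> rintg (fun x => cabs (f x)).
Proof.
move=> cf; have mf := cintg_meas cf; case: cf => fr fi.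
apply: (rintg_dom (rmeas_cabs mf) (rintgD (rintg_norm fr) (rintg_norm fi))) => x.
by rewrite ger0_norm ?cabs_ge0// cabs_le.
Qed.

Lemma eq_cint f g : f =1 g -> cint f = cint g.
Proof. by move=> fg; congr cint; apply/funext. Qed.

Lemma cintgD f g : cintg f -> cintg g -> cintg (fun x => f x + g x).
Proof.
move=> [fr fi] [gr gi]; split.
  have -> : (fun x => complex.Re (f x + g x)) =
      (fun x => complex.Re (f x) + complex.Re (g x)) by apply/funext => x; rewrite ReD.
  exact: rintgD.
have -> : (fun x => complex.Im (f x + g x)) =
    (fun x => complex.Im (f x) + complex.Im (g x)) by apply/funext => x; rewrite ImD.
exact: rintgD.
Qed.

Lemma cintD f g : cintg f -> cintg g -> cint (fun x => f x + g x) = cint f + cint g.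
Proof.
move=> [fr fi] [gr gi]; apply: complex_ext; rewrite ?ReD ?ImD /= -rintD//.
  by congr rint; apply/funext => x; rewrite ReD.
by congr rint; apply/funext => x; rewrite ImD.
Qed.

Lemma cintgZ (c : C) f : cintg f -> cintg (fun x => c * f x).
Proof.
move=> [fr fi]; split.
  have -> : (fun x => complex.Re (c * f x)) = (fun x =>
     complex.Re c * complex.Re (f x) - complex.Im c * complex.Im (f x)).
    by apply/funext => x; rewrite ReM.
  by apply: rintgB; exact: rintgZ.
have -> : (fun x => complex.Im (c * f x)) = (fun x =>
   complex.Re c * complex.Im (f x) + complex.Im c * complex.Re (f x)).
  by apply/funext => x; rewrite ImM.
by apply: rintgD; exact: rintgZ.
Qed.

Lemma cintZ (c : C) f : cintg f -> cint (fun x => c * f x) = c * cint f.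
Proof.
move=> [fr fi]; apply: complex_ext; rewrite ?ReM ?ImM /= -!rintZ//.
  rewrite -rintB; [|exact: rintgZ|exact: rintgZ].
  by congr rint; apply/funext => x; rewrite ReM.
rewrite -rintD; [|exact: rintgZ|exact: rintgZ].
by congr rint; apply/funext => x; rewrite ImM.
Qed.

Lemma cintgN f : cintg f -> cintg (fun x => - f x).
Proof.
move=> cf; have -> : (fun x => - f x) = (fun x => -1 * f x).
  by apply/funext => x; rewrite mulN1r.
exact: cintgZ.
Qed.

Lemma cintN f : cintg f -> cint (fun x => - f x) = - cint f.
Proof.
move=> cf; rewrite -mulN1r -cintZ//; apply: eq_cint => x; by rewrite mulN1r.
Qed.

Lemma cintgB f g : cintg f -> cintg g -> cintg (fun x => f x - g x).
Proof. by move=> cf cg; apply: cintgD => //; exact: cintgN. Qed.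

Lemma cintB f g : cintg f -> cintg g -> cint (fun x => f x - g x) = cint f - cint g.
Proof. by move=> cf cg; rewrite cintD ?cintN//; exact: cintgN. Qed.

Lemma cintg0 : cintg (fun=> 0).
Proof. by split; exact: integrable0. Qed.

Lemma cint0 : cint (fun=> 0) = 0.
Proof. by apply: complex_ext; rewrite /= rint_cst0. Qed.

Lemma cintg_sum (I : Type) (r : seq I) (F : I -> R -> C) : (forall i, cintg (F i)) ->
  cintg (fun x => \sum_(i <- r) F i x).
Proof.
move=> cF; elim: r => [|i r IH].
  by under eq_fun do rewrite big_nil; exact: cintg0.
have -> : (fun x => \sum_(j <- i :: r) F j x) = (fun x => F i x + \sum_(j <- r) F j x).
  by apply/funext => x; rewrite big_cons.
exact: cintgD.
Qed.

Lemma cint_sum (I : Type) (r : seq I) (F : I -> R -> C) : (forall i, cintg (F i)) ->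
  cint (fun x => \sum_(i <- r) F i x) = \sum_(i <- r) cint (F i).
Proof.
move=> cF; elim: r => [|i r IH].
  by rewrite big_nil -[RHS]cint0; apply: eq_cint => x; rewrite big_nil.
rewrite big_cons -IH -cintD//; last exact: cintg_sum.
by apply: eq_cint => x; rewrite big_cons.
Qed.

(** Multiplying by the unit [u = |z| / z] makes the integral [z] real and nonnegative; it remains to
    compare real parts with moduli. *)
Lemma cabs_cint f : cintg f -> cabs (cint f) <= rint (fun x => cabs (f x)).
Proof.
move=> cf; have [->|z0] := eqVneq (cint f) 0.
  by rewrite cabs0; apply: rint_ge0 => x; exact: cabs_ge0.
set z := cint f in z0 *; pose u : C := (cabs z)%:C / z.
have az : cabs z != 0 by rewrite gt_eqF// cabs_gt0.
have u1 : cabs u = 1 by rewrite cabsM cabsV cabs_real ger0_norm ?cabs_ge0// divff.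
have uz : u * z = (cabs z)%:C by rewrite /u -mulrA mulVf// mulr1.
have -> : cabs z = complex.Re (cint (fun x => u * f x)) by rewrite cintZ// uz.
rewrite /=; apply: rint_le; [by case: (cintgZ u cf)|exact: rintg_cabs|move=> x].
by rewrite (le_trans (ler_norm _))// (le_trans (cabs_Re _))// cabsM u1 mul1r.
Qed.

Lemma cint_le f k : cmeas f -> rintg k -> (forall x, cabs (f x) <= k x) ->
  cabs (cint f) <= rint k.
Proof.
move=> mf ik fk; have cf := cintg_dom mf ik fk.
by apply: le_trans (cabs_cint cf) _; apply: rint_le => //; exact: rintg_cabs.
Qed.

Lemma cintg_shift f (a : R) : cintg f -> cintg (fun x => f (x + a)).
Proof. by move=> [fr fi]; split; [exact: (rintg_shift a fr)|exact: (rintg_shift a fi)]. Qed.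
Lemma cint_shift f (a : R) : cintg f -> cint (fun x => f (x + a)) = cint f.
Proof.
by move=> [fr fi]; apply: complex_ext; rewrite /=; [exact: (rint_shift a fr)|exact: (rint_shift a fi)].
Qed.
Definition ccvg (u : nat -> C) (l : C) := (fun n => complex.Re (u n)) @ \oo --> complex.Re l /\
  (fun n => complex.Im (u n)) @ \oo --> complex.Im l.

Lemma ccvgP (u : nat -> C) l : ccvg u l <-> (fun n => cabs (u n - l)) @ \oo --> 0.
Proof.
split=> [[ur ui]|ul].
  apply: (@squeeze_cvgr _ _ _ _ (fun=> 0) (fun n => `|complex.Re (u n) - complex.Re l| +
     `|complex.Im (u n) - complex.Im l|)).
  - near=> n; rewrite cabs_ge0 /=; apply: le_trans (cabs_le _) _.
    by rewrite !ReImE.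
  - exact: cvg_cst.
  - have n0 (v : nat -> R) (m : R) : v @ \oo --> m -> (fun n => `|v n - m|) @ \oo --> (0 : R).
      by move=> /subr_cvg0 /cvg_norm; rewrite normr0.
    have h := cvgD (n0 _ _ ur) (n0 _ _ ui); rewrite addr0 in h; exact: h.
split; apply/subr_cvg0; apply: norm_cvg0; apply: (squeeze_cvgr _ (cvg_cst 0) ul);
  near=> n; rewrite normr_ge0 /=.
  by rewrite -ReN -ReD cabs_Re.
by rewrite -ImN -ImD cabs_Im.
Unshelve. all: by end_near.
Qed.

Lemma cint_dct (f_ : nat -> R -> C) f k :
  (forall n, cmeas (f_ n)) -> (forall x, ccvg (f_ ^~ x) (f x)) -> rintg k ->
  (forall n x, cabs (f_ n x) <= k x) ->
  cintg f /\ ccvg (fun n => cint (f_ n)) (cint f).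
Proof.
move=> mf ff ik fk.
have kr n x : `|complex.Re (f_ n x)| <= k x by apply: le_trans (fk n x); exact: cabs_Re.
have ki n x : `|complex.Im (f_ n x)| <= k x by apply: le_trans (fk n x); exact: cabs_Im.
have [i1 c1] := rint_dct (fun n => (mf n).1) (fun x => (ff x).1) ik kr.
have [i2 c2] := rint_dct (fun n => (mf n).2) (fun x => (ff x).2) ik ki.
by split; split.
Qed.

Lemma cint_ftc (F f : R -> C) (l l' : C) : (forall x : R, cderiv F x (f x)) -> ccont f -> cintg f ->
  ccvg (fun n => F n%:R) l -> ccvg (fun n => F (- n%:R)) l' -> cint f = l - l'.
Proof.
move=> dF [cr ci] [ir ii] [l1 l2] [l3 l4]; apply: complex_ext; rewrite !ReImE /=.
  exact: (rint_ftc (fun x => (dF x).1) cr ir l1 l3).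
exact: (rint_ftc (fun x => (dF x).2) ci ii l2 l4).
Qed.

Lemma cint_homotopy (Phi Psi D : R -> R -> C) (lo hi : R) (g : R -> R) :
  (forall t x : R, lo < t < hi -> cderiv (Phi ^~ x) t (D t x)) ->
  (forall t x : R, lo < t < hi -> cderiv (Psi t) x (D t x)) ->
  (forall t : R, lo < t < hi -> ccont (D t)) ->
  (forall t : R, lo < t < hi -> cintg (Phi t)) ->
  (forall t x : R, lo < t < hi -> cabs (D t x) <= g x) -> rintg g ->
  (forall t : R, lo < t < hi -> ccvg (fun n => Psi t n%:R) 0) ->
  (forall t : R, lo < t < hi -> ccvg (fun n => Psi t (- n%:R)) 0) ->
  forall s t, lo < s < hi -> lo < t < hi -> cint (Phi s) = cint (Phi t).
Proof.
move=> dPhi dPsi cD iPhi Dg ig Py PNy s t hs ht; apply: complex_ext => /=.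
  apply: (rint_homotopy (fun u x hu => (dPhi u x hu).1) (fun u x hu => (dPsi u x hu).1)
    (fun u hu => (cD u hu).1) (fun u hu => (iPhi u hu).1) _ ig
    (fun u hu => (Py u hu).1) (fun u hu => (PNy u hu).1) hs ht).
  by move=> u x hu; apply: le_trans (Dg u x hu); exact: cabs_Re.
apply: (rint_homotopy (fun u x hu => (dPhi u x hu).2) (fun u x hu => (dPsi u x hu).2)
  (fun u hu => (cD u hu).2) (fun u hu => (iPhi u hu).2) _ ig
  (fun u hu => (Py u hu).2) (fun u hu => (PNy u hu).2) hs ht).
by move=> u x hu; apply: le_trans (Dg u x hu); exact: cabs_Im.
Qed.

(** Fubini and translation invariance. The bound on [b] makes the inner integral exist for every
    [u], not only for almost every [u]. *)
Lemma rint_conv (a b : R -> R) (M : R) : rintg a -> rintg b -> (forall x, `|b x| <= M) ->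
  [/\ forall u, rintg (fun v => a v * b (u + v)),
      rintg (fun u => rint (fun v => a v * b (u + v))) &
      rint (fun u => rint (fun v => a v * b (u + v))) = rint a * rint b].
Proof.
move=> ia ib bM.
have ma := rintg_meas ia; have mb := rintg_meas ib.
have i1 u : rintg (fun v => a v * b (u + v)).
  apply: (@rintg_dom _ _ (fun v => M * `|a v|)).
  - apply: measurable_funM => //; under eq_fun do rewrite addrC; exact: rmeas_shift.
  - exact: rintgZ (rintg_norm ia).
  - by move=> v; rewrite normrM mulrC ler_wpM2r.
have i2 v : rintg (fun u => a v * b (u + v)) by apply: rintgZ; exact: rintg_shift.
have mF : rmeas2 (fun u v => a v * b (u + v)).
  apply: measurable_funM.
    exact: (measurableT_comp ma (@measurable_snd _ _ _ _)).
  apply: (measurableT_comp mb); apply: measurable_funD; [exact: measurable_fst|exact: measurable_snd].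
have Fc v : rint (fun u => `|a v * b (u + v)|) <= `|a v| * rint (fun u => `|b u|).
  have -> : (fun u => `|a v * b (u + v)|) = (fun u => `|a v| * `|b (u + v)|).
    by apply/funext => u; rewrite normrM.
  rewrite rintZ ?(rint_shift (h := fun u => `|b u|) v (rintg_norm ib))//.
  exact: (rintg_shift v (rintg_norm ib)).
have ic : rintg (fun v => `|a v| * rint (fun u => `|b u|)).
  by under eq_fun do rewrite mulrC; exact: rintgZ (rintg_norm ia).
have [j1 j2] := rint_fubini mF i1 i2 Fc ic.
split; [exact: i1|exact: j1|rewrite j2].
have -> : (fun v => rint (fun u => a v * b (u + v))) = (fun v => rint b * a v).
  apply/funext => v; rewrite rintZ; last exact: rintg_shift.
  by rewrite (rint_shift v ib) mulrC.
by rewrite (rintZ _ ia) mulrC.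
Qed.

Lemma cint_conv (a b : R -> C) (M : R) : cintg a -> cintg b -> (forall x, cabs (b x) <= M) ->
  [/\ forall u, cintg (fun v => a v * b (u + v)),
      cintg (fun u => cint (fun v => a v * b (u + v))) &
      cint (fun u => cint (fun v => a v * b (u + v))) = cint a * cint b].
Proof.
move=> [ar ai] [br bi] bM.
have Mr x : `|complex.Re (b x)| <= M by apply: le_trans (bM x); exact: cabs_Re.
have Mi x : `|complex.Im (b x)| <= M by apply: le_trans (bM x); exact: cabs_Im.
have [rr1 rr2 rr3] := rint_conv ar br Mr.
have [ri1 ri2 ri3] := rint_conv ar bi Mi.
have [ir1 ir2 ir3] := rint_conv ai br Mr.
have [ii1 ii2 ii3] := rint_conv ai bi Mi.
have eR u : (fun v => complex.Re (a v * b (u + v))) = (fun v =>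
    complex.Re (a v) * complex.Re (b (u + v)) - complex.Im (a v) * complex.Im (b (u + v))).
  by apply/funext => v; rewrite ReM.
have eI u : (fun v => complex.Im (a v * b (u + v))) = (fun v =>
    complex.Re (a v) * complex.Im (b (u + v)) + complex.Im (a v) * complex.Re (b (u + v))).
  by apply/funext => v; rewrite ImM.
have cR : (fun u => complex.Re (cint (fun v => a v * b (u + v)))) = (fun u =>
    rint (fun v => complex.Re (a v) * complex.Re (b (u + v))) -
    rint (fun v => complex.Im (a v) * complex.Im (b (u + v)))).
  by apply/funext => u; rewrite /= eR rintB.
have cI : (fun u => complex.Im (cint (fun v => a v * b (u + v)))) = (fun u =>
    rint (fun v => complex.Re (a v) * complex.Im (b (u + v))) +
    rint (fun v => complex.Im (a v) * complex.Re (b (u + v)))).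
  by apply/funext => u; rewrite /= eI rintD.
split.
- by move=> u; split; [rewrite eR; exact: rintgB|rewrite eI; exact: rintgD].
- by split; [rewrite cR; exact: rintgB|rewrite cI; exact: rintgD].
- rewrite {1}/cint cR cI; apply: complex_ext; rewrite ReImE /=.
    by rewrite rintB// rr3 ii3.
  by rewrite rintD// ri3 ir3.
Qed.

Lemma cint_real h : rintg h -> cint (fun x => (h x)%:C) = (rint h)%:C.
Proof. by move=> ih; apply: complex_ext; rewrite //= rint_cst0. Qed.

Lemma cintg_real h : rintg h -> cintg (fun x => (h x)%:C).
Proof. by move=> ih; split => //; exact: integrable0. Qed.

End ComplexIntegral.

(** * Exponential majorants *)

Section Decay.
Context {R : realType}.
Local Notation mu := (@lebesgue_measure R).
Local Notation C := R[i].

Lemma rintg_expabs (m : R) : 0 < m -> rintg (fun u : R => expR (- m * `|u|)).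
Proof.
move=> m0; have cf : continuous (fun u : R => expR (- m * `|u|)).
  move=> x; apply: continuous_comp; last exact: continuous_expR.
  by apply: cvgM; [exact: cvg_cst|exact: norm_continuous].
apply/integrableP; split; first by apply/rmeasP; exact: rmeas_cont.
under eq_integral do rewrite gee0_abs ?lee_fin ?expR_ge0//.
rewrite (@ge0_symfun_integralT R)//; last by move=> x /=; rewrite normrN.
have -> : [set x : R | 0 <= x] = `[0, +oo[%classic.
  by apply/seteqP; split => x /=; rewrite in_itv/= andbT.
rewrite lte_mul_pinfty//.
have dF (x : R) : is_derive x 1 (fun u : R => - m^-1 * expR (- m * u)) (expR (- m * x)).
  have h1 : is_derive x 1 (fun u : R => - m * u) (- m).
    by apply: (is_derive_val (is_derive_mul (is_derive_cst _ _ _) (is_derive_id _ _))); rewrite mul0r add0r mulr1.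
  have h2 := is_derive_mul (is_derive_cst (- m^-1) x 1) (is_derive_comp (is_derive_expR _) h1).
  by apply: (is_derive_val h2); rewrite mul0r add0r mulrCA mulrNN mulVf ?mulr1// gt_eqF.
rewrite (eq_integral (fun x : measurableTypeR R => (expR (- m * x))%:E)); last first.
  by move=> x; rewrite inE /= in_itv /= andbT => x0; rewrite ger0_norm.
rewrite (@ge0_continuous_FTC2y R _ (fun u : R => - m^-1 * expR (- m * u)) _ 0).
- by rewrite ltry.
- by move=> x _; exact: expR_ge0.
- apply: continuous_subspaceT => x; apply: continuous_comp; last exact: continuous_expR.
  by apply: cvgM; [exact: cvg_cst|exact: cvg_id].
- rewrite -[X in _ --> X](mulr0 (- m^-1)); apply: cvgM; first exact: cvg_cst.
  have -> : (fun u : R => expR (- m * u)) = (fun x => expR (- x)) \o (fun u => m * u).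
    by apply/funext => u; rewrite /= mulNr.
  apply: cvg_comp; last exact: cvgr_expR.
  by apply: gt0_cvgMry => //; exact: cvg_id.
- by move=> x _; case: (dF x).
- by apply: cvg_at_right_filter; exact: (is_derive_continuous (dF 0)).
- by move=> x _; rewrite derive1E; case: (dF x).
Qed.

(** From [t <= 1 + t <= e^t] at [t = y / n], raised to the [n]-th power. *)
Lemma expR_pow_le (n : nat) (y : R) : 0 <= y -> y ^+ n <= n%:R ^+ n * expR y.
Proof.
move=> y0; case: n => [|n]; first by rewrite !expr0 mul1r -[leLHS]expR0 ler_expR.
have -> : y = n.+1%:R * (y / n.+1%:R) by rewrite mulrCA mulfV ?mulr1.
rewrite exprMn ler_wpM2l ?exprn_ge0// expRM_natl.
rewrite ler_pXn2r ?nnegrE ?expR_ge0 ?divr_ge0//.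
by apply: le_trans (expR_ge1Dx _); rewrite lerDr.
Qed.

(** For [u < 0] the factor [e^(b u)] decays by itself. For [u >= 0], with [b <= N], one has
    [e^(2 b u) <= (e^(2 u))^N], and a power is beaten by the exponential: it is at most
    [(N / c)^N exp (c e^(2 u))]. *)
Lemma gauss_decay (c b : R) : 0 < c -> 0 < b -> exists2 K : R, 0 <= K &
  forall u, expR (b * u) * expR (- c * expR (2 * u)) <= K * expR (- b * `|u|).
Proof.
move=> c0 b0; have [N bN] : exists N : nat, b <= N%:R.
  exists (Num.truncn b).+1; apply/ltW; exact: truncnS_gt.
pose K := 1 + (N%:R / c) ^+ N.
have K0 : 0 <= (N%:R / c) ^+ N by rewrite exprn_ge0// divr_ge0// ltW.
exists K; first by rewrite addr_ge0.
move=> u; have [u0|u0] := leP 0 u; last first.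
  rewrite ltr0_norm// mulrNN; apply: le_trans (_ : 1 * expR (b * u) <= _); last first.
    by rewrite ler_wpM2r ?expR_ge0// lerDl.
  rewrite mulrC ler_wpM2r ?expR_ge0// -expR0 ler_expR mulNr oppr_le0.
  by rewrite mulr_ge0 ?expR_ge0// ltW.
rewrite ger0_norm//.
have -> : expR (b * u) = expR (2 * b * u) * expR (- b * u) by rewrite -expRD; congr expR; ring.
rewrite mulrAC ler_wpM2r ?expR_ge0//.
apply: (@le_trans _ _ ((N%:R / c) ^+ N)); last by rewrite lerDr.
rewrite mulNr expRN ler_pdivrMr ?expR_gt0//.
apply: (@le_trans _ _ (expR (2 * u) ^+ N)).
  by rewrite -expRM_natl ler_expR mulrA [N%:R * 2]mulrC -!mulrA ler_pM2l// ler_wpM2r.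
have := expR_pow_le N (ltW (mulr_gt0 c0 (expR_gt0 (2 * u)))).
rewrite exprMn mulrC -ler_pdivlMr ?exprn_gt0// => /le_trans; apply.
by rewrite expr_div_n mulrAC.
Qed.

End Decay.

(** * Gaussian kernels on horizontal lines *)

Section GaussKernel.
Context {R : realType}.
Local Notation mu := (@lebesgue_measure R).
Local Notation C := R[i].

(** The Gaussian [exp (- pi x^2)] in the logarithmic variable [x = e^w], continued to complex [w];
    it decays as [Re w] grows as long as [|Im w| < pi / 4]. *)
Definition Gau (w : C) : C := cexp (- (pi%:C * cexp (2%:C * w))).
(* Up to sign, [e^(s w)] times the derivative of [Gau]; its integral over the line is
   [pi^(- s / 2) Gamma (s / 2 + 1)]. *)
Definition bker (s w : C) : C := cexp (s * w) * ((2 * pi)%:C * cexp (2%:C * w)) * Gau w.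
Definition dbker (s w : C) : C := (s + 2%:C - (2 * pi)%:C * cexp (2%:C * w)) * bker s w.

Lemma cabs_Gau (u a : R) : cabs (Gau (u +i* a)) = expR (- (pi * cos (2 * a)) * expR (2 * u)).
Proof.
rewrite cabs_cexp ReN ReM Re_cexp Im_cexp !ReImE /= !mul0r !subr0 !addr0.
by congr expR; ring.
Qed.

Lemma cabs_bker (s : C) (u a : R) : cabs (bker s (u +i* a)) =
  expR (complex.Re s * u - complex.Im s * a) * (2 * pi * expR (2 * u)) *
  expR (- (pi * cos (2 * a)) * expR (2 * u)).
Proof.
rewrite /bker !cabsM cabs_Gau !cabs_cexp !ReImE /= mul0r subr0 cabs_real.
by rewrite ger0_norm// mulr_ge0// pi_ge0.
Qed.

Lemma cderiv_line_re (a x : R) : cderiv (fun u => u +i* a) x 1.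
Proof. by split => /=; [exact: is_derive_id|exact: is_derive_cst]. Qed.
Lemma cderiv_line_im (u x : R) : cderiv (fun a => u +i* a) x 'i.
Proof. by split => /=; [exact: is_derive_cst|exact: is_derive_id]. Qed.

Lemma cderiv_Gau (W : R -> C) (x : R) (d : C) : cderiv W x d ->
  cderiv (fun y => Gau (W y)) x (- (d * (2 * pi)%:C * cexp (2%:C * W x)) * Gau (W x)).
Proof.
move=> dW.
have h := cderiv_exp (cderivN (cderivZ pi%:C (cderiv_exp (cderivZ 2%:C dW)))).
apply: cderiv_eq h _; rewrite /Gau rmorphM /=; congr (- _ * _); ring.
Qed.

Lemma cderiv_bker (s : C) (W : R -> C) (x : R) (d : C) : cderiv W x d ->
  cderiv (fun y => bker s (W y)) x (d * dbker s (W x)).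
Proof.
move=> dW; have h1 := cderiv_exp (cderivZ s dW).
have h2 := cderivZ (2 * pi)%:C (cderiv_exp (cderivZ 2%:C dW)).
have h := cderivM (cderivM h1 h2) (cderiv_Gau dW).
by apply: cderiv_eq h _; rewrite /dbker /bker; ring.
Qed.

Lemma cderiv_dbker (s : C) (W : R -> C) (x : R) (d : C) : cderiv W x d ->
  exists d', cderiv (fun y => dbker s (W y)) x d'.
Proof.
move=> dW; eexists; apply: cderivM; last exact: (cderiv_bker s dW).
apply: cderivD; first exact: cderiv_cst.
exact: (cderivN (cderivZ (2 * pi)%:C (cderiv_exp (cderivZ 2%:C dW)))).
Qed.

Lemma cos2_gt0 (a : R) : - (pi / 4) < a < pi / 4 -> 0 < cos (2 * a).
Proof. by move=> /andP[h1 h2]; apply: cos_gt0_pihalf; lra. Qed.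

Lemma cos2_le (a a0 : R) : 0 <= a0 < pi / 4 -> - a0 < a < a0 -> cos (2 * a0) <= cos (2 * a).
Proof.
move=> /andP[h0 h1] /andP[h2 h3].
have -> : cos (2 * a) = cos (2 * `|a|).
  have [h|h] := leP 0 a; first by rewrite ger0_norm.
  by rewrite ltr0_norm// mulrN cosN.
have a1 : `|a| < a0 by rewrite ltr_norml h2.
have := pi_gt0 R => pi0; have := normr_ge0 a => na.
by rewrite ltW// ltr_cos ?in_itv /=; lra.
Qed.

(** The bounds below are uniform only on narrower strips, so each [a] is placed inside one. *)
Lemma strip_width (a : R) : - (pi / 4) < a < pi / 4 ->
  exists2 a0 : R, 0 <= a0 < pi / 4 & - a0 < a < a0.
Proof.
rewrite -ltr_norml => h; exists ((`|a| + pi / 4) / 2).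
  by have := normr_ge0 a; move=> ?; apply/andP; split; lra.
by rewrite -ltr_norml; lra.
Qed.

Lemma bker_bound (s : C) (a0 : R) : 0 <= complex.Re s -> 0 <= a0 < pi / 4 ->
  exists2 K : R, 0 <= K & forall u a, - a0 < a < a0 ->
    cabs (bker s (u +i* a)) <= K * expR (- 1 * `|u|) /\
    cabs (dbker s (u +i* a)) <= K * expR (- 1 * `|u|).
Proof.
move=> s0 ha0; pose c := pi * cos (2 * a0); have := pi_gt0 R => pi0.
have c0 : 0 < c by rewrite mulr_gt0// cos2_gt0//; move: ha0 => /andP[h0 h1]; lra.
set t := complex.Re s in s0; set y := complex.Im s.
have t2 : 0 < t + 2 by lra.
have t4 : 0 < t + 4 by lra.
(* The kernel grows like [e^((t + 2) u)] before the Gaussian acts, whence [K1]; the factor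
   [cexp (2 w)] of [dbker] raises the exponent to [t + 4], whence [K2]. *)
have [K1 K10 H1] := gauss_decay c0 t2; have [K2 K20 H2] := gauss_decay c0 t4.
pose M := expR (`|y| * a0) * (2 * pi).
have M0 : 0 <= M by rewrite mulr_ge0 ?expR_ge0// mulr_ge0// pi_ge0.
pose K := M * K1 + (cabs s + 2) * (M * K1) + (2 * pi) * (M * K2).
have s2 : 0 <= cabs s + 2 by rewrite addr_ge0// cabs_ge0.
have p2 : 0 <= 2 * pi :> R by rewrite mulr_ge0// pi_ge0.
have MK1 : 0 <= M * K1 by rewrite mulr_ge0.
have MK2 : 0 <= M * K2 by rewrite mulr_ge0.
have sM : 0 <= (cabs s + 2) * (M * K1) by rewrite mulr_ge0.
have pM : 0 <= 2 * pi * (M * K2) by rewrite mulr_ge0.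
exists K; first by rewrite addr_ge0// addr_ge0.
have ele b u : 1 <= b -> expR (- b * `|u|) <= expR (- 1 * `|u|).
  by move=> b1; rewrite ler_expR ler_wpM2r// lerN2.
have E1 u a : - a0 < a < a0 -> cabs (bker s (u +i* a)) <=
    M * (expR ((t + 2) * u) * expR (- c * expR (2 * u))).
  move=> ha; rewrite cabs_bker -/t -/y.
  have -> : expR (t * u - y * a) * (2 * pi * expR (2 * u)) =
      expR (- (y * a)) * (2 * pi) * expR ((t + 2) * u).
    have e : expR (t * u - y * a) * expR (2 * u) = expR (- (y * a)) * expR ((t + 2) * u).
      by rewrite -!expRD; congr expR; ring.
    by rewrite mulrCA e; ring.
  rewrite -mulrA; apply: ler_pM.
  - by rewrite !mulr_ge0 ?expR_ge0 ?pi_ge0.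
  - by rewrite mulr_ge0 ?expR_ge0.
  - rewrite ler_wpM2r// ler_expR; apply: le_trans (ler_norm _) _.
    by rewrite normrN normrM ler_wpM2l// ltW// ltr_norml.
  - rewrite ler_wpM2l ?expR_ge0// ler_expR ler_wpM2r ?expR_ge0// lerN2.
    by rewrite ler_wpM2l ?pi_ge0// cos2_le.
have B1 u a : - a0 < a < a0 -> cabs (bker s (u +i* a)) <= M * K1 * expR (- 1 * `|u|).
  move=> ha; apply: le_trans (E1 u a ha) _; rewrite -mulrA ler_wpM2l//.
  by apply: le_trans (H1 u) _; rewrite ler_wpM2l// ele//; lra.
have B2 u a : - a0 < a < a0 -> cabs (bker s (u +i* a)) * expR (2 * u) <= M * K2 * expR (- 1 * `|u|).
  move=> ha; apply: le_trans (ler_wpM2r (expR_ge0 _) (E1 u a ha)) _.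
  have e4 : expR ((t + 4) * u) = expR ((t + 2) * u) * expR (2 * u).
    by rewrite -expRD; congr expR; ring.
  have -> : M * (expR ((t + 2) * u) * expR (- c * expR (2 * u))) * expR (2 * u) =
      M * (expR ((t + 4) * u) * expR (- c * expR (2 * u))) by rewrite e4; ring.
  rewrite -[leRHS]mulrA ler_wpM2l//.
  by apply: le_trans (H2 u) _; rewrite ler_wpM2l// ele//; lra.
move=> u a ha; split.
  apply: le_trans (B1 u a ha) _; rewrite ler_wpM2r ?expR_ge0//.
  by rewrite /K -addrA lerDl addr_ge0.
rewrite /dbker cabsM.
apply: (@le_trans _ _ ((cabs s + 2 + 2 * pi * expR (2 * u)) * cabs (bker s (u +i* a)))).
  rewrite ler_wpM2r ?cabs_ge0//; apply: le_trans (cabsB _ _) _.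
  apply: lerD; last first.
    rewrite cabsM cabs_real cabs_cexp ReM /= mul0r subr0 ger0_norm//.
  by apply: le_trans (cabsD _ _) _; rewrite cabs_real ger0_norm.
rewrite mulrDl; apply: (@le_trans _ _ ((cabs s + 2) * (M * K1 * expR (- 1 * `|u|)) +
    2 * pi * (M * K2 * expR (- 1 * `|u|)))).
  apply: lerD; first by rewrite ler_wpM2l// B1.
  rewrite -mulrA ler_wpM2l// mulrC; exact: B2.
rewrite -subr_ge0; set e := expR _.
have -> : K * e - ((cabs s + 2) * (M * K1 * e) + 2 * pi * (M * K2 * e)) = M * K1 * e.
  by rewrite /K; ring.
by rewrite mulr_ge0 ?expR_ge0.
Qed.

Lemma cvg_expRn (b : R) : 0 < b -> (fun n : nat => expR (- b * n%:R)) @ \oo --> 0.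
Proof.
move=> b0.
apply: (@cvg_comp _ _ _ (fun n : nat => n%:R) (fun x : R => expR (- b * x)) _ (+oo%R)).
  exact: cvgr_idn.
have -> : (fun x : R => expR (- b * x)) = (fun x => expR (- x)) \o (fun x => b * x).
  by apply/funext => n; rewrite /= mulNr.
apply: cvg_comp; last exact: cvgr_expR.
by apply: gt0_cvgMry => //; exact: cvg_id.
Qed.

Lemma ccvg_exp (F : nat -> C) (K b : R) : 0 < b ->
  (forall n, cabs (F n) <= K * expR (- b * n%:R)) -> ccvg F 0.
Proof.
move=> b0 h; apply/ccvgP; apply: (@squeeze_cvgr _ _ _ _ (fun=> 0) (fun n => K * expR (- b * n%:R))).
- by near=> n; rewrite cabs_ge0 subr0 h.
- exact: cvg_cst.
- by rewrite -[X in _ --> X](mulr0 K); apply: cvgM; [exact: cvg_cst|exact: cvg_expRn].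
Unshelve. all: by end_near.
Qed.

Lemma cintg_expabs (F : R -> C) (K : R) : ccont F ->
  (forall u, cabs (F u) <= K * expR (- 1 * `|u|)) -> cintg F.
Proof.
move=> cF FK; apply: (cintg_dom (cmeas_cont cF) _ FK).
by apply: rintgZ; apply: rintg_expabs.
Qed.

Lemma ccont_bker (s : C) (a : R) : ccont (fun u => bker s (u +i* a)).
Proof. by apply: cderiv_ccont => x; apply: cderiv_bker; exact: cderiv_line_re. Qed.

Lemma cintg_bker (s : C) (a : R) : 0 <= complex.Re s -> - (pi / 4) < a < pi / 4 ->
  cintg (fun u => bker s (u +i* a)).
Proof.
move=> s0 /strip_width[a0 ha0 ha].
have [K K0 HK] := bker_bound s0 ha0.
by apply: (@cintg_expabs _ K (ccont_bker s a)) => u; case: (HK u a ha).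
Qed.

(** Cauchy-Riemann: the derivative in [a] is ['i] times the derivative in [u], so ['i] times the
    kernel itself serves as [Psi] in the homotopy. *)
Lemma bker_invariant (s : C) (a : R) : 0 <= complex.Re s -> - (pi / 4) < a < pi / 4 ->
  cint (fun u => bker s (u +i* a)) = cint (fun u => bker s u%:C).
Proof.
move=> s0 /strip_width[a0 ha0 ha].
have [K K0 HK] := bker_bound s0 ha0.
have i1 : cabs ('i : C) = 1 by rewrite cabsE /= expr0n add0r expr1n sqrtr1.
have ci t : ccont (fun u => dbker s (u +i* t)).
  split => x; have [d [d1 d2]] := cderiv_dbker s (cderiv_line_re t x).
    exact: is_derive_continuous d1.
  exact: is_derive_continuous d2.
apply: (@cint_homotopy R (fun a u => bker s (u +i* a)) (fun a u => 'i * bker s (u +i* a))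
  (fun a u => 'i * dbker s (u +i* a)) (- a0) a0 (fun u => K * expR (- 1 * `|u|))) => //.
- by move=> t x _; apply: cderiv_bker; exact: cderiv_line_im.
- move=> t x _; apply: cderivZ; rewrite -[X in cderiv _ _ X]mul1r.
  by apply: cderiv_bker; exact: cderiv_line_re.
- by move=> t _; apply: ccontM => //; exact: ccont_cst.
- move=> t /andP[t1 t2]; apply: cintg_bker => //; move: ha0 => /andP[? ?]; apply/andP; split; lra.
- by move=> t x ht; rewrite cabsM i1 mul1r; case: (HK x t ht).
- by apply: rintgZ; exact: rintg_expabs.
- move=> t ht; apply: (@ccvg_exp _ K 1 ltr01) => n; rewrite cabsM i1 mul1r.
  by have [+ _] := HK n%:R t ht; rewrite ger0_norm.
- move=> t ht; apply: (@ccvg_exp _ K 1 ltr01) => n; rewrite cabsM i1 mul1r.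
  by have [+ _] := HK (- n%:R) t ht; rewrite normrN ger0_norm.
- by move: ha => /andP[? ?]; apply/andP; split; lra.
Qed.

End GaussKernel.

(** * The mass of a complex Gaussian *)

Section GaussLine.
Context {R : realType}.
Local Notation mu := (@lebesgue_measure R).
Local Notation C := R[i].

(** One half of the Gaussian exponent absorbs [1 + x^2]; the other half gives [e^(- |x|)] through
    the completed square [|x| <= 1 / q + q x^2 / 4]. *)
Lemma quad_decay (q : R) : 0 < q -> exists2 K : R, 0 <= K &
  forall x, (1 + x ^+ 2) * expR (- q * x ^+ 2) <= K * expR (- 1 * `|x|).
Proof.
move=> q0; exists ((1 + 2 / q) * expR q^-1).
  by rewrite mulr_ge0 ?expR_ge0// addr_ge0// divr_ge0// ltW.
move=> x; have x2 := sqr_ge0 x.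
have q2 : 0 <= 2 / q by rewrite divr_ge0// ltW.
have qx : 0 <= q / 2 * x ^+ 2 by rewrite mulr_ge0// divr_ge0// ltW.
have h1 : 1 + x ^+ 2 <= (1 + 2 / q) * expR (q / 2 * x ^+ 2).
  apply: (@le_trans _ _ ((1 + 2 / q) * (1 + q / 2 * x ^+ 2))).
    have -> : (1 + 2 / q) * (1 + q / 2 * x ^+ 2) = 1 + x ^+ 2 + (2 / q + q / 2 * x ^+ 2).
      by field; rewrite gt_eqF.
    by rewrite lerDl addr_ge0.
  rewrite ler_wpM2l//; first by rewrite addr_ge0.
  exact: expR_ge1Dx.
have h2 : `|x| <= q^-1 + q / 4 * x ^+ 2.
  rewrite -(real_normK (num_real x)); set y := `|x|.
  have : 0 <= q^-1 * (1 - q / 2 * y) ^+ 2 by rewrite mulr_ge0 ?sqr_ge0// invr_ge0 ltW.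
  have -> : q^-1 * (1 - q / 2 * y) ^+ 2 = q^-1 + q / 4 * y ^+ 2 - y.
    by field; rewrite gt_eqF.
  by rewrite subr_ge0.
apply: (@le_trans _ _ ((1 + 2 / q) * expR (q / 2 * x ^+ 2) * expR (- q * x ^+ 2))).
  by rewrite ler_wpM2r ?expR_ge0.
rewrite -!mulrA ler_wpM2l//; first by rewrite addr_ge0.
rewrite -!expRD ler_expR.
by move: h2 qx; lra.
Qed.

(* e^w exp(-pi e^{2w} x^2), the Gaussian of parameter e^{2w} normalised to have mass 1 *)
Definition gl (w : C) (x : R) : C := cexp w * cexp (- (pi%:C * cexp (2%:C * w) * (x ^+ 2)%:C)).
Definition dgl (w : C) (x : R) : C :=
  (1 - (2 * pi)%:C * cexp (2%:C * w) * (x ^+ 2)%:C) * gl w x.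

Lemma cderiv_sqr (x : R) : cderiv (fun y : R => (y ^+ 2)%:C) x (2 * x)%:C.
Proof.
split; last exact: is_derive_cst.
by apply: (is_derive_val (is_derive_mul (is_derive_id _ _) (is_derive_id _ _))); rewrite /=; ring.
Qed.

Lemma cderiv_gl_w (W : R -> C) (t x : R) (d : C) : cderiv W t d ->
  cderiv (fun s => gl (W s) x) t (d * dgl (W t) x).
Proof.
move=> dW; have h2 := cderiv_exp (cderivZ 2%:C dW).
have h3 := cderiv_exp (cderivN (cderivM (cderivZ pi%:C h2) (cderiv_cst (x ^+ 2)%:C t))).
have h := cderivM (cderiv_exp dW) h3.
by apply: cderiv_eq h _; rewrite /dgl /gl !rmorphM /=; ring.
Qed.

Lemma cderiv_gl_x (w : C) (x : R) :
  cderiv (gl w) x (- ((2 * pi)%:C * cexp (2%:C * w) * x%:C) * gl w x).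
Proof.
have h3 := cderiv_exp (cderivN (cderivZ (pi%:C * cexp (2%:C * w)) (cderiv_sqr x))).
have h := cderivZ (cexp w) h3.
by apply: cderiv_eq h _; rewrite /gl !rmorphM /=; ring.
Qed.

(** This is what makes the mass of [gl w] independent of [w]: [dgl] is the derivative of [gl] in [w]
    and at the same time an exact derivative in [x]. *)
Lemma cderiv_xgl (w : C) (x : R) : cderiv (fun y => y%:C * gl w y) x (dgl w x).
Proof.
have h := cderivM (cderiv_id x) (cderiv_gl_x w x).
by apply: cderiv_eq h _; rewrite /dgl !(rmorphM, rmorphXn) /=; ring.
Qed.

Lemma cabs_gl (u a x : R) : cabs (gl (u +i* a) x) =
  expR u * expR (- (pi * (expR (2 * u) * cos (2 * a))) * x ^+ 2).
Proof.
rewrite /gl cabsM !cabs_cexp /=; congr (_ * expR _).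
rewrite !(ReN, ReM, ImM, Re_cexp, Im_cexp) /= !(mul0r, mulr0, subr0, addr0).
by ring.
Qed.

Lemma gl_bound (B a0 : R) : 0 <= a0 < pi / 4 -> exists2 K : R, 0 <= K &
  forall u a x, - B < u < B -> - a0 < a < a0 ->
   [/\ cabs (gl (u +i* a) x) <= K * expR (- 1 * `|x|),
       cabs (x%:C * gl (u +i* a) x) <= K * expR (- 1 * `|x|) &
       cabs (dgl (u +i* a) x) <= K * expR (- 1 * `|x|)].
Proof.
move=> ha0; have pi0 := pi_gt0 R.
have c0 : 0 < cos (2 * a0) by apply: cos2_gt0; move: ha0 => /andP[? ?]; apply/andP; split; lra.
pose q := pi * (expR (2 * - B) * cos (2 * a0)).
have q0 : 0 < q by rewrite !mulr_gt0 ?expR_gt0.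
have [K K0 HK] := quad_decay q0.
(* [p] bounds [2 pi |e^(2 w)|], so each of the three functions is [gl] times a factor of modulus at
   most [(1 + p) (1 + x^2)]. *)
pose p := 2 * pi * expR (2 * B).
have p0 : 0 <= p by rewrite !mulr_ge0 ?expR_ge0 ?pi_ge0.
pose M := (1 + p) * expR B.
have M0 : 0 <= M by rewrite mulr_ge0 ?expR_ge0// addr_ge0.
exists (M * K); first by rewrite mulr_ge0.
move=> u a x /andP[u1 u2] ha; have x2 := sqr_ge0 x.
have E : cabs (gl (u +i* a) x) <= expR B * expR (- q * x ^+ 2).
  rewrite cabs_gl ler_pM ?expR_ge0// ?ler_expR ?(ltW u2)//.
  rewrite ler_wpM2r// lerN2 ler_wpM2l ?pi_ge0// ler_pM ?expR_ge0 ?(ltW c0)//.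
    by rewrite ler_expR ler_wpM2l// ltW.
  exact: cos2_le.
have main y : 0 <= y -> y <= (1 + p) * (1 + x ^+ 2) ->
    y * cabs (gl (u +i* a) x) <= M * K * expR (- 1 * `|x|).
  move=> y0 yp; apply: le_trans (ler_wpM2l y0 E) _.
  apply: le_trans (ler_wpM2r (mulr_ge0 (expR_ge0 _) (expR_ge0 _)) yp) _.
  have -> : (1 + p) * (1 + x ^+ 2) * (expR B * expR (- q * x ^+ 2)) =
    M * ((1 + x ^+ 2) * expR (- q * x ^+ 2)) by rewrite /M; ring.
  by rewrite -[leRHS]mulrA ler_wpM2l.
have px : 0 <= p * x ^+ 2 by rewrite mulr_ge0.
split.
- by rewrite -[leLHS]mul1r; apply: main => //; rewrite mulrDl mulrDr; lra.
- rewrite cabsM cabs_real; apply: main => //.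
  have : `|x| <= 1 + x ^+ 2.
    rewrite -(real_normK (num_real x)); set y := `|x|.
    by have := sqr_ge0 (y - 1); rewrite sqrrB; have := sqr_ge0 y; rewrite mulr1 expr1n mulr2n; lra.
  by rewrite mulrDl mulrDr; lra.
- rewrite /dgl cabsM; apply: le_trans (main (1 + p * x ^+ 2) _ _); last 2 first.
  + by rewrite addr_ge0.
  + by rewrite mulrDl mulrDr; lra.
  rewrite ler_wpM2r ?cabs_ge0//; apply: le_trans (cabsB _ _) _.
  rewrite cabs1 lerD2l !cabsM !cabs_real cabs_cexp ReM /= mul0r subr0.
  rewrite (ger0_norm x2) ler_wpM2r// ger0_norm; last by rewrite mulr_ge0 ?pi_ge0.
  by rewrite ler_wpM2l ?ler_expR ?ler_wpM2l ?(ltW u2)// mulr_ge0 ?pi_ge0.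
Qed.

Lemma ccont_gl (w : C) : ccont (gl w).
Proof. by apply: cderiv_ccont => x; exact: cderiv_gl_x. Qed.

Lemma ccont_dgl (w : C) : ccont (dgl w).
Proof.
apply: ccontM (ccont_gl w); apply: (@cderiv_ccont _ _ (fun x => _)) => x.
apply: cderivD; first exact: cderiv_cst.
by apply: cderivN; apply: cderivZ; exact: cderiv_sqr.
Qed.

Lemma cintg_gl (u a : R) : - (pi / 4) < a < pi / 4 -> cintg (gl (u +i* a)).
Proof.
move=> /strip_width[a0 ha0 ha]; have [K K0 HK] := gl_bound (`|u| + 1) ha0.
apply: (@cintg_expabs _ _ K (ccont_gl _)) => x.
by have [] := HK u a x _ ha; rewrite // -ltr_norml ltrDl.
Qed.

(** The mass is constant along a vertical path to the real axis and along a horizontal one to a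
    point where the classical Gaussian integral applies. *)
Lemma cint_gl (u a : R) : - (pi / 4) < a < pi / 4 -> cint (gl (u +i* a)) = 1.
Proof.
move=> ha'; have /strip_width[a0 ha0 ha] := ha'.
have pi0 := pi_gt0 R; have h0 : - a0 < 0 < a0 by move: ha => /andP[? ?]; apply/andP; split; lra.
have hb t : - a0 < t < a0 -> - (pi / 4) < t < pi / 4.
  by move: ha0 => /andP[? ?] /andP[? ?]; apply/andP; split; lra.
(* Here [e^(2 r) = 1 / pi], so that [gl] at [r] is [e^r exp (- x^2)], of mass [e^r sqrt pi = 1]. *)
pose r := - (ln pi / 2) : R.
pose B := `|u| + `|r| + 1.
have uB : - B < u < B by rewrite -ltr_norml /B -addrA ltrDl ltr_wpDl.
have rB : - B < r < B by rewrite -ltr_norml /B addrAC ltrDr ltr_wpDl.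
have [K K0 HK] := gl_bound B ha0.
have i1 : cabs ('i : C) = 1 by rewrite cabsE /= expr0n add0r expr1n sqrtr1.
have ig : rintg (fun x : R => K * expR (- 1 * `|x|)) by apply: rintgZ; exact: rintg_expabs.
have vanish (d : C) t y : cabs d = 1 -> - B < t < B -> - a0 < y < a0 -> forall s : nat -> R,
    (forall n, `|s n| = n%:R) -> ccvg (fun n => d * ((s n)%:C * gl (t +i* y) (s n))) 0.
  move=> d1 ht hy s sn; apply: (@ccvg_exp _ _ K 1 ltr01) => n; rewrite cabsM d1 mul1r -sn.
  by have [] := HK t y (s n) ht hy.
have absn (n : nat) : `|n%:R : R| = n%:R by rewrite ger0_norm.
have absNn (n : nat) : `|- n%:R : R| = n%:R by rewrite normrN absn.
transitivity (cint (gl (u +i* 0))).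
  apply: (@cint_homotopy R (fun t => gl (u +i* t)) (fun t x => 'i * (x%:C * gl (u +i* t) x))
    (fun t x => 'i * dgl (u +i* t) x) (- a0) a0 (fun x => K * expR (- 1 * `|x|))) => //.
  - by move=> t x _; apply: cderiv_gl_w; exact: cderiv_line_im.
  - by move=> t x _; apply: cderivZ; exact: cderiv_xgl.
  - by move=> t _; apply: ccontM (ccont_dgl _); exact: ccont_cst.
  - by move=> t ht; apply: cintg_gl; exact: hb.
  - by move=> t x ht; rewrite cabsM i1 mul1r; have [] := HK u t x uB ht.
  - by move=> t ht; apply: vanish.
  - by move=> t ht; apply: (vanish _ _ _ _ _ _ (fun n => - n%:R)).
transitivity (cint (gl (r +i* 0))).
  apply: (@cint_homotopy R (fun t => gl (t +i* 0)) (fun t x => 1 * (x%:C * gl (t +i* 0) x))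
    (fun t x => 1 * dgl (t +i* 0) x) (- B) B (fun x => K * expR (- 1 * `|x|))) => //.
  - by move=> t x _; apply: cderiv_gl_w; exact: cderiv_line_re.
  - by move=> t x _; apply: cderivZ; exact: cderiv_xgl.
  - by move=> t _; apply: ccontM (ccont_dgl _); exact: ccont_cst.
  - by move=> t ht; apply: cintg_gl; exact: hb.
  - by move=> t x ht; rewrite mul1r; have [] := HK t 0 x ht h0.
  - by move=> t ht; apply: vanish => //; rewrite cabs1.
  - by move=> t ht; apply: (vanish _ _ _ _ _ _ (fun n => - n%:R)) => //; rewrite cabs1.
have e1 : expR (2 * r) = pi^-1.
  have -> : 2 * r = - ln pi by rewrite /r mulrN mulrCA mulfV ?mulr1.
  by rewrite expRN lnK ?posrE.
have e2 : expR r * Num.sqrt pi = 1.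
  apply/eqP; rewrite -(@eqrXn2 _ 2%N)// ?mulr_ge0 ?expR_ge0 ?sqrtr_ge0//.
  by rewrite exprMn -expRM_natl e1 sqr_sqrtr ?pi_ge0// expr1n mulVf// gt_eqF.
have e x : gl (r +i* 0) x = (expR r * gauss_fun x)%:C.
  rewrite /gl; have -> : 2%:C * (r +i* 0) = (2 * r)%:C by rewrite rmorphM.
  rewrite !cexp_real e1 -!rmorphM /= mulfV ?gt_eqF// mul1r -rmorphN cexp_real.
  by rewrite /gauss_fun rmorphM.
rewrite (eq_cint e) cint_real; last exact: rintgZ (@integrableT_gauss R).
rewrite rintZ; last exact: (@integrableT_gauss R).
have -> : rint (@gauss_fun R) = Num.sqrt pi by rewrite /rint /Rintegral integralT_gauss.
by rewrite e2.
Qed.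

End GaussLine.

(** * Concentration at a peak, and the Fourier transform of the Gaussian *)

Section Fourier.
Context {R : realType}.
Local Notation mu := (@lebesgue_measure R).
Local Notation C := R[i].

Lemma rintg_indic (a b : R) : rintg (\1_(`]a, b[%classic) : R -> R).
Proof.
apply: integrable_indic_itv.
Qed.

Lemma rint_indic (a b : R) : a <= b -> rint (\1_(`]a, b[%classic) : R -> R) = b - a.
Proof.
move=> ab; rewrite /rint /Rintegral integral_indic//= setIT lebesgue_measure_itv /= lte_fin.
by move: ab; rewrite le_eqVlt => /predU1P[->|->]; rewrite ?ltxx ?subrr -?EFinD.
Qed.

Lemma rintg_indico (a b : R) : rintg (\1_(`[a, b[%classic) : R -> R).
Proof. exact: integrable_indic_itv. Qed.

Lemma rint_indico (a b : R) : a <= b -> rint (\1_(`[a, b[%classic) : R -> R) = b - a.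
Proof.
move=> ab; rewrite /rint /Rintegral integral_indic//= setIT lebesgue_measure_itv /= lte_fin.
by move: ab; rewrite le_eqVlt => /predU1P[->|->]; rewrite ?ltxx ?subrr -?EFinD.
Qed.

(* Laplace's method: were [D x0] positive, the contribution of a neighbourhood of [x0]
   would beat the rest geometrically. *)
Lemma peak_le (D y : R -> R) (x0 : R) :
  rintg D -> rmeas y -> (forall x, 0 <= y x <= 1) ->
  (forall q, q < 1 -> exists2 e, 0 < e & forall x, `|x - x0| < e -> q <= y x) ->
  (forall e, 0 < e -> exists2 q, q < 1 & forall x, D x != 0 -> e <= `|x - x0| -> y x <= q) ->
  {for x0, continuous D} ->
  (forall n, rint (fun x => D x * y x ^+ n) <= 0) -> D x0 <= 0.
Proof.
move=> iD my y01 ynear yfar cD int0; rewrite leNgt; apply/negP => D0.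
have [e e0 De] : exists2 e, 0 < e & forall x, `|x - x0| < e -> D x0 / 2 <= D x.
  have /cvgrPdist_lt/(_ (D x0 / 2)) : D x @[x --> x0] --> D x0 by exact: cD.
  case; first by lra.
  move=> e /= e0 He; exists e => // x xe.
  by have := He x; rewrite /= distrC => /(_ xe); rewrite ltr_distl => /andP[? ?]; lra.
have [q' q'1 Hq'] := yfar e e0.
pose q := Num.max q' (1 / 2).
have q1 : q < 1 by rewrite gt_max q'1 /=; lra.
have q12 : 1 / 2 <= q by rewrite le_max lexx orbT.
have q0 : 0 < q by lra.
have Hq x : D x != 0 -> e <= `|x - x0| -> y x <= q.
  by move=> h1 h2; rewrite le_max Hq'.
pose r := (q + 1) / 2; have r1 : r < 1 by rewrite /r; lra.
have qr : q < r by rewrite /r; lra.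
have [e' e'0 He'] := ynear r r1.
pose d := Num.min e e'; have d0 : 0 < d by rewrite lt_min e0.
pose J := `]x0 - d, x0 + d[%classic.
have inJ x : (x \in J) = (`|x - x0| < d).
  by rewrite /J mem_setE in_itv /= ltr_distl.
pose I := rint (fun x => `|D x|).
have I0 : 0 <= I by apply: rint_ge0.
(* The ball of radius [d] contributes at least [D x0 / 2 * r^n] times its length. Between [d] and
   [e] the integrand is nonnegative, and further out it loses at most [q^n] times the L1 norm of
   [D]. *)
have key n : D x0 / 2 * r ^+ n * (2 * d) <= q ^+ n * I.
  have rn : 0 <= r ^+ n by rewrite exprn_ge0// ltW// (lt_trans q0).
  have qn : 0 <= q ^+ n by rewrite exprn_ge0// ltW.
  have yn x : 0 <= y x ^+ n <= 1.
    by have /andP[h1 h2] := y01 x; rewrite exprn_ge0//= exprn_ile1.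
  have i1 : rintg (fun x => D x * y x ^+ n).
    apply: (rintg_dom _ (rintg_norm iD)).
      by apply: measurable_funM; [exact: rintg_meas|exact: measurable_funX].
    move=> x; rewrite normrM ler_piMr//; have /andP[h1 h2] := yn x; by rewrite ger0_norm.
  have i2 : rintg (fun x => D x0 / 2 * r ^+ n * \1_J x - q ^+ n * `|D x|).
    by apply: rintgB; [apply: rintgZ; exact: rintg_indic|apply: rintgZ; exact: rintg_norm].
  have : rint (fun x => D x0 / 2 * r ^+ n * \1_J x - q ^+ n * `|D x|) <=
      rint (fun x => D x * y x ^+ n).
    apply: rint_le => // x.
    have nD : 0 <= q ^+ n * `|D x| by rewrite mulr_ge0.
    have /andP[yn0 yn1] := yn x; have /andP[yx0 yx1] := y01 x.
    rewrite indicE inJ; have [xd|xd] /= := ltP `|x - x0| d.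
      move: xd; rewrite lt_min => /andP[x1 x2].
      rewrite mulr1; apply: (@le_trans _ _ (D x0 / 2 * r ^+ n)); first by rewrite lerBlDr lerDl.
      by apply: ler_pM; rewrite ?divr_ge0 ?(ltW D0)//; [exact: De|rewrite lerXn2r ?nnegrE ?He'//; lra].
    rewrite mulr0 sub0r; have [x1|x1] := ltP `|x - x0| e.
      apply: (@le_trans _ _ 0); first by rewrite oppr_le0.
      by rewrite mulr_ge0// (le_trans _ (De _ x1))// divr_ge0// ltW.
    have [->|Dx] := eqVneq (D x) 0; first by rewrite normr0 mulr0 mul0r oppr0.
    rewrite lerNl -mulNr; apply: (@le_trans _ _ (`|D x| * y x ^+ n)).
      by rewrite ler_wpM2r// -normrN ler_norm.
    by rewrite mulrC ler_wpM2r// lerXn2r ?nnegrE ?(ltW q0)// Hq.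
  move=> /le_trans/(_ (int0 n)); rewrite rintB; [|by apply: rintgZ; exact: rintg_indic|by apply: rintgZ; exact: rintg_norm].
  rewrite rintZ; last exact: rintg_indic.
  rewrite rintZ; last exact: rintg_norm.
  rewrite rint_indic; last by lra.
  by rewrite subr_le0; have -> : x0 + d - (x0 - d) = 2 * d by ring.
pose c := r / q - 1; have c0 : 0 < c by rewrite subr_gt0 ltr_pdivlMr ?mul1r.
pose K := I / (D x0 * d).
(* Bernoulli's inequality for [r / q = 1 + c] contradicts a bound that is uniform in [n]. *)
have bound n : n%:R * c <= K.
  have : (r / q) ^+ n <= K.
    rewrite /K ler_pdivlMr ?mulr_gt0// expr_div_n mulrAC ler_pdivrMr ?exprn_gt0//.
    have := key n; have -> : D x0 / 2 * r ^+ n * (2 * d) = r ^+ n * (D x0 * d) by field.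
    by rewrite [I * _]mulrC.
  apply: le_trans.
  have -> : r / q = 1 + c by rewrite /c; ring.
  have : 1 + c *+ n <= (1 + c) ^+ n.
    elim: n => [|n IH]; first by rewrite expr0 addr0.
    rewrite exprS mulrSr; apply: (@le_trans _ _ ((1 + c) * (1 + c *+ n))); last first.
      by rewrite ler_wpM2l// addr_ge0// ltW.
    rewrite mulrDl mul1r mulrDr mulr1 !addrA -addrA.
    have : 0 <= c * (c *+ n) by rewrite mulr_ge0 ?mulrn_wge0 ?ltW.
    by lra.
  by rewrite -[c *+ n]mulr_natl; apply: le_trans; rewrite lerDr.
have := bound (Num.truncn (K / c)).+1.
have := truncnS_gt (K / c); rewrite ltr_pdivrMr// => h1 h2.
by have := lt_le_trans h1 h2; rewrite ltxx.
Qed.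

Lemma peak_eq0 (D y : R -> R) (x0 : R) :
  rintg D -> rmeas y -> (forall x, 0 <= y x <= 1) ->
  (forall q, q < 1 -> exists2 e, 0 < e & forall x, `|x - x0| < e -> q <= y x) ->
  (forall e, 0 < e -> exists2 q, q < 1 & forall x, D x != 0 -> e <= `|x - x0| -> y x <= q) ->
  {for x0, continuous D} ->
  (forall n, rint (fun x => D x * y x ^+ n) = 0) -> D x0 = 0.
Proof.
move=> iD my y01 ynear yfar cD int0; apply/eqP; rewrite eq_le; apply/andP; split.
  by apply: (@peak_le D y) => // n; rewrite int0.
suff : - D x0 <= 0 by rewrite oppr_le0.
apply: (@peak_le (fun x => - D x) y).
- exact: rintgN.
- exact: my.
- exact: y01.
- exact: ynear.
- move=> e e0; have [q q1 H] := yfar e e0; exists q => // x; rewrite oppr_eq0; exact: H.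
- exact: continuousN.
- move=> n; have -> : (fun x => - D x * y x ^+ n) = (fun x => (-1) * (D x * y x ^+ n)).
    by apply/funext => x; rewrite mulN1r mulNr.
  rewrite rintZ ?int0 ?mulr0//.
  apply: (rintg_dom _ (rintg_norm iD)).
    by apply: measurable_funM; [exact: rintg_meas|exact: measurable_funX].
  move=> x; rewrite normrM ler_piMr//; have /andP[h1 h2] := y01 x.
  by rewrite normrX exprn_ile1 ?normr_ge0// ger0_norm.
Qed.

(* The phase of the Fourier transform at frequency m, along x |-> x + t i m e^{-2w} *)
Definition glphase (w : C) (m t x : R) : C :=
  cexp (- (2 * pi * m * t * x)%:C * 'i + (pi * m ^+ 2 * t ^+ 2)%:C * cexp (- (2%:C * w))).

(** Completing the square as a homotopy: [gl w x * glphase w m t x] is [gl w] along the shifted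
    path, equal to [gl w x] at [t = 0] and to a constant times the Fourier integrand at [t = 1]. *)
Lemma gl_fourier (u a m : R) : - (pi / 4) < a < pi / 4 ->
  let w := u +i* a in
  cintg (fun x => gl w x * cexp (- (2 * pi * m * x)%:C * 'i)) /\
  cint (fun x => gl w x * cexp (- (2 * pi * m * x)%:C * 'i)) =
    cexp (- ((pi * m ^+ 2)%:C * cexp (- (2%:C * w)))).
Proof.
move=> ha' w; have /strip_width[a0 ha0 ha] := ha'.
have pi0 := pi_gt0 R.
have uB : - (`|u| + 1) < u < `|u| + 1 by rewrite -ltr_norml ltrDl.
have [K K0 HK] := gl_bound (`|u| + 1) ha0.
(* The velocity of the shifted path in [t], hence the ratio of the derivative in [t] to the
   derivative in [x]. *)
pose c : C := 'i * m%:C * cexp (- (2%:C * w)).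
pose D t x : C := ((- (2 * pi * m * x)%:C) * 'i + (2 * pi * m ^+ 2 * t)%:C * cexp (- (2%:C * w))) *
   (gl w x * glphase w m t x).
have ce : cexp (2%:C * w) * cexp (- (2%:C * w)) = 1 by rewrite -cexpD subrr cexp0.
have i2 : 'i * 'i = -1 :> C by rewrite -expr2 sqr_i.
have dphx t x : cderiv (glphase w m t) x (- (2 * pi * m * t)%:C * 'i * glphase w m t x).
  have h : cderiv (fun x : R => - (2 * pi * m * t * x)%:C * 'i +
      (pi * m ^+ 2 * t ^+ 2)%:C * cexp (- (2%:C * w))) x (- (2 * pi * m * t)%:C * 'i).
    have h1 := cderivD (cderivZ (- (2 * pi * m * t)%:C * 'i) (cderiv_id x))
      (cderiv_cst ((pi * m ^+ 2 * t ^+ 2)%:C * cexp (- (2%:C * w))) x).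
    have -> : (fun x : R => - (2 * pi * m * t * x)%:C * 'i +
      (pi * m ^+ 2 * t ^+ 2)%:C * cexp (- (2%:C * w))) =
      (fun y : R => - (2 * pi * m * t)%:C * 'i * y%:C +
        (pi * m ^+ 2 * t ^+ 2)%:C * cexp (- (2%:C * w))).
      by apply/funext => y; rewrite [(_ * y)%:C]rmorphM /=; ring.
    by apply: cderiv_eq h1 _; ring.
  exact: cderiv_exp h.
have dpht t x : cderiv (fun s => glphase w m s x) t ((- (2 * pi * m * x)%:C * 'i +
    (2 * pi * m ^+ 2 * t)%:C * cexp (- (2%:C * w))) * glphase w m t x).
  have h1 := cderivD (cderivZ (- (2 * pi * m * x)%:C * 'i) (cderiv_id t))
    (cderivZ ((pi * m ^+ 2)%:C * cexp (- (2%:C * w))) (cderiv_sqr t)).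
  have e : (fun s => glphase w m s x) =
      (fun y : R => cexp (- (2 * pi * m * x)%:C * 'i * y%:C +
        (pi * m ^+ 2)%:C * cexp (- (2%:C * w)) * (y ^+ 2)%:C)).
    by apply/funext => y; rewrite /glphase !rmorphM /=; congr cexp; ring.
  rewrite e; apply: cderiv_eq (cderiv_exp h1) _; rewrite /glphase.
  have -> : - (2 * pi * m * x)%:C * 'i * t%:C + (pi * m ^+ 2)%:C * cexp (- (2%:C * w)) * (t ^+ 2)%:C =
    - (2 * pi * m * t * x)%:C * 'i + (pi * m ^+ 2 * t ^+ 2)%:C * cexp (- (2%:C * w)).
    by rewrite !rmorphM /=; ring.
  by congr (_ * _); rewrite !rmorphM /=; ring.
have dPhi t x : cderiv (fun s => gl w x * glphase w m s x) t (D t x).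
  by apply: cderiv_eq (cderivZ (gl w x) (dpht t x)) _; rewrite /D; ring.
have dPhx t x : cderiv (fun y => gl w y * glphase w m t y) x
    (- ((2 * pi)%:C * cexp (2%:C * w) * x%:C + (2 * pi * m * t)%:C * 'i) * (gl w x * glphase w m t x)).
  by apply: cderiv_eq (cderivM (cderiv_gl_x w x) (dphx t x)) _; ring.
have dPsi t x : cderiv (fun y => c * (gl w y * glphase w m t y)) x (D t x).
  apply: cderiv_eq (cderivZ c (dPhx t x)) _; rewrite /D mulrA; congr (_ * _).
  have -> : c * - ((2 * pi)%:C * cexp (2%:C * w) * x%:C + (2 * pi * m * t)%:C * 'i) =
    - ((2 * pi)%:C * (cexp (2%:C * w) * cexp (- (2%:C * w))) * m%:C * x%:C * 'i) -
     ('i * 'i) * (m%:C * (2 * pi * m * t)%:C) * cexp (- (2%:C * w)) by rewrite /c; ring.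
  by rewrite ce i2 !(rmorphM, rmorphXn) /=; ring.
pose e2 := cabs (cexp (- (2%:C * w))); have e20 : 0 <= e2 by exact: cabs_ge0.
pose P := expR (pi * m ^+ 2 * 4 * e2).
have P0 : 0 <= P by exact: expR_ge0.
have ph t x : - 2 < t < 2 -> cabs (glphase w m t x) <= P.
  move=> /andP[t1 t2]; rewrite cabs_cexp !ReImE /= !(mulr0, mul0r, subr0, oppr0, add0r) ler_expR.
  apply: le_trans (ler_norm _) _; rewrite normrM.
  apply: ler_pM => //; last exact: cabs_Re.
  have pm : 0 <= pi * m ^+ 2 by rewrite mulr_ge0 ?pi_ge0 ?sqr_ge0.
  rewrite ger0_norm; last by rewrite mulr_ge0 ?sqr_ge0.
  rewrite ler_wpM2l//.
  have : 0 <= (2 - t) * (2 + t) by rewrite mulr_ge0//; lra.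
  have -> : (2 - t) * (2 + t) = 4 - t ^+ 2 by ring.
  by rewrite subr_ge0.
have Kx x := HK u a x uB ha.
pose M := (2 * pi * `|m| + 2 * pi * m ^+ 2 * 2 * e2 + 1) * (K * P).
have c1 : 0 <= 2 * pi * `|m| by rewrite !mulr_ge0 ?pi_ge0.
have p2 : 0 <= 2 * pi :> R by rewrite mulr_ge0 ?pi_ge0.
have pm : 0 <= 2 * pi * m ^+ 2 by rewrite mulr_ge0 ?sqr_ge0.
have c2 : 0 <= 2 * pi * m ^+ 2 * 2 * e2 by rewrite mulr_ge0// mulr_ge0.
have KP : 0 <= K * P by rewrite mulr_ge0.
have Phib t x : - 2 < t < 2 -> cabs (gl w x * glphase w m t x) <= (K * P) * expR (- 1 * `|x|).
  move=> ht; rewrite cabsM mulrAC; apply: ler_pM; rewrite ?cabs_ge0 ?ph//.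
  by have [] := Kx x.
have Dbound t x : - 2 < t < 2 -> cabs (D t x) <= M * expR (- 1 * `|x|).
  move=> ht; have [k1 k2 _] := Kx x; rewrite /D mulrDl; apply: le_trans (cabsD _ _) _.
  have -> : M * expR (- 1 * `|x|) = 2 * pi * `|m| * (K * P * expR (- 1 * `|x|)) +
      2 * pi * m ^+ 2 * 2 * e2 * (K * P * expR (- 1 * `|x|)) + K * P * expR (- 1 * `|x|).
    by rewrite /M; ring.
  rewrite -[leLHS]addr0; apply: lerD; last first.
    by rewrite mulr_ge0 ?expR_ge0.
  apply: lerD.
    have -> : - (2 * pi * m * x)%:C * 'i * (gl w x * glphase w m t x) =
      (- (2 * pi * m)%:C * 'i) * ((x%:C * gl w x) * glphase w m t x).
      by rewrite [(_ * x)%:C]rmorphM /=; ring.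
    rewrite cabsM; apply: ler_pM; rewrite ?cabs_ge0//.
      rewrite cabsM cabsN cabs_real !normrM (ger0_norm (ltW pi0)) ger0_norm//.
      by rewrite cabsE /= expr0n add0r expr1n sqrtr1 mulr1.
    by rewrite cabsM mulrAC; apply: ler_pM; rewrite ?cabs_ge0 ?ph.
  rewrite cabsM; apply: ler_pM; rewrite ?cabs_ge0//; last exact: Phib.
  rewrite cabsM -/e2 ler_wpM2r// cabs_real normrM.
  rewrite (ger0_norm pm) ler_wpM2l//.
  by rewrite ltW// ltr_norml.
have iPhi t : - 2 < t < 2 -> cintg (fun x => gl w x * glphase w m t x).
  move=> ht; apply: (@cintg_expabs _ _ (K * P)); last by move=> x; exact: Phib.
  by apply: cderiv_ccont => x; exact: dPhx.
have h1 : - 2 < (1 : R) < 2 by clear; apply/andP; split; lra.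
have h0 : - 2 < (0 : R) < 2 by clear; apply/andP; split; lra.
have cD t : ccont (D t).
  apply: ccontM; last by apply: cderiv_ccont => x; exact: dPhx.
  apply: (@cderiv_ccont _ _ (fun=> _)) => x; apply: cderivD; last exact: cderiv_cst.
  have h := cderivZ (- (2 * pi * m)%:C * 'i) (cderiv_id x).
  have -> : (fun x : R => - (2 * pi * m * x)%:C * 'i) = (fun x => - (2 * pi * m)%:C * 'i * x%:C).
    by apply/funext => y; rewrite [(_ * y)%:C]rmorphM /=; ring.
  exact: h.
have main : cint (fun x => gl w x * glphase w m 1 x) = cint (fun x => gl w x * glphase w m 0 x).
  apply: (@cint_homotopy R (fun t x => gl w x * glphase w m t x)
    (fun t x => c * (gl w x * glphase w m t x)) D (- 2) 2 (fun x => M * expR (- 1 * `|x|))) => //.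
  - by apply: rintgZ; exact: rintg_expabs.
  - move=> t ht; apply: (@ccvg_exp _ _ (cabs c * (K * P)) 1 ltr01) => n; rewrite cabsM -mulrA.
    by rewrite ler_wpM2l ?cabs_ge0//; have := Phib t n%:R ht; rewrite ger0_norm.
  - move=> t ht; apply: (@ccvg_exp _ _ (cabs c * (K * P)) 1 ltr01) => n; rewrite cabsM -mulrA.
    by rewrite ler_wpM2l ?cabs_ge0//; have := Phib t (- n%:R) ht; rewrite normrN ger0_norm.
have p0 x : glphase w m 0 x = 1.
  by rewrite /glphase expr0n /= !(mulr0, mul0r) oppr0 !mul0r addr0 cexp0.
have p1 x : glphase w m 1 x = cexp (- (2 * pi * m * x)%:C * 'i) * cexp ((pi * m ^+ 2)%:C * cexp (- (2%:C * w))).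
  by rewrite /glphase expr1n !mulr1 cexpD.
pose E := cexp ((pi * m ^+ 2)%:C * cexp (- (2%:C * w))).
have eF x : gl w x * cexp (- (2 * pi * m * x)%:C * 'i) = E^-1 * (gl w x * glphase w m 1 x).
  by rewrite p1 -/E; field; exact: cexp_neq0.
have {}main : cint (fun x => gl w x * glphase w m 1 x) = 1.
  rewrite main -(cint_gl u ha'); apply: eq_cint => x; by rewrite p0 mulr1.
have -> : (fun x => gl w x * cexp (- (2 * pi * m * x)%:C * 'i)) =
    (fun x => E^-1 * (gl w x * glphase w m 1 x)) by apply/funext.
split; first exact: (cintgZ _ (iPhi 1 h1)).
by rewrite (cintZ _ (iPhi 1 h1)) main mulr1 cexpN.
Qed.

End Fourier.

(** * Poisson summation for the theta series *)

Section Series.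
Context {R : realType}.
Local Notation mu := (@lebesgue_measure R).
Local Notation C := R[i].

(** Holds because [e >= 2]; it lets sums dominated by [e^(- n)] telescope. *)
Lemma expR_geo (n : nat) : expR (- n%:R) <= 2 * (expR (- n%:R) - expR (- n.+1%:R)) :> R.
Proof.
have e2 : 2 <= expR 1 :> R by have := @expR_ge1Dx R 1; lra.
have h : expR (- n%:R) = expR 1 * expR (- n.+1%:R) :> R.
  by rewrite -expRD; congr expR; rewrite -natr1; ring.
have := expR_ge0 (- n.+1%:R : R); set y := expR (- n.+1%:R) in h *.
by rewrite h => y0; nra.
Qed.

(** Subtracting and adding the tail bound [e N] makes the partial sums monotone in opposite
    directions; the limit is trapped in between, which gives convergence together with the explicit
    remainder. *)
Lemma rsum_cvg (u : nat -> R) (M : R) : (forall n, `|u n| <= M * expR (- n%:R)) ->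
  exists2 l : R, (fun N => \sum_(i < N) u i) @ \oo --> l &
    forall N, `|l - \sum_(i < N) u i| <= 2 * M * expR (- N%:R).
Proof.
move=> uM; have M0 : 0 <= M.
  by have := le_trans (normr_ge0 _) (uM 0%N); rewrite oppr0 expR0 mulr1.
pose s N := \sum_(i < N) u i; pose e N : R := 2 * M * expR (- N%:R).
have stepD N : s N - e N <= s N.+1 - e N.+1.
  rewrite /s big_ord_recr /= /e; have := uM N; rewrite ler_norml => /andP[h _].
  by have := ler_wpM2l M0 (expR_geo N); lra.
have stepU N : s N.+1 + e N.+1 <= s N + e N.
  rewrite /s big_ord_recr /= /e; have := uM N; rewrite ler_norml => /andP[_ h].
  by have := ler_wpM2l M0 (expR_geo N); lra.
have mono N k : s N - e N <= s (N + k)%N - e (N + k)%N.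
  elim: k => [|k IH]; first by rewrite addn0.
  by rewrite addnS (le_trans IH).
have anti N k : s (N + k)%N + e (N + k)%N <= s N + e N.
  elim: k => [|k IH]; first by rewrite addn0.
  by rewrite addnS (le_trans _ IH).
have e0 N : 0 <= e N by rewrite /e !mulr_ge0 ?expR_ge0.
have ecv : e @ \oo --> 0.
  rewrite -[X in _ --> X](mulr0 (2 * M)); apply: cvgM; first exact: cvg_cst.
  have := @cvg_expRn R 1 ltr01; apply: cvg_trans.
  by apply: near_eq_cvg; near=> n; rewrite mulN1r.
have nd : nondecreasing_seq (fun N => s N - e N) by apply/nondecreasing_seqP.
have ub : has_ubound (range (fun N => s N - e N)).
  exists (s 0%N + e 0%N) => _ [N _ <-].
  have := anti 0%N N; rewrite add0n; have := e0 N; lra.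
have cv := nondecreasing_is_cvgn nd ub.
pose l := limn (fun N => s N - e N).
have dcv : (fun N => s N - e N) @ \oo --> l by [].
have sl : s @ \oo --> l.
  have -> : s = (fun N => (s N - e N) + e N) by apply/funext => N; rewrite subrK.
  by rewrite -[l]addr0; exact: cvgD.
have ucv : (fun N => s N + e N) @ \oo --> l by rewrite -[l]addr0; exact: cvgD.
exists l => // N; rewrite ler_distl; apply/andP; split.
  apply: (ler_cvg_to (cvg_cst (s N - e N)) dcv); near=> k.
  have Nk : (N <= k)%N by near: k; exact: nbhs_infty_ge.
  by have := mono N (k - N)%N; rewrite subnKC.
apply: (ler_cvg_to ucv (cvg_cst (s N + e N))); near=> k.
have Nk : (N <= k)%N by near: k; exact: nbhs_infty_ge.
by have := anti N (k - N)%N; rewrite subnKC.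
Unshelve. all: by end_near.
Qed.

Lemma csum_cvg (u : nat -> C) (M : R) : (forall n, cabs (u n) <= M * expR (- n%:R)) ->
  exists2 l : C, ccvg (fun N => \sum_(i < N) u i) l &
    forall N, cabs (l - \sum_(i < N) u i) <= 4 * M * expR (- N%:R).
Proof.
move=> uM.
have [|l1 c1 b1] := @rsum_cvg (fun n => complex.Re (u n)) M.
  by move=> n; apply: le_trans (uM n); exact: cabs_Re.
have [|l2 c2 b2] := @rsum_cvg (fun n => complex.Im (u n)) M.
  by move=> n; apply: le_trans (uM n); exact: cabs_Im.
exists (l1 +i* l2).
  split => /=.
    have -> : (fun N => complex.Re (\sum_(i < N) u i)) = (fun N => \sum_(i < N) complex.Re (u i)).
      by apply/funext => N; rewrite Re_sum.
    exact: c1.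
  have -> : (fun N => complex.Im (\sum_(i < N) u i)) = (fun N => \sum_(i < N) complex.Im (u i)).
    by apply/funext => N; rewrite Im_sum.
  exact: c2.
move=> N; apply: le_trans (cabs_le _) _; rewrite !ReImE Re_sum Im_sum /=.
by have := b1 N; have := b2 N; lra.
Qed.

Lemma ccvg_unique (u : nat -> C) (l l' : C) : ccvg u l -> ccvg u l' -> l = l'.
Proof.
by move=> [a1 a2] [b1 b2]; apply: complex_ext; [exact: (cvg_unique _ a1 b1)|exact: (cvg_unique _ a2 b2)].
Qed.

Lemma ccvg_cst (l : C) : ccvg (fun=> l) l.
Proof. by split; exact: cvg_cst. Qed.

Lemma ccvgD (u v : nat -> C) (l l' : C) : ccvg u l -> ccvg v l' ->
  ccvg (fun n => u n + v n) (l + l').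
Proof.
move=> [a1 a2] [b1 b2]; split; rewrite ?ReD ?ImD.
  by under eq_fun do rewrite ReD; apply: cvgD.
by under eq_fun do rewrite ImD; apply: cvgD.
Qed.

Lemma ccvgM (u v : nat -> C) (l l' : C) : ccvg u l -> ccvg v l' ->
  ccvg (fun n => u n * v n) (l * l').
Proof.
move=> [a1 a2] [b1 b2]; split; rewrite ?ReM ?ImM.
  by under eq_fun do rewrite ReM; apply: cvgB; apply: cvgM.
by under eq_fun do rewrite ImM; apply: cvgD; apply: cvgM.
Qed.

Lemma cos_natpi (n : nat) (x : R) : cos (x + 2 * pi * n%:R) = cos x.
Proof.
have c2 y : cos (y + 2 * pi) = cos y :> R.
  have -> : y + 2 * pi = y + pi + pi by ring.
  by rewrite !cosDpi opprK.
elim: n => [|n IH]; first by rewrite mulr0 addr0.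
have -> : x + 2 * pi * n.+1%:R = x + 2 * pi * n%:R + 2 * pi by rewrite -(natr1 n); ring.
by rewrite c2 IH.
Qed.

(** Half-open, so that its integer translates tile the line without overlap, as [wcellS] requires at
    every point. *)
Definition cell : R -> R := \1_(`[- (1 / 2), 1 / 2[%classic).

Lemma rintg_cell : rintg cell. Proof. exact: rintg_indico. Qed.

Lemma rint_cell : rint cell = 1.
Proof. by rewrite rint_indico; lra. Qed.

Definition fcos (j : nat) (x : R) : R := cos (2 * pi * j%:R * x).

Lemma fcos_cont j : continuous (fcos j).
Proof.
move=> x; apply: continuous_comp; last exact: continuous_cos.
by apply: cvgM; [exact: cvg_cst|exact: cvg_id].
Qed.

Lemma fcos_le1 j x : `|fcos j x| <= 1. Proof. by rewrite ler_norml cos_geN1 cos_le1. Qed.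

Lemma fcos0 x : fcos 0 x = 1. Proof. by rewrite /fcos mulr0 mul0r cos0. Qed.

Lemma fcos_shift j x n : fcos j (x + n%:R) = fcos j x.
Proof.
rewrite /fcos; have -> : 2 * pi * j%:R * (x + n%:R) = 2 * pi * j%:R * x + 2 * pi * (j * n)%:R.
  by rewrite natrM; ring.
exact: cos_natpi.
Qed.

Lemma fcos_shiftN j x n : fcos j (x - n%:R) = fcos j x.
Proof. by rewrite -[in RHS](subrK n%:R x) fcos_shift. Qed.

Lemma fcosM j k x : (k <= j)%N -> fcos j x * fcos k x = (fcos (j - k) x + fcos (j + k) x) / 2.
Proof.
move=> kj; rewrite /fcos natrB// natrD.
have -> : 2 * pi * (j%:R - k%:R) * x = 2 * pi * j%:R * x - 2 * pi * k%:R * x :> R by ring.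
have -> : 2 * pi * (j%:R + k%:R) * x = 2 * pi * j%:R * x + 2 * pi * k%:R * x :> R by ring.
by rewrite cosB cosD; field.
Qed.

Lemma rintg_cellM (h : R -> R) : rmeas h -> (forall x, `|h x| <= 1) -> rintg (fun x => cell x * h x).
Proof.
move=> mh h1; apply: (rintg_dom _ rintg_cell).
  by apply: measurable_funM => //; exact: rintg_meas rintg_cell.
move=> x; rewrite normrM (ger0_norm (_ : 0 <= cell x)) ?ler_piMr//.
Qed.

Lemma rint_cell_fcos j : rint (fun x => cell x * fcos j x) = (j == 0%N)%:R.
Proof.
case: j => [|j].
  by rewrite -[RHS]rint_cell; congr rint; apply/funext => x; rewrite fcos0 mulr1.
have p0 := pi_gt0 R; pose w : R := 2 * pi * j.+1%:R.
have w0 : w != 0 by rewrite !mulf_neq0// gt_eqF.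
pose F (x : R) := w^-1 * sin (w * x).
have dF (x : R) : is_derive x 1 F (fcos j.+1 x).
  have h1 : is_derive x 1 (fun u : R => w * u) w.
    by apply: (is_derive_val (is_derive_mul (is_derive_cst w x 1) (is_derive_id x 1))); rewrite mul0r add0r mulr1.
  have h2 := is_derive_mul (is_derive_cst w^-1 x 1) (is_derive_comp (is_derive_sin _) h1).
  by apply: (is_derive_val h2); rewrite mul0r add0r mulrCA mulVf ?mulr1.
have ab : - (1 / 2) < 1 / 2 :> R by lra.
have := @continuous_FTC2 R (fcos j.+1) F _ _ ab.
rewrite /rint /Rintegral => E.
have -> : (\int[mu]_x (cell x * fcos j.+1 x)%:E =
    \int[mu]_(x in `[(- (1 / 2))%R, (1 / 2)%R]) (fcos j.+1 x)%:E)%E.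
  rewrite -integral_itv_bndo_bndc; last first.
    by apply/measurable_EFinP; apply: measurable_funTS; exact: (rmeas_cont (@fcos_cont _)).
  rewrite [RHS]integral_mkcond; apply: eq_integral => x _.
  by rewrite patchE /cell indicE; case: (x \in `[- (1 / 2), 1 / 2[%classic); rewrite ?mul1r ?mul0r.
rewrite E //=.
- have s0 (n : nat) : sin (pi * n%:R) = 0 :> R.
    elim: n => [|n IH]; first by rewrite mulr0 sin0.
    by rewrite -natr1 mulrDr mulr1 sinDpi IH oppr0.
  have e : w * (1 / 2) = pi * j.+1%:R by rewrite /w; field.
  by rewrite /F mulrN e sinN s0 oppr0 mulr0 subrr.
- by apply: continuous_subspaceT; exact: (@fcos_cont _).
- split => [x _||]; first by case: (dF x).
    by apply: cvg_at_right_filter; exact: (is_derive_continuous (dF _)).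
  by apply: cvg_at_left_filter; exact: (is_derive_continuous (dF _)).
- by move=> x _; rewrite derive1E; case: (dF x).
Qed.

End Series.

Section Poisson.
Context {R : realType}.
Local Notation mu := (@lebesgue_measure R).
Local Notation C := R[i].

Lemma cmeasM (h : R -> R) (f : R -> C) : rmeas h -> cmeas f -> cmeas (fun x => (h x)%:C * f x).
Proof.
move=> mh [mr mi]; split.
  have -> : (fun x => complex.Re ((h x)%:C * f x)) = (fun x => h x * complex.Re (f x)).
    by apply/funext => x; rewrite ReM /= mul0r subr0.
  exact: measurable_funM.
have -> : (fun x => complex.Im ((h x)%:C * f x)) = (fun x => h x * complex.Im (f x)).
  by apply/funext => x; rewrite ImM /= mul0r addr0.
exact: measurable_funM.
Qed.

Lemma cintgMr (h : R -> R) (f : R -> C) (B : R) : rmeas h -> (forall x, `|h x| <= B) ->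
  cintg f -> cintg (fun x => (h x)%:C * f x).
Proof.
move=> mh hB cf; apply: (cintg_dom (cmeasM mh (cintg_meas cf)) (rintgZ B (rintg_cabs cf))) => x.
by rewrite cabsM cabs_real ler_wpM2r ?cabs_ge0.
Qed.

Lemma rmeasM (h k : R -> R) : rmeas h -> rmeas k -> rmeas (fun x => h x * k x).
Proof. by move=> mh mk; exact: measurable_funM. Qed.

Lemma rmeas_fcos j : rmeas (@fcos R j).
Proof. by apply: rmeas_cont; exact: (@fcos_cont R j). Qed.

Lemma rmeas_cell : rmeas (@cell R). Proof. exact: rintg_meas rintg_cell. Qed.

Lemma cell01 (x : R) : cell x = 0 \/ (cell x = 1 /\ `|x| <= 1 / 2).
Proof.
rewrite /cell indicE mem_setE in_itv /=; case: andP => [[h1 h2]|_]; [right|by left].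
by split => //; rewrite ler_norml h1 ltW.
Qed.

Lemma cell_eq1 (x : R) : `|x| < 1 / 2 -> cell x = 1.
Proof. by rewrite ltr_norml => /andP[h1 h2]; rewrite /cell indicE mem_set//= in_itv /= h2 ltW. Qed.

Lemma cell0 : cell 0 = 1 :> R.
Proof. by apply: cell_eq1; rewrite normr0 divr_gt0. Qed.

Lemma cell_le1 (x : R) : `|cell x| <= 1.
Proof. by case: (cell01 x) => [->|[-> _]]; rewrite ?normr0 ?normr1. Qed.

Definition wcell (N : nat) : R -> R := \1_(`[- (N%:R + 1 / 2), N%:R + 1 / 2[%classic).

Lemma wcell0 : wcell 0 = cell.
Proof. by rewrite /wcell /cell add0r. Qed.

Lemma wcellS N x : wcell N.+1 x = wcell N x + cell (x - N.+1%:R) + cell (x + N.+1%:R).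
Proof.
rewrite /wcell /cell !indicE !mem_setE !in_itv /= -!(natr1 N).
have n0 : 0 <= N%:R :> R by []; move: (N%:R : R) n0 => n n0.
have -> : (- (1 / 2) <= x - (n + 1)) = (n + 1 / 2 <= x) by apply/idP/idP => ?; lra.
have -> : (x - (n + 1) < 1 / 2) = (x < n + 1 + 1 / 2) by apply/idP/idP => ?; lra.
have -> : (- (1 / 2) <= x + (n + 1)) = (- (n + 1 + 1 / 2) <= x) by apply/idP/idP => ?; lra.
have -> : (x + (n + 1) < 1 / 2) = (x < - (n + 1 / 2)) by apply/idP/idP => ?; lra.
have i1 : (- (n + 1 / 2) <= x) ==> (- (n + 1 + 1 / 2) <= x) by apply/implyP => ?; lra.
have i2 : (n + 1 / 2 <= x) ==> (- (n + 1 / 2) <= x) by apply/implyP => ?; lra.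
have i3 : (n + 1 + 1 / 2 <= x) ==> (n + 1 / 2 <= x) by apply/implyP => ?; lra.
rewrite !ltNge; move: i1 i2 i3.
by do 4! case: (_ <= _)%R => //=; rewrite ?addr0 ?add0r.
Qed.

Lemma wcell_le1 N x : `|wcell N x| <= 1.
Proof. by rewrite /wcell indicE; case: (x \in _); rewrite ?normr0 ?normr1. Qed.

Lemma rmeas_wcell N : rmeas (wcell N). Proof. exact: rintg_meas (rintg_indico _ _). Qed.

Definition th (w : C) (n : nat) : C := cexp (- ((pi * n%:R ^+ 2)%:C * cexp (2%:C * w))).

Lemma gl_nat (w : C) (n : nat) : gl w n%:R = cexp w * th w n.
Proof. by rewrite /gl /th rmorphM /=; congr (_ * cexp _); ring. Qed.

Lemma th0 w : th w 0 = 1.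
Proof. by rewrite /th expr0n mulr0 mul0r oppr0 cexp0. Qed.

Lemma th_bound (u a : R) : - (pi / 4) < a < pi / 4 -> exists2 K : R, 0 <= K &
  forall n, cabs (th (u +i* a) n) <= K * expR (- n%:R).
Proof.
move=> /strip_width[a0 ha0 ha]; have [K K0 HK] := gl_bound (`|u| + 1) ha0.
have uB : - (`|u| + 1) < u < `|u| + 1 by rewrite -ltr_norml ltrDl.
exists (K * expR (- u)); first by rewrite mulr_ge0 ?expR_ge0.
move=> n; have [+ _ _] := HK u a n%:R uB ha; rewrite gl_nat cabsM cabs_cexp /= ger0_norm// mulN1r.
by rewrite expRN mulrAC ler_pdivlMr ?expR_gt0// mulrC.
Qed.

(* [1 + 2 ths w] is the Jacobi theta series at [e^(2 w)]. *)
Definition ths (w : C) : C := limn (fun N => complex.Re (\sum_(i < N) th w i.+1)) +i*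
  limn (fun N => complex.Im (\sum_(i < N) th w i.+1)).

Lemma thsP (u a : R) : - (pi / 4) < a < pi / 4 ->
  ccvg (fun N => \sum_(i < N) th (u +i* a) i.+1) (ths (u +i* a)).
Proof.
move=> /(th_bound u)[K K0 HK].
have [|l [l1 l2] _] := @csum_cvg R (fun i => th (u +i* a) i.+1) K.
  move=> n; apply: le_trans (HK n.+1) _; rewrite ler_wpM2l// ler_expR lerN2 ler_nat//.
by split; rewrite /ths /=; apply/cvg_ex; [exists (complex.Re l)|exists (complex.Im l)].
Qed.

Lemma gl_opp (w : C) (x : R) : gl w (- x) = gl w x.
Proof. by rewrite /gl sqrrN. Qed.

Lemma cint_gl_fcos (u a : R) (j : nat) : - (pi / 4) < a < pi / 4 ->
  cintg (fun x => (fcos j x)%:C * gl (u +i* a) x) /\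
  cint (fun x => (fcos j x)%:C * gl (u +i* a) x) = th (- (u +i* a)) j.
Proof.
move=> ha; have [i1 e1] := gl_fourier u j%:R ha; have [i2 e2] := gl_fourier u (- j%:R) ha.
set w := u +i* a in i1 e1 i2 e2 *.
have two0 : 2%:C != 0 :> C.
  by apply/eqP => /(congr1 (@complex.Re R)) /= /eqP; rewrite pnatr_eq0.
have e x : (fcos j x)%:C * gl w x = 2%:C^-1 * (gl w x * cexp (- (2 * pi * j%:R * x)%:C * 'i) +
    gl w x * cexp (- (2 * pi * - j%:R * x)%:C * 'i)).
  have -> : cexp (- (2 * pi * j%:R * x)%:C * 'i) = fcos j x -i* sin (2 * pi * j%:R * x).
    by apply: complex_ext; rewrite ?Re_cexp ?Im_cexp !ReImE /=
      !(mulr0, mul0r, subr0, oppr0, mulr1, add0r, addr0) expR0 mul1r ?cosN ?sinN.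
  have -> : cexp (- (2 * pi * - j%:R * x)%:C * 'i) = fcos j x +i* sin (2 * pi * j%:R * x).
    by apply: complex_ext; rewrite ?Re_cexp ?Im_cexp !ReImE /=
      !(mulr0, mul0r, subr0, oppr0, mulr1, add0r, addr0) expR0 mul1r !(mulrN, mulNr) opprK.
  rewrite -mulrDr; have -> : (fcos j x -i* sin (2 * pi * j%:R * x)) +
    (fcos j x +i* sin (2 * pi * j%:R * x)) = 2%:C * (fcos j x)%:C.
    by apply: complex_ext; rewrite !ReImE /=; ring.
  by field.
split.
  by rewrite (funext e); apply: cintgZ; exact: cintgD.
rewrite (eq_cint e) cintZ ?cintD ?e1 ?e2//; last exact: cintgD.
have -> : cexp (- ((pi * j%:R ^+ 2)%:C * cexp (- (2%:C * w)))) = th (- w) j.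
  by rewrite /th mulrN.
rewrite sqrrN; have -> : cexp (- ((pi * j%:R ^+ 2)%:C * cexp (- (2%:C * w)))) = th (- w) j.
  by rewrite /th mulrN.
have -> : th (- w) j + th (- w) j = 2%:C * th (- w) j by rewrite rmorphD /=; ring.
by rewrite mulKf.
Qed.

Lemma rint_cell_orth j k : (0 < k)%N ->
  rint (fun x : R => cell x * (fcos j x * fcos k x)) = (j == k)%:R / 2.
Proof.
move=> k0; wlog : j k k0 / True by move=> h; exact: h.
move=> _; have i (m : nat) : rintg (fun x : R => cell x * fcos m x).
  by apply: rintg_cellM; [exact: rmeas_fcos|exact: fcos_le1].
have key p q : (q <= p)%N -> (0 < p + q)%N ->
    rint (fun x : R => cell x * (fcos p x * fcos q x)) = (p == q)%:R / 2.
  move=> qp pq; have -> : (fun x : R => cell x * (fcos p x * fcos q x)) =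
      (fun x => 2^-1 * (cell x * fcos (p - q) x + cell x * fcos (p + q) x)).
    by apply/funext => x; rewrite fcosM//; field.
  rewrite rintZ; last exact: rintgD.
  rewrite rintD// !rint_cell_fcos subn_eq0 [(p + q == 0)%N]gtn_eqF// addr0 mulrC.
  by rewrite eqn_leq qp andbT.
have [kj|jk] := leqP k j; first by apply: key => //; rewrite addn_gt0 k0 orbT.
rewrite eq_sym -(key k j (ltnW jk)) ?addn_gt0 ?k0//.
by congr rint; apply/funext => x; rewrite [fcos k x * _]mulrC.
Qed.

End Poisson.

(** * The periodised Gaussian and its Fourier series *)

Section PoissonSum.
Context {R : realType}.
Local Notation mu := (@lebesgue_measure R).
Local Notation C := R[i].

Lemma ccont_shift (f : R -> C) (b : R) : ccont f -> ccont (fun x => f (x + b)).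
Proof.
move=> [fr fi]; split => x.
  apply: (@continuous_comp _ _ _ (fun y => y + b) (fun y => complex.Re (f y))); last exact: fr.
  by apply: cvgD; [exact: cvg_id|exact: cvg_cst].
apply: (@continuous_comp _ _ _ (fun y => y + b) (fun y => complex.Im (f y))); last exact: fi.
by apply: cvgD; [exact: cvg_id|exact: cvg_cst].
Qed.

Lemma ccont_sum (n : nat) (f : nat -> R -> C) : (forall i, ccont (f i)) ->
  ccont (fun x => \sum_(i < n) f i x).
Proof.
move=> cf; elim: n => [|n IH].
  have -> : (fun x => \sum_(i < 0) f i x) = (fun=> 0) by apply/funext => x; rewrite big_ord0.
  exact: ccont_cst.
have -> : (fun x => \sum_(i < n.+1) f i x) = (fun x => \sum_(i < n) f i x + f n x).
  by apply/funext => x; rewrite big_ord_recr.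
exact: ccontD.
Qed.

Lemma fcos1_lt1 (e : R) : 0 < e -> exists2 q : R, q < 1 &
  forall x, `|x| <= 1 / 2 -> e <= `|x| -> (1 + fcos 1 x) / 2 <= q.
Proof.
move=> e0; have pi0 := pi_gt0 R; pose d := Num.min e (1 / 2).
have d0 : 0 < d by rewrite lt_min e0 /=; lra.
have d12 : d <= 1 / 2 by rewrite ge_min lexx orbT.
have dpi : 2 * pi * d <= pi by rewrite [2 * pi]mulrC -mulrA -[leRHS]mulr1 ler_wpM2l ?pi_ge0//; lra.
have d0' : 0 < 2 * pi * d by rewrite !mulr_gt0.
exists ((1 + cos (2 * pi * d)) / 2).
  have : cos (2 * pi * d) < cos 0 by rewrite ltr_cos ?in_itv /=; lra.
  by rewrite cos0; lra.
move=> x x12 ex; suff : fcos 1 x <= cos (2 * pi * d) by lra.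
have -> : fcos 1 x = cos (2 * pi * `|x|).
  rewrite /fcos mulr1; have [x0|x0] := leP 0 x; first by rewrite ger0_norm.
  by rewrite ltr0_norm// mulrN cosN.
have xd : d <= `|x| by rewrite ge_min ex.
have h1 : 2 * pi * d <= 2 * pi * `|x| by rewrite ler_wpM2l// mulr_ge0 ?pi_ge0.
have h2 : 2 * pi * `|x| <= pi by rewrite [2 * pi]mulrC -mulrA -[leRHS]mulr1 ler_wpM2l ?pi_ge0//; lra.
by rewrite leNgt ltr_cos ?in_itv /= -?leNgt//; lra.
Qed.

(** Unfolding: a translate of [gl w] on the central cell is [gl w] on a translated cell, the cosine
    having period 1. *)
Lemma cint_cell_gl (u a : R) (j N : nat) : - (pi / 4) < a < pi / 4 -> let w := u +i* a in
  let G x := gl w x + \sum_(i < N) (gl w (x + i.+1%:R) + gl w (x - i.+1%:R)) in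
  cintg (fun x => (cell x * fcos j x)%:C * G x) /\
  cint (fun x => (cell x * fcos j x)%:C * G x) = cint (fun x => (wcell N x * fcos j x)%:C * gl w x).
Proof.
move=> ha w G; have ig := cintg_gl u ha; rewrite -/w in ig.
have b1 (h : R -> R) x : `|h x| <= 1 -> `|h x * fcos j x| <= 1.
  by move=> h1; rewrite normrM -[1]mulr1 ler_pM// fcos_le1.
have ic (h : R -> R) (b : R) : rmeas h -> (forall x, `|h x| <= 1) ->
    cintg (fun x => (h x * fcos j x)%:C * gl w (x + b)).
  move=> mh h1; apply: (@cintgMr _ _ _ 1); last exact: cintg_shift.
    by apply: rmeasM => //; exact: rmeas_fcos.
  by move=> x; exact: b1.
have ic0 (h : R -> R) : rmeas h -> (forall x, `|h x| <= 1) ->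
    cintg (fun x => (h x * fcos j x)%:C * gl w x).
  move=> mh h1; have -> : (fun x => (h x * fcos j x)%:C * gl w x) =
      (fun x => (h x * fcos j x)%:C * gl w (x + 0)) by apply/funext => x; rewrite addr0.
  exact: ic.
have sh (b : R) : (forall x, fcos j (x + b) = fcos j x) ->
    cint (fun x => (cell x * fcos j x)%:C * gl w (x + b)) =
    cint (fun x => (cell (x - b) * fcos j x)%:C * gl w x).
  move=> hb; pose f x := (cell (x - b) * fcos j x)%:C * gl w x.
  have cf : cintg f.
    apply: (ic0 (fun x => cell (x - b))); first exact: (rmeas_shift (- b) rmeas_cell).
    by move=> x; exact: cell_le1.
  rewrite -(cint_shift b cf); apply: eq_cint => x.
  by rewrite /f addrK hb.
have shp n : cint (fun x => (cell x * fcos j x)%:C * gl w (x + n%:R)) =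
    cint (fun x => (cell (x - n%:R) * fcos j x)%:C * gl w x).
  by apply: sh => x; exact: fcos_shift.
have shm n : cint (fun x => (cell x * fcos j x)%:C * gl w (x - n%:R)) =
    cint (fun x => (cell (x + n%:R) * fcos j x)%:C * gl w x).
  by rewrite sh ?opprK// => x; exact: fcos_shiftN.
rewrite /G; elim: N {G} => [|N [IH1 IH2]].
  have -> : (fun x => (cell x * fcos j x)%:C * (gl w x + \sum_(i < 0)
      (gl w (x + i.+1%:R) + gl w (x - i.+1%:R)))) = (fun x => (wcell 0 x * fcos j x)%:C * gl w x).
    by apply/funext => x; rewrite big_ord0 addr0 wcell0.
  split => //; apply: ic0; [exact: rmeas_wcell|exact: wcell_le1].
have e : (fun x => (cell x * fcos j x)%:C * (gl w x + \sum_(i < N.+1)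
      (gl w (x + i.+1%:R) + gl w (x - i.+1%:R)))) =
    (fun x => (cell x * fcos j x)%:C * (gl w x + \sum_(i < N)
      (gl w (x + i.+1%:R) + gl w (x - i.+1%:R))) +
     ((cell x * fcos j x)%:C * gl w (x + N.+1%:R) + (cell x * fcos j x)%:C * gl w (x - N.+1%:R))).
  by apply/funext => x; rewrite big_ord_recr /=; ring.
have c1 : cintg (fun x => (cell x * fcos j x)%:C * gl w (x + N.+1%:R)).
  by apply: ic; [exact: rmeas_cell|exact: cell_le1].
have c2 : cintg (fun x => (cell x * fcos j x)%:C * gl w (x - N.+1%:R)).
  by apply: ic; [exact: rmeas_cell|exact: cell_le1].
have c12 := cintgD c1 c2.
rewrite e; split; first exact: cintgD.
rewrite cintD// IH2 cintD// shp shm.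
have d1 : cintg (fun x => (cell (x - N.+1%:R) * fcos j x)%:C * gl w x).
  by apply: ic0; [exact: (rmeas_shift (- N.+1%:R) rmeas_cell)|move=> x; exact: cell_le1].
have d2 : cintg (fun x => (cell (x + N.+1%:R) * fcos j x)%:C * gl w x).
  by apply: ic0; [exact: (rmeas_shift N.+1%:R rmeas_cell)|move=> x; exact: cell_le1].
have d0 : cintg (fun x => (wcell N x * fcos j x)%:C * gl w x).
  by apply: ic0; [exact: rmeas_wcell|exact: wcell_le1].
rewrite -cintD// -cintD//; last exact: cintgD.
by apply: eq_cint => x; rewrite wcellS !(rmorphM, rmorphD) /=; ring.
Qed.

(** Orthogonality selects one coefficient; the factor 2 compensates for the mean [1 / 2] of a
    squared cosine. *)
Lemma cint_cell_fcos_sum (c : nat -> C) (j N : nat) : (j <= N)%N ->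
  let A x := c 0%N + \sum_(i < N) 2%:C * c i.+1 * (fcos i.+1 x)%:C in
  cintg (fun x => (cell x * fcos j x)%:C * A x) /\
  cint (fun x => (cell x * fcos j x)%:C * A x) = c j.
Proof.
move=> jN A.
have i0 : rintg (fun x : R => cell x * fcos j x).
  by apply: rintg_cellM; [exact: rmeas_fcos|exact: fcos_le1].
have ik k : rintg (fun x : R => cell x * (fcos j x * fcos k x)).
  apply: rintg_cellM; first by apply: rmeasM; exact: rmeas_fcos.
  by move=> x; rewrite normrM -[1]mulr1 ler_pM// fcos_le1.
have e x : (cell x * fcos j x)%:C * A x = c 0%N * (cell x * fcos j x)%:C +
   \sum_(i < N) 2%:C * c i.+1 * (cell x * (fcos j x * fcos i.+1 x))%:C.
  rewrite /A mulrDr [_ * c 0%N]mulrC mulr_sumr; congr (_ + _); apply: eq_bigr => i _.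
  by rewrite !rmorphM /=; ring.
have c1 := cintgZ (c 0%N) (cintg_real i0).
have c2 (i : 'I_N) : cintg (fun x => 2%:C * c i.+1 * (cell x * (fcos j x * fcos i.+1 x))%:C).
  exact: cintgZ (cintg_real (ik _)).
have c3 := cintg_sum (index_enum 'I_N) c2.
split; first by rewrite (funext e); exact: cintgD.
rewrite (eq_cint e) cintD// cint_sum// cintZ ?cint_real ?rint_cell_fcos//; last exact: cintg_real.
have eI (i : 'I_N) : cint (fun x => 2%:C * c i.+1 * (cell x * (fcos j x * fcos i.+1 x))%:C) =
    if j == i.+1 then c i.+1 else 0.
  rewrite cintZ; last exact: cintg_real.
  rewrite cint_real// rint_cell_orth//; case: eqP => _ /=; last by rewrite mul0r mulr0.
  rewrite mulrAC -rmorphM /=; have -> : 2 * (1 / 2) = 1 :> R by field.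
  by rewrite mul1r.
under eq_bigr do rewrite eI.
case: j jN {A i0 ik e c1 c2 c3 eI} => [_|j jN].
  by rewrite mulr1 big1 ?addr0// => i _.
rewrite /= mulr0 add0r (bigD1 (Ordinal jN)) //= eqxx big1 ?addr0// => i /eqP ij.
by case: eqP => // -[ji]; exfalso; apply: ij; apply: val_inj.
Qed.

(* The periodisation of [gl w] minus its expected Fourier series is orthogonal to all
   cosines, hence to the powers of [(1 + cos (2 pi x)) / 2], which peak at 0. *)
Lemma theta_poisson (u a : R) : - (pi / 4) < a < pi / 4 ->
  cexp (u +i* a) * (1 + 2%:C * ths (u +i* a)) = 1 + 2%:C * ths (- (u +i* a)).
Proof.
move=> ha; set w := u +i* a.
have ha' : - (pi / 4) < - a < pi / 4 by move: ha => /andP[? ?]; apply/andP; split; lra.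
have wN : - w = (- u) +i* (- a) by [].
have /strip_width[a0 ha0 haa] := ha.
have [K K0 HK] := gl_bound (`|u| + 1) ha0.
have uB : - (`|u| + 1) < u < `|u| + 1 by rewrite -ltr_norml ltrDl.
have Kg x : cabs (gl w x) <= K * expR (- 1 * `|x|) by have [] := HK u a x uB haa.
have [K' K'0 HK'] := th_bound (- u) ha'; rewrite -wN in HK'.
(* The two translates by [i + 1] are grouped with the cosine of frequency [i + 1], so that a single
   series with terms [O(e^(- n))] carries both sides of the summation formula. *)
pose tm (i : nat) x := gl w (x + i.+1%:R) + gl w (x - i.+1%:R) -
  2%:C * th (- w) i.+1 * (fcos i.+1 x)%:C.
pose M := 2 * K + 2 * K'.
have M0 : 0 <= M by rewrite addr_ge0// mulr_ge0.
have Kn n x : `|x| <= 1 / 2 -> forall s : bool, cabs (gl w (x + (-1) ^+ s * n.+1%:R)) <= K * expR (- n%:R).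
  move=> x12 s; apply: le_trans (Kg _) _; rewrite ler_wpM2l// ler_expR mulN1r lerN2.
  have := ler_normB (x + (-1) ^+ s * n.+1%:R) x.
  rewrite addrAC subrr add0r normrM normrX normrN1 expr1n mul1r ger0_norm// -(natr1 n); lra.
have tmb n x : cabs ((cell x)%:C * tm n x) <= M * expR (- n%:R).
  case: (cell01 x) => [->|[-> x12]]; first by rewrite mul0r cabs0 mulr_ge0 ?expR_ge0.
  rewrite mul1r; apply: le_trans (cabsB _ _) _; rewrite /M mulrDl; apply: lerD.
    apply: le_trans (cabsD _ _) _; have := Kn n x x12 false; have := Kn n x x12 true.
    by rewrite expr0 expr1 mul1r mulN1r; lra.
  rewrite !cabsM !cabs_real (ger0_norm (ler0n _ 2)) -mulrA -[leRHS]mulrA ler_wpM2l//.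
  apply: (@le_trans _ _ (cabs (th (- w) n.+1))).
    by rewrite -[leRHS]mulr1 ler_wpM2l ?cabs_ge0 ?fcos_le1.
  apply: le_trans (HK' _) _; rewrite ler_wpM2l// ler_expR lerN2 ler_nat//.
have /choice[L HL] : forall x, exists l : C, ccvg (fun N => \sum_(i < N) (cell x)%:C * tm i x) l /\
    forall N, cabs (l - \sum_(i < N) (cell x)%:C * tm i x) <= 4 * M * expR (- N%:R).
  by move=> x; have [l l1 l2] := csum_cvg (tmb ^~ x); exists l.
(* The periodisation minus its expected Fourier series, cut to the cell; the lemma amounts to
   [E 0 = 0]. *)
pose E x := (cell x)%:C * (gl w x - 1) + L x.
pose E_ N x := (cell x)%:C * (gl w x - 1) + \sum_(i < N) (cell x)%:C * tm i x.
have EE_ N x : E_ N x = (cell x)%:C * (gl w x + \sum_(i < N) (gl w (x + i.+1%:R) + gl w (x - i.+1%:R)))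
    - (cell x)%:C * (1 + \sum_(i < N) 2%:C * th (- w) i.+1 * (fcos i.+1 x)%:C).
  rewrite /E_ -mulr_sumr -mulrDr -mulrBr; congr (_ * _).
  by rewrite /tm sumrB; ring.
have ctm i : ccont (tm i).
  have -> : tm i = (fun x => gl w (x + i.+1%:R) + gl w (x - i.+1%:R) +
      (- (2%:C * th (- w) i.+1)) * (fcos i.+1 x)%:C).
    by apply/funext => x; rewrite mulNr.
  apply: ccontD; first by apply: ccontD; apply: (ccont_shift _ (ccont_gl w)).
  by apply: ccontM; [exact: ccont_cst|apply: ccont_real; exact: (@fcos_cont R i.+1)].
pose T N x := gl w x - 1 + \sum_(i < N) tm i x.
have cT N : ccont (T N).
  exact: (ccontD (ccontD (ccont_gl w) (ccont_cst (-1))) (ccont_sum N ctm)).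
have ET N x : E_ N x = (cell x)%:C * T N x by rewrite /E_ /T -mulr_sumr -mulrDr.
have mE_ N : cmeas (E_ N).
  by rewrite (funext (ET N)); apply: cmeasM; [exact: rmeas_cell|apply: cmeas_cont; exact: cT].
have L4 N x : cabs (\sum_(i < N) (cell x)%:C * tm i x) <= 8 * M.
  have [_ hl] := HL x; have := hl 0%N; have := hl N; rewrite big_ord0 subr0 oppr0 expR0 mulr1 => h1 h2.
  have h3 : 4 * M * expR (- N%:R) <= 4 * M.
    by rewrite -[leRHS]mulr1 ler_wpM2l ?mulr_ge0// -expR0 ler_expR oppr_le0.
  have -> : \sum_(i < N) (cell x)%:C * tm i x = L x - (L x - \sum_(i < N) (cell x)%:C * tm i x) by rewrite subKr.
  by apply: le_trans (cabsB _ _) _; lra.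
pose B := K + 1 + 8 * M; have B0 : 0 <= B by rewrite !addr_ge0// mulr_ge0.
have E_b N x : cabs (E_ N x) <= B * cell x.
  have := L4 N x; rewrite /E_; case: (cell01 x) => [->|[-> _]].
    by rewrite mul0r add0r mulr0 => _; rewrite big1 ?cabs0// => i _; rewrite mul0r.
  rewrite mul1r mulr1 => h; apply: le_trans (cabsD _ _) _; apply: lerD => //.
  apply: le_trans (cabsB _ _) _; rewrite cabs1 lerD2r; apply: le_trans (Kg x) _.
  by rewrite -[leRHS]mulr1 ler_wpM2l// -expR0 ler_expR mulN1r oppr_le0.
have E_cv x : ccvg (E_ ^~ x) (E x) by apply: ccvgD; [exact: ccvg_cst|exact: (HL x).1].
have weight (p : R -> R) : rmeas p -> (forall x, `|p x| <= 1) ->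
    cintg (fun x => (p x)%:C * E x) /\
    ccvg (fun N => cint (fun x => (p x)%:C * E_ N x)) (cint (fun x => (p x)%:C * E x)).
  move=> mp p1; apply: (cint_dct (k := fun x => B * cell x)).
  - by move=> N; exact: cmeasM.
  - by move=> x; apply: ccvgM; [exact: ccvg_cst|exact: E_cv].
  - exact: rintgZ rintg_cell.
  - move=> N x; rewrite cabsM cabs_real; apply: le_trans (E_b N x).
    by rewrite ler_piMl ?cabs_ge0.
(* The integral of the periodisation tends to the full Fourier coefficient [th (- w) j] as the
   window widens, while the cosine sum gives [th (- w) j] as soon as [j <= N]. *)
have fcosE j : cint (fun x => (fcos j x)%:C * E x) = 0.
  have [_ c1] := weight _ (rmeas_fcos j) (@fcos_le1 R j).
  have [ig eg] := cint_gl_fcos u j ha; rewrite -/w in ig eg.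
  have [_ c2] : cintg (fun x => (fcos j x)%:C * gl w x) /\
      ccvg (fun N => cint (fun x => (wcell N x * fcos j x)%:C * gl w x))
        (cint (fun x => (fcos j x)%:C * gl w x)).
    apply: (cint_dct (k := fun x => cabs (gl w x))).
    - move=> N; apply: cmeasM; first by apply: rmeasM; [exact: rmeas_wcell|exact: rmeas_fcos].
      exact: cmeas_cont (ccont_gl w).
    - move=> x; apply/ccvgP.
      apply: (@cvg_trans _ ((fun=> 0 : R) @ \oo)); last exact: cvg_cst.
      apply: near_eq_cvg; near=> N.
      have -> : wcell N x = 1.
        rewrite /wcell indicE mem_set//= in_itv /=.
        have : `|x| <= N%:R by near: N; exact: nbhs_infty_ger.
        by rewrite ler_norml => /andP[hx1 hx2]; clear - hx1 hx2; apply/andP; split; lra.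
      by rewrite mul1r subrr cabs0.
    - exact: rintg_cabs (cintg_gl u ha).
    - move=> N x; rewrite cabsM cabs_real ler_piMl ?cabs_ge0// normrM -[1]mulr1.
      by rewrite ler_pM// ?fcos_le1// wcell_le1.
  have c3 := ccvgD c2 (ccvg_cst (- th (- w) j)).
  rewrite eg subrr in c3; apply: (ccvg_unique c1).
  apply/ccvgP; move/ccvgP : c3; apply: cvg_trans; apply: near_eq_cvg; near=> N.
  have jN : (j <= N)%N by near: N; exact: nbhs_infty_ge.
  have [i1 e1] := cint_cell_gl u j N ha; rewrite -/w in i1 e1.
  have [i2 e2] := cint_cell_fcos_sum (th (- w)) jN; rewrite th0 in i2 e2.
  congr (cabs (_ - _)); rewrite -e1 -{1}e2 -cintB//; apply: eq_cint => x.
  by rewrite EE_ rmorphM /=; ring.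
pose y (x : R) := (1 + fcos 1 x) / 2.
have y01 x : 0 <= y x <= 1.
  have := fcos_le1 1 x; rewrite ler_norml => /andP[h1 h2].
  by clear - h1 h2; rewrite /y; apply/andP; split; lra.
have cy : continuous y.
  move=> x; apply: cvgM; last exact: cvg_cst.
  by apply: cvgD; [exact: cvg_cst|exact: (@fcos_cont R 1)].
have my : rmeas y by exact: rmeas_cont.
have yn1 n x : `|y x ^+ n| <= 1.
  by have /andP[h1 h2] := y01 x; rewrite normrX exprn_ile1 ?normr_ge0// ger0_norm.
have mw n j : rmeas (fun x => y x ^+ n * fcos j x).
  by apply: rmeasM; [exact: measurable_funX|exact: rmeas_fcos].
have w1 n j x : `|y x ^+ n * fcos j x| <= 1 by rewrite normrM -[1]mulr1 ler_pM// fcos_le1.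
have ynE n : forall j, cint (fun x => (y x ^+ n * fcos j x)%:C * E x) = 0.
  elim: n => [|n IH] j.
    by rewrite -(fcosE j); apply: eq_cint => x; rewrite expr0 mul1r.
  have iE k : cintg (fun x => (y x ^+ n * fcos k x)%:C * E x).
    by have [] := weight _ (mw n k) (w1 n k).
  have two : (2^-1)%:C * 2%:C = 1 :> C by rewrite -rmorphM /= mulVf.
  case: j => [|j].
    have -> : (fun x => (y x ^+ n.+1 * fcos 0 x)%:C * E x) = (fun x =>
        (2^-1)%:C * ((y x ^+ n * fcos 0 x)%:C * E x + (y x ^+ n * fcos 1 x)%:C * E x)).
      apply/funext => x; rewrite fcos0 -mulrDl -rmorphD mulrA -rmorphM /=.
      by congr (_%:C * _); rewrite exprS /y; field.
    by rewrite cintZ ?cintD ?IH ?addr0 ?mulr0//; exact: cintgD.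
  have -> : (fun x => (y x ^+ n.+1 * fcos j.+1 x)%:C * E x) = (fun x =>
      (2^-1)%:C * ((y x ^+ n * fcos j.+1 x)%:C * E x) +
      (4^-1)%:C * ((y x ^+ n * fcos j x)%:C * E x + (y x ^+ n * fcos j.+2 x)%:C * E x)).
    apply/funext => x; rewrite -!mulrDl -rmorphD !mulrA -!rmorphM -mulrDl -rmorphD /=.
    congr (_%:C * _); rewrite exprS /y.
    have := @fcosM R j.+1 1 x isT; rewrite subn1 addn1 /= => h.
    have -> : (1 + fcos 1 x) / 2 * ((1 + fcos 1 x) / 2) ^+ n * fcos j.+1 x =
      ((1 + fcos 1 x) / 2) ^+ n * (fcos j.+1 x + fcos j.+1 x * fcos 1 x) / 2 by field.
    by rewrite h; field.
  have i1 := cintgZ (2^-1)%:C (iE j.+1); have i2 := cintgD (iE j) (iE j.+2).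
  by rewrite cintD ?cintZ ?cintD ?IH ?addr0 ?mulr0 ?addr0//; exact: cintgZ.
have iE : cintg E.
  have m1 : rmeas (fun=> 1 : R) by apply: rmeas_cont => x; exact: cvg_cst.
  have b1 (x : R) : `|1 : R| <= 1 by rewrite normr1.
  have [+ _] := weight _ m1 b1.
  by have -> : (fun x => 1%:C * E x) = E by apply/funext => x; rewrite mul1r.
have ynE0 n : cint (fun x => (y x ^+ n)%:C * E x) = 0.
  by rewrite -(ynE n 0%N); apply: eq_cint => x; rewrite fcos0 mulr1.
have ynear q : q < 1 -> exists2 e, 0 < e & forall x, `|x - 0| < e -> q <= y x.
  move=> q1; have y0 : y 0 = 1 by rewrite /y /fcos mulr0 cos0; field.
  have /cvgrPdist_lt/(_ (1 - q)) : y x @[x --> (0 : R)] --> y 0 by exact: cy.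
  case; first by rewrite subr_gt0.
  move=> e /= e0 He; exists e => // x xe.
  have := He x; rewrite /= distrC => /(_ xe); rewrite y0 ltr_distl => /andP[h h'].
  by move: (y x) h h'; clear => yx h h'; lra.
have Esupp x : E x != 0 -> `|x| <= 1 / 2.
  case: (cell01 x) => [c0|[]//] /eqP[]; apply: (ccvg_unique (E_cv x)).
  have -> : E_ ^~ x = (fun=> 0) by apply/funext => N; rewrite ET c0 mul0r.
  exact: ccvg_cst.
have yfar (h : C -> R) e : h 0 = 0 -> 0 < e -> exists2 q, q < 1 &
    forall x, h (E x) != 0 -> e <= `|x - 0| -> y x <= q.
  move=> h0 e0; have [q q1 Hq] := fcos1_lt1 e0; exists q => // x hx; rewrite subr0 => ex.
  by apply: Hq => //; apply: Esupp; apply: contra hx => /eqP ->; rewrite h0.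
have Etail N x : cabs (E x - E_ N x) <= 4 * M * expR (- N%:R).
  have [_ hl] := HL x; have := hl N; rewrite /E /E_.
  by have -> : forall p q r : C, p + q - (p + r) = q - r by move=> p q r; ring.
(* Continuity at 0 by uniform convergence ([Etail]), the partial sums being continuous where [cell]
   is 1; [h] stands for the real or the imaginary part. *)
have contE (h : C -> R) : (forall z z', h (z - z') = h z - h z') -> (forall z, `|h z| <= cabs z) ->
    (forall N, continuous (fun x => h (T N x))) -> {for 0, continuous (fun x => h (E x))}.
  move=> hB hb hT; apply/cvgrPdist_lt => eps eps0.
  have [N HN] : exists N, 4 * M * expR (- N%:R) < eps / 3.
    have cv : (fun N : nat => 4 * M * expR (- 1 * N%:R)) @ \oo --> 0.
      by rewrite -[X in _ --> X](mulr0 (4 * M)); apply: cvgM; [exact: cvg_cst|exact: cvg_expRn].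
    have /cvgrPdist_lt/(_ (eps / 3)) := cv; case; first by rewrite divr_gt0.
    move=> N _ /(_ N (leqnn N)) /=; rewrite sub0r normrN mulN1r => hN.
    by exists N; apply: le_lt_trans hN; exact: ler_norm.
  have /cvgrPdist_lt/(_ (eps / 3)) := hT N 0; case; first by rewrite divr_gt0.
  move=> e /= e0 He; exists (Num.min e (1 / 2)) => /=; first by rewrite lt_min e0 divr_gt0.
  move=> x /=; rewrite lt_min => /andP[xe x12].
  have x12' : `|x| < 1 / 2 by rewrite -normrN -sub0r.
  have := He x xe; rewrite -!hB => hT'.
  have e1 : T N 0 = E_ N 0 by rewrite ET cell0 mul1r.
  have e2 : T N x = E_ N x by rewrite ET (cell_eq1 x12') mul1r.
  rewrite e1 e2 in hT'.
  have -> : E 0 - E x = (E 0 - E_ N 0) - (- (E_ N 0 - E_ N x)) - (E x - E_ N x) by ring.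
  have hN z : h (- z) = - h z by rewrite -sub0r hB -(subrr 0) hB subrr sub0r.
  rewrite hB hB hN opprK.
  have b1 := le_trans (hb _) (Etail N 0); have b2 := le_trans (hb _) (Etail N x).
  apply: le_lt_trans (ler_normB _ _) _; apply: le_lt_trans (lerD (ler_normD _ _) (lexx _)) _.
  clear - b1 b2 HN hT'; lra.
have [ir ii] := iE.
have E0 : E 0 = 0.
  apply: complex_ext.
    apply: (@peak_eq0 R (fun x => complex.Re (E x)) y 0 ir my y01 ynear (fun e => yfar _ e erefl)).
      apply: contE.
      - by move=> z z'; rewrite ReD ReN.
      - exact: cabs_Re.
      - by move=> N; have [] := cT N.
    move=> n; have := congr1 (@complex.Re R) (ynE0 n); rewrite /=.
    have -> : (fun x => complex.Re ((y x ^+ n)%:C * E x)) = (fun x => complex.Re (E x) * y x ^+ n).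
      by apply/funext => x; rewrite ReM /= mul0r subr0 mulrC.
    by [].
  apply: (@peak_eq0 R (fun x => complex.Im (E x)) y 0 ii my y01 ynear (fun e => yfar _ e erefl)).
    apply: contE.
    - by move=> z z'; rewrite ImD ImN.
    - exact: cabs_Im.
    - by move=> N; have [] := cT N.
  move=> n; have := congr1 (@complex.Im R) (ynE0 n); rewrite /=.
  have -> : (fun x => complex.Im ((y x ^+ n)%:C * E x)) = (fun x => complex.Im (E x) * y x ^+ n).
    by apply/funext => x; rewrite ImM /= mul0r addr0 mulrC.
  by [].
have := E0; rewrite /E.
rewrite cell0.
have e0 i : (cell 0)%:C * tm i 0 = 2%:C * (cexp w * th w i.+1) - 2%:C * th (- w) i.+1.
  rewrite /tm cell0.
  rewrite mul1r add0r sub0r gl_opp gl_nat /fcos mulr0 cos0 mulr1.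
  by rewrite [2%:C]rmorphD /=; ring.
have lim : ccvg (fun N => \sum_(i < N) (cell 0)%:C * tm i 0)
    (2%:C * cexp w * ths w + - 2%:C * ths (- w)).
  have -> : (fun N => \sum_(i < N) (cell 0)%:C * tm i 0) = (fun N =>
      2%:C * cexp w * (\sum_(i < N) th w i.+1) + - 2%:C * \sum_(i < N) th (- w) i.+1).
    apply/funext => N; rewrite !mulr_sumr -big_split /=; apply: eq_bigr => i _.
    by rewrite e0; ring.
  by apply: ccvgD; apply: ccvgM; (try exact: ccvg_cst); [exact: thsP|rewrite wN; exact: thsP].
rewrite (ccvg_unique (HL 0).1 lim) mul1r -[0]/(0%:R) gl_nat th0 mulr1 => h.
apply/eqP; rewrite -subr_eq0 -[X in _ == X]h; apply/eqP; ring.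
Unshelve. all: by end_near.
Qed.

End PoissonSum.

(** * The Mellin transform J of the fractional part *)

Section ChangeOfVariables.
Context {R : realType}.
Local Notation mu := (@lebesgue_measure R).
Import HBNNSimple.

(** The identity holds on indicators by hypothesis, on simple functions by linearity, and passes to
    increasing limits. *)
Lemma ge0_integral_density (m1 : {measure set (measurableTypeR R) -> \bar R})
    (phi rho : R -> R) : rmeas phi -> rmeas rho -> (forall u, 0 <= rho u) ->
  (forall A : set (measurableTypeR R), measurable A ->
     m1 A = (\int[mu]_u (\1_A (phi u) * rho u)%:E)%E) ->
  forall f : R -> R, rmeas f -> (forall x, 0 <= f x) ->
  (\int[m1]_x (f x)%:E = \int[mu]_u (f (phi u) * rho u)%:E)%E.
Proof.
move=> mphi mrho rho0 HA f mf f0.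
have msf (g : {nnsfun (measurableTypeR R) >-> R}) : rmeas (fun u => g (phi u)).
  exact: (measurableT_comp (measurable_funPT g) mphi).
have simple (g : {nnsfun (measurableTypeR R) >-> R}) :
    (\int[m1]_x (g x)%:E = \int[mu]_u (g (phi u) * rho u)%:E)%E.
  rewrite integralT_nnsfun sintegralE.
  have mI (r : R) : measurable_fun [set: measurableTypeR R]
      (fun u : measurableTypeR R => (\1_(g @^-1` [set r]) (phi u) * rho u)%:E).
    apply/(rmeasP (fun u => \1_(g @^-1` [set r]) (phi u) * rho u)).
    apply: measurable_funM => //; apply: (measurableT_comp _ mphi).
    exact: measurable_indic.
  transitivity (\int[mu]_u \sum_(r \in range g) (r * (\1_(g @^-1` [set r]) (phi u) * rho u))%:E)%E.
    rewrite ge0_integral_fsum//; last 2 first.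
    - move=> r; under eq_fun do rewrite EFinM.
      exact: measurable_funeM.
    - move=> r u _; rewrite lee_fin mulrA mulr_ge0//.
      by have := nnfun_muleindic_ge0 g r (phi u); rewrite -EFinM lee_fin.
    apply: eq_fsbigr => r; rewrite inE => -[x _ <-].
    under eq_integral do rewrite EFinM.
    rewrite ge0_integralZl//; first by rewrite HA.
      by move=> u _; rewrite lee_fin mulr_ge0.
    by rewrite lee_fin.
  apply: eq_integral => u _; rewrite [in RHS]EFinM [in RHS]fimfunE -fsumEFin//.
  rewrite ge0_mule_fsuml; last first.
    by move=> r; exact: (nnfun_muleindic_ge0 g r (phi u)).
  by apply: eq_fsbigr => r _; rewrite -EFinM mulrA.
have mfE : measurable_fun [set: measurableTypeR R] (fun x : measurableTypeR R => (f x)%:E).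
  exact/rmeasP.
pose g_ := nnsfun_approx measurableT mfE.
have gcv x : (fun n => (g_ n x)%:E) @ \oo --> (f x)%:E.
  by apply: cvg_nnsfun_approx => // y _; rewrite lee_fin.
have gnd x : {homo (fun n => g_ n x) : n m / (n <= m)%N >-> n <= m}.
  by move=> n m nm; have /lefP := nd_nnsfun_approx measurableT mfE nm; apply.
transitivity (limn (fun n => \int[m1]_x (g_ n x)%:E))%E.
  rewrite -monotone_convergence//.
  - by apply: eq_integral => x _; apply/esym/cvg_lim => //; exact: gcv.
  - by move=> n; apply/measurable_EFinP; exact: measurable_funPT.
  - by move=> n x _; rewrite lee_fin.
  - by move=> x _ n m nm; rewrite lee_fin gnd.
under eq_fun do rewrite simple.
rewrite -monotone_convergence//.
- apply: eq_integral => u _; apply/cvg_lim => //.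
  under eq_fun do rewrite EFinM.
  by rewrite EFinM; apply: cvgeZr => //; exact: gcv.
- by move=> n; apply/(rmeasP (fun u => g_ n (phi u) * rho u)); apply: measurable_funM => //; exact: msf.
- by move=> n x _; rewrite lee_fin mulr_ge0.
- by move=> x _ n m nm; rewrite lee_fin ler_wpM2r// gnd.
Qed.

(** The image under [ln] of Lebesgue measure on [(0, +oo)]. It is given a measure structure so that
    the two can be identified through their values on intervals. *)
Definition exp_measure (A : set (measurableTypeR R)) : \bar R :=
  (\int[mu]_(u in A) (expR u)%:E)%E.

Let exp_measure0 : exp_measure set0 = 0%E.
Proof. by rewrite /exp_measure integral_set0. Qed.

Let exp_measure_ge0 A : (0 <= exp_measure A)%E.
Proof. by apply: integral_ge0 => x _; rewrite lee_fin expR_ge0. Qed.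

Let exp_measure_sigma_additive : semi_sigma_additive exp_measure.
Proof.
move=> A mA tA mUA; rewrite /exp_measure ge0_integral_bigcup//=; last first.
  apply: measurable_funTS; apply/(rmeasP expR).
  by apply: rmeas_cont; exact: continuous_expR.
apply: is_cvg_ereal_nneg_natsum_cond => n _ _.
exact: exp_measure_ge0.
Qed.

HB.instance Definition _ := isMeasure.Build _ _ _
  exp_measure exp_measure0 exp_measure_ge0 exp_measure_sigma_additive.

Lemma exp_measure_itv (a b : R) : a <= b ->
  exp_measure `]a, b] = (expR b - expR a)%:E.
Proof.
rewrite le_eqVlt => /predU1P[->|ab].
  by rewrite set_itvoc0 /exp_measure integral_set0 subrr.
rewrite /exp_measure integral_itv_obnd_cbnd; last first.
  apply: measurable_funTS; apply/(rmeasP expR).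
  by apply: rmeas_cont; exact: continuous_expR.
rewrite (@continuous_FTC2 R expR expR)//.
- by apply: continuous_subspaceT; exact: continuous_expR.
- split => [x _||]; first exact: derivable_expR.
    by apply: cvg_at_right_filter; exact: continuous_expR.
  by apply: cvg_at_left_filter; exact: continuous_expR.
- by move=> x _; rewrite derive1E; case: (is_derive_expR x).
Qed.

Lemma lebesgue_positive_exp (A : set (measurableTypeR R)) : measurable A ->
  lebesgue_positive R A = (\int[mu]_u (\1_A (expR u) * expR u)%:E)%E.
Proof.
move=> mA.
have mln : measurable_fun [set: measurableTypeR R] (@ln R : measurableTypeR R -> measurableTypeR R).
  exact: measurable_ln.
pose m : {measure set (measurableTypeR R) -> \bar R} := pushforward (lebesgue_positive R) (@ln R : measurableTypeR R -> measurableTypeR R).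
have mexp : rmeas (@expR R) by apply: rmeas_cont; exact: continuous_expR.
have mB : measurable ((@expR R : measurableTypeR R -> measurableTypeR R) @^-1` A).
  by rewrite -[X in measurable X]setTI; exact: mexp.
have main (B : set (measurableTypeR R)) : measurable B -> m mln B = exp_measure B.
  move=> mB'; apply: (@measure_unique _ R (measurableTypeR R) (@ocitv R)
    (fun n => `]- n%:R, n%:R]%classic) _ _ _ _ (m mln) exp_measure _ _ B mB').
  - by [].
  - exact: ocitvI.
  - by move=> n; exact: is_ocitv.
  - apply/seteqP; split => // x _; exists (Num.truncn `|x|).+1 => //=.
    rewrite in_itv /=; have := truncnS_gt `|x|; rewrite ltr_norml => /andP[-> /ltW ->] //.
  - move=> X [[a b] _ <-] /=; rewrite /m /pushforward /lebesgue_positive /mrestr /=.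
    have -> : (@ln R @^-1` `]a, b] `&` `]0, +oo[) = `]expR a, expR b]%classic.
      apply/seteqP; split => x /=; rewrite !in_itv /= ?andbT.
        by move=> [/andP[h1 h2] x0]; rewrite -[x]lnK// ltr_expR ler_expR h1.
      move=> /andP[h1 h2]; have x0 : 0 < x by rewrite (lt_trans _ h1)// expR_gt0.
      by split => //; rewrite -ltr_expR -ler_expR lnK// h1.
    have [ab|ba] := leP a b.
      rewrite exp_measure_itv//.
      rewrite [LHS]lebesgue_measure_itv /= lte_fin ltr_expR.
      by move: ab; rewrite le_eqVlt => /predU1P[->|->]; rewrite ?ltxx ?subrr -?EFinD.
    by rewrite !set_itv_ge ?measure0 -?leNgt ?bnd_simp -?leNgt ?ler_expR ?(ltW ba).
  - move=> n; rewrite /m /pushforward /lebesgue_positive /mrestr /=.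
    apply: (@le_lt_trans _ _ (mu `]0, expR n%:R])).
      apply: le_measure; rewrite ?inE.
      - apply: measurableI; last exact: measurable_itv.
        rewrite -[X in measurable X]setTI; apply: mln => //; exact: measurable_itv.
      - exact: measurable_itv.
      - move=> x /=; rewrite !in_itv /= andbT => -[/andP[_ h] x0]; rewrite x0 /=.
        by rewrite -[x]lnK// ler_expR.
    by rewrite lebesgue_measure_itv /= lte_fin expR_gt0 -EFinB ltry.
transitivity (m mln (expR @^-1` A)).
  rewrite /m /pushforward /lebesgue_positive /mrestr /=; congr (mu _).
  apply/seteqP; split => x /= [h1]; rewrite in_itv /= andbT => x0; split => //.
    by rewrite /= lnK.
  by move: h1; rewrite /= lnK.
rewrite main// /exp_measure [LHS]integral_mkcond; apply: eq_integral => u _.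
rewrite patchE indicE /=.
have -> : (u \in expR @^-1` A) = (expR u \in A) by apply/idP/idP; rewrite !inE.
by case: (expR u \in A); rewrite ?mul1r ?mul0r.
Qed.

Lemma ge0_integral_positive (f : R -> R) : rmeas f -> (forall x, 0 <= f x) ->
  (\int[lebesgue_positive R]_x (f x)%:E = \int[mu]_u (f (expR u) * expR u)%:E)%E.
Proof.
move=> mf f0; apply: ge0_integral_density => //.
- by apply: rmeas_cont; exact: continuous_expR.
- by apply: rmeas_cont; exact: continuous_expR.
- exact: lebesgue_positive_exp.
Qed.

End ChangeOfVariables.

(** * The fractional part in the logarithmic variable *)

Section FracKernel.
Context {R : realType}.
Local Notation mu := (@lebesgue_measure R).
Local Notation C := R[i].

(* rho(e^v): the variable is x = e^{-v} in rho(1/x) *)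
Definition fr (v : R) : R := frac_part (expR v).

Lemma floor_trunc (y : R) : 0 <= y -> (Num.floor y)%:~R = (Num.truncn y)%:R :> R.
Proof.
move=> y0; have /andP[h1 h2] := truncn_itv y0.
have -> : Num.floor y = (Num.truncn y : int).
  apply: floor_def; apply/andP; split; first by rewrite -pmulrn.
  by rewrite intrD rmorph1 -pmulrn natr1.
by rewrite -pmulrn.
Qed.

Lemma fr_trunc v : fr v = expR v - (Num.truncn (expR v))%:R.
Proof. by rewrite /fr /frac_part floor_trunc// expR_ge0. Qed.

Lemma fr_ge0 v : 0 <= fr v.
Proof. by rewrite fr_trunc subr_ge0; have /andP[] := truncn_itv (expR_ge0 v). Qed.

Lemma fr_le1 v : fr v <= 1.
Proof.
rewrite fr_trunc lerBlDr ltW//; have /andP[_] := truncn_itv (expR_ge0 v).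
by rewrite -natr1 addrC.
Qed.

Lemma fr_le_exp v : fr v <= expR v.
Proof. by rewrite fr_trunc lerBlDr lerDl. Qed.

Lemma rmeas_fr : rmeas fr.
Proof.
have -> : fr = (fun v => expR v - (Num.floor (expR v))%:~R) by [].
apply: measurable_funB; first by apply: rmeas_cont; exact: continuous_expR.
apply: nondecreasing_measurable => // x y xy.
by rewrite ler_int le_floor// ler_expR.
Qed.

(** With [x = e^(- v)] the Mellin weight [x^(s - 1) dx] becomes [e^(- s v) dv]. *)
Definition Jker (s : C) (v : R) : C := (fr v)%:C * cexp (- (s * v%:C)).
(* The Mellin transform of [x |-> rho (1 / x)]; it equals [- zeta s / s]. *)
Definition Jz (s : C) : C := cint (Jker s).

Lemma cmeas_Jker s : cmeas (Jker s).
Proof.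
apply: cmeasM; first exact: rmeas_fr.
apply: cmeas_cont; apply: cderiv_ccont => x.
exact: cderiv_exp (cderivN (cderivZ s (cderiv_id x))).
Qed.

Lemma cabs_Jker s v : cabs (Jker s v) = fr v * expR (- (complex.Re s * v)).
Proof.
by rewrite cabsM cabs_real ger0_norm ?fr_ge0// cabs_cexp ReN ReM /= mulr0 subr0.
Qed.

(** [fr <= 1] gives decay at [+oo] for [Re s > 0], and [fr v <= e^v] gives decay at [-oo] for
    [Re s < 1]. *)
Lemma Jker_bound s (m : R) v : m <= complex.Re s <= 1 - m ->
  cabs (Jker s v) <= expR (- m * `|v|).
Proof.
move=> /andP[h1 h2]; rewrite cabs_Jker; have [v0|v0] := leP 0 v.
  rewrite ger0_norm// -[leRHS]mul1r ler_pM ?fr_ge0 ?expR_ge0 ?fr_le1// ler_expR mulNr lerN2.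
  by rewrite ler_wpM2r.
rewrite ltr0_norm// mulrNN; apply: (@le_trans _ _ (expR v * expR (- (complex.Re s * v)))).
  by rewrite ler_wpM2r ?expR_ge0// fr_le_exp.
rewrite -expRD ler_expR; have : 0 <= (1 - m - complex.Re s) * - v by rewrite mulr_ge0; lra.
by rewrite mulrN mulrBl mulrBl mul1r; lra.
Qed.

Lemma cintg_Jker s : 0 < complex.Re s < 1 -> cintg (Jker s).
Proof.
move=> /andP[s0 s1]; pose m := Num.min (complex.Re s) (1 - complex.Re s).
have m0 : 0 < m by rewrite lt_min s0 subr_gt0.
apply: (cintg_dom (cmeas_Jker s) (rintg_expabs m0)) => v; apply: Jker_bound.
rewrite ge_min lexx /=; have : m <= 1 - complex.Re s by rewrite ge_min lexx orbT.
by lra.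
Qed.

Lemma rint_ftc_half (F h : R -> R) (b l : R) : (forall x : R, is_derive x 1 F (h x)) ->
  continuous h -> rintg h -> F n%:R @[n --> \oo] --> l ->
  rint (fun x => \1_(`[b, +oo[%classic) x * h x) = l - F b.
Proof.
move=> dF ch ih Fl.
pose A n := `[b, n%:R : R]%classic.
pose f_ n x := \1_(A n) x * h x.
have mf n : rmeas (f_ n).
  apply: measurable_funM; last exact: rintg_meas.
  by apply: measurable_indic; exact: measurable_itv.
have fh x : f_ ^~ x @ \oo --> \1_(`[b, +oo[%classic) x * h x.
  apply: (@cvg_trans _ ((fun=> \1_(`[b, +oo[%classic) x * h x) @ \oo)); last exact: cvg_cst.
  apply: near_eq_cvg; near=> n.
  rewrite /f_ /A !indicE !mem_setE !in_itv /= andbT.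
  have -> : x <= n%:R by apply: le_trans (ler_norm x) _; near: n; exact: nbhs_infty_ger.
  by rewrite andbT.
have fg n x : `|f_ n x| <= `|h x|.
  by rewrite /f_ normrM ler_piMl// indicE; case: (x \in A n); rewrite ?normr1 ?normr0.
have [_ cv] := rint_dct mf fh (rintg_norm ih) fg.
have E : \forall n \near \oo, rint (f_ n) = F n%:R - F b.
  near=> n.
  have bn : b < n%:R :> R.
    apply: le_lt_trans (ler_norm b) _; near: n; exact: nbhs_infty_gtr.
  exact: rint_ftc_itv bn dF ch.
apply: (cvg_unique _ cv) => //.
apply: (@cvg_trans _ ((fun n => F n%:R - F b) @ \oo)); last by apply: cvgB => //; exact: cvg_cst.
by apply: near_eq_cvg; apply: filterS E => n.
Unshelve. all: by end_near.
Qed.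

Lemma cint_ftc_half (F f : R -> C) (b : R) (l : C) : (forall x : R, cderiv F x (f x)) -> ccont f ->
  cintg f -> ccvg (fun n => F n%:R) l ->
  cint (fun x => (\1_(`[b, +oo[%classic) x)%:C * f x) = l - F b.
Proof.
move=> dF [cr ci] [ir ii] [l1 l2]; apply: complex_ext; rewrite !ReImE /=.
  rewrite -(rint_ftc_half b (fun x => (dF x).1) cr ir l1); congr rint.
  by apply/funext => x; rewrite ReM /= mul0r subr0.
rewrite -(rint_ftc_half b (fun x => (dF x).2) ci ii l2); congr rint.
by apply/funext => x; rewrite ImM /= mul0r addr0.
Qed.

Lemma integral_lebesgue_positive (f : R -> R) : rmeas f -> (forall x, 0 <= f x) ->
  (\int[lebesgue_positive R]_x (f x)%:E = \int[mu]_(x in `]0%R, +oo[) (f x)%:E)%E.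
Proof.
move=> mf f0.
transitivity (\int[lebesgue_positive R]_(x in `]0%R, +oo[) (f x)%:E)%E; last first.
  apply: eq_measure_integral => A mA /= A0.
  by rewrite /lebesgue_positive /mrestr /= setIidl.
have mf' : measurable_fun [set: measurableTypeR R] (fun x : measurableTypeR R => (f x)%:E).
  exact/rmeasP.
have N0 : lebesgue_positive R `]-oo, (0 : R)]%classic = 0%E.
  rewrite /lebesgue_positive /= /mrestr.
  rewrite (_ : _ `&` _ = set0); last first.
    by apply/seteqP; split => x //=; rewrite !in_itv /= andbT => -[h1 h2]; move: (lt_le_trans h2 h1); rewrite ltxx.
  exact: measure0.
rewrite (ge0_negligible_integral _ _ mf' _ N0)//; last by move=> x _; rewrite lee_fin.
congr (integral _ _ _); apply/seteqP; split => x /=; rewrite !in_itv /= andbT.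
  by move=> [_ /negP]; rewrite -ltNge.
by move=> x0; split => //; apply/negP; rewrite -ltNge.
Qed.

(** With [x = e^u] this is half the integral over the line of [f x = 2 pi x^2 exp (- pi x^2)]. As
    [f = gl 0 - dgl 0], where [gl 0] has mass 1 and [dgl 0] is an exact derivative, that integral is
    1. *)
Lemma rint_gauss_half :
  rint (fun u : R => expR u * (2 * pi * expR (2 * u)) * expR (- (pi * expR (2 * u)))) = 1 / 2.
Proof.
pose f (x : R) := 2 * pi * x ^+ 2 * expR (- (pi * x ^+ 2)).
have f0 x : 0 <= f x by rewrite mulr_ge0 ?expR_ge0// mulr_ge0 ?sqr_ge0// mulr_ge0 ?pi_ge0.
have cf : continuous f.
  have cs : continuous (fun x : R => x ^+ 2) by move=> x; exact: exprn_continuous.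
  move=> x; apply: cvgM; first by apply: cvgM; [exact: cvg_cst|exact: cs].
  apply: continuous_comp; last exact: continuous_expR.
  by apply: cvgN; apply: cvgM; [exact: cvg_cst|exact: cs].
have pi0 := pi_gt0 R.
have h00 : - (pi / 4) < (0 : R) < pi / 4 by apply/andP; split; lra.
have [a0 ha0 ha] := strip_width h00; have [K K0 HK] := gl_bound 1 ha0.
have u01 : - 1 < (0 : R) < 1 by apply/andP; split; lra.
have idgl : cintg (dgl ((0 : R) +i* 0)).
  by apply: (@cintg_expabs _ _ K (ccont_dgl _)) => x; have [] := HK 0 0 x u01 ha.
have c0 : cint (dgl ((0 : R) +i* 0)) = 0.
  rewrite (@cint_ftc R (fun x => x%:C * gl ((0 : R) +i* 0) x) _ 0 0) ?subr0//.
  - by move=> x; exact: cderiv_xgl.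
  - exact: ccont_dgl.
  - apply: (@ccvg_exp _ _ K 1 ltr01) => n; have [_ + _] := HK 0 0 n%:R u01 ha.
    by rewrite ger0_norm.
  - apply: (@ccvg_exp _ _ K 1 ltr01) => n; have [_ + _] := HK 0 0 (- n%:R) u01 ha.
    by rewrite normrN ger0_norm.
have igl := cintg_gl 0 h00.
have fE x : gl ((0 : R) +i* 0) x - dgl ((0 : R) +i* 0) x = (f x)%:C.
  have e : cexp (2%:C * ((0 : R) +i* 0)) = 1 :> C by rewrite (_ : (0 : R) +i* 0 = 0)// mulr0 cexp0.
  have e' : cexp ((0 : R) +i* 0) = 1 :> C by rewrite (_ : (0 : R) +i* 0 = 0)// cexp0.
  rewrite /dgl /gl e e' !mulr1 !mul1r -!rmorphM -rmorphN cexp_real /f.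
  by rewrite mulrBl mul1r subKr -rmorphM.
have if_ : rintg f.
  have [+ _] := cintgB igl idgl.
  by have -> : (fun x => complex.Re (gl ((0 : R) +i* 0) x - dgl ((0 : R) +i* 0) x)) = f by apply/funext => x; rewrite fE.
have f1 : rint f = 1.
  have := cintB igl idgl; rewrite cint_gl// c0 subr0 (eq_cint fE) cint_real//.
  by move=> /(congr1 (@complex.Re R)).
have mf : rmeas f by exact: rmeas_cont.
have half : (2 * \int[mu]_u (f (expR u) * expR u)%:E = 1%:E)%E.
  rewrite -(ge0_integral_positive mf f0) (integral_lebesgue_positive mf f0).
  have <- : (\int[mu]_x (f x)%:E = 1%:E)%E by rewrite (rint_EFin if_) f1.
  rewrite (ge0_symfun_integralT f0 cf); last first.
    by move=> x; rewrite /f /= sqrrN.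
  congr (_ * _)%E; rewrite integral_itv_obnd_cbnd; last first.
    by apply: measurable_funTS; exact/rmeasP.
  by congr (integral _ _ _); apply/seteqP; split => x /=; rewrite in_itv /= andbT.
have e u : expR u * (2 * pi * expR (2 * u)) * expR (- (pi * expR (2 * u))) = f (expR u) * expR u.
  by rewrite /f expRM_natl; ring.
rewrite /rint /Rintegral; under eq_integral do rewrite e.
case: (\int[mu]_u _)%E half => [x| |] //=.
- by rewrite -EFinM => -[]; lra.
- by rewrite gt0_muley ?lte_fin.
- by rewrite gt0_muleNy ?lte_fin.
Qed.

End FracKernel.

(** * Convolving with a Gaussian: J times a Gamma factor *)

Section MellinTheta.
Context {R : realType}.
Local Notation mu := (@lebesgue_measure R).
Local Notation C := R[i].

Lemma sum_le_truncn (N : nat) (y : R) : 0 <= y ->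
  \sum_(i < N) (((i.+1%:R : R) <= y)%R%:R : R) = (minn N (Num.truncn y))%:R :> R.
Proof.
move=> y0; elim: N => [|N IH]; first by rewrite big_ord0 min0n.
rewrite big_ord_recr /= IH -truncn_ge_nat//.
have [h|h] := leqP N.+1 (Num.truncn y).
  by rewrite (minn_idPl (ltnW h)) natr1.
by rewrite addr0 (minn_idPr _)//.
Qed.

Lemma indic_ln (n : nat) (v : R) :
  \1_(`[ln (n.+1%:R : R), +oo[%classic) v = ((n.+1%:R : R) <= expR v)%R%:R :> R.
Proof.
rewrite indicE mem_setE in_itv /= andbT; congr (nat_of_bool _)%:R.
by rewrite -[RHS]ler_ln ?posrE ?expR_gt0// expRK.
Qed.

Lemma Gau_ln (u a : R) (n : nat) : Gau ((u + ln n.+1%:R) +i* a) = th (u +i* a) n.+1.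
Proof.
rewrite /Gau /th; congr (cexp (- _)).
have -> : (u + ln n.+1%:R) +i* a = (u +i* a) + (ln n.+1%:R)%:C.
  by apply: complex_ext; rewrite !ReImE /= ?addr0.
rewrite mulrDr cexpD -rmorphM cexp_real /=.
rewrite expRM_natl lnK ?posrE// [(pi * _)%:C]rmorphM /=; ring.
Qed.

Lemma bker0 (w : C) : bker 0 w = (2 * pi)%:C * cexp (2%:C * w) * Gau w.
Proof. by rewrite /bker mul0r cexp0 mul1r. Qed.

Lemma bkerE (s w : C) : bker s w = cexp (s * w) * bker 0 w.
Proof. by rewrite bker0 /bker !mulrA. Qed.

(** In classical terms, [pi^(- 1 / 2) Gamma (3 / 2) = 1 / 2]. *)
Lemma cint_bker1 : cint (fun u : R => bker 1 u%:C) = (1 / 2)%:C.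
Proof.
have e (u : R) : bker 1 u%:C = (expR u * (2 * pi * expR (2 * u)) * expR (- (pi * expR (2 * u))))%:C.
  by rewrite /bker /Gau mul1r cexp_real -rmorphM cexp_real -!rmorphM -rmorphN cexp_real -!rmorphM.
have pi0 := pi_gt0 R.
have [i1 _] : cintg (fun u : R => bker 1 u%:C).
  apply: (@cintg_bker R 1 0); [exact: ler01|apply/andP; split; lra].
rewrite (eq_cint e) cint_real ?rint_gauss_half//.
by have -> : (fun u : R => expR u * (2 * pi * expR (2 * u)) * expR (- (pi * expR (2 * u)))) =
  (fun u => complex.Re (bker 1 u%:C)) by apply/funext => u; rewrite e.
Qed.

(** [- Gau] is a primitive of [bker 0] and vanishes at [+oo]. *)
Lemma cint_indic_bker0 (u a b : R) : - (pi / 4) < a < pi / 4 ->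
  cint (fun v => (\1_(`[b, +oo[%classic) v)%:C * bker 0 ((u + v) +i* a)) = Gau ((u + b) +i* a).
Proof.
move=> ha.
have line x : cderiv (fun v => (u + v) +i* a) x 1.
  split => /=; last exact: is_derive_cst.
  by apply: (is_derive_val (is_derive_add (is_derive_cst u x 1) (is_derive_id x 1))); rewrite add0r.
have dF x : cderiv (fun v => - Gau ((u + v) +i* a)) x (bker 0 ((u + x) +i* a)).
  by apply: cderiv_eq (cderivN (cderiv_Gau (line x))) _; rewrite bker0; ring.
have ib : cintg (fun v => bker 0 ((u + v) +i* a)).
  have -> : (fun v => bker 0 ((u + v) +i* a)) = (fun v => bker 0 ((v + u) +i* a)).
    by apply/funext => v; rewrite addrC.
  by apply: (@cintg_shift R (fun v => bker 0 (v +i* a)) u); exact: cintg_bker.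
have pi0 := pi_gt0 R.
pose c := pi * cos (2 * a); have c0 : 0 < c by rewrite mulr_gt0// cos2_gt0.
rewrite (@cint_ftc_half R (fun v => - Gau ((u + v) +i* a)) _ b 0 dF) ?sub0r ?opprK//.
  by apply: cderiv_ccont => x; apply: cderiv_bker; exact: line.
apply: (@ccvg_exp _ _ (expR (- c * (1 + 2 * u))) (2 * c)); first by rewrite mulr_gt0.
move=> n; rewrite cabsN cabs_Gau -/c -expRD ler_expR.
have := @expR_ge1Dx R (2 * (u + n%:R)) => /(ler_wpM2l (ltW c0)).
by rewrite !mulNr -opprD lerN2 => h; apply: le_trans h; lra.
Qed.

(* The multiplicative convolution of rho(1/x) with [bker 0], see [Hf_conv]. *)
Definition Hf (w : C) : C := cexp (- w) * (1 / 2)%:C - ths w.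

(** [fr v] is [e^v] minus the number of integers [n >= 1] with [ln n <= v]. The term [e^v] turns
    [bker 0] into [bker 1], of integral [1 / 2], and each indicator produces one theta term.
    Stopping the count at [N] keeps the sums finite, with values between 0 and [e^v]. *)
Lemma Hf_conv (u a : R) : - (pi / 4) < a < pi / 4 ->
  cint (fun v => (fr v)%:C * bker 0 ((u + v) +i* a)) = Hf (u +i* a).
Proof.
move=> ha; set w := u +i* a.
have re10 : (0 : R) <= complex.Re (1 : C) by exact: ler01.
have ib1 : cintg (fun v => bker 1 ((u + v) +i* a)).
  have -> : (fun v => bker 1 ((u + v) +i* a)) = (fun v => bker 1 ((v + u) +i* a)).
    by apply/funext => v; rewrite addrC.
  by apply: (@cintg_shift R (fun v => bker 1 (v +i* a)) u); exact: cintg_bker.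
have cb0 : ccont (fun v => bker 0 ((u + v) +i* a)).
  have -> : (fun v => bker 0 ((u + v) +i* a)) = (fun v => bker 0 ((v + u) +i* a)).
    by apply/funext => v; rewrite addrC.
  exact: (ccont_shift u (ccont_bker 0 a)).
have ib0 : cintg (fun v => bker 0 ((u + v) +i* a)).
  have -> : (fun v => bker 0 ((u + v) +i* a)) = (fun v => bker 0 ((v + u) +i* a)).
    by apply/funext => v; rewrite addrC.
  by apply: (@cintg_shift R (fun v => bker 0 (v +i* a)) u); exact: cintg_bker.
have e01 v : (expR v)%:C * bker 0 ((u + v) +i* a) = cexp (- w) * bker 1 ((u + v) +i* a).
  rewrite [bker 1 _]bkerE mulrA -cexpD -cexp_real; congr (cexp _ * _).
  by apply: complex_ext; rewrite /w !ReImE /=; ring.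
have iev : cintg (fun v => (expR v)%:C * bker 0 ((u + v) +i* a)).
  by rewrite (funext e01); exact: cintgZ.
have cev : cint (fun v => (expR v)%:C * bker 0 ((u + v) +i* a)) = cexp (- w) * (1 / 2)%:C.
  rewrite (eq_cint e01) cintZ//; congr (_ * _).
  transitivity (cint (fun v => bker 1 (v +i* a))); last by rewrite bker_invariant// cint_bker1.
  rewrite -(cint_shift u (cintg_bker re10 ha)); apply: eq_cint => v; by rewrite addrC.
pose ch (i : nat) (v : R) : R := \1_(`[ln (i.+1%:R : R), +oo[%classic) v.
pose rN N v := expR v - \sum_(i < N) ch i v.
have rNE N v : rN N v = expR v - (minn N (Num.truncn (expR v)))%:R.
  rewrite /rN -sum_le_truncn ?expR_ge0//; congr (_ - _).
  by apply: eq_bigr => i _; rewrite /ch indic_ln.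
have mch i : rmeas (ch i) by apply: measurable_indic; exact: measurable_itv.
have ich i : cintg (fun v => (ch i v)%:C * bker 0 ((u + v) +i* a)).
  apply: (@cintgMr _ _ _ 1) => // v.
  by rewrite /ch indicE; case: (v \in _); rewrite ?normr1 ?normr0.
have cN N : cintg (fun v => (rN N v)%:C * bker 0 ((u + v) +i* a)) /\
    cint (fun v => (rN N v)%:C * bker 0 ((u + v) +i* a)) =
    cexp (- w) * (1 / 2)%:C - \sum_(i < N) th w i.+1.
  have e v : (rN N v)%:C * bker 0 ((u + v) +i* a) = (expR v)%:C * bker 0 ((u + v) +i* a) -
      \sum_(i < N) (ch i v)%:C * bker 0 ((u + v) +i* a).
    by rewrite /rN rmorphB mulrBl rmorph_sum mulr_suml.
  have is_ := cintg_sum (index_enum 'I_N) (fun i : 'I_N => ich i).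
  split; first by rewrite (funext e); exact: cintgB.
  rewrite (eq_cint e) cintB// cev cint_sum//; congr (_ - _).
  by apply: eq_bigr => i _; rewrite cint_indic_bker0// Gau_ln.
have [_ lim] : cintg (fun v => (fr v)%:C * bker 0 ((u + v) +i* a)) /\
    ccvg (fun N => cint (fun v => (rN N v)%:C * bker 0 ((u + v) +i* a)))
      (cint (fun v => (fr v)%:C * bker 0 ((u + v) +i* a))).
  apply: (cint_dct (k := fun v => cabs ((expR v)%:C * bker 0 ((u + v) +i* a)))).
  - by move=> N; exact: cintg_meas (cN N).1.
  - move=> v; apply/ccvgP; apply: (@cvg_trans _ ((fun=> 0 : R) @ \oo)); last exact: cvg_cst.
    apply: near_eq_cvg; near=> N; rewrite rNE fr_trunc.
    have -> : minn N (Num.truncn (expR v)) = Num.truncn (expR v).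
      by apply/minn_idPr; near: N; exact: nbhs_infty_ge.
    by rewrite subrr cabs0.
  - exact: rintg_cabs.
  - move=> N v; rewrite [leLHS]cabsM [leRHS]cabsM ler_wpM2r ?cabs_ge0// [leLHS]cabs_real [leRHS]cabs_real.
    rewrite [leRHS]ger0_norm ?expR_ge0//.
    have /andP[h1 h2] := truncn_itv (expR_ge0 v).
    have h3 : (minn N (Num.truncn (expR v)))%:R <= (Num.truncn (expR v))%:R :> R.
      by rewrite ler_nat geq_minr.
    have h4 : (0 : R) <= (minn N (Num.truncn (expR v)))%:R by [].
    by rewrite rNE ger0_norm; lra.
apply: (ccvg_unique lim).
have -> : (fun N => cint (fun v => (rN N v)%:C * bker 0 ((u + v) +i* a))) =
   (fun N => cexp (- w) * (1 / 2)%:C + (-1) * \sum_(i < N) th w i.+1).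
  by apply/funext => N; rewrite (cN N).2 mulN1r.
rewrite /Hf -[X in ccvg _ (_ + X)]mulN1r.
by apply: ccvgD; [exact: ccvg_cst|apply: ccvgM; [exact: ccvg_cst|exact: thsP]].
Unshelve. all: by end_near.
Qed.

Definition Bz (s : C) : C := cint (fun u : R => bker s u%:C).

(** The transform of a convolution is the product of the transforms: the weight [e^(s w)] is shared
    between [Jker s] and [bker s]. *)
Lemma Hf_mellin (s : C) (a : R) : 0 < complex.Re s < 1 -> - (pi / 4) < a < pi / 4 ->
  cintg (fun u => cexp (s * (u +i* a)) * Hf (u +i* a)) /\
  cint (fun u => cexp (s * (u +i* a)) * Hf (u +i* a)) = Jz s * Bz s.
Proof.
move=> hs ha; have s0 : 0 <= complex.Re s by move: hs => /andP[/ltW].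
have /strip_width[a0 ha0 haa] := ha; have [K K0 HK] := bker_bound s0 ha0.
have ia := cintg_Jker hs; have ib := cintg_bker s0 ha.
have bM u : cabs (bker s (u +i* a)) <= K.
  have [h _] := HK u a haa; apply: le_trans h _.
  by rewrite -[leRHS]mulr1 ler_wpM2l// -expR0 ler_expR mulN1r oppr_le0.
have [_ i2 i3] := cint_conv ia ib bM.
have e u : cint (fun v => Jker s v * bker s ((u + v) +i* a)) = cexp (s * (u +i* a)) * Hf (u +i* a).
  rewrite -Hf_conv// -cintZ.
    apply: eq_cint => v; rewrite /Jker [bker s _]bkerE.
    have -> : cexp (s * ((u + v) +i* a)) = cexp (s * (u +i* a)) * cexp (s * v%:C).
      by rewrite -cexpD -mulrDr; congr (cexp (_ * _)); apply: complex_ext; rewrite !ReImE /= ?addr0.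
    rewrite cexpN; have := cexp_neq0 (s * v%:C); set E := cexp (s * v%:C) => E0.
    by field.
  have i0 : cintg (fun v => bker 0 ((u + v) +i* a)).
    have -> : (fun v => bker 0 ((u + v) +i* a)) = (fun v => bker 0 ((v + u) +i* a)).
      by apply/funext => v; rewrite addrC.
    by apply: (@cintg_shift R (fun v => bker 0 (v +i* a)) u); exact: cintg_bker.
  apply: (cintgMr rmeas_fr (B := 1)) => // v.
  by rewrite ger0_norm ?fr_ge0 ?fr_le1.
rewrite -(funext e); split; first exact: i2.
by rewrite i3 (bker_invariant s0 ha) /Jz /Bz.
Qed.

End MellinTheta.

(** * Nonvanishing of the Gamma factor on the line Re s = 1/2 *)

Section GammaNonzero.
Context {R : realType}.
Local Notation mu := (@lebesgue_measure R).
Local Notation C := R[i].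

Definition Vk (u : R) : R := expR (- (pi * expR (2 * u))).

Lemma Gau_real (u : R) : Gau u%:C = (Vk u)%:C.
Proof. by rewrite /Gau -!rmorphM cexp_real -rmorphM -rmorphN cexp_real. Qed.

Lemma Vk_gt0 u : 0 < Vk u. Proof. exact: expR_gt0. Qed.

Lemma Vk_le1 u : Vk u <= 1.
Proof. by rewrite -expR0 ler_expR oppr_le0 mulr_ge0 ?pi_ge0 ?expR_ge0. Qed.

Lemma Vk_cont : continuous Vk.
Proof.
move=> x; have h1 := is_derive_mul (is_derive_cst (2 : R) x 1) (is_derive_id x 1).
have h2 := is_derive_mul (is_derive_cst (pi : R) x 1) (is_derive_comp (is_derive_expR _) h1).
exact: (is_derive_continuous (is_derive_comp (is_derive_expR _) (is_deriveN h2))).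
Qed.

Lemma Vk_anti (u v : R) : (Vk u < Vk v) = (v < u).
Proof. by rewrite ltr_expR ltrN2 ltr_pM2l ?pi_gt0// ltr_expR ltr_pM2l// ltr0n. Qed.

Lemma Vk_shift u j : Vk (u + ln (j.+1%:R : R) / 2) = Vk u ^+ j.+1.
Proof.
rewrite /Vk -expRM_natl; congr expR.
have -> : 2 * (u + ln (j.+1%:R : R) / 2) = 2 * u + ln (j.+1%:R : R) by field.
by rewrite expRD lnK ?posrE//; ring.
Qed.

Lemma bker_shift (s : C) u j :
  bker s (u + ln (j.+1%:R : R) / 2)%:C =
  cexp (s * (ln (j.+1%:R : R) / 2)%:C) * j.+1%:R%:C * ((Vk u ^+ j)%:C * bker s u%:C).
Proof.
rewrite /bker !Gau_real Vk_shift exprS.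
have -> : cexp (2%:C * (u + ln (j.+1%:R : R) / 2)%:C) = j.+1%:R%:C * cexp (2%:C * u%:C) :> C.
  rewrite -!rmorphM !cexp_real -rmorphM; congr (_%:C).
  have -> : 2 * (u + ln (j.+1%:R : R) / 2) = 2 * u + ln (j.+1%:R : R) by field.
  by rewrite expRD lnK ?posrE//; ring.
by rewrite rmorphD mulrDr cexpD [(Vk u * _)%:C]rmorphM; ring.
Qed.

(* [Vk] is raised to powers by translations, so a zero of [Bz] makes the kernel orthogonal
   to every [Vk ^+ j], [j > 0]; the combinations [yk ^+ n] peak at the point where [Vk = 1 / 2]. *)
Definition yk (u : R) : R := 4 * Vk u * (1 - Vk u).

Lemma yk_itv u : 0 <= yk u <= 1.
Proof.
have h1 := Vk_gt0 u; have h2 := Vk_le1 u; rewrite /yk; apply/andP; split.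
  by rewrite !mulr_ge0//; [exact: ltW|lra].
by have := sqr_ge0 (1 - 2 * Vk u); nra.
Qed.

Lemma parabola_le (a v : R) : 0 <= (v - a) * (v + a - 1) -> 4 * v * (1 - v) <= 4 * a * (1 - a).
Proof.
move=> h; rewrite -subr_ge0.
have -> : 4 * a * (1 - a) - 4 * v * (1 - v) = 4 * ((v - a) * (v + a - 1)) by ring.
by rewrite mulr_ge0.
Qed.

Lemma parabola_lt1 (v : R) : v != 1 / 2 -> 4 * v * (1 - v) < 1.
Proof.
move=> h; rewrite -subr_gt0; have -> : 1 - 4 * v * (1 - v) = (2 * (v - 1 / 2)) ^+ 2 by field.
by rewrite exprn_even_gt0// mulf_neq0 ?subr_eq0 ?pnatr_eq0.
Qed.

Lemma yk_cont : continuous yk.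
Proof.
move=> x; rewrite /yk; apply: cvgM; first by apply: cvgM; [exact: cvg_cst|exact: Vk_cont].
by apply: cvgB; [exact: cvg_cst|exact: Vk_cont].
Qed.

Lemma cintg_yk (s : C) n j : 0 <= complex.Re s ->
  cintg (fun u => (Vk u ^+ j * yk u ^+ n)%:C * bker s u%:C).
Proof.
move=> s0; have pi0 := pi_gt0 R; apply: (cintgMr (B := 1)).
- apply: rmeas_cont => x; apply: cvgM.
    by apply: (@continuous_comp _ _ _ Vk (fun y => y ^+ j)); [exact: Vk_cont|exact: exprn_continuous].
  by apply: (@continuous_comp _ _ _ yk (fun y => y ^+ n)); [exact: yk_cont|exact: exprn_continuous].
- move=> u; have /andP[h1 h2] := yk_itv u.
  rewrite ger0_norm ?mulr_ge0 ?exprn_ge0 ?(ltW (Vk_gt0 u))//.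
  by rewrite mulr_ile1 ?exprn_ge0 ?exprn_ile1 ?Vk_le1 ?(ltW (Vk_gt0 u)).
- by apply: (@cintg_bker R s 0) => //; apply/andP; split; lra.
Qed.

Lemma cint_yk0 (s : C) n j : 0 <= complex.Re s -> Bz s = 0 ->
  cint (fun u => (Vk u ^+ j * yk u ^+ n)%:C * bker s u%:C) = 0.
Proof.
move=> s0 B0; have pi0 := pi_gt0 R; elim: n j => [|n IH] j.
  have ib : cintg (fun u : R => bker s u%:C).
    by apply: (@cintg_bker R s 0) => //; apply/andP; split; lra.
  have := cint_shift (ln (j.+1%:R : R) / 2) ib; rewrite [RHS]B0.
  rewrite (eq_cint (bker_shift s ^~ j)) cintZ.
    move=> /eqP; rewrite !mulf_eq0 (negPf (cexp_neq0 _)) /= => /orP[/eqP/(congr1 (@complex.Re R)) /= /eqP|/eqP h].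
      by rewrite pnatr_eq0.
    by rewrite -[RHS]h; apply: eq_cint => u; rewrite expr0 mulr1.
  have := cintg_yk 0 j s0; congr cintg; apply/funext => u; by rewrite expr0 mulr1.
have e u : (Vk u ^+ j * yk u ^+ n.+1)%:C * bker s u%:C =
    4%:C * ((Vk u ^+ j.+1 * yk u ^+ n)%:C * bker s u%:C) -
    4%:C * ((Vk u ^+ j.+2 * yk u ^+ n)%:C * bker s u%:C).
  have -> : Vk u ^+ j * yk u ^+ n.+1 = 4 * (Vk u ^+ j.+1 * yk u ^+ n) - 4 * (Vk u ^+ j.+2 * yk u ^+ n).
    by rewrite [yk u ^+ n.+1]exprS !exprS {1}/yk; ring.
  rewrite [(_ - _)%:C]rmorphB /= [(4 * (Vk u ^+ j.+1 * _))%:C]rmorphM /=.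
  by rewrite [(4 * (Vk u ^+ j.+2 * _))%:C]rmorphM /=; ring.
rewrite (eq_cint e) cintB; [|exact/cintgZ/cintg_yk|exact/cintgZ/cintg_yk].
by rewrite !cintZ ?IH ?mulr0 ?subrr//; exact: cintg_yk.
Qed.

Lemma Bz_neq0 (t : R) : Bz ((1 / 2) +i* t) != 0.
Proof.
set s : C := _ +i* t; have pi0 := pi_gt0 R.
have s0 : 0 <= complex.Re s by rewrite /=; lra.
apply/eqP => B0.
pose x0 : R := ln (ln 2 / pi) / 2.
have l2 : (0 : R) < ln 2 by rewrite ln_gt0// ltr1n.
have Vx0 : Vk x0 = 1 / 2.
  rewrite /Vk; have -> : 2 * x0 = ln (ln 2 / pi) by rewrite /x0; field.
  rewrite lnK ?posrE ?divr_gt0//.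
  have -> : pi * (ln 2 / pi) = ln 2 :> R by rewrite mulrC divfK// gt_eqF.
  by rewrite expRN lnK ?posrE ?ltr0n// div1r.
(* Cancels the phase [e^(i t x0)] of the kernel at the peak [x0], so that [D x0] is positive. *)
pose ph : C := cexp (- (0 +i* (t * x0))).
pose D u := complex.Re (ph * bker s u%:C).
have ib : cintg (fun u : R => ph * bker s u%:C).
  by apply: cintgZ; apply: (@cintg_bker R s 0) => //; apply/andP; split; lra.
suff : D x0 = 0.
  have -> : D x0 = expR (x0 / 2) * (2 * pi * expR (2 * x0)) * Vk x0.
    rewrite /D /bker Gau_real -[cexp (2%:C * _)]/(cexp (2%:C * x0%:C)) -rmorphM cexp_real.
    have e : ph * cexp (s * x0%:C) = (expR (x0 / 2))%:C.
      rewrite /ph -cexpD -cexp_real; congr cexp.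
      by apply: complex_ext; rewrite /s !ReImE /=; field.
    by rewrite !mulrA e -!rmorphM /= !mulrA.
  by apply/eqP; rewrite gt_eqF// !mulr_gt0 ?expR_gt0.
apply: (@peak_eq0 R D yk x0) ib.1 (rmeas_cont yk_cont) yk_itv _ _ _ _.
- move=> q q1; have yx0 : yk x0 = 1 by rewrite /yk Vx0; field.
  have q0 : 0 < 1 - q by rewrite subr_gt0.
  have [e /= e0 he] := (iffLR (cvgrPdist_lt _ _) (@yk_cont x0)) _ q0.
  exists e => // x xe; have := he x; rewrite /ball /= distrC => /(_ xe).
  by rewrite yx0 ltr_norml => /andP[_ h]; clear - h; lra.
- move=> e e0.
  pose q1 := yk (x0 - e); pose q2 := yk (x0 + e).
  have h1 : 1 / 2 < Vk (x0 - e) by rewrite -Vx0 Vk_anti ltrBlDr ltrDl.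
  have h2 : Vk (x0 + e) < 1 / 2 by rewrite -Vx0 Vk_anti ltrDl.
  exists (Num.max q1 q2).
    by rewrite gt_max !parabola_lt1// ?(gt_eqF h1)// (lt_eqF h2).
  move=> x _ xe; rewrite le_max; have [hx|hx] := leP x x0; apply/orP; [left|right]; apply: parabola_le.
    have h3 : Vk (x0 - e) <= Vk x.
      by rewrite leNgt Vk_anti -leNgt; move: xe; rewrite ler0_norm ?subr_le0// opprB lerBrDr lerBrDl addrC.
    by clear - h1 h3; apply: mulr_ge0; lra.
  have h3 : Vk x <= Vk (x0 + e).
    by rewrite leNgt Vk_anti -leNgt; move: xe; rewrite ger0_norm ?subr_ge0 ?(ltW hx)// lerBrDr addrC.
  by clear - h2 h3; apply: mulr_le0; lra.
- have [cD _] : ccont (fun u : R => ph * bker s u%:C).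
    by apply: ccontM; [exact: ccont_cst|exact: (@ccont_bker R s 0)].
  exact: cD.
- move=> n.
  have : complex.Re (ph * cint (fun u => (Vk u ^+ 0 * yk u ^+ n)%:C * bker s u%:C)) = 0.
    by rewrite cint_yk0// mulr0.
  rewrite -cintZ; last exact: cintg_yk.
  rewrite /cint /= => h; rewrite -[RHS]h; congr rint; apply/funext => u.
  transitivity (complex.Re ((yk u ^+ n)%:C * (ph * bker s u%:C))).
    by rewrite ReM [complex.Re _%:C]/= [complex.Im _%:C]/= mul0r subr0 mulrC.
  by congr complex.Re; rewrite expr0 mul1r mulrCA.
Qed.

End GammaNonzero.

(** * J vanishes somewhere on the line Re s = 1/2 *)

Section PositiveDefinite.
Context {R : realType}.
Local Notation mu := (@lebesgue_measure R).
Local Notation C := R[i].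

(** Dominated convergence along sequences tending to [t0], cut off at the index [N] from which they
    stay within 1 of [t0], where [g] dominates. *)
Lemma rint_continuous (F : R -> R -> R) (t0 : R) (g : R -> R) :
  (forall t, rmeas (F t)) -> (forall x, {for t0, continuous (F ^~ x)}) -> rintg g ->
  (forall t x, `|t - t0| < 1 -> `|F t x| <= g x) ->
  {for t0, continuous (fun t => rint (F t))}.
Proof.
move=> mF cF ig Fg; apply/(@cvg_nbhsP _ R^o) => w ww.
have [N _ HN] := (iffLR (cvgrPdist_lt _ _) ww) _ ltr01.
rewrite -(cvg_shiftn N).
have wN n : `|w (n + N)%N - t0| < 1 by rewrite distrC; apply: HN; rewrite /= leq_addl.
apply: (rint_dct (f_ := fun n => F (w (n + N)%N)) _ _ ig _).2 => // [x|n x].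
- have wS : w (n + N)%N @[n --> \oo] --> t0 by rewrite cvg_shiftn.
  exact: (iffLR (@cvg_nbhsP _ R^o (F ^~ x) t0 (F t0 x)) (cF x) _ wS).
- exact: Fg (wN n).
Qed.

(* A function with nonnegative Fourier transform is maximal at 0. To avoid Fourier inversion,
   both values are averaged against Gaussian powers, whose transforms are explicit. *)
Lemma posdef_max (f : R -> R) (u0 : R) :
  rintg f -> continuous f -> (forall u, f (- u) = f u) ->
  (forall t, 0 <= rint (fun u => f u * cos (t * u))) -> f u0 <= f 0.
Proof.
move=> fi fc fe W0.
pose E (v : R) := expR (- (pi * v ^+ 2)).
have E01 v : 0 < E v <= 1.
  by rewrite expR_gt0 -expR0 ler_expR oppr_le0 mulr_ge0 ?pi_ge0 ?sqr_ge0.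
have mE : rmeas E.
  apply: rmeas_cont => x.
  have h := is_derive_mul (is_derive_cst (pi : R) x 1) (is_derive_mul (is_derive_id x 1) (is_derive_id x 1)).
  exact: (is_derive_continuous (is_derive_comp (is_derive_expR _) (is_deriveN h))).
have mfX n (h : R -> R) : rmeas h -> rmeas (fun v => h v ^+ n).
  by move=> mh; exact: measurable_funX.
have En v n : 0 <= E v ^+ n <= 1.
  by have /andP[/ltW h1 h2] := E01 v; rewrite exprn_ge0//=; exact: exprn_ile1.
have ifE n (h : R -> R) : rintg h -> rintg (fun v => h v * E v ^+ n).
  move=> ih; apply: (rintg_dom _ (rintg_norm ih)).
    by apply: measurable_funM; [exact: rintg_meas|exact: mfX].
  by move=> x; have /andP[h1 h2] := En x n; rewrite normrM (ger0_norm h1) ler_piMr.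
(* By Parseval the average of [f] about a point [c] is the integral of [G x * cos (2 pi x c)]
   against the nonnegative transform of [f]; since cosines are at most 1, the value at [c = 0] is
   the largest. *)
have key n : rint (fun v => f (v + u0) * E v ^+ n) <= rint (fun v => f v * E v ^+ n).
  case: n => [|n].
    have e (h : R -> R) : (fun v => h v * E v ^+ 0) = h by apply/funext => v; rewrite expr0 mulr1.
    by rewrite (e (fun v => f (v + u0))) e rint_shift.
  (* Chosen with [e^(- 2 w) = n + 1], so that the Fourier transform of [gl w] is the power
     [E ^+ n.+1]. *)
  pose w : C := (- (ln (n.+1%:R : R) / 2)) +i* 0.
  have pi0 := pi_gt0 R.
  have a0 : - (pi / 4) < (0 : R) < pi / 4 by apply/andP; split; lra.
  pose G x := complex.Re (gl w x).
  have GE x : gl w x = (G x)%:C.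
    apply: complex_ext => //=; rewrite /gl.
    have -> : w = (- (ln (n.+1%:R : R) / 2))%:C by [].
    by rewrite -rmorphM !cexp_real -!rmorphM -rmorphN cexp_real -rmorphM.
  have G0 x : 0 <= G x.
    rewrite /G /gl; have -> : w = (- (ln (n.+1%:R : R) / 2))%:C by [].
    by rewrite -rmorphM !cexp_real -!rmorphM -rmorphN cexp_real -rmorphM /= mulr_ge0 ?expR_ge0.
  have iG : rintg G := (cintg_gl (- (ln (n.+1%:R : R) / 2)) a0).1.
  have mG := rintg_meas iG.
  have GF m : rint (fun x => G x * cos (2 * pi * m * x)) = E m ^+ n.+1.
    have [_ /(congr1 (@complex.Re R))] := gl_fourier (- (ln (n.+1%:R : R) / 2)) m a0.
    rewrite -/w /cint /=.
    have -> : (fun x => complex.Re (gl w x * cexp (- (2 * pi * m * x)%:C * 'i))) =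
        (fun x => G x * cos (2 * pi * m * x)).
      apply/funext => x; rewrite GE.
      have -> : - (2 * pi * m * x)%:C * 'i = 0 +i* (- (2 * pi * m * x)).
        by apply: complex_ext; rewrite !ReImE /=; ring.
      by rewrite ReM Re_cexp /= expR0 mul1r cosN mul0r subr0.
    move=> ->; have -> : - (2%:C * w) = (ln (n.+1%:R : R))%:C.
      by apply: complex_ext; rewrite /w !ReImE /=; field.
    rewrite cexp_real lnK ?posrE// -rmorphM -rmorphN cexp_real /=.
    by rewrite /E -expRM_natl; congr expR; ring.
  have mcos (c d : R) : rmeas (fun x => cos (c * x + d)).
    apply: rmeas_cont => x.
    have h := is_derive_add (is_derive_mul (is_derive_cst c x 1) (is_derive_id x 1)) (is_derive_cst d x 1).
    exact: (is_derive_continuous (is_derive_comp (is_derive_cos _) h)).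
  have mf := rintg_meas fi.
  have cos1 (x : R) : `|cos x| <= 1 by rewrite ler_norml cos_geN1 cos_le1.
  have icos (h : R -> R) (c d : R) : rintg h -> rintg (fun x => h x * cos (c * x + d)).
    move=> ih; apply: (rintg_dom _ (rintg_norm ih)).
      by apply: measurable_funM; [exact: rintg_meas|exact: mcos].
    by move=> x; rewrite normrM ler_piMr.
  (* [f] is even, so the sine part of the shifted cosine integrates to 0. *)
  have Sym t c : rint (fun v => f v * cos (t * (v - c))) = cos (t * c) * rint (fun v => f v * cos (t * v)).
    have e2 : rint (fun v => f v * cos (t * (- v - c))) = rint (fun v => f v * cos (t * (v - c))).
      have ih : rintg (fun v => f v * cos (t * (v - c))).
        have -> : (fun v => f v * cos (t * (v - c))) = (fun v => f v * cos (t * v + (- (t * c)))).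
          by apply/funext => v; rewrite mulrBr.
        exact: icos.
      by rewrite -(rint_opp ih); congr rint; apply/funext => v; rewrite fe.
    have i1 : rintg (fun v => f v * cos (t * (v - c))).
      have -> : (fun v => f v * cos (t * (v - c))) = (fun v => f v * cos (t * v + (- (t * c)))).
        by apply/funext => v; rewrite mulrBr.
      exact: icos.
    have i2 : rintg (fun v => f v * cos (t * (- v - c))).
      have -> : (fun v => f v * cos (t * (- v - c))) = (fun v => f v * cos (- t * v + (- (t * c)))).
        by apply/funext => v; congr (_ * cos _); ring.
      exact: icos.
    have i3 : rintg (fun v => f v * cos (t * v)).
      have -> : (fun v => f v * cos (t * v)) = (fun v => f v * cos (t * v + 0)).
        by apply/funext => v; rewrite addr0.
      exact: icos.
    have : rint (fun v => f v * cos (t * (v - c)) + f v * cos (t * (- v - c))) =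
        rint (fun v => 2 * cos (t * c) * (f v * cos (t * v))).
      congr rint; apply/funext => v.
      have -> : t * (v - c) = t * v - t * c by ring.
      have -> : t * (- v - c) = - (t * v + t * c) by ring.
      by rewrite cosN cosB cosD; ring.
    by rewrite rintD// e2 rintZ//; lra.
  have Fub c : rint (fun v => f v * E (v - c) ^+ n.+1) =
      rint (fun x => G x * cos (2 * pi * x * c) * rint (fun v => f v * cos (2 * pi * x * v))).
    have mF : rmeas2 (fun v x => f v * (G x * cos (2 * pi * (v - c) * x))).
      apply: measurable_funM; first exact: (measurableT_comp mf (@measurable_fst _ _ _ _)).
      apply: measurable_funM; first exact: (measurableT_comp mG (@measurable_snd _ _ _ _)).
      have mc := rmeas_cont (@continuous_cos R).
      apply: (measurableT_comp mc); apply: measurable_funM; last exact: measurable_snd.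
      apply: measurable_funM; first exact: measurable_cst.
      by apply: measurable_funB; [exact: measurable_fst|exact: measurable_cst].
    have ic1 v : rintg (fun x => G x * cos (2 * pi * (v - c) * x)).
      have := icos G (2 * pi * (v - c)) 0 iG; congr rintg.
      by apply/funext => x; rewrite addr0.
    have i1 v : rintg (fun x => f v * (G x * cos (2 * pi * (v - c) * x))).
      exact: rintgZ (ic1 v).
    have ic2 x : rintg (fun v => f v * cos (2 * pi * x * (v - c))).
      have := icos f (2 * pi * x) (- (2 * pi * x * c)) fi; congr rintg.
      by apply/funext => v; rewrite mulrBr.
    have e2 x : (fun v => f v * (G x * cos (2 * pi * (v - c) * x))) =
        (fun v => G x * (f v * cos (2 * pi * x * (v - c)))).
      by apply/funext => v; rewrite [2 * pi * (v - c) * x]mulrAC; ring.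
    have i2 x : rintg (fun v => f v * (G x * cos (2 * pi * (v - c) * x))).
      by rewrite e2; exact: rintgZ.
    have Fc x : rint (fun v => `|f v * (G x * cos (2 * pi * (v - c) * x))|) <=
        rint (fun v => `|f v|) * G x.
      rewrite [leRHS]mulrC -(rintZ (G x) (rintg_norm fi)); apply: rint_le.
      - exact: rintg_norm.
      - exact: rintgZ (rintg_norm fi).
      - move=> v; rewrite !normrM (ger0_norm (G0 x)) mulrCA ler_wpM2l//.
        by rewrite ler_piMr.
    have [_] := rint_fubini mF i1 i2 Fc (rintgZ _ iG).
    have -> : (fun v => rint (fun x => f v * (G x * cos (2 * pi * (v - c) * x)))) =
        (fun v => f v * E (v - c) ^+ n.+1).
      by apply/funext => v; rewrite rintZ// GF.
    move=> ->; congr rint; apply/funext => x.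
    by rewrite e2 rintZ// Sym mulrA.
  have sh : rint (fun v => f (v + u0) * E v ^+ n.+1) = rint (fun v => f v * E (v - u0) ^+ n.+1).
    have ih : rintg (fun v => f v * E (v - u0) ^+ n.+1).
      have := rintg_shift (- u0) (ifE n.+1 _ (rintg_shift u0 fi)); congr rintg.
      by apply/funext => v; rewrite subrK.
    by rewrite -(rint_shift u0 ih); congr rint; apply/funext => v; rewrite addrK.
  rewrite sh Fub.
  have -> : (fun v => f v * E v ^+ n.+1) = (fun v => f v * E (v - 0) ^+ n.+1).
    by apply/funext => v; rewrite subr0.
  rewrite Fub.
  have iW c : rintg (fun x => G x * cos (2 * pi * x * c) * rint (fun v => f v * cos (2 * pi * x * v))).
    have cW : continuous (fun x : R => rint (fun v => f v * cos (2 * pi * x * v))).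
      move=> x0; apply: (rint_continuous (g := fun v => `|f v|)).
      - move=> x; have := icos f (2 * pi * x) 0 fi => /rintg_meas; congr rmeas.
        by apply/funext => v; rewrite addr0.
      - move=> v; have h := is_derive_mul (is_derive_mul (is_derive_cst (2 * pi : R) x0 1) (is_derive_id x0 1)) (is_derive_cst v x0 1).
        exact: (is_derive_continuous (is_derive_mul (is_derive_cst (f v) x0 1) (is_derive_comp (is_derive_cos _) h))).
      - exact: rintg_norm.
      - by move=> x v _; rewrite normrM ler_piMr.
    apply: (@rintg_dom _ _ (fun x => rint (fun v => `|f v|) * G x)).
    - apply: measurable_funM; last exact: rmeas_cont cW.
      apply: measurable_funM; first exact: mG.
      have := mcos (2 * pi * c) 0; congr rmeas; apply/funext => x.
      by rewrite addr0 [_ * c * x]mulrAC.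
    - exact: rintgZ _ iG.
    - move=> x; rewrite normrM mulrC; apply: ler_pM; [exact: normr_ge0|exact: normr_ge0| |].
        have iv : rintg (fun v => f v * cos (2 * pi * x * v)).
          have := icos f (2 * pi * x) 0 fi; congr rintg; apply/funext => v; by rewrite addr0.
        apply: le_trans (rint_norm iv) _; apply: rint_le; [exact: rintg_norm|exact: rintg_norm|].
        by move=> v; rewrite normrM ler_piMr.
      by rewrite normrM (ger0_norm (G0 x)); exact: ler_piMr (G0 x) (cos1 _).
  apply: rint_le; [exact: iW|exact: iW|move=> x].
  apply: ler_wpM2r; first exact: W0.
  apply: ler_wpM2l; first exact: G0.
  by rewrite mulr0 cos0; exact: cos_le1.
rewrite -subr_le0.
pose D v := f (v + u0) - f v.
have -> : f u0 - f 0 = D 0 by rewrite /D add0r.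
apply: (@peak_le R D E 0).
- by apply: rintgB => //; exact: rintg_shift.
- exact: mE.
- by move=> x; have /andP[/ltW -> ->] := E01 x.
- move=> q q1.
  have cE : {for (0 : R), continuous E}.
    have h := is_derive_mul (is_derive_cst (pi : R) (0 : R) 1) (is_derive_mul (is_derive_id (0 : R) 1) (is_derive_id (0 : R) 1)).
    exact: (is_derive_continuous (is_derive_comp (is_derive_expR _) (is_deriveN h))).
  have q0 : 0 < 1 - q by rewrite subr_gt0.
  have [e /= e0 he] := (iffLR (cvgrPdist_lt _ _) cE) _ q0.
  exists e => // x xe; have := he x; rewrite /= distrC => /(_ xe).
  have -> : E 0 = 1 by rewrite /E expr0n mulr0 oppr0 expR0.
  by rewrite ltr_norml => /andP[_]; lra.
- move=> e e0; exists (E e).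
    by rewrite -expR0 ltr_expR oppr_lt0 mulr_gt0 ?pi_gt0 ?exprn_gt0.
  move=> x _; rewrite subr0 => xe; rewrite ler_expR lerN2 ler_wpM2l ?pi_ge0//.
  by rewrite -[leRHS]real_normK ?num_real// lerXn2r ?nnegrE ?normr_ge0 ?(ltW e0).
- move=> v; rewrite /D; apply: cvgB; last exact: fc.
  apply: (@continuous_comp _ _ _ (fun v : R => v + u0) f); last exact: fc.
  by apply: cvgD; [exact: cvg_id|exact: cvg_cst].
- move=> n; have -> : (fun v => D v * E v ^+ n) = (fun v => f (v + u0) * E v ^+ n - f v * E v ^+ n).
    by apply/funext => v; rewrite mulrBl.
  rewrite rintB ?subr_le0//; last exact: ifE.
  by apply: (ifE n (fun v => f (v + u0))); exact: rintg_shift.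
Qed.

End PositiveDefinite.

(** * The rotated kernel and its transform *)

Section HardyKernel.
Context {R : realType}.
Local Notation mu := (@lebesgue_measure R).
Local Notation C := R[i].

(** The factor [e^(w / 2)] is the real part of the exponent in [e^(s w)] on [Re s = 1 / 2]: what
    remains of the Mellin transform there is a Fourier transform. *)
Definition Kf (w : C) : C := cexp ((1 / 2)%:C * w) * Hf w.

Arguments Kf : simpl never.

(** Separates [cosh (w / 2)] from half of [e^(w / 2)] times the theta series; the parity of [Kf] and
    its behaviour near the critical angle are read off this form. *)
Lemma KfE (w : C) : Kf w = (1 / 2)%:C * (cexp ((1 / 2)%:C * w) + cexp (- ((1 / 2)%:C * w))) -
  (1 / 2)%:C * (cexp ((1 / 2)%:C * w) * (1 + 2%:C * ths w)).
Proof.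
rewrite /Kf /Hf; have e2 : (1 / 2)%:C * 2%:C = 1 :> C by apply: complex_ext; rewrite !ReImE /=; field.
have e1 : - w = - ((1 / 2)%:C * w) - (1 / 2)%:C * w by apply: complex_ext; rewrite !ReImE /=; field.
rewrite {1}e1 cexpD [cexp (- _)]cexpN; have := cexp_neq0 ((1 / 2)%:C * w).
set E := cexp _; set h := (1 / 2)%:C => E0.
have -> : h * (E * (1 + 2%:C * ths w)) = h * E + (h * 2%:C) * (E * ths w) by ring.
by rewrite e2; field.
Qed.

(** [theta_poisson] says that [e^(w / 2)] times the theta series is an even function of [w]. *)
Lemma Kf_even (u a : R) : - (pi / 4) < a < pi / 4 -> Kf (- (u +i* a)) = Kf (u +i* a).
Proof.
move=> ha; rewrite !KfE -(theta_poisson u ha) mulrN opprK; set w := u +i* a.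
have e1 : cexp w = cexp ((1 / 2)%:C * w) * cexp ((1 / 2)%:C * w).
  by rewrite -cexpD; congr cexp; apply: complex_ext; rewrite !ReImE /=; field.
rewrite e1 [cexp (- _)]cexpN; have := cexp_neq0 ((1 / 2)%:C * w).
by set E := cexp _ => E0; field.
Qed.

Definition cj (z : C) : C := complex.Re z +i* - complex.Im z.

Lemma cjM (z w : C) : cj (z * w) = cj z * cj w.
Proof. by apply: complex_ext; rewrite ?ReImE /= ?ReImE; ring. Qed.
Lemma cjD (z w : C) : cj (z + w) = cj z + cj w.
Proof. by apply: complex_ext; rewrite ?ReImE /= ?ReImE; ring. Qed.
Lemma cjN (z : C) : cj (- z) = - cj z.
Proof. by apply: complex_ext; rewrite ?ReImE /= ?ReImE. Qed.
Lemma cj_real (x : R) : cj x%:C = x%:C.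
Proof. by apply: complex_ext; rewrite /= ?oppr0. Qed.
Lemma cj_exp z : cj (cexp z) = cexp (cj z).
Proof. by apply: complex_ext; rewrite ?(Re_cexp, Im_cexp) /= ?(Re_cexp, Im_cexp) ?cosN ?sinN ?mulrN. Qed.
Lemma cj_sum (n : nat) (F : 'I_n -> C) : cj (\sum_(i < n) F i) = \sum_(i < n) cj (F i).
Proof. by apply: (big_morph cj cjD); exact: (cj_real 0). Qed.

Lemma ths_conj (u a : R) : - (pi / 4) < a < pi / 4 -> ths (u +i* - a) = cj (ths (u +i* a)).
Proof.
move=> ha; have ha' : - (pi / 4) < - a < pi / 4 by move: ha => /andP[? ?]; apply/andP; split; lra.
apply: (ccvg_unique (thsP u ha')).
have -> : (fun N => \sum_(i < N) th (u +i* - a) i.+1) = (fun N => cj (\sum_(i < N) th (u +i* a) i.+1)).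
  apply/funext => N; rewrite cj_sum; apply: eq_bigr => i _.
  by rewrite /th cj_exp cjN cjM cj_real cj_exp cjM cj_real.
have [h1 h2] := thsP u ha; split.
  exact: h1.
exact: cvgN.
Qed.

Lemma Kf_conj (u a : R) : - (pi / 4) < a < pi / 4 -> Kf (u +i* - a) = cj (Kf (u +i* a)).
Proof.
move=> ha; rewrite /Kf /Hf (ths_conj u ha).
by rewrite cjM cjD cjN cjM !cj_real !cj_exp cjM cjN cj_real.
Qed.

Lemma Kf_opp (u a : R) : - (pi / 4) < a < pi / 4 -> Kf (- u +i* a) = cj (Kf (u +i* a)).
Proof.
move=> ha; rewrite -(Kf_even (- u) ha) -(Kf_conj u ha).
by apply: (congr1 Kf); apply: complex_ext; rewrite /= ?opprK.
Qed.

(** Continuity is taken from the integral [Hf_conv], with a majorant common to all arguments within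
    1 of [u0]; the factor [expR 1] pays for that displacement. *)
Lemma ccont_Hf (a : R) : - (pi / 4) < a < pi / 4 -> ccont (fun u => Hf (u +i* a)).
Proof.
move=> ha; have /strip_width[a0 ha0 haa] := ha.
have [K K0 HK] := @bker_bound R 0 a0 (lexx 0) ha0.
have [br bi] : ccont (fun v => bker 0 (v +i* a)) := ccont_bker 0 a.
have cF (h : R -> R) : continuous h -> (forall u, `|h u| <= cabs (bker 0 (u +i* a))) ->
    continuous (fun u => rint (fun v => fr v * h (u + v))).
  move=> ch hb u0; apply: (rint_continuous (g := fun v => K * expR 1 * expR (- 1 * `|v + u0|))).
  - move=> t; apply: measurable_funM; first exact: rmeas_fr.
    by under eq_fun do rewrite addrC; exact: (rmeas_shift t (rmeas_cont ch)).
  - move=> v; apply: cvgM; first exact: cvg_cst.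
    apply: (@continuous_comp _ _ _ (fun t : R => t + v) h); last exact: ch.
    by apply: cvgD; [exact: cvg_id|exact: cvg_cst].
  - by apply: rintgZ; apply: (rintg_shift u0 (h := fun v => expR (- 1 * `|v|))); exact: (rintg_expabs (m := 1)).
  - move=> t v tu; rewrite normrM.
    apply: (@le_trans _ _ (cabs (bker 0 ((t + v) +i* a)))).
      rewrite -[leRHS]mul1r; apply: ler_pM => //.
      by rewrite ger0_norm ?fr_ge0 ?fr_le1.
    have [h1 _] := HK (t + v) a haa; apply: le_trans h1 _.
    rewrite -mulrA ler_wpM2l// -expRD ler_expR.
    have h2 := ler_normD (t + v) (u0 - t); rewrite [`|u0 - t|]distrC in h2.
    have e : t + v + (u0 - t) = v + u0 by ring.
    by rewrite e in h2; lra.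
have e u : Hf (u +i* a) = cint (fun v => (fr v)%:C * bker 0 ((u + v) +i* a)) by rewrite Hf_conv.
split.
  have -> : (fun u => complex.Re (Hf (u +i* a))) =
      (fun u => rint (fun v => fr v * complex.Re (bker 0 ((u + v) +i* a)))).
    by apply/funext => u; rewrite e /cint /=; congr rint; apply/funext => v; rewrite ReM /= mul0r subr0.
  by apply: (cF (fun v => complex.Re (bker 0 (v +i* a)))) => // u; exact: cabs_Re.
have -> : (fun u => complex.Im (Hf (u +i* a))) =
    (fun u => rint (fun v => fr v * complex.Im (bker 0 ((u + v) +i* a)))).
  by apply/funext => u; rewrite e /cint /=; congr rint; apply/funext => v; rewrite ImM /= mul0r addr0.
by apply: (cF (fun v => complex.Im (bker 0 (v +i* a)))) => // u; exact: cabs_Im.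
Qed.

Lemma ccont_Kf (a : R) : - (pi / 4) < a < pi / 4 -> ccont (fun u => Kf (u +i* a)).
Proof.
move=> ha; apply: ccontM; last exact: ccont_Hf.
by apply: cderiv_ccont => x; apply: cderiv_exp; apply: cderivZ; exact: cderiv_line_re.
Qed.

Definition half (t : R) : C := (1 / 2) +i* t.
(* Up to elementary factors, the completed zeta function on the critical line. *)
Definition Tz (t : R) : C := Jz (half t) * Bz (half t).

(** The value of [Hf_mellin] does not depend on [a]; rotating the line only brings out [e^(t a)],
    whose positivity preserves the sign of the transform. *)
Lemma Kf_mellin (t a : R) : - (pi / 4) < a < pi / 4 ->
  cintg (fun u => cexp (0 +i* (t * u)) * Kf (u +i* a)) /\
  cint (fun u => cexp (0 +i* (t * u)) * Kf (u +i* a)) = (expR (t * a))%:C * Tz t.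
Proof.
move=> ha; have hs : 0 < complex.Re (half t) < 1 by rewrite /=; apply/andP; split; lra.
have [h1 h2] := Hf_mellin hs ha; rewrite /Tz -h2.
have e : (fun u => cexp (0 +i* (t * u)) * Kf (u +i* a)) =
    (fun u => (expR (t * a))%:C * (cexp (half t * (u +i* a)) * Hf (u +i* a))).
  apply/funext => u; rewrite /Kf !mulrA -cexpD -cexp_real -cexpD; congr (cexp _ * _).
  by apply: complex_ext; rewrite /half !ReImE /=; ring.
by rewrite e; split; [exact: cintgZ|rewrite cintZ].
Qed.

Lemma Kf_cos (t a : R) : - (pi / 4) < a < pi / 4 ->
  rint (fun u => complex.Re (Kf (u +i* a)) * cos (t * u)) =
  (expR (t * a) * complex.Re (Tz t) + expR (- t * a) * complex.Re (Tz (- t))) / 2.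
Proof.
move=> ha; have [[i1 _] /(congr1 (@complex.Re R)) h1] := Kf_mellin t ha.
have [[i2 _] /(congr1 (@complex.Re R)) h2] := Kf_mellin (- t) ha.
rewrite ReM /= mul0r subr0 in h1; rewrite ReM /= mul0r subr0 in h2.
rewrite -h1 -h2 -rintD// mulrC -rintZ; last exact: rintgD.
congr rint; apply/funext => u; rewrite !ReM !Re_cexp !Im_cexp /= expR0 !mulNr cosN sinN.
by field.
Qed.

Lemma Kf_real (u : R) : complex.Im (Kf (u +i* 0)) = 0.
Proof.
have pi0 := pi_gt0 R; have h0 : - (pi / 4) < (0 : R) < pi / 4 by apply/andP; split; lra.
have := Kf_conj u h0; rewrite oppr0 => /(congr1 (@complex.Im R)).
by case: (Kf _) => x y /=; lra.
Qed.

(** On the real axis [Kf] is real and even. *)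
Lemma Tz_re (t : R) : complex.Re (Tz t) = rint (fun u => complex.Re (Kf (u +i* 0)) * cos (t * u)) /\
  complex.Im (Tz t) = 0.
Proof.
have pi0 := pi_gt0 R; have h0 : - (pi / 4) < (0 : R) < pi / 4 by apply/andP; split; lra.
have [[i1 i2] h] := Kf_mellin t h0.
rewrite mulr0 expR0 mul1r in h; rewrite -h; split; rewrite /cint /=.
  congr rint; apply/funext => u; rewrite ReM Re_cexp Im_cexp /= expR0 Kf_real mulr0 subr0.
  by rewrite mul1r mulrC.
set g := fun u : R => complex.Im _ in i2 *.
have := rint_opp i2; have -> : (fun x => g (- x)) = (fun x => - 1 * g x).
  apply/funext => u; rewrite /g (Kf_opp u h0); have := Kf_real u; case: (Kf _) => x y /= ->.
  by rewrite !ImM !Re_cexp !Im_cexp /= (mulrN t) sinN cosN; ring.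
by rewrite rintZ//; lra.
Qed.

Lemma Tz_cont : continuous (fun t => complex.Re (Tz t)).
Proof.
have pi0 := pi_gt0 R; have h0 : - (pi / 4) < (0 : R) < pi / 4 by apply/andP; split; lra.
have cK := (ccont_Kf h0).1.
have iK : rintg (fun u => complex.Re (Kf (u +i* 0))).
  have [[+ _] _] := Kf_mellin 0 h0; congr rintg; apply/funext => u.
  by rewrite mul0r cexp0 mul1r.
have -> : (fun t => complex.Re (Tz t)) = (fun t => rint (fun u => complex.Re (Kf (u +i* 0)) * cos (t * u))).
  by apply/funext => t; rewrite (Tz_re t).1.
move=> t0; apply: (rint_continuous (g := fun u => `|complex.Re (Kf (u +i* 0))|)).
- move=> t; apply: measurable_funM; first exact: rintg_meas.
  apply: rmeas_cont => x; have h := is_derive_mul (is_derive_cst t x 1) (is_derive_id x 1).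
  exact: (is_derive_continuous (is_derive_comp (is_derive_cos _) h)).
- move=> u; have h := is_derive_mul (is_derive_id t0 1) (is_derive_cst u t0 1).
  exact: (is_derive_continuous (is_derive_mul (is_derive_cst (complex.Re (Kf (u +i* 0))) t0 1)
    (is_derive_comp (is_derive_cos _) h))).
- exact: rintg_norm.
- by move=> t u _; rewrite normrM ler_piMr// ler_norml cos_geN1 cos_le1.
Qed.

(** Decides which constant sign is meant: at [t = 0] both [Jz] and [Bz] are integrals of nonnegative
    functions. *)
Lemma Tz0_ge0 : 0 <= complex.Re (Tz 0).
Proof.
rewrite /Tz; have -> : half 0 = (1 / 2)%:C by [].
have eJ v : Jker (1 / 2)%:C v = (fr v * expR (- (1 / 2 * v)))%:C.
  by rewrite /Jker -rmorphM -rmorphN cexp_real -rmorphM.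
have eB v : bker (1 / 2)%:C v%:C = (expR (1 / 2 * v) * (2 * pi * expR (2 * v)) * Vk v)%:C.
  by rewrite /bker Gau_real -!rmorphM !cexp_real -!rmorphM.
rewrite ReM /Jz /Bz /cint /=.
have -> : (fun x : R => complex.Im (Jker (1 / 2)%:C x)) = (fun=> 0) by apply/funext => v; rewrite eJ.
rewrite rint_cst0 mul0r subr0 mulr_ge0//; apply: rint_ge0 => v.
  by rewrite eJ /= mulr_ge0 ?fr_ge0 ?expR_ge0.
by rewrite eB /= !mulr_ge0 ?expR_ge0 ?pi_ge0.
Qed.

Lemma Tz_gt0 : (forall t, Jz (half t) != 0) -> forall t, 0 < complex.Re (Tz t).
Proof.
move=> J0; have T0 t : complex.Re (Tz t) != 0.
  apply/eqP => h; have : Tz t = 0 by apply: complex_ext; rewrite ?h ?(Tz_re t).2.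
  by move=> /eqP; rewrite mulf_eq0 (negPf (J0 t)) (negPf (Bz_neq0 t)).
move=> t; rewrite ltNge; apply/negP => Tt.
have T00 : 0 < complex.Re (Tz 0) by rewrite lt_neqAle eq_sym T0 Tz0_ge0.
have cT (a b : R) : {within `[a, b], continuous (fun t => complex.Re (Tz t))}.
  exact: continuous_subspaceT Tz_cont.
have [t0|t0] := leP 0 t.
  have [|c _ /eqP] := IVT t0 (cT 0 t) (v := 0); last by rewrite (negPf (T0 c)).
  by rewrite ge_min le_max (ltW T00) Tt orbT.
have [|c _ /eqP] := IVT (ltW t0) (cT t 0) (v := 0); last by rewrite (negPf (T0 c)).
by rewrite ge_min le_max (ltW T00) Tt orbT.
Qed.

Lemma Kf_max (u a : R) : (forall t, Jz (half t) != 0) -> - (pi / 4) < a < pi / 4 ->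
  complex.Re (Kf (u +i* a)) <= complex.Re (Kf (0 +i* a)).
Proof.
move=> J0 ha; have T0 := Tz_gt0 J0.
apply: (@posdef_max R (fun u => complex.Re (Kf (u +i* a)))).
- have [[+ _] _] := Kf_mellin 0 ha; congr rintg; apply/funext => v.
  by rewrite mul0r cexp0 mul1r.
- exact: (ccont_Kf ha).1.
- by move=> v; rewrite Kf_opp//; case: (Kf _).
- by move=> t; rewrite Kf_cos// divr_ge0// addr_ge0// mulr_ge0 ?expR_ge0// ltW.
Qed.

End HardyKernel.

(** * The theta series near the point i *)

Section HardyZero.
Context {R : realType}.
Local Notation C := R[i].

Lemma ccvg_le (F : nat -> C) (l : C) (B : R) : ccvg F l -> (forall n, cabs (F n) <= B) -> cabs l <= B.
Proof.
move=> /ccvgP h hB; rewrite -[leRHS]addr0.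
have h' : B + cabs (F n - l) @[n --> \oo] --> B + 0 by apply: cvgD; [exact: cvg_cst|exact: h].
rewrite -(cvg_lim _ h')//; apply: limr_ge; first by apply/cvg_ex; exists (B + 0).
near=> n; have := cabsB (F n) (F n - l).
have -> : F n - (F n - l) = l by ring.
by have := hB n; lra.
Unshelve. all: by end_near.
Qed.

(** As [pi n^2 >= n], the [n]-th term is at most [r^n] with [r = e^(- Y) <= 1 / 2], and the
    geometric series is at most [2 r]. *)
Lemma ths_le (u a : R) (Y : R) : - (pi / 4) < a < pi / 4 -> 1 <= Y ->
  Y <= expR (2 * u) * cos (2 * a) -> cabs (ths (u +i* a)) <= 2 * expR (- Y).
Proof.
move=> ha Y1 YX; apply: (ccvg_le (thsP u ha)) => N.
pose r := expR (- Y); have r0 : 0 < r by exact: expR_gt0.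
have r2 : r <= 1 / 2.
  rewrite /r expRN div1r lef_pV2 ?posrE ?expR_gt0//.
  by apply: le_trans (expR_ge1Dx Y); lra.
have hth i : cabs (th (u +i* a) i.+1) <= r ^+ i.+1.
  rewrite /th cabs_cexp /r -expRM_natl ler_expR ReN mulrN lerN2.
  have -> : complex.Re ((pi * i.+1%:R ^+ 2)%:C * cexp (2%:C * (u +i* a))) =
      pi * i.+1%:R ^+ 2 * (expR (2 * u) * cos (2 * a)).
    by rewrite ReM [complex.Im _%:C]/= mul0r subr0 Re_cexp !ReImE /= !mul0r subr0 addr0.
  have i1 : 1 <= i.+1%:R :> R by rewrite ler1n.
  have p1 : 1 <= pi :> R by have := @pi_ge2 R; lra.
  have h : i.+1%:R <= pi * i.+1%:R ^+ 2 :> R by nra.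
  by apply: ler_pM => //; lra.
apply: (@le_trans _ _ (\sum_(i < N) r ^+ i.+1)).
  by apply: le_trans (cabs_sum _ _ _) _; apply: ler_sum => i _; exact: hth.
suff : \sum_(i < N) r ^+ i.+1 <= 2 * r - 2 * r ^+ N.+1.
  have h0 : 0 <= r ^+ N.+1 by rewrite exprn_ge0// ltW.
  by move=> h; apply: le_trans h _; rewrite -/r; lra.
elim: N => [|N IH]; first by rewrite big_ord0 expr1 subrr.
rewrite big_ord_recr /= [r ^+ N.+2]exprS.
have h0 : 0 <= r ^+ N.+1 by rewrite exprn_ge0// ltW.
by move: IH; nra.
Qed.

Lemma polar_half_plane (x y : R) : 0 < x -> exists2 d : R * R, - (pi / 4) < d.2 < pi / 4 &
  expR (2 * d.1) * cos (2 * d.2) = x /\ expR (2 * d.1) * sin (2 * d.2) = y.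
Proof.
move=> x0; pose f := atan (y / x).
have f1 : - (pi / 2) < f := atan_gtNpi2 _.
have f2 : f < pi / 2 := atan_ltpi2 _.
have c0 : 0 < cos f by apply: cos_gt0_pihalf; rewrite f1 f2.
have ft : sin f = y / x * cos f.
  by have := atanK (y / x); rewrite -/f /tan => <-; rewrite divfK// gt_eqF.
exists (ln (x / cos f) / 2, f / 2) => /=; first by apply/andP; split; lra.
have -> : 2 * (f / 2) = f by field.
have -> : 2 * (ln (x / cos f) / 2) = ln (x / cos f) by field.
rewrite lnK ?posrE ?divr_gt0// ft; split; first by rewrite divfK// gt_eqF.
by field; rewrite !gt_eqF.
Qed.

Lemma cexpX (z : C) n : cexp z ^+ n = cexp (n%:R%:C * z).
Proof.
elim: n => [|n IH]; first by rewrite expr0 mul0r cexp0.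
by rewrite exprS IH -cexpD; congr cexp; rewrite -(natr1 n) rmorphD; ring.
Qed.

Lemma th_alt (w d : C) n : cexp (2%:C * w) = cexp (2%:C * d) + 'i -> th w n = (-1) ^+ n * th d n.
Proof.
move=> e; rewrite /th e mulrDr opprD cexpD mulrC; congr (_ * _).
have e1 : cexp (0 +i* (- pi)) = -1 :> C.
  by apply: complex_ext; rewrite ?Re_cexp ?Im_cexp /= expR0 ?cosN ?sinN ?cospi ?sinpi; lra.
have -> : - ((pi * n%:R ^+ 2)%:C * 'i) = (n ^ 2)%:R%:C * (0 +i* (- pi)) :> C.
  by rewrite natrX; apply: complex_ext; rewrite !ReImE /=; ring.
by rewrite -cexpX e1 -[LHS]signr_odd oddX /= signr_odd.
Qed.

(* Adding [i] to [e^(2 d)] multiplies the [n]-th term of the theta series by [(-1) ^ n]. *)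
Lemma ths_alt (u a x b : R) : - (pi / 4) < a < pi / 4 -> - (pi / 4) < b < pi / 4 ->
  cexp (2%:C * (u +i* a)) = cexp (2%:C * (x +i* b)) + 'i ->
  ths (u +i* a) = 2%:C * ths ((x + ln 2) +i* b) - ths (x +i* b).
Proof.
move=> ha hb e; set w := u +i* a; set d := x +i* b.
(* An alternating sum is twice its even terms minus all terms, and the even terms at [d] are the
   terms at [d + ln 2]. The two sides match exactly at even truncations. *)
have dbl (F : nat -> C) l : ccvg F l -> ccvg (fun n => F n.*2) l.
  have h : n.*2 @[n --> \oo] --> \oo.
    by apply/cvgnyPge => M; near=> n; apply: (@leq_trans n); [near: n; exact: nbhs_infty_ge|rewrite -addnn leq_addr].
  by move=> [h1 h2]; split; [exact: (cvg_comp _ _ h h1)|exact: (cvg_comp _ _ h h2)].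
apply: (ccvg_unique (dbl _ _ (thsP u ha))).
have -> : (fun n => \sum_(i < n.*2) th (u +i* a) i.+1) =
  (fun n => 2%:C * (\sum_(i < n) th ((x + ln 2) +i* b) i.+1) + (-1) * \sum_(i < n.*2) th d i.+1).
  apply/funext; elim => [|n IH]; first by rewrite !big_ord0 !mulr0 addr0.
  rewrite doubleS !big_ord_recr /= IH !(th_alt _ e) !exprS -signr_odd odd_double expr0.
  have -> : th ((x + ln 2) +i* b) n.+1 = th d n.*2.+2.
    rewrite /th; congr (cexp (- _)).
    have -> : (x + ln 2) +i* b = d + (ln 2)%:C by apply: complex_ext; rewrite !ReImE /= ?addr0.
    have -> : 2%:C * (d + (ln 2)%:C) = 2%:C * d + (ln 2 + ln 2)%:C by rewrite mulrDr rmorphD; ring.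
    rewrite cexpD cexp_real expRD !lnK ?posrE ?ltr0n//.
    have -> : n.*2.+2%:R = 2 * n.+1%:R :> R by rewrite -doubleS -mul2n natrM.
    by rewrite [_ * (2 * 2)%:C]mulrC mulrA -rmorphM; congr (_%:C * _); ring.
  by rewrite -/d; ring.
rewrite -[X in ccvg _ (_ + X)]mulN1r; apply: ccvgD; apply: ccvgM; try exact: ccvg_cst.
  exact: thsP.
exact: (dbl _ _ (thsP x hb)).
Unshelve. all: by end_near.
Qed.

(** Write [e^(2 w) = e^(2 d) + i]. By [ths_alt] the theta series at [w] combines those at [d] and
    [d + ln 2]; applying [theta_poisson] to both cancels their main terms and leaves [key], a
    difference exponentially small in [1 / A]. *)
Lemma theta_small : exists2 K : R, 0 < K & forall (u a A x y : R), - (pi / 4) < a < pi / 4 ->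
  0 < A <= 1 / 20 -> A <= x -> x ^+ 2 + y ^+ 2 <= 5 * A ^+ 2 ->
  expR (2 * u) * cos (2 * a) = x -> expR (2 * u) * sin (2 * a) = y + 1 ->
  cabs (1 + 2%:C * ths (u +i* a)) <= K * A ^+ 3.
Proof.
(* 8 comes from [T], [4^4] from [Y^4 <= 4^4 e^Y], and [20^4] from [Y = 1 / (20 A)]. Of the resulting
   [A^4], one factor is spent on [A <= expR p]. *)
exists (8 * (4 ^+ 4 * 20 ^+ 4)) => [|u a A x y ha /andP[A0 A1] Ax xy hc hs].
  by rewrite !mulr_gt0 ?exprn_gt0.
have x0 : 0 < x by lra.
have [[p b] /= hb [dc ds]] := polar_half_plane y x0.
have hb' : - (pi / 4) < - b < pi / 4 by move: hb => /andP[? ?]; apply/andP; split; lra.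
have e : cexp (2%:C * (u +i* a)) = cexp (2%:C * (p +i* b)) + 'i.
  by apply: complex_ext; rewrite !(ReImE, Re_cexp, Im_cexp) /= !mul0r !subr0 !addr0 ?hc ?hs ?dc ?ds.
have P1 := theta_poisson p hb; have P2 := theta_poisson (p + ln 2) hb.
set d := p +i* b in e P1.
have e2 : (p + ln 2) +i* b = d + (ln 2)%:C by apply: complex_ext; rewrite !ReImE /= ?addr0.
have E0 := cexp_neq0 d; have D0 : expR p != 0 by rewrite gt_eqF ?expR_gt0.
have E2 : cexp (d + (ln 2)%:C) = 2%:C * cexp d.
  by rewrite cexpD cexp_real lnK ?posrE ?ltr0n// mulrC.
have key : cexp d * (1 + 2%:C * ths (u +i* a)) = 2%:C * (ths (- ((p + ln 2) +i* b)) - ths (- d)).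
  rewrite (ths_alt ha hb e) -/d; move: P2; rewrite {1}e2 E2 => P2.
  have -> : cexp d * (1 + 2%:C * (2%:C * ths ((p + ln 2) +i* b) - ths d)) =
     2%:C * cexp d * (1 + 2%:C * ths ((p + ln 2) +i* b)) - cexp d * (1 + 2%:C * ths d) +
     (2%:C - 2%:C * 1) * cexp d.
    have -> : (2%:C : C) = 1 + 1 by apply: complex_ext; rewrite !ReImE /= ?addr0.
    by ring.
  by rewrite P2 P1 mulr1 subrr mul0r addr0; ring.
have Ep : expR (2 * p) = expR p * expR p by rewrite -expRD; congr expR; ring.
have ep0 := expR_gt0 p.
have q4 : expR (2 * p) ^+ 2 = x ^+ 2 + y ^+ 2.
  by rewrite -dc -ds !exprMn -mulrDr cos2Dsin2 mulr1.
have qx : x <= expR (2 * p).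
  by rewrite -dc -[leRHS]mulr1 ler_wpM2l ?expR_ge0 ?cos_le1.
(* The real part of [e^(- 2 d)] is [x / (x^2 + y^2) >= 1 / (5 A) = 4 Y]; the shift by [ln 2] divides
   it by 4, so [ths_le] applies with [Y] to both terms. *)
pose Y := 1 / (20 * A).
have Y1 : 1 <= Y by rewrite /Y ler_pdivlMr ?mulr_gt0//; lra.
have YA : Y * (20 * A) = 1 by rewrite /Y divfK// gt_eqF ?mulr_gt0.
have X1 : 4 * Y <= expR (2 * (- p)) * cos (2 * (- b)).
  have -> : expR (2 * (- p)) * cos (2 * (- b)) = x / (expR (2 * p)) ^+ 2.
    by rewrite !mulrN expRN cosN -dc; field; rewrite gt_eqF ?expR_gt0.
  rewrite ler_pdivlMr ?exprn_gt0 ?expR_gt0// q4.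
  apply: (@le_trans _ _ (4 * Y * (5 * A ^+ 2))); first by rewrite ler_wpM2l//; lra.
  have -> : 4 * Y * (5 * A ^+ 2) = (Y * (20 * A)) * A by ring.
  by rewrite YA mul1r.
have X2 : Y <= expR (2 * (- (p + ln 2))) * cos (2 * (- b)).
  have -> : 2 * (- (p + ln 2)) = 2 * (- p) - (ln 2 + ln 2) by ring.
  rewrite expRD [expR (- _)]expRN [expR (ln 2 + _)]expRD lnK ?posrE ?ltr0n//.
  by rewrite mulrAC ler_pdivlMr; lra.
have T1 : cabs (ths (- d)) <= 2 * expR (- Y) by apply: (@ths_le (- p) (- b)) => //; lra.
have T2 : cabs (ths (- ((p + ln 2) +i* b))) <= 2 * expR (- Y).
  by apply: (@ths_le (- (p + ln 2)) (- b)).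
have T : expR p * cabs (1 + 2%:C * ths (u +i* a)) <= 8 * expR (- Y).
  have -> : expR p = cabs (cexp d) by rewrite cabs_cexp.
  rewrite -cabsM key cabsM cabs_real ger0_norm//.
  by have := cabsB (ths (- ((p + ln 2) +i* b))) (ths (- d)); lra.
have Yb : expR (- Y) <= 4 ^+ 4 * 20 ^+ 4 * A ^+ 4.
  have := @expR_pow_le R 4 Y => /(_ (le_trans ler01 Y1)) h.
  have e3 : expR (- Y) = Y ^+ 4 * expR (- Y) * (20 * A) ^+ 4.
    by rewrite mulrAC -exprMn YA expr1n mul1r.
  have h2 : Y ^+ 4 * expR (- Y) <= 4 ^+ 4 by rewrite expRN ler_pdivrMr ?expR_gt0.
  have h3 : 0 <= (20 * A) ^+ 4 by rewrite exprn_ge0// mulr_ge0// ltW.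
  by rewrite e3; apply: le_trans (ler_wpM2r h3 h2) _; rewrite exprMn mulrA.
have pA : A <= expR p.
  rewrite leNgt; apply/negP => pA; have : expR p * expR p < A by nra.
  by rewrite -Ep; lra.
have : A * cabs (1 + 2%:C * ths (u +i* a)) <= A * (8 * (4 ^+ 4 * 20 ^+ 4) * A ^+ 3).
  apply: (@le_trans _ _ (expR p * cabs (1 + 2%:C * ths (u +i* a)))).
    by rewrite ler_wpM2r ?cabs_ge0.
  apply: le_trans T _; apply: (@le_trans _ _ (8 * (4 ^+ 4 * 20 ^+ 4 * A ^+ 4))).
    by rewrite ler_wpM2l.
  by rewrite le_eqVlt; apply/orP; left; apply/eqP; ring.
by rewrite ler_pM2l.
Qed.

End HardyZero.

(** * Existence of a zero of J on the critical line *)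

Section HardyZero2.
Context {R : realType}.
Local Notation C := R[i].

Lemma cos_half_ge (a : R) : - (pi / 4) < a < pi / 4 -> 1 / 2 <= cos (1 / 2 * a).
Proof.
move=> /andP[h1 h2]; have pi0 := pi_gt0 R.
have c0 : 0 < cos (1 / 2 * a) by apply: cos_gt0_pihalf; apply/andP; split; lra.
have c1 : 0 < cos a by apply: cos_gt0_pihalf; apply/andP; split; lra.
have e : cos a = 2 * cos (1 / 2 * a) ^+ 2 - 1.
  have -> : cos a = cos (1 / 2 * a + 1 / 2 * a) by congr cos; field.
  by rewrite cosD; have := cos2Dsin2 (1 / 2 * a); nra.
by clear - c0 c1 e; nra.
Qed.

(** With [q = e^(u / 2)] this measures the gain of [cosh (u / 2)] over 1, namely
    [q + 1 / q - 2 = (q - 1)^2 / q]. The constant 15 is the value of [(q + 1) (q^2 + 1)] at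
    [q = 2]. *)
Lemma quartic_gap (q A : R) : 1 <= q -> q <= 2 -> 0 < A -> q ^+ 4 = 1 + A ->
  A ^+ 2 <= 15 ^+ 2 * (2 * (q + q^-1 - 2)).
Proof.
move=> q1 q2 A0 q4; have q0 : 0 < q by lra.
have hqA : (q - 1) * ((q + 1) * (q ^+ 2 + 1)) = A.
  have -> : (q - 1) * ((q + 1) * (q ^+ 2 + 1)) = q ^+ 4 - 1 by ring.
  by rewrite q4; ring.
have q15 : (q + 1) * (q ^+ 2 + 1) <= 15 by clear - q1 q2; rewrite expr2; nra.
have hA15 : A <= (q - 1) * 15 by rewrite -hqA ler_wpM2l// subr_ge0.
have hX : A ^+ 2 <= (q - 1) ^+ 2 * 15 ^+ 2.
  rewrite -exprMn lerXn2r ?nnegrE//; first exact: ltW.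
  exact: le_trans (ltW A0) hA15.
have -> : q + q^-1 - 2 = (q - 1) ^+ 2 / q by field; rewrite gt_eqF.
apply: (le_trans hX); rewrite mulrC ler_wpM2l ?exprn_ge0// mulrA ler_pdivlMr// mulrC.
by rewrite ler_wpM2r// sqr_ge0.
Qed.

(** The maximality [Kf_max] is tested at [u] with [e^(2 u) = 1 + A]: the hyperbolic term gains at
    least a fixed multiple of [A^2] over [u = 0], and the two theta terms, of size [K A^3], cannot
    compensate for it. *)
Lemma Jz_zero_half : exists t : R, Jz ((1 / 2) +i* t) = 0.
Proof.
apply: contrapT => nex.
have J0 (t : R) : Jz (half t) != 0 by apply/eqP => h; apply: nex; exists t.
have [K K0 HK] := @theta_small R.
(* Small enough for [A <= 1 / 20], as [theta_small] asks, and for [20^3 A K <= 1], which makes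
   [K A^3] negligible against the gap of [quartic_gap]. *)
pose A : R := 1 / (20 + 20 ^+ 3 * K).
have D0 : 0 < 20 + 20 ^+ 3 * K by rewrite addr_gt0// mulr_gt0// exprn_gt0.
have A0 : 0 < A by rewrite divr_gt0.
have AE : A * (20 + 20 ^+ 3 * K) = 1 by rewrite /A divfK// gt_eqF.
have AK0 : 0 < A * K by rewrite mulr_gt0.
have A20 : A <= 1 / 20 by lra.
have AK : 20 ^+ 3 * (A * K) <= 1 by lra.
(* [A + i B] is on the unit circle, close to [i]; writing it as [e^(2 i a)] gives the angle [a] just
   below [pi / 4]. *)
pose B := Num.sqrt (1 - A ^+ 2).
have A2 : 0 < A ^+ 2 by rewrite exprn_gt0.
have A2le : A ^+ 2 <= 1 / 400 by rewrite expr2; nra.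
have BE : B ^+ 2 = 1 - A ^+ 2 by rewrite sqr_sqrtr//; lra.
have B0 : 0 <= B := sqrtr_ge0 _.
have B1 : 1 - A ^+ 2 <= B by rewrite leNgt; apply/negP => h; nra.
have [[c a] /= ha [hc hs]] := polar_half_plane B A0.
have ec : expR (2 * c) = 1.
  have : expR (2 * c) ^+ 2 = 1.
    have : expR (2 * c) ^+ 2 * (cos (2 * a) ^+ 2 + sin (2 * a) ^+ 2) = A ^+ 2 + B ^+ 2.
      by rewrite mulrDr -!exprMn hc hs.
    by rewrite cos2Dsin2 mulr1 BE => ->; ring.
  by have := expR_gt0 (2 * c); move=> h0 /eqP; rewrite sqrf_eq1 => /orP[/eqP//|/eqP h]; lra.
rewrite ec !mul1r in hc hs.
pose u : R := ln (1 + A) / 2.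
have eu : expR (2 * u) = 1 + A.
  have -> : 2 * u = ln (1 + A) by rewrite /u; field.
  by rewrite lnK// posrE; lra.
pose q := expR (1 / 2 * u).
have q0 : 0 < q by exact: expR_gt0.
have q4 : q ^+ 4 = 1 + A by rewrite /q -expRM_natl -eu; congr expR; field.
have q1 : 1 <= q.
  rewrite leNgt; apply/negP => h; have hq : q ^+ 4 <= 1 by rewrite exprn_ile1 ?ltW.
  by clear - hq q4 A0; lra.
have q2 : q <= 2.
  rewrite leNgt; apply/negP => h.
  have : 2 ^+ 4 <= q ^+ 4 by rewrite lerXn2r ?nnegrE ?(ltW q0) ?ltW.
  by rewrite q4; clear - A20; lra.
have hA : 0 < A <= 1 / 20 by rewrite A0.
have T0 : cabs (1 + 2%:C * ths (0 +i* a)) <= K * A ^+ 3.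
  apply: (HK 0 a A A (B - 1) ha hA) => //; rewrite ?mulr0 ?expR0 ?mul1r ?subrK//.
  by rewrite sqrrB BE; lra.
have T1 : cabs (1 + 2%:C * ths (u +i* a)) <= K * A ^+ 3.
  apply: (HK u a A ((1 + A) * A) ((1 + A) * B - 1) ha hA) => //; rewrite ?eu ?hc ?hs ?subrK//.
    by rewrite mulrDl mul1r lerDl ltW// mulr_gt0.
  have -> : ((1 + A) * A) ^+ 2 + ((1 + A) * B - 1) ^+ 2 = (1 + A) ^+ 2 * (A ^+ 2 + B ^+ 2) + 1 - 2 * (1 + A) * B by ring.
  rewrite BE.
  have : (1 + A) * (1 - A ^+ 2) <= (1 + A) * B by rewrite ler_wpM2l//; clear - A0; lra.
  have : A ^+ 2 * A <= A ^+ 2 * (1 / 20) by rewrite ler_wpM2l// ltW.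
  by clear - A0 A2; nra.
have ca := cos_half_ge ha.
have := Kf_max u J0 ha; rewrite !KfE.
have Re1 v : complex.Re ((1 / 2)%:C * (cexp ((1 / 2)%:C * (v +i* a)) + cexp (- ((1 / 2)%:C * (v +i* a)))) -
    (1 / 2)%:C * (cexp ((1 / 2)%:C * (v +i* a)) * (1 + 2%:C * ths (v +i* a)))) =
   1 / 2 * (cos (1 / 2 * a) * (expR (1 / 2 * v) + expR (- (1 / 2 * v)))) -
   1 / 2 * complex.Re (cexp ((1 / 2)%:C * (v +i* a)) * (1 + 2%:C * ths (v +i* a))).
  set Z := _ * (1 + _); rewrite ReD ReN !ReM [complex.Im _%:C]/= !mul0r !subr0 ReD !Re_cexp !ReImE /=.
  by rewrite !mul0r !subr0 !addr0 cosN; ring.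
rewrite !Re1 mulr0 oppr0 expR0 expRN -/q.
have Z v : `|complex.Re (cexp ((1 / 2)%:C * (v +i* a)) * (1 + 2%:C * ths (v +i* a)))| <=
    expR (1 / 2 * v) * cabs (1 + 2%:C * ths (v +i* a)).
  apply: le_trans (cabs_Re _) _; rewrite cabsM cabs_cexp.
  by rewrite (_ : complex.Re _ = 1 / 2 * v)// !ReImE /= mul0r subr0.
have := Z u; have := Z 0; rewrite mulr0 expR0 [1 * cabs _]mul1r -/q !ler_norml.
set z0 := complex.Re (_ * (1 + 2%:C * ths (0 +i* a))).
set z1 := complex.Re (_ * (1 + 2%:C * ths (u +i* a))) => /andP[h1 h2] /andP[h3 h4] hle.
have A3 : K * A ^+ 3 = (A * K) * A ^+ 2 by ring.
have z1le : z1 <= 2 * (K * A ^+ 3).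
  apply: le_trans h4 _; apply: (@le_trans _ _ (q * (K * A ^+ 3))).
    by apply: ler_wpM2l => //; exact: ltW.
  by rewrite ler_wpM2r// A3 mulr_ge0// ltW.
have qq : q + q^-1 - 2 = (q - 1) ^+ 2 / q by field; rewrite gt_eqF.
have g := quartic_gap q1 q2 A0 q4.
have qq0 : 0 <= q + q^-1 - 2 by rewrite qq mulr_ge0 ?sqr_ge0// invr_ge0 ltW.
have g' : 2 * (q + q^-1 - 2) <= 4 * (cos (1 / 2 * a) * (q + q^-1 - 2)).
  by have := ler_wpM2r qq0 ca; clear - qq0; lra.
have h : (A * K) * A ^+ 2 <= (1 / 20 ^+ 3) * A ^+ 2 by rewrite ler_wpM2r ?(ltW A2)//; clear - AK; lra.
clear - A2 A3 z1le T0 h1 hle g g' AK h.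
set D := cos _ in g' hle; set X := A ^+ 2 in A2 A3 h g; set W := A * K in A3 AK h.
have e1 : D * (q + q^-1) = D * (q + q^-1 - 2) + 2 * D by ring.
have e2 : D * (1 + 1^-1) = 2 * D by rewrite invr1; ring.
rewrite e1 ?e2 in hle; move: (D * (q + q^-1 - 2)) (q + q^-1 - 2) g g' hle => G G2 g g' hle.
by have := ltW A2; clear - A2 A3 z1le T0 h1 hle g g' AK h; lra.
Qed.

End HardyZero2.

(** * The functions S_n and V_n *)

Section Moebius.

Lemma moebius_mul (p e : nat) : prime p -> ~~ (p %| e)%N -> moebius (p * e) = - moebius e.
Proof.
move=> pp pe; have p0 := prime_gt0 pp.
case: (posnP e) => [e0|e0]; first by rewrite e0 dvdn0 in pe.
have np : p \notin primes e by rewrite mem_primes pp e0 (negPf pe).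
have hp : perm_eq (primes (p * e)) (p :: primes e).
  apply: uniq_perm; rewrite ?primes_uniq //= ?np ?primes_uniq// => q.
  by rewrite primesM// primes_prime// !inE.
rewrite /moebius muln_gt0 p0 e0 (perm_all _ hp) (perm_size hp) /= lognM// logn_prime// eqxx.
have -> : logn p e = 0%N by rewrite lognE pp e0 (negPf pe).
have -> : all (fun q => logn q (p * e) == 1%N) (primes e) = all (fun q => logn q e == 1%N) (primes e).
  apply: eq_in_all => q qe; rewrite lognM// logn_prime//.
  have -> : (q == p) = false by apply/negbTE/eqP => qp; rewrite -qp qe in np.
  by rewrite add0n.
by rewrite /=; case: ifP => _; rewrite ?oppr0//= exprS mulN1r.
Qed.

Lemma moebius_mul0 (p e : nat) : prime p -> (p %| e)%N -> moebius (p * e) = 0.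
Proof.
move=> pp pe; have p0 := prime_gt0 pp; rewrite /moebius.
case: (posnP e) => [->|e0]; first by rewrite muln0.
rewrite muln_gt0 p0 e0 /=; case: ifP => // /allP/(_ p).
rewrite mem_primes pp muln_gt0 p0 e0 dvdn_mulr// => /(_ isT).
rewrite lognM// logn_prime// eqxx => /eqP; rewrite add1n => -[] /eqP.
by rewrite -leqn0 leqNgt logn_gt0 mem_primes pp e0 pe.
Qed.

Lemma sum_multiples (p N : nat) (f : nat -> int) : (0 < p)%N ->
  \sum_(0 <= d < p * N | (p %| d)%N) f d = \sum_(0 <= e < N) f (p * e)%N.
Proof.
move=> p0; elim: N => [|N IH]; first by rewrite muln0 !big_geq.
rewrite big_nat_recr//= -IH mulnS addnC (big_cat_nat (n := p * N)) ?leq_addr//=; congr (_ + _).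
rewrite big_ltn_cond ?dvdn_mulr//; last by rewrite -[X in (X < _)%N]addn0 ltn_add2l.
rewrite big1_seq ?addr0// => i /andP[/dvdnP[k ->]]; rewrite mem_index_iota => /andP[h1 h2].
have Nk : (N < k)%N by rewrite -(ltn_pmul2l p0) [(p * k)%N]mulnC.
have pk : (p * N.+1 <= p * k)%N by rewrite leq_pmul2l.
by move: pk h2; rewrite mulnS [(p * k)%N]mulnC; lia.
Qed.

(** For a prime factor [p] of [m], the divisors [e] prime to [p] are paired with [p e], which
    carries the opposite sign; the divisors [p e] with [p] dividing [e] have [moebius] equal to
    0. *)
Lemma moebius_divisors (m N : nat) : (0 < m < N)%N ->
  \sum_(0 <= d < N | (d %| m)%N) moebius d = (m == 1)%N%:R.
Proof.
move=> /andP[m0 mN].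
have ext (f : nat -> int) (a b : nat) (P : pred nat) : (m < a)%N -> (a <= b)%N ->
    \sum_(0 <= d < b | (d %| m)%N && P d) f d = \sum_(0 <= d < a | (d %| m)%N && P d) f d.
  move=> ma ab; rewrite (big_cat_nat (n := a))//= [X in _ + X]big1_seq ?addr0// => i.
  rewrite mem_index_iota => /andP[/andP[+ _]] /andP[ai _].
  by move=> /(dvdn_leq m0); rewrite leqNgt (leq_trans ma ai).
have drop (a b : nat) : \sum_(a <= d < b | (d %| m)%N) moebius d =
    \sum_(a <= d < b | (d %| m)%N && true) moebius d.
  by apply: eq_bigl => d; rewrite andbT.
have [m1|m1] := eqVneq m 1%N.
  rewrite drop (ext moebius 2%N N predT) ?m1//; last by rewrite -m1.
  by rewrite 2?big_ltn_cond//= big_geq.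
have m2 : (1 < m)%N by rewrite ltn_neqAle eq_sym m1.
have pp := pdiv_prime m2; set p := pdiv m in pp; have p0 := prime_gt0 pp.
have /dvdnP[m' em] : (p %| m)%N := pdiv_dvd m.
have mm : (m < p * m.+1)%N by nia.
rewrite drop (ext moebius m.+1 N predT)// -drop (bigID (fun d => p %| d)%N) /=.
(* No divisor of [m] exceeds [m], so the multiples of [p] may be summed up to [p * m.+1], where
   [sum_multiples] reindexes them by [e <= m]. *)
rewrite -(ext moebius m.+1 (p * m.+1)%N (fun d => p %| d)%N)//.
have -> : \sum_(0 <= d < p * m.+1 | (d %| m)%N && (p %| d)%N) moebius d =
    \sum_(0 <= d < p * m.+1 | (p %| d)%N) (if (d %| m)%N then moebius d else 0).
  by rewrite big_mkcond [RHS]big_mkcond; apply: eq_bigr => d _; case: (d %| m)%N; case: (p %| d)%N.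
rewrite sum_multiples// [X in _ + X]big_mkcond -big_split /=.
rewrite big1_seq// => e _; have [pe|pe] /= := boolP (p %| e)%N.
  by rewrite andbF addr0 moebius_mul0//; case: ifP.
have -> : (p * e %| m)%N = (e %| m)%N.
  by rewrite {1}em mulnC dvdn_pmul2r// [in RHS]em Gauss_dvdl// coprime_sym prime_coprime.
by rewrite andbT; case: ifP => _; rewrite ?addr0// moebius_mul// addNr.
Qed.

(** From [N] to [N + 1] the quotient by [k] grows by 1 exactly when [k] divides [N + 1], so the
    increment is a divisor sum, which is nonzero only for [N + 1 = 1]. *)
Lemma moebius_floor (n N : nat) : (N <= n)%N ->
  \sum_(1 <= k < n.+1) moebius k * (N %/ k)%:R = (0 < N)%N%:R.
Proof.
elim: N => [|N IH] Nn.
  by rewrite big1_seq// => k _; rewrite div0n mulr0.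
have -> : \sum_(1 <= k < n.+1) moebius k * (N.+1 %/ k)%:R =
    \sum_(1 <= k < n.+1) (moebius k * (N %/ k)%:R + (if (k %| N.+1)%N then moebius k else 0)).
  rewrite !big_nat; apply: eq_bigr => k /andP[k0 _]; rewrite divnS// natrD mulrDr addrC; congr (_ + _).
  by case: ifP => _; rewrite ?mulr1 ?mulr0.
rewrite big_split /= IH ?(ltnW Nn)// -big_mkcond /=.
have h : (0 < N.+1 < n.+1)%N by apply/andP.
have := moebius_divisors h; rewrite (big_ltn_cond (m := 0))// dvd0n /= => ->.
by rewrite eqSS; case: N {IH Nn h}.
Qed.

End Moebius.

(** * Explicit formula away from 0 *)

Section Formula.
Context {R : realType}.
Local Notation mu := (@lebesgue_measure R).
Local Notation C := R[i].

Definition mg (n : nat) : R := \sum_(1 <= k < n.+1) (moebius k)%:~R / k%:R.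

(* [Uc 0] is [S_n] and [Uc 1] is [V_n]. *)
Definition Uc (c : R) (n : nat) (x : R) : R := S_seq n x - c * (mg n * frac_part (1 / x)).

Lemma moebius_gE (n : nat) : moebius_g (n%:R : R) = mg n.
Proof.
rewrite /moebius_g (_ : Num.truncn (n%:R : R) = n)//.
by apply: truncn_def; rewrite lexx ltr_nat ltnSn.
Qed.

Lemma S_Uc n : @S_seq R n = Uc 0 n.
Proof. by apply/funext => x; rewrite /Uc mul0r subr0. Qed.

Lemma V_Uc n : @V_seq R n = Uc 1 n.
Proof. by apply/funext => x; rewrite /V_seq moebius_gE /Uc /S_seq [1 * (mg _ * _)]mul1r. Qed.

Lemma truncn_div (y : R) k : 0 <= y -> (0 < k)%N -> Num.truncn (y / k%:R) = (Num.truncn y %/ k)%N.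
Proof.
move=> y0 k0; have k0' : 0 < k%:R :> R by rewrite ltr0n.
have /andP[h1 h2] := truncn_itv y0; apply: truncn_def; apply/andP; split.
  by rewrite ler_pdivlMr// -natrM; apply: le_trans h1; rewrite ler_nat leq_divM.
rewrite ltr_pdivrMr// -natrM; apply: lt_le_trans h2 _.
by rewrite ler_nat -ltn_divLR.
Qed.

Lemma frac_trunc (y : R) : 0 <= y -> frac_part y = y - (Num.truncn y)%:R.
Proof. by move=> y0; rewrite /frac_part floor_trunc. Qed.

(** With [y = 1 / x], the integer part of [y / k] is that of [y] divided by [k]. As [y < n + 1],
    [moebius_floor] applies and all integer parts collapse to the indicator of [y >= 1]. *)
Lemma Uc_formula (c : R) n x : 0 < x -> 1 < x * n.+1%:R ->
  Uc c n x = mg n * (1 / x - c * frac_part (1 / x)) - (x <= 1)%R%:R.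
Proof.
move=> x0 xn; pose y := 1 / x; have y0 : 0 < y by rewrite divr_gt0.
have -> : Uc c n x = (mg n * y - (x <= 1)%R%:R) - c * (mg n * frac_part (1 / x)); last by rewrite -/y; ring.
rewrite /Uc; congr (_ - _).
rewrite /S_seq /mg mulr_suml.
have -> : (x <= 1)%R%:R = \sum_(1 <= k < n.+1) (moebius k)%:~R * (Num.truncn y %/ k)%:R :> R.
  have h : (Num.truncn y <= n)%N by rewrite truncn_le_nat /y ltr_pdivrMr// mulrC.
  have := moebius_floor h => /(congr1 (fun z : int => z%:~R : R)); rewrite rmorph_sum /=.
  under eq_bigr do rewrite rmorphM /= [(_%:R)%:~R]rmorph_nat.
  move=> ->; rewrite rmorph_nat truncn_gt0; congr (nat_of_bool _)%:R.
  by rewrite /y ler_pdivlMr// mul1r.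
rewrite -sumrB !big_nat; apply: eq_bigr => k /andP[k0 _].
have k0' : 0 < k%:R :> R by rewrite ltr0n.
have -> : 1 / (k%:R * x) = y / k%:R by rewrite /y; field; rewrite !gt_eqF.
by rewrite frac_trunc ?truncn_div ?ltW// ?divr_gt0//; field; rewrite gt_eqF.
Qed.

Lemma frac_itv (y : R) : 0 <= frac_part y < 1.
Proof.
rewrite /frac_part subr_ge0 floor_le_tmp /=.
by have := floorD1_gt y; rewrite intrD; lra.
Qed.

Lemma Uc_log (c : R) n v :
  Uc c n (expR (- v)) = \sum_(1 <= k < n.+1) (moebius k)%:~R * fr (v - ln k%:R) - c * (mg n * fr v).
Proof.
rewrite /Uc /S_seq; congr (_ - _ * (_ * _)); last by rewrite /fr expRN div1r invrK.
rewrite !big_nat; apply: eq_bigr => k /andP[k0 _]; rewrite /fr; congr (_ * frac_part _).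
rewrite expRD !expRN lnK ?posrE ?ltr0n//; field.
by rewrite ?gt_eqF ?expR_gt0 ?ltr0n.
Qed.

Lemma Uc_log_small (c : R) n v : expR v < n.+1%:R ->
  Uc c n (expR (- v)) = mg n * (expR v - c * fr v) - (0 <= v)%R%:R.
Proof.
move=> h; rewrite Uc_formula ?expR_gt0//; last first.
  by rewrite expRN mulrC ltr_pdivlMr ?expR_gt0// mul1r.
by rewrite div1r -expRN opprK -/(fr v) (_ : (expR (- v) <= 1) = (0 <= v))// -[1 in LHS]expR0 ler_expR oppr_le0.
Qed.

(** A pointwise limit of the continuous functions [x / (x^2 + 1 / (n + 1))], also at 0 since
    [0^-1 = 0]. *)
Lemma rmeas_inv : rmeas (fun x : R => x^-1).
Proof.
pose f_ (n : nat) (x : R) := x / (x ^+ 2 + n.+1%:R^-1).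
apply: (@measurable_fun_cvg _ _ _ setT f_) => //.
  move=> n; apply: rmeas_cont => x; apply: cvgM; first exact: cvg_id.
  apply: cvgV; first by rewrite gt_eqF// ltr_wpDl ?sqr_ge0// invr_gt0.
  by apply: cvgD; [exact: exprn_continuous|exact: cvg_cst].
move=> x _; have [->|x0] := eqVneq x 0.
  rewrite invr0; have -> : f_ ^~ 0 = (fun=> 0) by apply/funext => n; rewrite /f_ mul0r.
  exact: cvg_cst.
have -> : x^-1 = x / (x ^+ 2 + 0) by field.
apply: cvgM; first exact: cvg_cst.
apply: cvgV; first by rewrite addr0 sqrf_eq0.
by apply: cvgD; [exact: cvg_cst|exact: cvg_harmonic].
Qed.

Lemma rmeas_frac : rmeas (@frac_part R).
Proof.
have -> : @frac_part R = (fun v => v - (Num.floor v)%:~R) by [].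
apply: measurable_funB; first exact: measurable_id.
by apply: nondecreasing_measurable => // x y xy; rewrite ler_int le_floor.
Qed.

Lemma rmeas_Uc (c : R) n : rmeas (Uc c n).
Proof.
have h (a : R) : rmeas (fun x => frac_part (1 / (a * x))).
  apply: (measurableT_comp rmeas_frac); rewrite (_ : (fun x => _) = (fun x => (a * x)^-1)).
    apply: (measurableT_comp rmeas_inv); exact: measurable_funM.
  by apply/funext => x; rewrite div1r.
apply: measurable_funB.
  elim: n => [|n IH].
    by rewrite (_ : S_seq 0 = fun=> 0); [exact: measurable_cst|apply/funext => x; rewrite /S_seq big_geq].
  rewrite (_ : S_seq n.+1 = fun x => S_seq n x + (moebius n.+1)%:~R * frac_part (1 / (n.+1%:R * x))).
    by apply: measurable_funD => //; apply: measurable_funM; [exact: measurable_cst|exact: h].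
  by apply/funext => x; rewrite /S_seq big_nat_recr.
apply: measurable_funM; first exact: measurable_cst.
apply: measurable_funM; first exact: measurable_cst.
by have := h 1; congr rmeas; apply/funext => x; rewrite [1 * x]mul1r.
Qed.

End Formula.

(** * L_p norms, and the decay of g(n) under convergence *)

Section LpConsequences.
Context {R : realType}.
Local Notation mu := (@lebesgue_measure R).
Local Notation lp := (@lebesgue_positive R).

(* The L_p norm on the positive half-line. *)
Definition Np (p : R) (F : R -> R) : \bar R := 'N[lp]_(p%:E)[EFin \o (F : measurableTypeR R -> R)].

Lemma NpX (p : R) F : p != 0 -> (Np p F `^ p = \int[lp]_x (`|F x| `^ p)%:E)%E.
Proof. by move=> p0; rewrite /Np poweR_Lnorm. Qed.

Lemma rmeas_powR (p : R) (F : R -> R) : rmeas F -> rmeas (fun x => `|F x| `^ p).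
Proof.
by move=> mF; apply: (measurableT_comp (measurable_powR p)); apply: measurableT_comp => //.
Qed.

Lemma Np_lower (p a b B : R) (F : R -> R) : 0 < p -> rmeas F -> 0 < a -> a < b -> 0 <= B ->
  (forall x, a <= x <= b -> B <= `|F x|) -> ((B * (b - a) `^ p^-1)%:E <= Np p F)%E.
Proof.
move=> p0 mF a0 ab B0 BF; have pn0 : p != 0 by rewrite gt_eqF.
have ba : 0 <= b - a by rewrite subr_ge0 ltW.
have key : ((B `^ p * (b - a))%:E <= Np p F `^ p)%E.
  rewrite NpX//.
  have mI : measurable (`[a, b]%classic : set (measurableTypeR R)) by exact: measurable_itv.
  have lI : lp (`[a, b]%classic : set (measurableTypeR R)) = (b - a)%:E.
    rewrite /lebesgue_positive /= /mrestr.
    have -> : (`[a, b] `&` `]0%R, +oo[)%classic = `[a, b]%classic.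
      apply/setIidl => x; rewrite /= !in_itv /= => /andP[h _].
      by rewrite andbT (lt_le_trans a0).
    by rewrite lebesgue_measure_itv /= lte_fin ab -EFinB.
  have mP : measurable_fun [set: measurableTypeR R] (fun x : measurableTypeR R => (`|F x| `^ p)%:E).
    by apply/rmeasP; exact: rmeas_powR.
  have P0 (x : measurableTypeR R) : (0 <= (`|F x| `^ p)%:E)%E by rewrite lee_fin powR_ge0.
  rewrite EFinM -lI -(integral_cst lp mI).
  apply: (@le_trans _ _ (\int[lp]_(x in (`[a, b]%classic : set (measurableTypeR R))) (`|F x| `^ p)%:E)%E).
    apply: ge0_le_integral => //.
    - by move=> x _; rewrite lee_fin powR_ge0.
    - exact: measurable_funTS.
    - move=> x; rewrite /= in_itv /= => h; rewrite lee_fin.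
      by apply: ge0_ler_powR; rewrite ?nnegrE ?(ltW p0)//; exact: BF.
  exact: ge0_subset_integral.
have -> : B * (b - a) `^ p^-1 = (B `^ p * (b - a)) `^ p^-1.
  by rewrite powRM ?powR_ge0// -powRrM mulfV// powRr1.
have -> : Np p F = ((Np p F `^ p) `^ p^-1)%E.
  by rewrite -poweRrM mulfV// poweRe1// Lnorm_ge0.
rewrite -poweR_EFin; apply: gt0_ler_poweR => //.
- by rewrite invr_ge0 ltW.
- by rewrite in_itv /= leey andbT lee_fin mulr_ge0 ?powR_ge0.
- by rewrite in_itv /= leey andbT poweR_ge0.
Qed.

Lemma NpD (p : R) (F G : R -> R) : 1 <= p -> rmeas F -> rmeas G ->
  (Np p (fun x => (F x + G x)%R) <= Np p F + Np p G)%E.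
Proof. by move=> p1 mF mG; exact: minkowski_EFin. Qed.

Lemma NpN (p : R) (F : R -> R) : Np p (fun x => - F x) = Np p F.
Proof. by rewrite /Np -[RHS]oppe_Lnorm; apply: eq_Lnorm => x. Qed.

(* The real power [n ^ a] for [n > 0], and 1 for [n = 0]. *)
Definition npow (a : R) (n : nat) : R := expR (a * ln n%:R).

Lemma npow_gt0 a n : 0 < npow a n. Proof. exact: expR_gt0. Qed.

Lemma npowD a b n : npow (a + b) n = npow a n * npow b n.
Proof. by rewrite /npow mulrDl expRD. Qed.

Lemma npow1 n : (0 < n)%N -> npow 1 n = n%:R.
Proof. by move=> n0; rewrite /npow mul1r lnK// posrE ltr0n. Qed.

Lemma npow_le1 a n : a <= 0 -> npow a n <= 1.
Proof.
move=> a0; rewrite /npow -[leRHS]expR0 ler_expR; case: n => [|n]; first by rewrite ln0 ?mulr0.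
apply: mulr_le0_ge0 => //; by apply: ln_ge0; rewrite ler1n.
Qed.

Lemma npow_cvg0 (a : R) : 0 < a -> npow (- a) @ \oo --> 0.
Proof.
move=> a0; apply/cvgrPdist_le => e e0; near=> n.
rewrite sub0r normrN ger0_norm ?expR_ge0// /npow -[leRHS]lnK ?posrE// ler_expR.
have n0 : 0 < n%:R :> R by rewrite ltr0n; near: n; exact: nbhs_infty_gt.
suff : - ln e / a <= ln n%:R by rewrite ler_pdivrMr//; lra.
rewrite -[leLHS]expRK ler_ln ?posrE ?expR_gt0//.
near: n; exact: nbhs_infty_ger.
Unshelve. all: by end_near.
Qed.

Lemma Np_log (p M : R) (F : R -> R) : 0 < p -> rmeas F -> (Np p F <= M%:E)%E ->
  rintg (fun v => `|F (expR (- v))| `^ p * expR (- v)) /\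
  rint (fun v => `|F (expR (- v))| `^ p * expR (- v)) <= M `^ p.
Proof.
move=> p0 mF hM; have pn0 : p != 0 by rewrite gt_eqF.
have M0 : 0 <= M by rewrite -lee_fin (le_trans _ hM)// Lnorm_ge0.
have h : (Np p F `^ p <= (M `^ p)%:E)%E.
  rewrite -poweR_EFin; apply: gt0_ler_poweR => //; first exact: ltW.
  - by rewrite in_itv /= leey andbT Lnorm_ge0.
  - by rewrite in_itv /= leey andbT lee_fin.
have mE : rmeas (@expR R) by apply: rmeas_cont; exact: continuous_expR.
have mG : rmeas (fun u => `|F (expR u)| `^ p * expR u).
  apply: measurable_funM => //.
  exact: (measurableT_comp (rmeas_powR p mF) mE).
rewrite NpX// ge0_integral_positive in h; last 2 first.
- exact: rmeas_powR.
- by move=> x; exact: powR_ge0.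
have G0 u : 0 <= `|F (expR u)| `^ p * expR u by rewrite mulr_ge0 ?powR_ge0 ?expR_ge0.
have iG : rintg (fun u => `|F (expR u)| `^ p * expR u).
  apply/integrableP; split; first exact/rmeasP.
  under eq_integral => u _ do rewrite gee0_abs ?lee_fin ?G0//.
  exact: le_lt_trans h (ltry _).
have iG' : rintg (fun v => `|F (expR (- v))| `^ p * expR (- v)).
  exact: (rintg_opp iG).
split => //; rewrite (rint_opp iG) -lee_fin.
by rewrite -(rint_EFin iG).
Qed.

(** The fractional part is below 1 and the integer part is at least 1, so the former is at most
    [y / 2]. *)
Lemma frac_half (c y : R) : 0 <= c <= 1 -> 1 <= y -> y / 2 <= y - c * frac_part y.
Proof.
move=> /andP[c0 c1] y1; have y0 : 0 <= y by lra.
have /andP[f0 f1] := frac_itv y; have := frac_trunc y0.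
have t1 : (0 < Num.truncn y)%N by rewrite truncn_gt0.
have t2 : 1 <= (Num.truncn y)%:R :> R by rewrite ler1n.
have : c * frac_part y <= 1 * frac_part y by rewrite ler_wpM2r.
by lra.
Qed.

(** The same [h = 1 / x - c * frac_part (1 / x)] serves for [n] and for [m]: on this window two
    approximants differ by [(mg n - mg m) * h], the indicator being 1 for both. *)
Lemma Uc_lower (c : R) (n m : nat) (x : R) : 0 <= c <= 1 -> (1 < n)%N -> (n <= m)%N ->
  n%:R^-1 <= x <= 2 / n%:R ->
  exists h : R, [/\ n%:R / 4 <= h, Uc c n x = @mg R n * h - 1 & Uc c m x = @mg R m * h - 1].
Proof.
move=> hc n1 nm /andP[h1 h2].
have n0 : 0 < n%:R :> R by rewrite ltr0n ltnW.
have n2 : 2 <= n%:R :> R by rewrite ler_nat.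
have x0 : 0 < x by apply: lt_le_trans h1; rewrite invr_gt0.
have x1 : x <= 1 by apply: le_trans h2 _; rewrite ler_pdivrMr// mul1r.
have xk k : (n <= k)%N -> 1 < x * k.+1%:R.
  move=> nk; apply: (@lt_le_trans _ _ (x * n.+1%:R)); last by rewrite ler_pM2l// ler_nat.
  apply: (@lt_le_trans _ _ (n%:R^-1 * n.+1%:R)); last by rewrite ler_wpM2r.
  by rewrite mulrC ltr_pdivlMr// mul1r ltr_nat.
exists (1 / x - c * frac_part (1 / x)); split.
- have h3 : n%:R / 2 <= 1 / x.
    by rewrite ler_pdivlMr// mulrAC ler_pdivrMr// mul1r mulrC -ler_pdivlMr.
  have y1 : 1 <= 1 / x by rewrite ler_pdivlMr// mul1r.
  by apply: le_trans (frac_half hc y1); lra.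
- by rewrite Uc_formula ?x1// xk.
- by rewrite Uc_formula ?x1// xk.
Qed.

(** The interval has length [1 / n], so a height of [G n] on it forces a norm of at least
    [G n * n^(- 1 / p)]. *)
Lemma Np_mg (p B G : R) (n : nat) (F : R -> R) : 0 < p -> rmeas F -> (1 < n)%N -> 0 <= G ->
  (forall x, n%:R^-1 <= x <= 2 / n%:R -> G * n%:R <= `|F x|) -> (Np p F <= B%:E)%E ->
  G * npow (1 - p^-1) n <= B.
Proof.
move=> p0 mF n1 G0 hF hB; have n0 : 0 < n%:R :> R by rewrite ltr0n ltnW.
have i0 : 0 < n%:R^-1 :> R by rewrite invr_gt0.
have h2 : n%:R^-1 < 2 / n%:R :> R by rewrite ltr_pMl// ltr1n.
have := Np_lower p0 mF i0 h2 (mulr_ge0 G0 (ltW n0)) hF.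
move=> /le_trans/(_ hB); rewrite lee_fin; apply: le_trans.
have -> : 2 / n%:R - n%:R^-1 = n%:R^-1 :> R by ring.
rewrite -mulrA ler_wpM2l// /powR gt_eqF// lnV ?posrE//.
by rewrite npowD npow1 ?(ltnW n1)// /npow; rewrite mulrN -mulNr.
Qed.

(* The p-th power of the L_p norm is at most [M], after [x = e^(- v)]. *)
Definition Lbound (p c M : R) (n : nat) : Prop :=
  rintg (fun v => `|Uc c n (expR (- v))| `^ p * expR (- v)) /\
  rint (fun v => `|Uc c n (expR (- v))| `^ p * expR (- v)) <= M.

(** The Cauchy differences [Uc c n - Uc c m] give smallness where the functions alone give only
    boundedness. Letting [m] tend to infinity removes [mg m], which tends to 0 by the crude bound
    [gb], and leaves [4 * q n]. *)
Lemma mg_decay_of_Lp_convergence (p c : R) : 1 < p -> converges_in_Lp p (@Uc R c) -> 0 <= c <= 1 ->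
  exists (e : nat -> R) (M : R) (N : nat), [/\ (forall n, 0 <= e n), e @ \oo --> 0,
    (forall n, (N <= n)%N -> `|@mg R n| * npow (1 - p^-1) n <= e n) &
    (forall n, (N <= n)%N -> Lbound p c M n)].
Proof.
move=> p1 [f fL cvf] hc; have p0 : 0 < p by lra.
have [mf fin] : rmeas f /\ (Np p f < +oo)%E.
  by move: fL; rewrite inE => /andP[/set_mem h1 /set_mem h2]; split.
pose d n := Np p (fun x => Uc c n x - f x).
have d0 n : (0 <= d n)%E by exact: Lnorm_ge0.
have mU n : rmeas (Uc c n) := rmeas_Uc c n.
have mD n : rmeas (fun x => Uc c n x - f x).
  by apply: measurable_funB; [exact: mU|exact: mf].
have cd : d @ \oo --> 0%E by exact: cvf.
have [N0 _ HN0] : \forall n \near \oo, d n \is a fin_num.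
  by move/fine_cvgP : (cd) => [].
have ce : (fine \o d) @ \oo --> 0 by move/fine_cvgP : cd => [].
pose q n : R := fine (d n).
have q0 n : 0 <= q n by exact: fine_ge0.
have dq n : (N0 <= n)%N -> d n = (q n)%:E by move=> h; rewrite fineK// HN0.
have [Q HQ] : exists Q, forall n, q n <= Q.
  have /cvg_seq_bounded[Q [_ hQ]] : cvgn (fine \o d) by apply/cvg_ex; exists 0.
  exists (Q + 1) => n; have := hQ (Q + 1); rewrite ltrDl ltr01 => /(_ isT n I) /=.
  exact: le_trans (ler_norm _).
have Q0 : 0 <= Q := le_trans (q0 0%N) (HQ 0%N).
pose F := fine (Np p f).
have eF : Np p f = F%:E by rewrite fineK// ge0_fin_numE// Lnorm_ge0.
have F0 : 0 <= F by apply: fine_ge0; exact: Lnorm_ge0.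
pose M := Q + F; have M0 : 0 <= M by exact: addr_ge0.
have hM n : (N0 <= n)%N -> (Np p (Uc c n) <= M%:E)%E.
  move=> hn; have -> : Uc c n = (fun x => (Uc c n x - f x) + f x).
    by apply/funext => x; rewrite subrK.
  apply: le_trans (NpD (ltW p1) (mD n) mf) _; rewrite -/(d n) dq// eF -EFinD lee_fin.
  by rewrite lerD2r.
pose N := maxn N0 2.
have Nn n : (N <= n)%N -> (N0 <= n)%N /\ (1 < n)%N by rewrite geq_max => /andP[].
set al := 1 - p^-1.
have al0 : 0 < al by rewrite subr_gt0 invf_lt1.
have al1 : al <= 1 by rewrite /al lerBlDr lerDl invr_ge0 ltW.
have gb n : (N <= n)%N -> `|@mg R n| * npow al n <= 8 * (M + 1).
  move=> /Nn[h1 h2]; have n0 : 0 < n%:R :> R by rewrite ltr0n ltnW.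
  (* When [|mg n| * n >= 8], the summand [- 1] of [Uc_lower] is at most half of [|mg n| * n / 4];
     otherwise the bound is immediate, as [npow al n <= n]. *)
  have [big|small] := leP 8 (`|@mg R n| * n%:R).
    have : `|@mg R n| / 8 * npow al n <= M.
      apply: (Np_mg p0 (mU n) h2 _ _ (hM n h1)) => [|x hx]; first by rewrite divr_ge0.
      have [h [hh -> _]] := Uc_lower hc h2 (leqnn n) hx.
      have h0 : 0 <= h by apply: le_trans hh; rewrite divr_ge0// ltW.
      have := lerB_normD (@mg R n * h) (- 1); rewrite normrN normr1 normrM (ger0_norm h0).
      have : `|@mg R n| * (n%:R / 4) <= `|@mg R n| * h by rewrite ler_wpM2l.
      by lra.
    by lra.
  have h3 : npow al n <= n%:R.
    have e : al = 1 + (al - 1) by rewrite addrC subrK.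
    rewrite e npowD npow1 ?(ltnW h2)// -[leRHS]mulr1 ler_wpM2l ?(ltW n0)//.
    by apply: npow_le1; rewrite subr_le0.
  have : `|@mg R n| * npow al n <= `|@mg R n| * n%:R by rewrite ler_wpM2l.
  by lra.
have key n m : (N <= n)%N -> (n <= m)%N -> `|@mg R n - @mg R m| / 4 * npow al n <= q n + q m.
  move=> Nn' nm; have [h1 h2] := Nn n Nn'; have h3 := leq_trans h1 nm.
  apply: (@Np_mg p _ _ n (fun x => (Uc c n x - f x) + - (Uc c m x - f x)) p0 _ h2).
  - by apply: measurable_funD; [exact: mD|apply: measurableT_comp => //; exact: mD].
  - by rewrite divr_ge0.
  - move=> x hx; have [h [hh -> ->]] := Uc_lower hc h2 nm hx.
    have -> : @mg R n * h - 1 - f x - (@mg R m * h - 1 - f x) = (@mg R n - @mg R m) * h by ring.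
    have h0 : 0 <= h by apply: le_trans hh; rewrite divr_ge0.
    rewrite normrM (ger0_norm h0); have : `|@mg R n - @mg R m| * (n%:R / 4) <= `|@mg R n - @mg R m| * h by rewrite ler_wpM2l.
    by lra.
  - apply: le_trans (NpD (ltW p1) (mD n) _) _; first by apply: measurableT_comp => //; exact: mD.
    by rewrite NpN -/(d n) -/(d m) !dq.
have cg : @mg R @ \oo --> 0.
  apply/norm_cvg0P; apply: (@squeeze_cvgr _ _ _ _ (fun=> 0) (fun n => 8 * (M + 1) * npow (- al) n)).
  - near=> n; rewrite normr_ge0 /=.
    have hn : (N <= n)%N by near: n; exact: nbhs_infty_ge.
    have := gb n hn; rewrite -ler_pdivlMr ?npow_gt0//.
    by rewrite /npow mulNr expRN.
  - exact: cvg_cst.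
  - by rewrite -[X in _ --> X](mulr0 (8 * (M + 1))); apply: cvgM; [exact: cvg_cst|exact: npow_cvg0].
exists (fun n => 4 * q n), (M `^ p), N; split.
- by move=> n; rewrite mulr_ge0.
- by rewrite -[X in _ --> X](mulr0 4); apply: cvgM; [exact: cvg_cst|exact: ce].
- move=> n hn.
  have lim : (fun m => 4 * (q n + q m) + `|@mg R m| * npow al n) @ \oo --> 4 * (q n + 0) + 0 * npow al n.
    apply: cvgD; first by apply: cvgM; [exact: cvg_cst|apply: cvgD; [exact: cvg_cst|exact: ce]].
    by apply: cvgM; [exact/norm_cvg0P|exact: cvg_cst].
  have -> : 4 * q n = 4 * (q n + 0) + 0 * npow al n by ring.
  rewrite -(cvg_lim _ lim)//; apply: limr_ge; first by apply/cvg_ex; eexists; exact: lim.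
  near=> m; have nm : (n <= m)%N by near: m; exact: nbhs_infty_ge.
  have := key n m hn nm.
  have := ler_normD (@mg R n - @mg R m) (@mg R m); rewrite subrK => h.
  have := ler_wpM2r (ltW (npow_gt0 al n)) h; rewrite mulrDl; lra.
- by move=> n /Nn[h1 _]; exact: Np_log p0 (mU n) (hM n h1).
Unshelve. all: by end_near.
Qed.

End LpConsequences.

(** * L_p convergence prevents zeros of J on the line Re s = 1/p *)

Section MellinBounds.
Context {R : realType}.
Local Notation mu := (@lebesgue_measure R).
Local Notation C := R[i].

Lemma cint_ftc_itv (F f : R -> C) (a b : R) : a < b -> (forall x : R, cderiv F x (f x)) -> ccont f ->
  cint (fun x => (\1_(`[a, b]%classic) x)%:C * f x) = F b - F a.
Proof.
move=> ab dF [cr ci]; apply: complex_ext; rewrite !ReImE /=.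
  rewrite -(rint_ftc_itv ab (fun x => (dF x).1) cr); congr rint.
  by apply/funext => x; rewrite ReM /= mul0r subr0.
rewrite -(rint_ftc_itv ab (fun x => (dF x).2) ci); congr rint.
by apply/funext => x; rewrite ImM /= mul0r addr0.
Qed.

Lemma cderiv_expZ (z : C) (x : R) : cderiv (fun v => cexp (z * v%:C)) x (z * cexp (z * x%:C)).
Proof. by apply: cderiv_eq (cderiv_exp (cderivZ z (cderiv_id x))) _; rewrite mulr1. Qed.

Lemma ccont_expZ (z : C) : ccont (fun v => cexp (z * v%:C)).
Proof. by apply: cderiv_ccont => x; exact: cderiv_expZ. Qed.

Lemma cabs_expZ (z : C) (v : R) : cabs (cexp (z * v%:C)) = expR (complex.Re z * v).
Proof. by rewrite cabs_cexp ReM /= mulr0 subr0. Qed.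

Lemma cint_exp_itv (z : C) (a b : R) : z != 0 -> a < b ->
  cint (fun v => (\1_(`[a, b]%classic) v)%:C * cexp (z * v%:C)) =
  z^-1 * (cexp (z * b%:C) - cexp (z * a%:C)).
Proof.
move=> z0 ab; rewrite mulrBr; apply: (cint_ftc_itv (F := fun v => z^-1 * cexp (z * v%:C))) => //.
  by move=> x; apply: cderiv_eq (cderivZ z^-1 (cderiv_expZ z x)) _; rewrite mulKf.
exact: ccont_expZ.
Qed.

Lemma rmeas_indic_itv (i : interval R) : rmeas (\1_([set` i]) : R -> R).
Proof. by apply: measurable_indic; exact: measurable_itv. Qed.

Lemma cintg_exp_itv (z : C) (a b : R) :
  cintg (fun v => (\1_(`[a, b]%classic) v)%:C * cexp (z * v%:C)).
Proof.
have [h1 h2] : cmeas (fun v : R => (\1_(`[a, b]%classic) v)%:C * cexp (z * v%:C)).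
  by apply: cmeasM; [exact: rmeas_indic_itv|apply: cmeas_cont; exact: ccont_expZ].
have ib : rintg (\1_(`[a, b]%classic) : R -> R) by exact: integrable_indic_itv.
apply: (cintg_dom (conj h1 h2) (rintgZ (expR (`|complex.Re z| * (`|a| + `|b|))) ib)) => v.
rewrite cabsM cabs_real cabs_expZ indicE mulrC.
have [/set_mem|_] := boolP (v \in _); last by rewrite normr0 !mulr0.
rewrite /= in_itv /= => /andP[av vb]; rewrite normr1 !mulr1 ler_expR.
apply: le_trans (ler_norm _) _; rewrite normrM ler_wpM2l// ler_norml.
have := ler_norm (- a); have := ler_norm b; rewrite normrN => h3 h4.
by have := normr_ge0 a; have := normr_ge0 b; move=> *; apply/andP; split; lra.
Qed.

(** The value is [2 / k] for [k > 0]; it is carried as a constant of the bounds. *)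
Definition Ek (k : R) : R := rint (fun v : R => expR (- k * `|v|)).

(* The partial Dirichlet sum of [1 / zeta s]. *)
Definition Mn (s : C) (n : nat) : C :=
  \sum_(1 <= k < n.+1) ((moebius k)%:~R : R)%:C * cexp (- (s * (ln (k%:R : R))%:C)).

(** The term of index [k] is [fr] translated by [ln k], which multiplies its transform by
    [k^(- s)]. *)
Lemma Uc_mellin (s : C) (c : R) (n : nat) : 0 < complex.Re s < 1 ->
  cintg (fun v => (Uc c n (expR (- v)))%:C * cexp (- s * v%:C)) /\
  cint (fun v => (Uc c n (expR (- v)))%:C * cexp (- s * v%:C)) = Jz s * (Mn s n - (c * mg n)%:C).
Proof.
move=> hs; have iJ := cintg_Jker hs.
pose G k v := ((moebius k)%:~R : R)%:C * cexp (- (s * (ln (k%:R : R))%:C)) * Jker s (v + - ln k%:R).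
have iG k : cintg (G k) by apply: cintgZ; exact: cintg_shift.
have RM (x y : R) : (x * y)%:C = x%:C * y%:C :> C by exact: rmorphM.
have e v : (Uc c n (expR (- v)))%:C * cexp (- s * v%:C) =
    \sum_(1 <= k < n.+1) G k v - (c * mg n)%:C * Jker s v.
  rewrite Uc_log rmorphB mulrBl rmorph_sum mulr_suml; congr (_ - _).
    apply: eq_bigr => k _; rewrite /G /Jker -!mulrA.
    have -> : - s * v%:C = - (s * (ln (k%:R : R))%:C) + - (s * (v - ln k%:R)%:C).
      by rewrite rmorphB; ring.
    by rewrite cexpD rmorphM /=; ring.
  by rewrite /Jker !RM mulNr; ring.
have iS := cintg_sum (index_iota 1 n.+1) iG.
split; first by rewrite (funext e); apply: cintgB => //; exact: cintgZ.
rewrite (eq_cint e) cintB//; last exact: cintgZ.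
rewrite cint_sum// cintZ// mulrBr [Jz s * _%:C]mulrC; congr (_ - _).
rewrite /Mn mulr_sumr; apply: eq_bigr => k _.
rewrite /G cintZ; last exact: cintg_shift.
by rewrite cint_shift// mulrC.
Qed.

Lemma rint_expabs_shift (k L : R) : 0 < k -> rintg (fun v : R => expR (- k * `|v - L|)) /\
  rint (fun v : R => expR (- k * `|v - L|)) = Ek k.
Proof.
move=> k0; have i := rintg_expabs k0; split; first exact: (rintg_shift (- L) i).
exact: (rint_shift (- L) i).
Qed.

(** Young's inequality after splitting [e^(- Re s v)] into [e^(- v / p)] and [e^(- eta v)]. The
    weight [lam] makes the part controlled by the L_p norm small; its cost falls on a decaying
    exponential, which the region [v > ln n] makes vanish with [n]. *)
Lemma young_tail (p q eta s_re w v lam : R) : 1 < p -> 0 < lam ->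
  q = (1 - p^-1)^-1 -> eta = s_re - p^-1 ->
  `|w| * expR (- s_re * v) <=
  lam / p * (`|w| `^ p * expR (- v)) + (lam `^ (- p^-1)) `^ q / q * expR (- (eta * q) * v).
Proof.
move=> p1 l0 qE etaE; have p0 : 0 < p by lra.
have ip : p^-1 < 1 by rewrite invf_lt1.
have ip0 : 0 < p^-1 by rewrite invr_gt0.
have q0 : 0 < q by rewrite qE invr_gt0 subr_gt0.
pose a := lam `^ p^-1 * (`|w| * expR (- (p^-1 * v))).
pose b := lam `^ (- p^-1) * expR (- eta * v).
have a0 : 0 <= a by rewrite !mulr_ge0 ?powR_ge0 ?expR_ge0.
have b0 : 0 <= b by rewrite mulr_ge0 ?powR_ge0 ?expR_ge0.
have pq : p^-1 + q^-1 = 1 by rewrite qE invrK addrC subrK.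
have eX (x r : R) : expR x `^ r = expR (r * x) by rewrite /powR gt_eqF ?expR_gt0// expRK.
have := conjugate_powR a0 b0 p0 q0 pq.
have -> : a * b = `|w| * expR (- s_re * v).
  rewrite /a /b mulrACA -powRD; last by rewrite (gt_eqF l0) implybT.
  rewrite subrr powRr0 mul1r -mulrA -expRD; congr (_ * expR _).
  by rewrite etaE; ring.
have -> : a `^ p = lam * (`|w| `^ p * expR (- v)).
  rewrite /a powRM ?powR_ge0 ?mulr_ge0 ?expR_ge0// -powRrM mulVf ?gt_eqF// powRr1 ?ltW//.
  rewrite powRM ?expR_ge0// eX; congr (_ * (_ * expR _)).
  by rewrite mulrN mulrA mulfV ?gt_eqF// mul1r.
have -> : b `^ q = (lam `^ (- p^-1)) `^ q * expR (- (eta * q) * v).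
  by rewrite /b powRM ?powR_ge0 ?expR_ge0// eX; congr (_ * expR _); ring.
by move=> h; apply: le_trans h _; rewrite le_eqVlt; apply/orP; left; apply/eqP; ring.
Qed.

(* The Mellin transform of [Uc c n] is [Jz s * (Mn s n - c * mg n)], and on [x > 1 / n] the
   function is [mg n] times a fixed function minus the indicator of [x <= 1], whose transform is [1 / s]. *)
Lemma mellin_ineq (p q eta c M lam : R) (s : C) (n : nat) : 1 < p -> 0 <= c <= 1 -> 0 < lam ->
  p^-1 < complex.Re s < 1 -> (1 < n)%N -> Lbound p c M n ->
  q = (1 - p^-1)^-1 -> eta = complex.Re s - p^-1 ->
  cabs (s^-1 * (1 - cexp (- s * (ln (n%:R : R))%:C))) <=
    cabs (Jz s) * (cabs (Mn s n) + `|@mg R n|) +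
    `|@mg R n| * npow (1 - complex.Re s) n * Ek (1 - complex.Re s) +
    lam / p * M + (lam `^ (- p^-1)) `^ q / q * (npow (- (eta * q)) n * Ek (eta * q)).
Proof.
move=> p1 hc l0 /andP[s1 s2] n1 [iW WM] qE etaE.
have p0 : 0 < p by lra.
have ip : p^-1 < 1 by rewrite invf_lt1.
have ip0 : 0 < p^-1 by rewrite invr_gt0.
have q0 : 0 < q by rewrite qE invr_gt0 subr_gt0.
have eta0 : 0 < eta by rewrite etaE subr_gt0.
have hs : 0 < complex.Re s < 1 by rewrite s2 andbT; lra.
have sn0 : s != 0 by apply: contraTneq hs => ->; rewrite ltxx.
pose L : R := ln n%:R; have L0 : 0 < L by rewrite ln_gt0// ltr1n.
have n0 : 0 < n%:R :> R by rewrite ltr0n ltnW.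
pose W v := Uc c n (expR (- v)).
pose lo := \1_(`]-oo, L]%classic) : R -> R.
pose hi := \1_(`]L, +oo[%classic) : R -> R.
pose E v := cexp (- s * v%:C).
have [iU cU] := Uc_mellin c n hs.
(* On [v <= ln n] the explicit formula splits into [A], proportional to [mg n], and [B], the
   indicator; [T] is the remaining part [v > ln n], controlled only through the L_p norm. *)
pose A v := (lo v * (@mg R n * (expR v - c * fr v)))%:C * E v.
pose B v := (\1_(`[0, L]%classic) v)%:C * E v.
pose T v := (hi v)%:C * ((W v)%:C * E v).
have mlo : rmeas lo by exact: rmeas_indic_itv.
have mhi : rmeas hi by exact: rmeas_indic_itv.
have loE v : lo v = (v <= L)%R%:R by rewrite /lo indicE mem_setE in_itv.
have hiE v : hi v = (L < v)%R%:R by rewrite /hi indicE mem_setE in_itv /= andbT.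
have dec v : (W v)%:C * E v = A v - B v + T v.
  rewrite /A /B /T loE hiE indicE mem_setE in_itv /=; have [vL|vL] := leP v L.
    rewrite andbT mul0r addr0 -mulrBl -rmorphB mul1r; congr (_%:C * _).
    rewrite /W Uc_log_small//; apply: (@le_lt_trans _ _ n%:R); last by rewrite ltr_nat.
    by rewrite -[leRHS]lnK ?posrE// ler_expR.
  by rewrite andbF !mul0r subrr add0r mul1r.
have iB : cintg B by exact: cintg_exp_itv.
have cB : cint B = s^-1 * (1 - cexp (- s * L%:C)).
  have ns0 : - s != 0 by rewrite oppr_eq0.
  have := cint_exp_itv ns0 L0; rewrite -/B mulr0 cexp0 => ->.
  by rewrite invrN; ring.

have [iA bA] : cintg A /\ cabs (cint A) <= `|@mg R n| * npow (1 - complex.Re s) n * Ek (1 - complex.Re s).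
  have k0 : 0 < 1 - complex.Re s by lra.
  have [ig eg] := rint_expabs_shift L k0.
  have mA : cmeas A.
    apply: cmeasM; last by apply: cmeas_cont; exact: ccont_expZ.
    apply: measurable_funM => //; apply: measurable_funM; first exact: measurable_cst.
    apply: measurable_funB; first by apply: rmeas_cont; exact: continuous_expR.
    by apply: measurable_funM; [exact: measurable_cst|exact: rmeas_fr].
  have hA v : cabs (A v) <= `|@mg R n| * npow (1 - complex.Re s) n * expR (- (1 - complex.Re s) * `|v - L|).
    rewrite /A cabsM cabs_real cabs_expZ loE; have [vL|vL] := leP v L; last first.
      by rewrite mul0r normr0 mul0r !mulr_ge0 ?expR_ge0.
    rewrite mul1r normrM -!mulrA ler_wpM2l//.
    have -> : `|v - L| = L - v by rewrite ler0_norm ?subr_le0// opprB.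
    rewrite /npow -/L -expRD.
    apply: (@le_trans _ _ (expR v * expR (complex.Re (- s) * v))).
      rewrite ler_wpM2r ?expR_ge0//.
      have f0 := fr_ge0 v; have f1 := fr_le_exp v; move: hc => /andP[c0 c1].
      have h1 : c * fr v <= 1 * fr v by rewrite ler_wpM2r.
      have h2 : 0 <= c * fr v by rewrite mulr_ge0.
      by clear - h1 h2 f0 f1; rewrite ger0_norm; lra.
    by rewrite -expRD ler_expR ReN; lra.
  have ik := rintgZ (`|@mg R n| * npow (1 - complex.Re s) n) ig.
  split; first exact: cintg_dom mA ik hA.
  by rewrite -eg -rintZ//; exact: cint_le.
have [iT bT] : cintg T /\ cabs (cint T) <= lam / p * M + (lam `^ (- p^-1)) `^ q / q * (npow (- (eta * q)) n * Ek (eta * q)).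
  have k0 : 0 < eta * q by rewrite mulr_gt0.
  have [ig eg] := rint_expabs_shift L k0.
  have mT : cmeas T by apply: cmeasM => //; exact: cintg_meas iU.
  pose K := (lam `^ (- p^-1)) `^ q / q.
  have K0 : 0 <= K by rewrite divr_ge0 ?powR_ge0 ?ltW.
  have hT v : cabs (T v) <= lam / p * (`|W v| `^ p * expR (- v)) +
      K * (npow (- (eta * q)) n * expR (- (eta * q) * `|v - L|)).
    rewrite /T cabsM cabs_real hiE; have [vL|vL] := ltP L v; last first.
      have h1 : 0 <= lam / p by rewrite divr_ge0 ?ltW.
      have h2 : 0 <= `|W v| `^ p * expR (- v) by rewrite mulr_ge0 ?powR_ge0 ?expR_ge0.
      have h3 : 0 <= npow (- (eta * q)) n * expR (- (eta * q) * `|v - L|) by rewrite mulr_ge0 ?expR_ge0.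
      by rewrite normr0 mul0r; apply: addr_ge0; apply: mulr_ge0.
    rewrite normr1 mul1r cabsM cabs_real cabs_expZ ReN.
    apply: le_trans (young_tail (W v) v p1 l0 qE etaE) _.
    rewrite lerD2l ler_wpM2l// /npow -/L -expRD ler_expR gtr0_norm ?subr_gt0//.
    by lra.
  have i2 : rintg (fun v => K * (npow (- (eta * q)) n * expR (- (eta * q) * `|v - L|))).
    by apply: rintgZ; exact: rintgZ.
  have i1 : rintg (fun v => lam / p * (`|W v| `^ p * expR (- v))) by exact: rintgZ.
  have ik := rintgD i1 i2.
  split; first exact: cintg_dom mT ik hT.
  apply: le_trans (cint_le mT ik hT) _.
  rewrite rintD// rintZ// rintZ; last exact: rintgZ.
  rewrite rintZ// eg lerD2r ler_wpM2l//.
  by rewrite divr_ge0 ?ltW.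
have cE : s^-1 * (1 - cexp (- s * L%:C)) = cint A + cint T - Jz s * (Mn s n - (c * mg n)%:C).
  rewrite -cU (eq_cint dec) cintD ?cintB//; last exact: cintgB.
  by rewrite cB; ring.
rewrite -/L cE; apply: le_trans (cabsB _ _) _; have := cabsD (cint A) (cint T).
have : cabs (Jz s * (Mn s n - (c * mg n)%:C)) <= cabs (Jz s) * (cabs (Mn s n) + `|@mg R n|).
  rewrite cabsM ler_wpM2l ?cabs_ge0//; apply: le_trans (cabsB _ _) _.
  rewrite lerD2l cabs_real normrM ler_piMl//; move: hc => /andP[c0 c1].
  by rewrite ger0_norm.
by clear - bA bT; move: bA bT; lra.
Qed.

End MellinBounds.

(** * Abel summation and the Lipschitz bound for J *)

Section NonVanishing.
Context {R : realType}.
Local Notation C := R[i].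

Lemma cexp_lip (z : C) (a b : R) : 0 < complex.Re z -> a < b ->
  cabs (cexp (z * b%:C) - cexp (z * a%:C)) <= cabs z * ((b - a) * expR (complex.Re z * b)).
Proof.
move=> rz ab; have z0 : z != 0 by apply: contraTneq rz => ->; rewrite ltxx.
have := cint_exp_itv z0 ab => /(congr1 (fun w => z * w)); rewrite mulVKf// => <-.
rewrite cabsM ler_wpM2l ?cabs_ge0//.
have ib : rintg (\1_(`[a, b]%classic) : R -> R) by exact: integrable_indic_itv.
have -> : b - a = rint (\1_(`[a, b]%classic) : R -> R).
  rewrite /rint /Rintegral integral_indic//= setIT lebesgue_measure_itv /= lte_fin ab.
  by rewrite -EFinD.
rewrite mulrC -rintZ//; apply: cint_le.
- exact: cintg_meas (cintg_exp_itv z a b).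
- exact: rintgZ.
- move=> v; rewrite cabsM cabs_real cabs_expZ indicE mulrC.
  have [/set_mem|_] := boolP (v \in _); last by rewrite normr0 !mulr0.
  by rewrite /= in_itv /= => /andP[av vb]; rewrite normr1 !mulr1 ler_expR ler_pM2l.
Qed.

(** The step [ln (k + 1) - ln k] is at most [1 / k], and the 2 absorbs the ratio of [(k + 1)^(Re z)]
    to [k^(Re z)]. *)
Lemma cexp_ln_diff (z : C) (k : nat) : 0 < complex.Re z <= 1 -> (0 < k)%N ->
  cabs (cexp (z * (ln (k%:R : R))%:C) - cexp (z * (ln (k.+1%:R : R))%:C)) <=
  2 * cabs z * @npow R (complex.Re z - 1) k.
Proof.
move=> /andP[z0 z1] k0; have k0' : 0 < k%:R :> R by rewrite ltr0n.
rewrite -cabsN opprB.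
have ab : ln (k%:R : R) < ln (k.+1%:R : R) by rewrite ltr_ln ?posrE ?ltr0n// ltr_nat.
apply: le_trans (cexp_lip z0 ab) _.
rewrite [2 * _]mulrC -mulrA ler_wpM2l ?cabs_ge0//.
have e : npow (complex.Re z - 1) k = (k%:R)^-1 * npow (complex.Re z) k :> R.
  rewrite npowD mulrC; congr (_ * _); rewrite /npow mulN1r expRN lnK ?posrE//.
rewrite e mulrCA; apply: ler_pM.
- by rewrite subr_ge0 ltW.
- exact: expR_ge0.
- rewrite lerBlDr -ler_expR expRD !lnK ?posrE ?ltr0n//.
  have := @expR_ge1Dx R (k%:R^-1) => /(ler_wpM2r (ltW k0')); apply: le_trans.
  by rewrite mulrDl mul1r mulVf ?gt_eqF// natr1.
- have l2 : 2 = expR (ln 2) :> R by rewrite lnK ?posrE.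
  have h1 : ln (k.+1%:R : R) <= ln 2 + ln k%:R.
    rewrite -lnM ?posrE// ler_ln ?posrE ?mulr_gt0 ?ltr0n//.
    by rewrite -natrM ler_nat mul2n -addnn -addn1 leq_add2l.
  rewrite {1}l2 /npow -expRD ler_expR.
  have h2 : 0 <= ln 2 :> R by rewrite ln_ge0// ler1n.
  have := ler_wpM2l (ltW z0) h1; have : complex.Re z * ln 2 <= 1 * ln 2 by rewrite ler_wpM2r.
  by rewrite mulrDr; lra.
Qed.

(** Summation by parts for [mu(k) k^(- s) = (mu(k) / k) k^(1 - s)]: decay is known for the partial
    sums of [mu(k) / k]. *)
Lemma Mn_abel (s : C) (n : nat) : let X k := cexp ((1 - s) * (ln (k%:R : R))%:C) in
  Mn s n = (mg n)%:C * X n + \sum_(1 <= k < n) (mg k)%:C * (X k - X k.+1).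
Proof.
move=> X; have mg0 : @mg R 0 = 0 by rewrite /mg big_geq.
elim: n => [|n IH].
  by rewrite /Mn big_geq// mg0 big_geq// mul0r addr0.
have -> : Mn s n.+1 = Mn s n + ((moebius n.+1)%:~R / n.+1%:R)%:C * X n.+1.
  rewrite /Mn big_nat_recr//=; congr (_ + _).
  have -> : X n.+1 = (n.+1%:R)%:C * cexp (- (s * (ln (n.+1%:R : R))%:C)).
    rewrite /X mulrBl mul1r cexpD cexp_real lnK ?posrE//.
  rewrite mulrA -rmorphM divfK//.
have eg : mg n.+1 = mg n + (moebius n.+1)%:~R / n.+1%:R :> R by rewrite /mg big_nat_recr.
rewrite IH eg rmorphD mulrDl; set Y := (_ / _)%:C * _.
case: n IH eg @Y => [|n] IH eg Y.
  by rewrite mg0 !mul0r !add0r !big_geq// addr0 add0r.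
rewrite [in RHS]big_nat_recr//=; ring.
Qed.

Lemma Mn_le (s : C) (n : nat) : 0 < complex.Re s < 1 ->
  cabs (Mn s n) <= `|@mg R n| * npow (1 - complex.Re s) n +
    2 * cabs (1 - s) * \sum_(1 <= k < n) `|@mg R k| * npow (- complex.Re s) k.
Proof.
move=> /andP[s0 s1]; have hz : 0 < complex.Re (1 - s) <= 1.
  by rewrite ReD ReN /=; apply/andP; split; lra.
rewrite Mn_abel; apply: le_trans (cabsD _ _) _; apply: lerD.
  by rewrite cabsM cabs_real cabs_expZ ReD ReN.
apply: le_trans (cabs_sum _ _ _) _; rewrite mulr_sumr !big_nat.
apply: ler_sum => k /andP[k0 _]; rewrite cabsM cabs_real mulrCA ler_wpM2l//.
apply: le_trans (cexp_ln_diff hz k0) _; rewrite ReD ReN.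
have -> : complex.Re 1 - complex.Re s - 1 = - complex.Re s by rewrite /=; ring.
by [].
Qed.

Lemma npow_sum (eta : R) (n : nat) : 0 < eta ->
  \sum_(1 <= k < n.+1) npow (- (1 + eta)) k <= 1 + eta^-1.
Proof.
move=> e0; case: n => [|n]; first by rewrite big_geq// addr_ge0// invr_ge0 ltW.
(* Strengthened for induction to [1] plus the integral of [x^(- 1 - eta)] over [[1, n + 1]]. *)
suff h : \sum_(1 <= k < n.+2) npow (- (1 + eta)) k <= 1 + (1 - npow (- eta) n.+1) / eta.
  apply: le_trans h _; rewrite lerD2l ler_pdivrMr// mulVf ?gt_eqF//.
  by rewrite lerBlDr lerDl ltW// npow_gt0.
elim: n => [|n IH].
  by rewrite big_nat1 /npow ln1 !mulr0 expR0 subrr mul0r addr0.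
rewrite big_nat_recr//=; apply: le_trans (lerD IH (lexx _)) _.
rewrite -addrA lerD2l -lerBrDl -mulrBl ler_pdivlMr//.
have -> : 1 - npow (- eta) n.+2 - (1 - npow (- eta) n.+1) = npow (- eta) n.+1 - npow (- eta) n.+2 :> R by ring.
rewrite lerBrDr; set m : R := n.+2%:R.
have m0 : 0 < m by rewrite ltr0n.
have -> : npow (- (1 + eta)) n.+2 = npow (- eta) n.+2 * m^-1 :> R.
  by rewrite opprD addrC npowD /npow mulN1r [X in _ * X]expRN lnK ?posrE.
have h : ln (n.+1%:R : R) <= ln m - m^-1.
  have -> : ln m - m^-1 = ln (m * expR (- m^-1)) by rewrite lnM ?posrE ?expR_gt0// expRK.
  rewrite ler_ln ?posrE ?mulr_gt0 ?expR_gt0 ?ltr0n//.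
  have := ler_wpM2l (ltW m0) (@expR_ge1Dx R (- m^-1)); apply: le_trans.
  by rewrite mulrDr mulr1 mulrN mulfV ?gt_eqF// /m -(natr1 n.+1) addrK.
have h2 : npow (- eta) n.+2 * (1 + eta / m) <= npow (- eta) n.+1 :> R.
  apply: (@le_trans _ _ (npow (- eta) n.+2 * expR (eta / m))).
    by rewrite ler_wpM2l ?expR_ge0// expR_ge1Dx.
  rewrite /npow -expRD ler_expR -/m.
  have := ler_wpM2l (ltW e0) h; rewrite mulrBr => h'.
  by rewrite !mulNr -/m; move: (eta * ln m) (eta * ln n.+1%:R) (eta / m) h' => x y w; lra.
by apply: le_trans h2; rewrite le_eqVlt; apply/orP; left; apply/eqP; ring.
Qed.

Lemma sum_split_le (f g : nat -> R) (N n : nat) : (forall k, 0 <= f k) -> (forall k, 0 <= g k) ->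
  (forall k, (N <= k)%N -> f k <= g k) ->
  \sum_(1 <= k < n) f k <= \sum_(0 <= k < N) f k + \sum_(1 <= k < n) g k.
Proof.
move=> f0 g0 fg.
have s0 (h : nat -> R) a b : (forall k, 0 <= h k) -> 0 <= \sum_(a <= k < b) h k.
  by move=> h0; rewrite big_nat; apply: sumr_ge0 => k _; exact: h0.
have [nN|Nn] := leqP n N.
  apply: (@le_trans _ _ (\sum_(0 <= k < N) f k)); last by rewrite lerDl; exact: s0.
  have [n0|n0] := leqP n 1; first by rewrite big_geq//; exact: s0.
  rewrite [leRHS](big_cat_nat (n := n))//= [X in X + _](big_cat_nat (n := 1)) ?(ltnW n0)//=.
  by rewrite -addrA addrCA lerDl addr_ge0 ?s0.
case: N Nn fg => [|N] Nn fg.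
  by rewrite [X in _ <= X + _]big_geq// add0r !big_nat; apply: ler_sum => k _; exact: fg.
rewrite [leLHS](big_cat_nat (n := N.+1)) ?(ltnW Nn)//= [X in _ <= _ + X](big_cat_nat (n := N.+1)) ?(ltnW Nn)//=.
rewrite addrA; apply: lerD; last by rewrite !big_nat; apply: ler_sum => k /andP[h _]; exact: fg.
by rewrite [X in _ <= X + _]big_ltn// -addrA [_ + (_ + _)]addrCA lerDl addr_ge0 ?s0.
Qed.

Lemma expR_sub1 (x : R) : `|expR x - 1| <= `|x| * expR `|x|.
Proof.
have [x0|x0] := leP 0 x.
  rewrite (ger0_norm x0) ger0_norm ?subr_ge0 -?expR0 ?ler_expR//.
  have := ler_wpM2r (expR_ge0 x) (@expR_ge1Dx R (- x)); rewrite -expRD addNr expR0; lra.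
rewrite (ltr0_norm x0) ltr0_norm; last by rewrite subr_lt0 -expR0 ltr_expR.
have h1 := @expR_ge1Dx R x; have h2 := @expR_ge1Dx R (- x).
have h3 : - x * 1 <= - x * expR (- x) by rewrite ler_wpM2l; lra.
by lra.
Qed.

(** From [|e^(- eta v) - 1| <= eta |v| e^(eta |v|)]. Of the decay rate [m] of the kernel, one half
    pays for [e^(eta |v|)] and one quarter for [|v|]; the last quarter gives [Ek (m / 4)]. *)
Lemma Jz_lip (s : C) (m eta : R) : 0 < m -> m <= complex.Re s <= 1 - m -> 0 <= eta <= m / 2 ->
  cabs (Jz (s + eta%:C) - Jz s) <= eta * (4 / m * Ek (m / 4)).
Proof.
move=> m0 hs /andP[e0 e1]; move: (hs) => /andP[h1 h2].
have i1 : cintg (Jker s) by apply: cintg_Jker; apply/andP; split; lra.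
have i2 : cintg (Jker (s + eta%:C)).
  by apply: cintg_Jker; rewrite ReD /=; apply/andP; split; lra.
rewrite /Jz -cintB//.
have m4 : 0 < m / 4 by rewrite divr_gt0.
have ie := rintg_expabs m4.
rewrite mulrA -rintZ//; apply: cint_le; first exact: cintg_meas (cintgB i2 i1).
  exact: rintgZ.
move=> v; have -> : Jker (s + eta%:C) v - Jker s v = Jker s v * (expR (- (eta * v)) - 1)%:C.
  rewrite /Jker mulrDl opprD cexpD -rmorphM -rmorphN cexp_real rmorphB /=; ring.
rewrite cabsM cabs_real.
have hJ := Jker_bound v hs; have hE := expR_sub1 (- (eta * v)).
rewrite normrN normrM (ger0_norm e0) in hE.
apply: (@le_trans _ _ (expR (- m * `|v|) * (eta * `|v| * expR (eta * `|v|)))).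
  by apply: ler_pM => //; exact: cabs_ge0.
have v0 := normr_ge0 v.
have hv : `|v| <= 4 / m * expR (m / 4 * `|v|).
  have := @expR_ge1Dx R (m / 4 * `|v|) => h.
  have -> : `|v| = 4 / m * (m / 4 * `|v|) by field; rewrite gt_eqF.
  apply: ler_wpM2l; first by rewrite divr_ge0 ?ltW.
  have -> : 4 / m * (m / 4 * `|v|) = `|v| by field; rewrite gt_eqF.
  by lra.
have h3 : expR (eta * `|v|) <= expR (m / 2 * `|v|) by rewrite ler_expR ler_wpM2r.
have e : expR (- (m / 4) * `|v|) = expR (m / 4 * `|v|) * (expR (- m * `|v|) * expR (m / 2 * `|v|)).
  by rewrite -!expRD; congr expR; field.
have -> : expR (- m * `|v|) * (eta * `|v| * expR (eta * `|v|)) =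
  eta * (`|v| * (expR (- m * `|v|) * expR (eta * `|v|))) by ring.
have hab : expR (- m * `|v|) * expR (eta * `|v|) <= expR (- m * `|v|) * expR (m / 2 * `|v|).
  by rewrite ler_wpM2l ?expR_ge0.
have h0 : 0 <= expR (- m * `|v|) * expR (eta * `|v|) by rewrite mulr_ge0 ?expR_ge0.
have := ler_wpM2l e0 (ler_pM v0 h0 hv hab).
by move=> /le_trans; apply; rewrite e le_eqVlt; apply/orP; left; apply/eqP; ring.
Qed.

End NonVanishing.

(** * The limit inequality and the contradiction *)

Section NonVanishing2.
Context {R : realType}.
Local Notation C := R[i].

(** [mellin_ineq] as [n] tends to infinity with [lam] fixed; the vanishing terms are collected in
    [x n]. [K1] accounts for the finitely many indices before the decay of [mg] reaches [eps]; it is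
    chosen before [s], so that [s] may approach the line afterwards. *)
Lemma mellin_limit (p c M lam eps : R) (e : nat -> R) (N : nat) : 1 < p -> 0 <= c <= 1 -> 0 < lam -> 0 < eps ->
  (forall n, 0 <= e n) -> e @ \oo --> 0 ->
  (forall n, (N <= n)%N -> `|@mg R n| * npow (1 - p^-1) n <= e n) ->
  (forall n, (N <= n)%N -> Lbound p c M n) ->
  exists2 K1 : R, 0 <= K1 & forall s : C, p^-1 < complex.Re s < 1 ->
    cabs s^-1 <= cabs (Jz s) * (2 * cabs (1 - s) * (K1 + eps * (1 + (complex.Re s - p^-1)^-1))) + lam / p * M.
Proof.
move=> p1 hc l0 eps0 e0 ce He HL; have p0 : 0 < p by lra.
have ip : p^-1 < 1 by rewrite invf_lt1.
have ip0 : 0 < p^-1 by rewrite invr_gt0.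
have [N1 _ HN1] : \forall n \near \oo, e n < eps.
  by near=> n; near: n; apply: (cvgr_lt _ ce).
pose N2 := maxn N N1.
exists (\sum_(0 <= k < N2) `|@mg R k|).
  by rewrite big_nat; apply: sumr_ge0.
set K1 := \sum_(0 <= k < N2) _ => s hs; have /andP[s1 s2] := hs.
set eta := complex.Re s - p^-1; have eta0 : 0 < eta by rewrite subr_gt0.
set q := (1 - p^-1)^-1; have q0 : 0 < q by rewrite invr_gt0 subr_gt0.
have hs' : 0 < complex.Re s < 1 by rewrite s2 andbT; lra.
have sumb n : \sum_(1 <= k < n) `|@mg R k| * npow (- complex.Re s) k <= K1 + eps * (1 + eta^-1).
  have g0 k : 0 <= eps * @npow R (- (1 + eta)) k by rewrite mulr_ge0 ?expR_ge0 ?ltW.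
  have f0 k : 0 <= `|@mg R k| * npow (- complex.Re s) k by rewrite mulr_ge0 ?expR_ge0.
  have fg k : (N2 <= k)%N -> `|@mg R k| * npow (- complex.Re s) k <= eps * npow (- (1 + eta)) k.
    rewrite geq_max => /andP[h1 h2].
    have -> : - complex.Re s = (1 - p^-1) + - (1 + eta) by rewrite /eta; ring.
    rewrite npowD mulrA ler_wpM2r ?expR_ge0//; apply: le_trans (He k h1) _.
    by apply: ltW; exact: HN1.
  apply: le_trans (sum_split_le n f0 g0 fg) _; apply: lerD.
    rewrite /K1 !big_nat; apply: ler_sum => k _; rewrite ler_piMr//.
    by apply: npow_le1; lra.
  rewrite -mulr_sumr ler_wpM2l ?(ltW eps0)//.
  case: n => [|n]; first by rewrite big_geq// addr_ge0// invr_ge0 ltW.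
  exact: npow_sum.
pose D := (lam `^ (- p^-1)) `^ q / q.
pose x n := cabs (Jz s) * (e n + e n) + e n * Ek (1 - complex.Re s) +
  D * (npow (- (eta * q)) n * Ek (eta * q)) + npow (- complex.Re s) n * cabs s^-1.
have cx : x @ \oo --> 0.
  have -> : (0 : R) = cabs (Jz s) * (0 + 0) + 0 * Ek (1 - complex.Re s) +
    D * (0 * Ek (eta * q)) + 0 * cabs s^-1 by ring.
  apply: cvgD; last first.
    by apply: cvgM; [apply: npow_cvg0; lra|exact: cvg_cst].
  apply: cvgD; last first.
    apply: cvgM; first exact: cvg_cst.
    by apply: cvgM; [apply: npow_cvg0; rewrite mulr_gt0|exact: cvg_cst].
  apply: cvgD; last by apply: cvgM; [exact: ce|exact: cvg_cst].
  by apply: cvgM; [exact: cvg_cst|apply: cvgD].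
set Rhs := cabs (Jz s) * _ + _.
have lim : (fun n => Rhs + x n) @ \oo --> Rhs + 0 by apply: cvgD; [exact: cvg_cst|exact: cx].
rewrite -[leRHS]addr0 -(cvg_lim _ lim)//; apply: limr_ge; first by apply/cvg_ex; eexists; exact: lim.
near=> n.
have n1 : (1 < n)%N by near: n; exact: nbhs_infty_gt.
have nN : (N <= n)%N by near: n; exact: nbhs_infty_ge.
have := mellin_ineq p1 hc l0 hs n1 (HL n nN) (erefl q) (erefl eta).
have ha : `|@mg R n| * npow (1 - p^-1) n <= e n := He n nN.
have l0' : 0 <= ln (n%:R : R) by rewrite ln_ge0// ler1n ltnW.
have ge1 : 1 <= npow (1 - p^-1) n :> R.
  by rewrite /npow -[leLHS]expR0 ler_expR mulr_ge0// subr_ge0 ltW.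
have g1 : `|@mg R n| <= e n by apply: le_trans ha; rewrite ler_peMr.
have g2 : `|@mg R n| * npow (1 - complex.Re s) n <= e n.
  apply: le_trans ha; rewrite ler_wpM2l// /npow ler_expR ler_wpM2r//; lra.
have Ek0 k : 0 <= @Ek R k by apply: rint_ge0 => v; exact: expR_ge0.
have hM := Mn_le n hs'.
have hM' : cabs (Mn s n) <= e n + 2 * cabs (1 - s) * (K1 + eps * (1 + eta^-1)).
  apply: le_trans hM _; apply: lerD => //.
  by rewrite ler_wpM2l// ?mulr_ge0 ?cabs_ge0.
have hJ : cabs (Jz s) * (cabs (Mn s n) + `|@mg R n|) <=
    cabs (Jz s) * (e n + 2 * cabs (1 - s) * (K1 + eps * (1 + eta^-1)) + e n).
  by rewrite ler_wpM2l ?cabs_ge0//; apply: lerD.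
have hE : `|@mg R n| * npow (1 - complex.Re s) n * Ek (1 - complex.Re s) <= e n * Ek (1 - complex.Re s).
  by rewrite ler_wpM2r.
have low : cabs s^-1 - npow (- complex.Re s) n * cabs s^-1 <= cabs (s^-1 * (1 - cexp (- s * (ln (n%:R : R))%:C))).
  have := cabsD (s^-1 * (1 - cexp (- s * (ln (n%:R : R))%:C))) (s^-1 * cexp (- s * (ln (n%:R : R))%:C)).
  rewrite -mulrDr subrK mulr1 [cabs (s^-1 * cexp _)]cabsM cabs_expZ ReN -/(npow (- complex.Re s) n).
  by rewrite [cabs s^-1 * npow _ _]mulrC; lra.
rewrite -/D => up; have := le_trans low up; rewrite /x /Rhs.
clear - hJ hE; move: hJ hE; rewrite !mulrDr; lra.
Unshelve. all: by end_near.
Qed.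

(** At [s = s0 + eta] a zero of [Jz] at [s0] gives [|Jz s| <= K eta]. This cancels the factor
    [1 / eta] of [mellin_limit], so the right-hand side becomes arbitrarily small while [1 / |s|]
    stays bounded below. *)
Lemma Jz_neq0_of_Lp_convergence (p c t : R) : 1 < p -> 0 <= c <= 1 -> converges_in_Lp p (@Uc R c) ->
  Jz (p^-1 +i* t) != 0.
Proof.
move=> p1 hc cv; apply/eqP => J0; have p0 : 0 < p by lra.
have ip : p^-1 < 1 by rewrite invf_lt1.
have ip0 : 0 < p^-1 by rewrite invr_gt0.
have [e [M [N [e0 ce He HL]]]] := mg_decay_of_Lp_convergence p1 cv hc.
set s0 := p^-1 +i* t in J0.
pose m := Num.min (p^-1) (1 - p^-1).
have m0 : 0 < m by rewrite lt_min ip0 subr_gt0.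
have hm : m <= complex.Re s0 <= 1 - m.
  rewrite /= /m ge_min lexx /=; have : m <= 1 - p^-1 by rewrite ge_min lexx orbT.
  by rewrite /m; lra.
pose K := 4 / m * Ek (m / 4) + 1.
have K0 : 0 < K.
  rewrite ltr_wpDl// mulr_ge0 ?divr_ge0 ?(ltW m0)//.
  by apply: rint_ge0 => v; exact: expR_ge0.
pose B := cabs s0 + 1; have B0 : 0 < B by rewrite ltr_wpDl ?cabs_ge0.
pose B1 := B + 1; have B10 : 0 < B1 by rewrite addr_gt0.
(* [eps], [lam] and [eta] are sized so that each of three contributions is at most [(4 B)^-1],
   against the lower bound [B^-1]; [eta] is chosen last because [G] contains [K1], which depends on
   [eps] and [lam]. *)
pose eps := (8 * K * B1 * B)^-1.
have eps0 : 0 < eps by rewrite invr_gt0 !mulr_gt0.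
pose lam := p / (4 * B * (`|M| + 1)).
have M1 : 0 < `|M| + 1 by rewrite ltr_wpDl.
have lam0 : 0 < lam by rewrite divr_gt0 ?mulr_gt0.
have [K1 K10 HK] := mellin_limit p1 hc lam0 eps0 e0 ce He HL.
pose G := 8 * K * B1 * B * (K1 + eps).
have G0 : 0 < G by rewrite !mulr_gt0// ltr_wpDl.
pose eta := Num.min (m / 2) (Num.min 1 G^-1).
have m2 : 0 < m / 2 by rewrite divr_gt0.
have eta0 : 0 < eta by rewrite !lt_min m2 ltr01 invr_gt0.
have eta1 : eta <= m / 2 by rewrite ge_min lexx.
have eta2 : eta <= 1 by rewrite !ge_min lexx orbT.
have eta3 : eta <= G^-1 by rewrite !ge_min lexx !orbT.
pose s := s0 + eta%:C.
have Rs : complex.Re s = p^-1 + eta by rewrite ReD.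
have hs : p^-1 < complex.Re s < 1.
  by rewrite Rs ltrDl eta0 /=; move: hm => /andP[_] /=; lra.
have hJ : cabs (Jz s) <= eta * K.
  have he : 0 <= eta <= m / 2 by rewrite ltW.
  have := Jz_lip m0 hm he; rewrite J0 subr0 -/s => h; apply: le_trans h _.
  by rewrite ler_wpM2l ?(ltW eta0)// /K lerDl.
have sB : cabs s <= B.
  apply: le_trans (cabsD _ _) _; rewrite cabs_real ger0_norm ?(ltW eta0)//.
  by rewrite lerD2l.
have sB1 : cabs (1 - s) <= B1.
  by apply: le_trans (cabsB _ _) _; rewrite cabs1 addrC lerD2r.
have Ms : lam / p * M <= (4 * B)^-1.
  have -> : lam / p * M = (4 * B)^-1 * (M / (`|M| + 1)).
    by rewrite /lam; field; rewrite !gt_eqF.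
  rewrite ler_piMr// ?invr_ge0 ?mulr_ge0 ?(ltW B0)// ler_pdivrMr// mul1r.
  by have := ler_norm M; lra.
have sn0 : s != 0 by apply: contraTneq hs => ->; rewrite /= ltNge (ltW ip0).
have := HK s hs; rewrite Rs addrAC subrr add0r => h.
have lower : B^-1 <= cabs s^-1.
  by rewrite cabsV lef_pV2 ?posrE ?cabs_gt0.
have up : cabs (Jz s) * (2 * cabs (1 - s) * (K1 + eps * (1 + eta^-1))) <=
    eta * K * (2 * B1 * (K1 + eps * (1 + eta^-1))).
  have X0 : 0 <= K1 + eps * (1 + eta^-1).
    apply: addr_ge0 => //; apply: mulr_ge0; first exact: ltW.
    by rewrite addr_ge0// invr_ge0 ltW.
  apply: ler_pM => //; first exact: cabs_ge0.
    by rewrite !mulr_ge0 ?cabs_ge0.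
  by rewrite ler_wpM2r// ler_wpM2l.
have eq : eta * K * (2 * B1 * (K1 + eps * (1 + eta^-1))) =
    (eta * G) * (4 * B)^-1 + (8 * K * B1 * B * eps) * (4 * B)^-1.
  by rewrite /G; field; rewrite !gt_eqF.
have h1 : eta * G <= 1.
  by have := ler_wpM2r (ltW G0) eta3; rewrite mulVf// gt_eqF.
have h2 : 8 * K * B1 * B * eps = 1 by rewrite /eps mulfV// gt_eqF ?mulr_gt0.
have b4 : 0 < (4 * B)^-1 by rewrite invr_gt0 mulr_gt0.
have h3 : (eta * G) * (4 * B)^-1 <= (4 * B)^-1.
  by have := ler_wpM2r (ltW b4) h1; rewrite mul1r.
have b5 : B^-1 = 4 * (4 * B)^-1 by field; rewrite gt_eqF.
move: up; rewrite eq h2 mul1r => up; rewrite b5 in lower.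
by lra.
Qed.

End NonVanishing2.

(** * Zeros of zeta are zeros of J *)

Section RealAnalytic.
Context {R : realType}.
Local Notation C := R[i].

Lemma normC (z : C) : `|z| = (cabs z)%:C.
Proof. by rewrite normc_def cabsE. Qed.

Lemma series_ccvg (u : nat -> C) (l : C) : complex_series_sum u l ->
  ccvg (fun n => \sum_(i < n) u i) l.
Proof.
move=> h; apply/ccvgP/cvgrPdist_lt => e e0.
have e0' : (0 : (R[i])^o) < e%:C by rewrite ltcR.
have [N _ HN] := (iffLR (cvgrPdist_lt _ _) h) _ e0'; exists N => //= n Nn.
have := HN n Nn; rewrite /series /= big_mkord => hn; rewrite sub0r normrN ger0_norm ?cabs_ge0//.
by rewrite -ltcR -normC distrC.
Qed.

Lemma near_cabs (z : C) (Q : C -> Prop) : (\forall w \near (z : (R[i])^o), Q w) ->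
  exists2 r : R, 0 < r & forall w, cabs (w - z) < r -> Q w.
Proof.
move=> /nbhs_ballP[e /= e0 he]; move: (e0); rewrite ltcE /= => /andP[/eqP ei er].
exists (complex.Re e) => // w hw; apply: he; rewrite /ball /= distrC normC.
by rewrite ltcE /= ei eqxx.
Qed.

(** Analyticity in the real parameter of a segment, with complex coefficients: the identity theorem
    is applied along such a segment. *)
Definition analytic_at (f : R -> C) (t0 : R) : Prop := exists (b : nat -> C) (r : R), 0 < r /\
  forall t, `|t - t0| < r -> ccvg (fun n => \sum_(i < n) b i * ((t - t0)%:C) ^+ i) (f t).

Lemma ccvg_shiftS (u : nat -> C) (l : C) : ccvg (fun n => u n.+1) l -> ccvg u l.
Proof.
move=> [h1 h2]; split.
  by move: h1; rewrite (cvg_shiftS (fun n => complex.Re (u n))).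
by move: h2; rewrite (cvg_shiftS (fun n => complex.Im (u n))).
Qed.

Lemma ccvg_unshiftS (u : nat -> C) (l : C) : ccvg u l -> ccvg (fun n => u n.+1) l.
Proof.
move=> [h1 h2]; split.
  by move: h1; rewrite (cvg_shiftS (fun n => complex.Re (u n))).
by move: h2; rewrite (cvg_shiftS (fun n => complex.Im (u n))).
Qed.

Lemma analytic_atD f g t0 : analytic_at f t0 -> analytic_at g t0 -> analytic_at (fun t => f t + g t) t0.
Proof.
move=> [b [r [r0 hb]]] [c [q [q0 hc]]].
exists (fun n => b n + c n), (Num.min r q); split; first by rewrite lt_min r0.
move=> t; rewrite lt_min => /andP[tr tq].
have -> : (fun n => \sum_(i < n) (b i + c i) * ((t - t0)%:C) ^+ i) =
  (fun n => \sum_(i < n) b i * ((t - t0)%:C) ^+ i + \sum_(i < n) c i * ((t - t0)%:C) ^+ i).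
  by apply/funext => n; rewrite -big_split; apply: eq_bigr => i _; rewrite mulrDl.
by apply: ccvgD; [exact: hb|exact: hc].
Qed.

Lemma analytic_at_cst (z : C) t0 : analytic_at (fun=> z) t0.
Proof.
exists (fun n => if n is 0%N then z else 0), 1; split => // t _; apply: ccvg_shiftS.
have -> : (fun n => \sum_(i < n.+1) (if i : nat is 0%N then z else 0) * ((t - t0)%:C) ^+ i) = (fun=> z).
  apply/funext => n; rewrite big_ord_recl /= mulr1 big1 ?addr0// => i _.
  by rewrite mul0r.
exact: ccvg_cst.
Qed.

Lemma analytic_at_affineM (f : R -> C) (a z : C) t0 : analytic_at f t0 -> analytic_at (fun t => (a + t%:C * z) * f t) t0.
Proof.
move=> [b [r [r0 hb]]].
pose a0 := a + t0%:C * z.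
exists (fun n => a0 * b n + (if n is m.+1 then z * b m else 0)), r; split => // t tr.
pose x := (t - t0)%:C; pose S n := \sum_(i < n) b i * x ^+ i.
have hS : ccvg S (f t) := hb t tr.
have -> : a + t%:C * z = a0 + x * z by rewrite /a0 /x rmorphB /=; ring.
apply: ccvg_shiftS.
have -> : (fun n => \sum_(i < n.+1) (a0 * b i + (if i : nat is m.+1 then z * b m else 0)) * x ^+ i) =
    (fun n => a0 * S n.+1 + (x * z) * S n).
  apply/funext => n.
  have -> : \sum_(i < n.+1) (a0 * b i + (if i : nat is m.+1 then z * b m else 0)) * x ^+ i =
     \sum_(i < n.+1) a0 * (b i * x ^+ i) + \sum_(i < n.+1) (if i : nat is m.+1 then z * b m else 0) * x ^+ i.
    by rewrite -big_split; apply: eq_bigr => i _; rewrite mulrDl mulrA.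
  rewrite -mulr_sumr; congr (_ + _); rewrite big_ord_recl /= mul0r add0r /S mulr_sumr.
  by apply: eq_bigr => i _; rewrite /bump /= add1n exprS; ring.
rewrite mulrDl; apply: ccvgD; apply: ccvgM; try exact: ccvg_cst.
  exact: ccvg_unshiftS.
exact: hS.
Qed.

Lemma ccvg_bounded (u : nat -> C) (l : C) : ccvg u l -> exists2 Q : R, 0 <= Q & forall n, cabs (u n - l) <= Q.
Proof.
move=> /ccvgP h.
have /cvg_seq_bounded[Q [_ hQ]] : cvgn (fun n => cabs (u n - l)) by apply/cvg_ex; exists 0.
have hn n : cabs (u n - l) <= Q + 1.
  have := hQ (Q + 1); rewrite ltrDl ltr01 => /(_ isT n I) /=.
  exact: le_trans (ler_norm _).
exists (Q + 1) => //; exact: le_trans (cabs_ge0 _) (hn 0%N).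
Qed.

(** Vanishing is available only to the left of 0, since [analytic_at_eq0] expands at a supremum. By
    strong induction [b k] is the first coefficient left, so it is bounded by the tail of the series
    divided by [y^k], which is [O(y)]. *)
Lemma power_series_eq0 (b : nat -> C) (r d : R) : 0 < r -> 0 < d ->
  (forall x, `|x| < r -> exists l, ccvg (fun n => \sum_(i < n) b i * (x%:C) ^+ i) l) ->
  (forall x, - d < x < 0 -> `|x| < r -> ccvg (fun n => \sum_(i < n) b i * (x%:C) ^+ i) 0) ->
  forall k, b k = 0.
Proof.
move=> r0 d0 hr hd; pose rho := r / 2; have rho0 : 0 < rho by rewrite divr_gt0.
have [Q Q0 HQ] : exists2 Q : R, 0 <= Q & forall n, cabs (b n) * rho ^+ n <= Q.
  have [|l hl] := hr rho; first by rewrite gtr0_norm// /rho; lra.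
  have [Q Q0 HQ] := ccvg_bounded hl; exists (Q + Q); first by rewrite addr_ge0.
  move=> n; have -> : cabs (b n) * rho ^+ n = cabs (b n * (rho%:C) ^+ n).
    by rewrite cabsM cabsX cabs_real gtr0_norm.
  have := HQ n.+1; rewrite big_ord_recr /=; have := HQ n; set S := \sum_(i < n) _ => h1 h2.
  have -> : b n * rho%:C ^+ n = (S + b n * rho%:C ^+ n - l) - (S - l) by ring.
  by apply: le_trans (cabsB _ _) _; lra.
elim/ltn_ind => k IH.
(* A nonzero [b k] would contradict this [O(y)] bound for a [y] small enough compared with
   [|b k|]. *)
suff small (y : R) : 0 < y -> y < d -> y <= rho / 2 -> cabs (b k) * rho ^+ k <= 2 * Q * (y / rho).
  apply: cabs_eq0; apply/eqP; rewrite eq_le cabs_ge0 andbT leNgt; apply/negP => bk.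
  pose X := cabs (b k) * rho ^+ k; have X0 : 0 < X by rewrite mulr_gt0// exprn_gt0.
  pose y := Num.min (d / 2) (Num.min (rho / 2) (X * rho / (4 * (Q + 1)))).
  have Q1 : 0 < Q + 1 by lra.
  have y0 : 0 < y.
    have z1 : 0 < d / 2 by rewrite divr_gt0.
    have z2 : 0 < rho / 2 by rewrite divr_gt0.
    have z3 : 0 < X * rho / (4 * (Q + 1)) by apply: divr_gt0; apply: mulr_gt0.
    by rewrite !lt_min z1 z2.
  have y1 : y <= d / 2 by rewrite ge_min lexx.
  have y2 : y <= rho / 2 by rewrite !ge_min lexx orbT.
  have y3 : y <= X * rho / (4 * (Q + 1)) by rewrite !ge_min lexx !orbT.
  have := small y y0; rewrite -/X => /(_ _ y2); have yd : y < d by lra.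
  move=> /(_ yd) h.
  have h2 : 2 * Q * (y / rho) <= 2 * Q * (X / (4 * (Q + 1))).
    rewrite ler_wpM2l ?mulr_ge0// ler_pdivrMr//; apply: le_trans y3 _.
    by rewrite le_eqVlt; apply/orP; left; apply/eqP; field; rewrite gt_eqF.
  have h3 : 2 * Q * (X / (4 * (Q + 1))) < X.
    have -> : 2 * Q * (X / (4 * (Q + 1))) = X * (Q / (2 * (Q + 1))) by field; rewrite gt_eqF.
    by rewrite gtr_pMr// ltr_pdivrMr ?mulr_gt0//; lra.
  by lra.
move=> y0 yd yr.
have hx : - d < - y < 0 by rewrite ltrN2 yd oppr_lt0 y0.
have hxr : `|- y| < r by rewrite normrN gtr0_norm//; move: yr; rewrite /rho; lra.
have /ccvgP lim := hd _ hx hxr.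
set q := y / rho; have q0 : 0 < q by rewrite divr_gt0.
have q2 : q <= 1 / 2 by rewrite /q ler_pdivrMr//; lra.
have yq : y = q * rho by rewrite /q divfK// gt_eqF.
have geo n : \sum_(i < n) (if (k < i)%N then q ^+ i else 0) <= 2 * q ^+ k.+1.
  suff h : \sum_(i < n) (if (k < i)%N then q ^+ i else 0) <= 2 * q ^+ k.+1 - 2 * q ^+ maxn n k.+1.
    by apply: le_trans h _; rewrite gerBl mulr_ge0// exprn_ge0// ltW.
  elim: n => [|n IHn]; first by rewrite big_ord0 max0n subrr.
  rewrite big_ord_recr /=; have [kn|nk] := ltnP k n.
    rewrite (maxn_idPl _) in IHn; last by [].
    rewrite (maxn_idPl _); last by rewrite ltnS ltnW.
    have : 0 <= q ^+ n by rewrite exprn_ge0// ltW.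
    by move: IHn; rewrite [q ^+ n.+1]exprS; nra.
  by move: IHn; rewrite addr0 (maxn_idPr (leqW nk)) (maxn_idPr (_ : n.+1 <= k.+1)%N).
have low n : (k < n)%N -> q ^+ k * (cabs (b k) * rho ^+ k) <= q ^+ k * (2 * Q * q) + cabs (\sum_(i < n) b i * ((- y)%:C) ^+ i).
  move=> kn; pose T := \sum_(i < n) (if (i == k :> nat) then 0 else b i * ((- y)%:C) ^+ i).
  have eS : b k * ((- y)%:C) ^+ k = \sum_(i < n) b i * ((- y)%:C) ^+ i - T.
    rewrite /T -sumrB (bigD1 (Ordinal kn)) //= eqxx subr0 big1 ?addr0// => i.
    by rewrite -val_eqE /= => /negPf ->; rewrite subrr.
  have hT : cabs T <= q ^+ k * (2 * Q * q).
    apply: le_trans (cabs_sum _ _ _) _.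
    apply: (@le_trans _ _ (\sum_(i < n) Q * (if (k < i)%N then q ^+ i else 0))).
      apply: ler_sum => i _; have [ik|ki|ik] := ltngtP i k; last by rewrite cabs0 mulr0.
        by rewrite IH// mul0r cabs0 mulr0.
      rewrite cabsM cabsX cabs_real normrN gtr0_norm// yq exprMn mulrCA mulrC.
      by rewrite ler_wpM2r// exprn_ge0// ltW.
    rewrite -mulr_sumr; apply: le_trans (ler_wpM2l Q0 (geo n)) _.
    by rewrite exprS le_eqVlt; apply/orP; left; apply/eqP; ring.
  have : cabs (b k * ((- y)%:C) ^+ k) = q ^+ k * (cabs (b k) * rho ^+ k).
    by rewrite cabsM cabsX cabs_real normrN gtr0_norm// yq exprMn; ring.
  by move=> <-; rewrite eS; apply: le_trans (cabsB _ _) _; lra.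
suff : q ^+ k * (cabs (b k) * rho ^+ k) <= q ^+ k * (2 * Q * q) + 0 by rewrite addr0 ler_pM2l// exprn_gt0.
have lim' : (fun n => q ^+ k * (2 * Q * q) + cabs (\sum_(i < n) b i * ((- y)%:C) ^+ i)) @ \oo --> q ^+ k * (2 * Q * q) + 0.
  apply: cvgD; first exact: cvg_cst.
  by move: lim; have -> : (fun n => cabs (\sum_(i < n) b i * (- y)%:C ^+ i - 0)) = (fun n => cabs (\sum_(i < n) b i * (- y)%:C ^+ i)) by apply/funext => n; rewrite subr0.
rewrite -(cvg_lim _ lim')//; apply: limr_ge; first by apply/cvg_ex; eexists; exact: lim'.
by near=> n; apply: low; near: n; exact: nbhs_infty_gt.
Unshelve. all: by end_near.
Qed.

(** Connectedness of [[0, 1]]: let [s] be the supremum of the lengths on which [f] vanishes. The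
    expansion at [s] vanishes to the left of [s], hence identically, so the zeros continue beyond
    [s] unless [s = 1]. *)
Lemma analytic_at_eq0 (f : R -> C) (e : R) : (forall t, 0 <= t <= 1 -> analytic_at f t) -> 0 < e ->
  (forall t, 0 <= t < e -> f t = 0) -> f 1 = 0.
Proof.
move=> hf e0 fe.
pose A := [set t : R | 0 <= t <= 1 /\ forall u, 0 <= u <= t -> f u = 0].
pose t1 := Num.min (e / 2) 1.
have t10 : 0 < t1 by rewrite lt_min divr_gt0//=.
have At1 : A t1.
  split; first by rewrite (ltW t10) ge_min lexx orbT.
  move=> u /andP[u0 u1]; apply: fe; rewrite u0 /=; apply: le_lt_trans u1 _.
  by rewrite gt_min; apply/orP; left; lra.
have hA : has_sup A by split; [exists t1|exists 1 => t [/andP[]]].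
pose s := sup A.
have s0 : 0 < s by apply: lt_le_trans t10 _; apply: sup_ubound => //; exact: hA.2.
have s1 : s <= 1 by apply: ge_sup; [exists t1|move=> t [/andP[]]].
have fs u : 0 <= u < s -> f u = 0.
  move=> /andP[u0 us].
  have su : 0 < s - u by rewrite subr_gt0.
  have [t [_ At] ut] := sup_adherent su hA; apply: At.
  by rewrite u0 ltW//; move: ut; rewrite -/s; lra.
have [b [r [r0 hb]]] := hf s (introT andP (conj (ltW s0) s1)).
have b0 : forall k, b k = 0.
  apply: (power_series_eq0 r0 s0) => x.
    move=> xr; exists (f (s + x)); have := hb (s + x).
    have -> : s + x - s = x by ring.
    by move=> /(_ xr).
  move=> /andP[x1 x2] xr.
  have := hb (s + x); have -> : s + x - s = x by ring.
  by move=> /(_ xr); rewrite fs//; apply/andP; split; lra.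
have fz t : `|t - s| < r -> f t = 0.
  move=> /hb; have -> : (fun n => \sum_(i < n) b i * ((t - s)%:C) ^+ i) = (fun=> 0).
    by apply/funext => n; rewrite big1// => i _; rewrite b0 mul0r.
  by move=> h; apply: (ccvg_unique h); exact: ccvg_cst.
have [s_lt|s_ge] := ltP s 1; last first.
  have -> : 1 = s by apply/eqP; rewrite eq_le s_ge s1.
  by apply: fz; rewrite subrr normr0.
exfalso; pose t := Num.min 1 (s + r / 2).
have st : s < t by rewrite lt_min s_lt ltrDl divr_gt0.
have : A t.
  split; first by rewrite ge_min lexx andbT ltW// (lt_trans s0).
  move=> u /andP[u0 ut]; have [us|us] := ltP u s; first by apply: fs; rewrite u0.
  apply: fz; rewrite ger0_norm ?subr_ge0//.
  by move: ut; rewrite le_min => /andP[_]; lra.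
move=> At; have : t <= s by apply: sup_ubound => //; exact: hA.2.
by rewrite leNgt st.
Qed.

End RealAnalytic.

(** * The exponential series with remainder *)

Section ExpSeries.
Context {R : realType}.
Local Notation C := R[i].

Lemma unimodular (z : C) : exists2 c : C, cabs c = 1 & complex.Re (c * z) = cabs z.
Proof.
have [->|z0] := eqVneq z 0; first by exists 1; rewrite ?cabs1// mulr0 cabs0.
have cz := cabs_gt0 z0; exists ((cabs z)%:C * z^-1).
  by rewrite cabsM cabs_real cabsV ger0_norm ?(ltW cz)// mulfV// gt_eqF.
by rewrite -mulrA mulVf// mulr1.
Qed.

(** A unit [c] turns [f T] into its modulus; the real mean value theorem is applied to
    [g - Re (c f)], whose derivative is nonnegative on [[0, T]]. *)
Lemma mean_value (f f' : R -> C) (g g' : R -> R) (T : R) : 0 <= T ->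
  (forall t, cderiv f t (f' t)) -> (forall t : R, is_derive t 1 g (g' t)) ->
  (forall t, 0 <= t <= T -> cabs (f' t) <= g' t) -> f 0 = 0 -> g 0 = 0 -> cabs (f T) <= g T.
Proof.
move=> T0 df dg fg f0 g0; have [c c1 ec] := unimodular (f T).
pose h t := g t - complex.Re (c * f t).
have dh (t : R) : is_derive t 1 h (g' t - complex.Re (c * f' t)).
  by apply: is_derive_sub => //; exact: (cderivZ c (df t)).1.
have [TT|TT] := leP T 0.
  have Te : T = 0 by apply/eqP; rewrite eq_le TT T0.
  by rewrite Te f0 g0 cabs0.
have := @MVT R h (fun t => g' t - complex.Re (c * f' t)) 0 T TT (fun t _ => dh t).
move=> /(_ (continuous_subspaceT (fun t => is_derive_continuous (dh t)))).
move=> [t]; rewrite in_itv /= => /andP[t1 t2] e.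
have hT : h 0 = 0 by rewrite /h g0 f0 mulr0 subr0.
rewrite hT subr0 in e.
have : 0 <= h T.
  rewrite e mulr_ge0 ?subr_ge0//.
  apply: le_trans (ler_norm _) _; apply: le_trans (cabs_Re _) _.
  by rewrite cabsM c1 mul1r; apply: fg; rewrite !ltW.
by rewrite /h ec subr_ge0.
Qed.

Definition expS (z : C) (n : nat) : C := \sum_(i < n) (i`!%:R^-1)%:C * z ^+ i.

Lemma cderiv_expS (z : C) n t : cderiv (fun t => expS (t%:C * z) n.+1) t (z * expS (t%:C * z) n).
Proof.
have dX k : cderiv (fun t => (t%:C * z) ^+ k) t ((k%:R)%:C * z * (t%:C * z) ^+ k.-1).
  elim: k => [|k IH].
    by apply: cderiv_eq (cderiv_cst 1 t) _; rewrite !mul0r.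
  have := cderivM (cderivM (cderiv_id t) (cderiv_cst z t)) IH.
  have -> : (fun y => y%:C * z * (y%:C * z) ^+ k) = (fun y => (y%:C * z) ^+ k.+1).
    by apply/funext => y; rewrite exprS.
  move=> h; apply: cderiv_eq h _; case: k {IH} => [|k] /=.
    by rewrite !expr0; ring.
  by rewrite [in LHS]exprS -(natr1 k.+1) rmorphD /= [_ ^+ k.+1]exprS; ring.
rewrite /expS; elim: n => [|n IH].
  have -> : (fun t => \sum_(i < 1) (i`!%:R^-1)%:C * (t%:C * z) ^+ i) = (fun=> 1).
    by apply/funext => y; rewrite big_ord1 fact0 invr1 mul1r expr0.
  by apply: cderiv_eq (cderiv_cst 1 t) _; rewrite big_ord0 mulr0.
have -> : (fun t => \sum_(i < n.+2) (i`!%:R^-1)%:C * (t%:C * z) ^+ i) =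
    (fun t => \sum_(i < n.+1) (i`!%:R^-1)%:C * (t%:C * z) ^+ i + (n.+1`!%:R^-1)%:C * (t%:C * z) ^+ n.+1).
  by apply/funext => y; rewrite big_ord_recr.
apply: cderiv_eq (cderivD IH (cderivZ _ (dX n.+1))) _.
rewrite [in RHS]big_ord_recr /= mulrDr; congr (_ + _).
have e : (n.+1`!%:R^-1)%:C * (n.+1%:R)%:C = (n`!%:R^-1)%:C :> C.
  by rewrite -rmorphM factS natrM invfM mulrAC mulVf ?pnatr_eq0// mul1r.
by rewrite !mulrA e; ring.
Qed.

Lemma is_derive_powr (a t : R) n :
  is_derive t 1 (fun t => (t * a) ^+ n) (n%:R * a * (t * a) ^+ n.-1).
Proof.
elim: n => [|n IH].
  by apply: (is_derive_val (is_derive_cst (1 : R) t 1)); rewrite !mul0r.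
have := is_derive_mul (is_derive_mul (is_derive_id t 1) (is_derive_cst a t 1)) IH.
have -> : (fun y => y * a * (y * a) ^+ n) = (fun y => (y * a) ^+ n.+1).
  by apply/funext => y; rewrite exprS.
move=> h; apply: (is_derive_val h); case: n {IH h} => [|n] /=.
  by rewrite !expr0; ring.
by rewrite [in LHS]exprS -(natr1 n.+1) [_ ^+ n.+1]exprS; ring.
Qed.

(** Induction on [n] by [mean_value]: differentiating in the parameter lowers the order by one. The
    exponential is frozen at the end point [T], which leaves a monomial in [t] as majorant. *)
Lemma expS_rem (z : C) n (T : R) : 0 <= T ->
  cabs (cexp (T%:C * z) - expS (T%:C * z) n) <=
  expR (T * cabs z) * (T * cabs z) ^+ n / n`!%:R.
Proof.
elim: n T => [|n IH] T T0.
  rewrite /expS big_ord0 subr0 expr0 fact0 divr1 mulr1 cabs_cexp ler_expR.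
  by rewrite ReM /= mul0r subr0 ler_wpM2l// (le_trans (ler_norm _) (cabs_Re _)).
pose K := expR (T * cabs z) / n.+1`!%:R.
have K0 : 0 <= K by rewrite divr_ge0 ?expR_ge0.
rewrite mulrAC -/K.
apply: (@mean_value (fun t => cexp (t%:C * z) - expS (t%:C * z) n.+1)
  (fun t => z * (cexp (t%:C * z) - expS (t%:C * z) n))
  (fun t => K * (t * cabs z) ^+ n.+1)
  (fun t => K * (n.+1%:R * cabs z * (t * cabs z) ^+ n)) T).
- exact: T0.
- move=> t; have d1 := cderiv_exp (cderivM (cderiv_id t) (cderiv_cst z t)).
  apply: cderiv_eq (cderivD d1 (cderivN (cderiv_expS z n t))) _.
  by ring.
- move=> t; have := is_derive_mul (is_derive_cst K t 1) (is_derive_powr (cabs z) t n.+1).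
  by move=> h; apply: (is_derive_val h); rewrite mul0r add0r.
- move=> t /andP[t0 tT]; rewrite cabsM.
  apply: le_trans (ler_wpM2l (cabs_ge0 z) (IH t t0)) _.
  have -> : K * (n.+1%:R * cabs z * (t * cabs z) ^+ n) =
      cabs z * (expR (T * cabs z) * (t * cabs z) ^+ n / n`!%:R).
    have f0 : (n`!%:R : R) != 0 by rewrite pnatr_eq0 -lt0n fact_gt0.
    have n0 : (n.+1%:R : R) != 0 by rewrite pnatr_eq0.
    rewrite /K factS natrM; move: (n.+1%:R : R) (n`!%:R : R) n0 f0 => a b a0 b0.
    by field; rewrite a0 b0.
  rewrite ler_wpM2l ?cabs_ge0// -!mulrA ler_wpM2r//.
    by rewrite mulr_ge0 ?invr_ge0// exprn_ge0// mulr_ge0 ?cabs_ge0.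
  by rewrite ler_expR ler_wpM2r ?cabs_ge0.
- rewrite mul0r cexp0 /expS big_ord_recl /= fact0 invr1 mul1r expr0 big1 ?addr0 ?subrr// => i _.
  by rewrite expr0n /= mulr0.
- by rewrite mul0r expr0n mulr0.
Qed.

Lemma exp_coeff_sum (y : R) n : 0 <= y -> \sum_(i < n) y ^+ i / i`!%:R <= expR y.
Proof.
move=> y0; have := @is_cvg_series_exp_coeff R y => cv.
have nd : nondecreasing_seq (series (exp_coeff y)).
  by apply: nondecreasing_series => k _ _; exact: exp_coeff_ge0.
have := nondecreasing_cvgn_le nd cv n; rewrite /expR; apply: le_trans.
by rewrite /series /= big_mkord.
Qed.

Lemma cexp_series (z : C) : ccvg (expS z) (cexp z).
Proof.
apply/ccvgP; apply: (@squeeze_cvgr _ _ _ _ (fun=> 0) (fun n => expR (cabs z) * (cabs z ^+ n / n`!%:R))).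
- near=> n; rewrite cabs_ge0 /= -cabsN opprB.
  by have := expS_rem z n ler01; rewrite !mul1r mulrA.
- exact: cvg_cst.
- rewrite -[X in _ --> X](mulr0 (expR (cabs z))); apply: cvgM; first exact: cvg_cst.
  exact: cvg_exp_coeff.
Unshelve. all: by end_near.
Qed.

Lemma cabs_expS (z : C) n : cabs (expS z n) <= expR (cabs z).
Proof.
apply: le_trans (exp_coeff_sum n (cabs_ge0 z)).
apply: le_trans (cabs_sum _ _ _) _; apply: ler_sum => i _.
by rewrite cabsM cabs_real cabsX ger0_norm ?invr_ge0// mulrC.
Qed.

End ExpSeries.

(** * From zeta to J by continuation *)

Section ZetaZero.
Context {R : realType}.
Local Notation mu := (@lebesgue_measure R).
Local Notation C := R[i].

Lemma ccvg_near (u w : nat -> C) (l : C) : (\forall n \near \oo, u n = w n) -> ccvg w l -> ccvg u l.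
Proof.
move=> h [h1 h2]; split; [apply: (cvg_trans _ h1)|apply: (cvg_trans _ h2)]; apply: near_eq_cvg;
  by apply: filterS h => n ->.
Qed.

Lemma ccvg_indic_itv (i : nat -> interval R) (j : interval R) (f : R -> C) (v : R) :
  (\forall n \near \oo, (v \in i n) = (v \in j)) ->
  ccvg (fun n => (\1_([set` i n]) v)%:C * f v) ((\1_([set` j]) v)%:C * f v).
Proof.
move=> h; apply: (ccvg_near (w := fun=> (\1_([set` j]) v)%:C * f v)); last exact: ccvg_cst.
by apply: filterS h => n e; rewrite !indicE !mem_setE e.
Qed.

Lemma cint_exp_half (z : C) (b : R) : complex.Re z < 0 ->
  cintg (fun v => (\1_(`[b, +oo[%classic) v)%:C * cexp (z * v%:C)) /\
  cint (fun v => (\1_(`[b, +oo[%classic) v)%:C * cexp (z * v%:C)) = - (z^-1 * cexp (z * b%:C)).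
Proof.
move=> rz; have z0 : z != 0 by apply: contraTneq rz => ->; rewrite ltxx.
have k0 : 0 < - complex.Re z by rewrite oppr_gt0.
have [ig _] := rint_expabs_shift b k0.
have ik := rintgZ (expR (complex.Re z * b)) ig.
have hb v : cabs ((\1_(`[b, +oo[%classic) v)%:C * cexp (z * v%:C)) <=
    expR (complex.Re z * b) * expR (- - complex.Re z * `|v - b|).
  rewrite cabsM cabs_real cabs_expZ indicE mem_setE in_itv /= andbT.
  have [bv|bv] := leP b v; last by rewrite normr0 mul0r mulr_ge0 ?expR_ge0.
  by rewrite normr1 mul1r -expRD ler_expR opprK ger0_norm ?subr_ge0//; lra.
have hf n v : cabs ((\1_(`[b, n%:R]%classic) v)%:C * cexp (z * v%:C)) <=
    expR (complex.Re z * b) * expR (- - complex.Re z * `|v - b|).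
  apply: le_trans (hb v); rewrite [leLHS]cabsM [leRHS]cabsM ler_wpM2r ?cabs_ge0// !cabs_real.
  rewrite !indicE !mem_setE !in_itv /= andbT; case: (b <= v)%R => /=; case: (v <= n%:R)%R;
    by rewrite ?normr1 ?normr0.
have hl v : ccvg (fun n => (\1_(`[b, n%:R]%classic) v)%:C * cexp (z * v%:C))
    ((\1_(`[b, +oo[%classic) v)%:C * cexp (z * v%:C)).
  apply: (@ccvg_indic_itv (fun n => `[b, n%:R]) `[b, +oo[ (fun v => cexp (z * v%:C)) v).
  near=> n; rewrite !in_itv /= andbT.
  have -> : v <= n%:R by apply: le_trans (ler_norm v) _; near: n; exact: nbhs_infty_ger.
  by rewrite andbT.
have [i1 c1] := cint_dct (fun n => cintg_meas (cintg_exp_itv z b n%:R)) hl ik hf.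
split => //; apply: (ccvg_unique c1).
apply: (ccvg_near (w := fun n => z^-1 * cexp (z * (n%:R)%:C) + - (z^-1 * cexp (z * b%:C)))).
  near=> n; rewrite cint_exp_itv ?mulrBr//.
  by apply: le_lt_trans (ler_norm b) _; near: n; exact: nbhs_infty_gtr.
rewrite -[X in ccvg _ X]add0r; apply: ccvgD; last exact: ccvg_cst.
apply: (@ccvg_exp _ _ (cabs z^-1) (- complex.Re z) k0) => n.
by rewrite cabsM cabs_expZ opprK.
Unshelve. all: by end_near.
Qed.

Lemma cint_exp_left (z : C) : 0 < complex.Re z ->
  cintg (fun v => (\1_(`]-oo, 0[%classic) v)%:C * cexp (z * v%:C)) /\
  cint (fun v => (\1_(`]-oo, 0[%classic) v)%:C * cexp (z * v%:C)) = z^-1.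
Proof.
move=> rz; have z0 : z != 0 by apply: contraTneq rz => ->; rewrite ltxx.
have ik := rintg_expabs rz.
(* Closed intervals exhausting the open half-line; the shift by 2 ensures [a n < b n] from [n = 0]
   on. *)
pose a n : R := - n.+2%:R; pose b n : R := - n.+2%:R^-1.
have p n : 0 < n.+2%:R :> R by rewrite ltr0n.
have ab n : a n < b n.
  rewrite /a /b ltrN2; apply: (@lt_le_trans _ _ 1); last by rewrite ler1n.
  by rewrite invf_lt1// ltr1n.
have b0 n : b n < 0 by rewrite /b oppr_lt0 invr_gt0.
have hf n v : cabs ((\1_(`[a n, b n]%classic) v)%:C * cexp (z * v%:C)) <= expR (- complex.Re z * `|v|).
  rewrite cabsM cabs_real cabs_expZ indicE mem_setE in_itv /=.
  have [/andP[_ vb]|_] := boolP (_ && _); last by rewrite normr0 mul0r expR_ge0.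
  by rewrite normr1 mul1r ltr0_norm ?mulrNN// (le_lt_trans vb).
have hl v : ccvg (fun n => (\1_(`[a n, b n]%classic) v)%:C * cexp (z * v%:C))
    ((\1_(`]-oo, 0[%classic) v)%:C * cexp (z * v%:C)).
  apply: (@ccvg_indic_itv (fun n => `[a n, b n]) `]-oo, 0[ (fun v => cexp (z * v%:C)) v).
  have [v0|v0] := ltP v 0; last first.
    near=> n; rewrite !in_itv /= [RHS]ltNge v0 /=; apply/negbTE; rewrite negb_and -!ltNge.
    by rewrite (lt_le_trans (b0 n) v0) orbT.
  near=> n; rewrite !in_itv /= v0; apply/andP; split.
    rewrite /a lerNl; apply: le_trans (ler_norm _) _; apply: (@le_trans _ _ n%:R); last by rewrite ler_nat -addn2 leq_addr.
    by near: n; exact: nbhs_infty_ger.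
  rewrite /b lerNr -[leRHS]invrK lef_pV2 ?posrE ?invr_gt0 ?oppr_gt0//.
  apply: le_trans (ler_norm _) _; apply: (@le_trans _ _ n%:R); last by rewrite ler_nat -addn2 leq_addr.
  by near: n; exact: nbhs_infty_ger.
have [i1 c1] := cint_dct (fun n => cintg_meas (cintg_exp_itv z (a n) (b n))) hl ik hf.
split => //; apply: (ccvg_unique c1).
have -> : (fun n => cint (fun v => (\1_(`[a n, b n]%classic) v)%:C * cexp (z * v%:C))) =
    (fun n => z^-1 * cexp (z * (b n)%:C) + - z^-1 * cexp (z * (a n)%:C)).
  by apply/funext => n; rewrite cint_exp_itv// mulrBr mulNr.
have e : z^-1 = z^-1 * 1 + - z^-1 * 0 by rewrite mulr0 addr0 mulr1.
rewrite [X in ccvg _ X]e.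
apply: ccvgD; apply: ccvgM; try exact: ccvg_cst.
  have bn : b n @[n --> \oo] --> 0.
    rewrite -[X in _ --> X]oppr0; apply: cvgN.
    by have := @cvg_harmonic R; rewrite -(cvg_shiftS (fun n : nat => n.+1%:R^-1 : R)).
  have [h1 h2] := ccont_expZ z.
  have e1 : (1 : C) = cexp (z * (0 : R)%:C) by rewrite mulr0 cexp0.
  rewrite e1; split.
    by apply: (cvg_comp b (fun x : R => complex.Re (cexp (z * x%:C))) bn); exact: h1.
  by apply: (cvg_comp b (fun x : R => complex.Im (cexp (z * x%:C))) bn); exact: h2.
apply: (@ccvg_exp _ _ 1 (complex.Re z) rz) => n.
rewrite cabs_expZ mul1r ler_expR /a mulrN mulNr lerN2 ler_wpM2l ?(ltW rz)//.
by rewrite ler_nat -addn2 leq_addr.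
Unshelve. all: by end_near.
Qed.

(* The part [0 < x <= 1] of [Jz]; unlike [Jz], it converges on the whole half-plane [0 < Re s]. *)
Definition Hz (s : C) : C := cint (fun v => (\1_(`[0, +oo[%classic) v)%:C * Jker s v).

Lemma cintg_Hz (s : C) : 0 < complex.Re s -> cintg (fun v => (\1_(`[0, +oo[%classic) v)%:C * Jker s v).
Proof.
move=> s0; have rs : complex.Re (- s) < 0 by rewrite ReN oppr_lt0.
have [i _] := cint_exp_half 0 rs.
have := cintgMr rmeas_fr (B := 1) _ i; have h x : `|fr x| <= 1 :> R.
  by rewrite ger0_norm ?fr_ge0 ?fr_le1.
move=> /(_ h); congr cintg; apply/funext => v.
by rewrite /Jker mulrCA mulNr.
Qed.

(** For [v < 0] the fractional part of [e^v] is [e^v] itself, with transform [1 / (1 - s)]. *)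
Lemma Jz_Hz (s : C) : 0 < complex.Re s < 1 -> Jz s = Hz s + (1 - s)^-1.
Proof.
move=> /andP[s0 s1]; have r1 : 0 < complex.Re (1 - s) by rewrite ReD ReN subr_gt0.
have [i1 c1] := cint_exp_left r1.
rewrite -c1 /Hz -cintD//; last exact: cintg_Hz.
apply: eq_cint => v; rewrite !indicE !mem_setE !in_itv /= andbT.
have [v0|v0] := leP 0 v; first by rewrite mul1r mul0r addr0.
rewrite mul0r add0r mul1r /Jker fr_trunc.
have -> : Num.truncn (expR v) = 0%N.
  by apply: truncn_def; rewrite expR_ge0 /= -[X in _ < X]expR0 ltr_expR.
rewrite subr0 -cexp_real -cexpD; congr cexp; rewrite mulrBl mul1r.
by [].
Qed.

(** Integrating [y] minus its integer part termwise gives [Hz s = 1 / (s - 1) - l / s]. Multiplied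
    by [s (s - 1)], it becomes the vanishing of a function that can be continued to [0 < Re s]. *)
Lemma zeta_Hz (s l : C) : 1 < complex.Re s ->
  complex_series_sum (fun n => nat_cpow n.+1 (- s)) l -> (s - 1) * l - s + s * ((s - 1) * Hz s) = 0.
Proof.
move=> s1 /series_ccvg hl.
have s0 : 0 < complex.Re s by lra.
have sn0 : s != 0 by apply: contraTneq s0 => ->; rewrite ltxx.
have sn1 : s - 1 != 0 by apply: contraTneq s1 => /eqP; rewrite subr_eq0 => /eqP ->; rewrite ltxx.
have rs : complex.Re (- s) < 0 by rewrite ReN oppr_lt0.
have r1 : complex.Re (1 - s) < 0 by rewrite ReD ReN subr_lt0.
have [ie ce] := cint_exp_half 0 r1.
pose ch (i : nat) (v : R) : R := \1_(`[ln (i.+1%:R : R), +oo[%classic) v.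
pose ind0 : R -> R := \1_(`[0, +oo[%classic).
pose rN N v := ind0 v * expR v - \sum_(i < N) ch i v.
have chE i v : ch i v = ((i.+1%:R : R) <= expR v)%R%:R by rewrite /ch indic_ln.
have sch N v : \sum_(i < N) ch i v = (minn N (Num.truncn (expR v)))%:R.
  by rewrite -sum_le_truncn ?expR_ge0//; apply: eq_bigr => i _; rewrite chE.
have chs i : cintg (fun v => (ch i v)%:C * cexp (- s * v%:C)) /\
    cint (fun v => (ch i v)%:C * cexp (- s * v%:C)) = s^-1 * nat_cpow i.+1 (- s).
  have [h1 h2] := cint_exp_half (ln (i.+1%:R : R)) rs; split => //.
  by rewrite /ch h2 /nat_cpow -cexpE invrN mulNr opprK.
have ee v : (ind0 v)%:C * cexp ((1 - s) * v%:C) = (ind0 v * expR v)%:C * cexp (- s * v%:C).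
  by rewrite rmorphM /= -mulrA -cexp_real -cexpD mulrBl mul1r mulNr.
have cN N : cintg (fun v => (rN N v)%:C * cexp (- s * v%:C)) /\
    cint (fun v => (rN N v)%:C * cexp (- s * v%:C)) = (s - 1)^-1 - s^-1 * \sum_(i < N) nat_cpow i.+1 (- s).
  have e v : (rN N v)%:C * cexp (- s * v%:C) = (ind0 v)%:C * cexp ((1 - s) * v%:C) -
      \sum_(i < N) (ch i v)%:C * cexp (- s * v%:C).
    by rewrite ee /rN rmorphB mulrBl rmorph_sum mulr_suml.
  have is_ := cintg_sum (index_enum 'I_N) (fun i : 'I_N => (chs i).1).
  split; first by rewrite (funext e); exact: cintgB.
  rewrite (eq_cint e) cintB// cint_sum; last by move=> i; exact: (chs i).1.
  rewrite ce mulr0 cexp0 mulr1 -invrN opprB mulr_sumr; congr (_ - _).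
  by apply: eq_bigr => i _; exact: (chs i).2.
have [_ lim] : cintg (fun v => (ind0 v)%:C * Jker s v) /\
    ccvg (fun N => cint (fun v => (rN N v)%:C * cexp (- s * v%:C))) (Hz s).
  apply: (cint_dct (k := fun v => cabs ((ind0 v)%:C * cexp ((1 - s) * v%:C)))).
  - by move=> N; exact: cintg_meas (cN N).1.
  - move=> v; apply/ccvgP; apply: (@cvg_trans _ ((fun=> 0 : R) @ \oo)); last exact: cvg_cst.
    apply: near_eq_cvg; near=> N; rewrite /rN sch /Jker fr_trunc.
    have -> : minn N (Num.truncn (expR v)) = Num.truncn (expR v).
      by apply/minn_idPr; near: N; exact: nbhs_infty_ge.
    rewrite mulrA -rmorphM mulrBr mulNr.
    have -> : ind0 v * (Num.truncn (expR v))%:R = (Num.truncn (expR v))%:R.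
      rewrite /ind0 indicE mem_setE in_itv /= andbT; have [v0|v0] := leP 0 v; first by rewrite mul1r.
      rewrite mul0r (_ : Num.truncn _ = 0%N)//.
      by apply: truncn_def; rewrite expR_ge0 /= -[X in _ < X]expR0 ltr_expR.
    by rewrite subrr cabs0.
  - exact: rintg_cabs.
  - move=> N v; rewrite ee [leLHS]cabsM [leRHS]cabsM ler_wpM2r ?cabs_ge0// [leLHS]cabs_real [leRHS]cabs_real.
    have /andP[h1 h2] := truncn_itv (expR_ge0 v).
    have h3 : (minn N (Num.truncn (expR v)))%:R <= (Num.truncn (expR v))%:R :> R.
      by rewrite ler_nat geq_minr.
    have h4 : (0 : R) <= (minn N (Num.truncn (expR v)))%:R by [].
    rewrite /rN sch /ind0 indicE mem_setE in_itv /= andbT; have [v0|v0] := leP 0 v.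
      by rewrite !mul1r (ger0_norm (expR_ge0 v)) ger0_norm; lra.
    rewrite !mul0r (_ : Num.truncn _ = 0%N) ?minn0 ?subr0//.
    by apply: truncn_def; rewrite expR_ge0 /= -[X in _ < X]expR0 ltr_expR.
have e : Hz s = (s - 1)^-1 - s^-1 * l.
  apply: (ccvg_unique lim).
  have -> : (fun N => cint (fun v => (rN N v)%:C * cexp (- s * v%:C))) =
      (fun N => (s - 1)^-1 + (- s^-1) * \sum_(i < N) nat_cpow i.+1 (- s)).
    by apply/funext => N; rewrite (cN N).2 mulNr.
  by rewrite -mulNr; apply: ccvgD; [exact: ccvg_cst|apply: ccvgM; [exact: ccvg_cst|exact: hl]].
by rewrite e; field; rewrite sn0 sn1.
Unshelve. all: by end_near.
Qed.

(** The factor [e^(- x d v)] is expanded under the integral. For [|x d| <= k], half of [Re s], every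
    partial sum is at most [e^(k |v|)], which leaves the integrable majorant [e^(- k |v|)]. *)
Lemma analytic_at_Hz (z d : C) (t0 : R) : 0 < complex.Re (z + t0%:C * d) -> analytic_at (fun t => Hz (z + t%:C * d)) t0.
Proof.
set s := z + t0%:C * d => s0.
pose k := complex.Re s / 2; have k0 : 0 < k by rewrite divr_gt0.
pose r := k / (cabs d + 1).
have d1 : 0 < cabs d + 1 by rewrite ltr_wpDl ?cabs_ge0.
have r0 : 0 < r by rewrite divr_gt0.
pose ind0 : R -> R := \1_(`[0, +oo[%classic).
pose W v := (ind0 v)%:C * Jker s v.
have iH : cintg W := cintg_Hz s0.
pose g (i : nat) v := (i`!%:R^-1)%:C * (- d) ^+ i * ((v ^+ i)%:C * W v).
exists (fun i => cint (g i)), r; split => // t tr.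
pose x := t - t0.
have xd : `|x| * cabs d <= k.
  apply: (@le_trans _ _ (r * (cabs d + 1))); last by rewrite /r divfK// gt_eqF.
  by apply: ler_pM => //; [exact: cabs_ge0|exact: ltW|rewrite lerDl].
have ik : rintg (fun v => expR (- k * `|v|)) := rintg_expabs k0.
have bH v : expR (k * `|v|) * cabs (W v) <= expR (- k * `|v|).
  rewrite /W cabsM cabs_real /ind0 indicE mem_setE in_itv /= andbT.
  have [v0|v0] := leP 0 v; last by rewrite normr0 mul0r mulr0 expR_ge0.
  rewrite normr1 mul1r cabs_Jker ger0_norm//.
  apply: (@le_trans _ _ (expR (k * v) * expR (- (complex.Re s * v)))).
    by rewrite ler_wpM2l ?expR_ge0// ler_piMl ?expR_ge0 ?fr_le1.
  by rewrite -expRD ler_expR /k; lra.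
have ih i : cintg (fun v => (v ^+ i)%:C * W v).
  apply: (cintg_dom _ (rintgZ ((k^-1) ^+ i * i%:R ^+ i) ik)).
    apply: cmeasM; last exact: cintg_meas.
    by apply: rmeas_cont => y; exact: exprn_continuous.
  move=> v; rewrite cabsM cabs_real normrX.
  apply: (@le_trans _ _ ((k^-1) ^+ i * i%:R ^+ i * (expR (k * `|v|) * cabs (W v)))); last first.
    by rewrite ler_wpM2l// mulr_ge0 ?exprn_ge0// invr_ge0 ltW.
  rewrite mulrA ler_wpM2r ?cabs_ge0// -mulrA.
  have -> : `|v| ^+ i = (k^-1) ^+ i * (k * `|v|) ^+ i.
    by rewrite exprMn mulrA -exprMn mulVf ?gt_eqF// expr1n mul1r.
  rewrite ler_wpM2l ?exprn_ge0 ?invr_ge0 ?(ltW k0)//.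
  by apply: expR_pow_le; rewrite mulr_ge0// ltW.
have ig i : cintg (g i) by exact: cintgZ.
have eS n v : \sum_(i < n) ((x%:C) ^+ i * g i v) = expS (- (x%:C * d) * v%:C) n * W v.
  rewrite /expS mulr_suml; apply: eq_bigr => i _; rewrite /g.
  have -> : - (x%:C * d) * v%:C = x%:C * (- d) * v%:C by ring.
  by rewrite !exprMn rmorphXn /=; ring.
have ixg i : cintg (fun v => (x%:C) ^+ i * g i v) by exact: cintgZ.
have isum n : cintg (fun v => expS (- (x%:C * d) * v%:C) n * W v).
  have := cintg_sum (index_enum 'I_n) (fun i : 'I_n => ixg i); congr cintg.
  by apply/funext => v; exact: eS.
have e n : \sum_(i < n) cint (g i) * ((t - t0)%:C) ^+ i = cint (fun v => expS (- (x%:C * d) * v%:C) n * W v).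
  rewrite -(eq_cint (eS n)) (cint_sum (index_enum 'I_n) (fun i : 'I_n => ixg i)).
  by apply: eq_bigr => i _; rewrite cintZ// mulrC.
have -> : (fun n => \sum_(i < n) cint (g i) * ((t - t0)%:C) ^+ i) =
    (fun n => cint (fun v => expS (- (x%:C * d) * v%:C) n * W v)) by apply/funext => n; exact: e.
have -> : Hz (z + t%:C * d) = cint (fun v => cexp (- (x%:C * d) * v%:C) * W v).
  apply: eq_cint => v; rewrite /W /Jker.
  have -> : z + t%:C * d = s + x%:C * d by rewrite /s /x rmorphB /=; ring.
  have -> : - ((s + x%:C * d) * v%:C) = - (x%:C * d) * v%:C + - (s * v%:C) by ring.
  by rewrite cexpD; ring.
apply: (cint_dct (k := fun v => expR (- k * `|v|)) _ _ ik _).2.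
- by move=> n; exact: cintg_meas.
- by move=> v; apply: ccvgM; [exact: cexp_series|exact: ccvg_cst].
- move=> n v; rewrite cabsM; apply: le_trans (bH v); rewrite ler_wpM2r ?cabs_ge0//.
  apply: le_trans (cabs_expS _ _) _; rewrite ler_expR mulNr cabsN !cabsM !cabs_real.
  by rewrite ler_wpM2r.
Qed.

(* Identity theorem along the segment from [z], with [Re z = 2], to [s0]; [Im z] is chosen so
   that the segment misses the pole 1. *)
Lemma zeta_zero_Jz (zeta : C -> C) (s0 : C) : is_riemann_zeta zeta -> 0 < complex.Re s0 < 1 ->
  zeta s0 = 0 -> Jz s0 = 0.
Proof.
move=> [zd za] /andP[h0 h1] z0.
pose z : C := 2 +i* (if 0 <= complex.Im s0 then complex.Im s0 + 1 else complex.Im s0).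
pose d := s0 - z.
pose P (w : C) := (w - 1) * zeta w - w + w * ((w - 1) * Hz w).
have ReG (t : R) : complex.Re (z + t%:C * d) = 2 + t * (complex.Re s0 - 2).
  by rewrite /d ReD ReM ReD ReN /= mul0r subr0.
have ImG (t : R) : complex.Im (z + t%:C * d) = complex.Im z + t * (complex.Im s0 - complex.Im z).
  by rewrite /d ImD ImM ImD ImN /= mul0r addr0.
have w1 (t : R) : 0 <= t <= 1 -> z + t%:C * d != 1.
  move=> /andP[t0 t1]; apply/eqP => /[dup] /(congr1 (@complex.Re R)) + /(congr1 (@complex.Im R)).
  rewrite ReG ImG /=; case: ifP => [i0|/negbT]; last first.
    by rewrite -ltNge => i0 _; rewrite subrr mulr0 addr0; lra.
  move=> hr hi.
  (* The imaginary part is [complex.Im s0 + 1 - t], which can vanish only at [t = 1]; there the real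
     part is that of [s0], below 1. *)
  have t1' : t = 1 by nra.
  by move: hr; rewrite t1'; lra.
have hran t : 0 <= t <= 1 -> analytic_at (fun t => P (z + t%:C * d)) t.
  move=> ht; have /andP[t0 t1] := ht.
  have [a ha] := za _ (w1 t ht).
  have [r r0 hr] := near_cabs ha.
  have rz : analytic_at (fun t => zeta (z + t%:C * d)) t.
    have d1 : 0 < cabs d + 1 by rewrite ltr_wpDl ?cabs_ge0.
    exists (fun n => a n * d ^+ n), (r / (cabs d + 1)); split; first by rewrite divr_gt0.
    move=> u ut; have := hr (z + u%:C * d).
    have -> : z + u%:C * d - (z + t%:C * d) = (u - t)%:C * d by rewrite rmorphB; ring.
    have -> : cabs ((u - t)%:C * d) < r.
      rewrite cabsM cabs_real; apply: (@le_lt_trans _ _ (`|u - t| * (cabs d + 1))).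
        by rewrite ler_wpM2l// lerDl.
      by rewrite -ltr_pdivlMr.
    move=> /(_ isT)/series_ccvg.
    have -> // : (fun n => \sum_(i < n) a i * ((u - t)%:C * d) ^+ i) =
      (fun n => \sum_(i < n) a i * d ^+ i * (u - t)%:C ^+ i).
    by apply/funext => n; apply: eq_bigr => i _; rewrite exprMn; ring.
  have rH : analytic_at (fun t => Hz (z + t%:C * d)) t.
    by apply: analytic_at_Hz; rewrite ReG; nra.
  have aff (w : C) : analytic_at (fun t => z + t%:C * d + w) t.
    have := analytic_at_affineM (z + w) d (analytic_at_cst 1 t); congr analytic_at.
    by apply/funext => u; rewrite mulr1; ring.
  have e : (fun u : R => P (z + u%:C * d)) = (fun u => ((z - 1) + u%:C * d) * zeta (z + u%:C * d) +
      (((- z) + u%:C * (- d)) * 1 + (z + u%:C * d) * (((z - 1) + u%:C * d) * Hz (z + u%:C * d)))).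
    by apply/funext => u; rewrite /P; ring.
  rewrite e; apply: analytic_atD; first exact: analytic_at_affineM.
  apply: analytic_atD; first exact: analytic_at_affineM (analytic_at_cst 1 t).
  by apply: analytic_at_affineM; exact: analytic_at_affineM.
have P1 : P (z + 1%:C * d) = 0.
  (* As [Re z = 2] and [Re s0 > 0], the first half of the segment lies in [Re w > 1], where
     [zeta_Hz] applies. *)
  apply: (analytic_at_eq0 (e := 1 / 2) (f := fun t => P (z + t%:C * d)) hran) => [|t /andP[t0 t1]]; first by lra.
  have r1 : 1 < complex.Re (z + t%:C * d) by rewrite ReG; nra.
  exact: zeta_Hz r1 (zd _ r1).
have ez : z + 1%:C * d = s0 by rewrite /d mul1r addrC subrK.
rewrite ez /P z0 mulr0 sub0r in P1.
have sn0 : s0 != 0 by apply: contraTneq h0 => ->; rewrite ltxx.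
have sn1 : 1 - s0 != 0 by apply: contraTneq h1 => /eqP; rewrite subr_eq0 => /eqP <-; rewrite ltxx.
rewrite Jz_Hz ?h0//; apply: (mulfI sn0); apply: (mulfI sn1); rewrite !mulr0.
have -> : (1 - s0) * (s0 * (Hz s0 + (1 - s0)^-1)) = - (- s0 + s0 * ((s0 - 1) * Hz s0)) by field.
by rewrite P1 oppr0.
Qed.

End ZetaZero.

(** * Divergence of both sequences at a zero of J *)

Section Divergence.
Context {R : realType}.

Lemma Lp_divergence (p t : R) : 1 < p -> Jz (p^-1 +i* t) = 0 ->
  diverges_in_Lp p (@S_seq R) /\ diverges_in_Lp p (@V_seq R).
Proof.
move=> p1 J0; split => cv.
  have cv' : converges_in_Lp p (@Uc R 0) by move: cv; rewrite (funext (@S_Uc R)).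
  by have := Jz_neq0_of_Lp_convergence t p1 _ cv'; rewrite lexx ler01 J0 eqxx => /(_ isT).
have cv' : converges_in_Lp p (@Uc R 1) by move: cv; rewrite (funext (@V_Uc R)).
by have := Jz_neq0_of_Lp_convergence t p1 _ cv'; rewrite lexx ler01 J0 eqxx => /(_ isT).
Qed.

End Divergence.

Unset Implicit Arguments.
Set Strict Implicit.
Set Printing Implicit Defensive.

Theorem proposition4p4 (R : realType) :
  (forall (p : R) (zeta : R[i] -> R[i]),
     1 < p ->
     is_riemann_zeta zeta ->
     (exists s : R[i], complex.Re s = 1 / p /\ zeta s = 0) ->
     diverges_in_Lp p (@S_seq R) /\ diverges_in_Lp p (@V_seq R)) /\
  (diverges_in_Lp 2 (@S_seq R) /\ diverges_in_Lp 2 (@V_seq R)).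
Proof.
split=> [p zeta p1 hz [s [hs zs]]|].
  have p0 : 0 < p by lra.
  have Rs : complex.Re s = p^-1 by rewrite hs div1r.
  apply: (@Lp_divergence R p (complex.Im s) p1).
  have -> : (p^-1 +i* complex.Im s)%C = s by apply: complex_ext.
  by apply: (zeta_zero_Jz hz _ zs); rewrite Rs invr_gt0 p0 invf_lt1.
have [t ht] := @Jz_zero_half R.
apply: (@Lp_divergence R 2 t); first by rewrite ltr1n.
by rewrite -ht div1r.
Qed.
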